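(* Let $G$ be a Berge graph that contains no induced subgraph isomorphic to an antihole of length at least six and no induced subgraph isomorphic to an odd prism. If $G$ does not admit a balanced skew-partition, then $G$ is either complete or has an even pair.
   Context: All graphs are finite and simple. A path in a graph means an induced (chordless) path; its length is its number of edges, and it is even or odd according to its length. An antipath is an induced subgraph whose complement is a path. A hole is an induced subgraph isomorphic to a cycle on at least five vertices; an antihole is an induced subgraph whose complement is a hole of the complement graph; the length of a hole/antihole is its number of vertices. A graph is Berge if it contains no hole of odd length and no antihole of odd length. A prism is an induced subgraph consisting of two vertex-disjoint triangles $\{a_1,a_2,a_3\}$ and $\{b_1,b_2,b_3\}$ together with three vertex-disjoint paths $P_1,P_2,P_3$, $P_i$ from $a_i$ to $b_i$, with no edges other than those of the two triangles and the three paths; it is odd if all three paths $P_i$ have odd length. An even pair is a pair $\{u,v\}$ of nonadjacent vertices such that every induced path from $u$ to $v$ has an even number of edges. A skew-partition of $G$ is a partition $(A,B)$ of $V(G)$ such that $G[A]$ is not connected and the complement of $G[B]$ is not connected; it is balanced if there is no odd path of length greater than one with both ends in $B$ and interior in $A$, and no odd antipath of length greater than one with both ends in $A$ and interior in $B$. *)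

(* Defs.v *)
(* A finite simple graph is a symmetric irreflexive
   relation e on a finType T. *)
From mathcomp Require Import all_boot.
Set Implicit Arguments. Unset Strict Implicit. Unset Printing Implicit Defensive.

Section Graphs.
Variable T : finType.
Implicit Types (e : rel T) (p c : seq T) (A : {set T}).

Definition compl e : rel T := fun x y => (x != y) && ~~ e x y.

(* p = [v0; ...; vk] is an induced (chordless) path: distinct vertices,
   and two vertices are adjacent iff they are consecutive in p.
   Its length is (size p).-1. *)
Definition ipath e p : bool :=
  uniq p &&
  all (fun x => all (fun y =>
        e x y == ((index x p == (index y p).+1) || (index y p == (index x p).+1))) p) p.

Definition hole e c : bool :=
  [&& 5 <= size c, uniq c &
  all (fun x => all (fun y =>
        e x y == ((index x c == (index y c).+1 %% size c)
               || (index y c == (index x c).+1 %% size c))) c) c].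

Definition antihole e c : bool := hole (compl e) c.

Definition berge e : Prop :=
  forall c, (hole e c -> ~~ odd (size c)) /\ (antihole e c -> ~~ odd (size c)).

(* edges between two prism paths P = a::q (from a to last a q) and
   Q = a'::q': only the triangle edges a a' and b b' *)
Definition prism_cross e a q a' q' : bool :=
  all (fun x => all (fun y =>
    e x y == (((x == a) && (y == a')) || ((x == last a q) && (y == last a' q'))))
    (a' :: q')) (a :: q).

Definition prism e a1 a2 a3 q1 q2 q3 : bool :=
  [&& ipath e (a1 :: q1), ipath e (a2 :: q2), ipath e (a3 :: q3),
      q1 != [::], q2 != [::], q3 != [::],
      [disjoint (a1 :: q1) & (a2 :: q2)],
      [disjoint (a1 :: q1) & (a3 :: q3)],
      [disjoint (a2 :: q2) & (a3 :: q3)],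
      prism_cross e a1 q1 a2 q2, prism_cross e a1 q1 a3 q3 &
      prism_cross e a2 q2 a3 q3].

Definition odd_prism e a1 a2 a3 q1 q2 q3 : bool :=
  [&& prism e a1 a2 a3 q1 q2 q3, odd (size q1), odd (size q2) & odd (size q3)].

Definition even_pair e u v : Prop :=
  [/\ u != v, ~~ e u v &
      forall q, ipath e (u :: q) -> last u q = v -> ~~ odd (size q)].

Definition complete e : Prop := forall x y, x != y -> e x y.

Definition restr e A : rel T := fun x y => [&& x \in A, y \in A & e x y].

Definition disconnected_on e A : Prop :=
  exists x y, [/\ x \in A, y \in A & ~~ connect (restr e A) x y].

Definition skew_partition e A : Prop :=
  disconnected_on e A /\ disconnected_on (compl e) (~: A).

Definition interior u q : seq T := behead (belast u q).

Definition balanced e A : Prop :=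
  (forall u q, ipath e (u :: q) -> 2 <= size q -> odd (size q) ->
     u \in ~: A -> last u q \in ~: A -> ~ all (fun x => x \in A) (interior u q))
  /\
  (forall u q, ipath (compl e) (u :: q) -> 2 <= size q -> odd (size q) ->
     u \in A -> last u q \in A -> ~ all (fun x => x \in ~: A) (interior u q)).

End Graphs.

(* Main.v *)
(* In this class every antidisconnected set B leaves V \ B connected: a skew-partition with B as
   large as possible is balanced by the Roussel-Rubio lemma.

   Let y be a vertex with non-clique neighbourhood such that no prism has two corners of one
   triangle in N(y), and let X be a maximal anticonnected set containing y whose set C of common
   neighbours is not a clique.  Following Maffray and Trotignon, a shortest outgoing path (ends in
   C, interior disjoint from C and X) orders the vertices of C attaching only to its first, resp.
   only to its last, interior vertex; extremal vertices of the two orders form an even pair,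
   because every obstruction yields a prism with a triangle edge inside C.

   To find y when there is a prism, grow it to a maximal structure (A, B, H): A and B are
   disjoint, and H splits into units, joined to each other exactly inside A and inside B, each of
   them a union of rungs from A to B.  A vertex or path outside H attaches to it locally or else
   enlarges it, and a vertex seeing most ends of three rungs is excluded by the absence
   of antidisconnected cutsets.  Hence the structure extends to the whole vertex set.  Among all such
   decompositions take a class S meeting A with |S| minimal, and y in S outside A and B: a prism
   with two corners adjacent to y would yield a decomposition having a class strictly inside S. *)
Require Import Defs.
From Stdlib Require Import Classical.
From mathcomp Require Import all_boot.
From mathcomp Require Import zify.
Set Implicit Arguments. Unset Strict Implicit. Unset Printing Implicit Defensive.

(** An antihole has at least five vertices, and one with exactly five is odd, so the hypotheses
    leave the complement without any hole ([noanti]). Antipath arguments therefore all end alike: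
    the antipath is closed to a cycle of the complement on at least five vertices. Likewise,
    excluding odd prisms forces all three paths of every prism to be even. Together these remove
    every exceptional outcome from the Roussel-Rubio lemma for paths; exceptions survive only for a
    hole with two consecutive complete vertices, and those are what create prisms.

    Since [size] counts vertices, a path is even exactly when its [size] is odd. The recurring tool
    is the parity of the number of edges joining complete vertices along a path or hole, computed
    once from Roussel-Rubio and once by cutting the path at the vertices that touch something else.

    Once no antidisconnected set cuts the graph, the skew-partition hypothesis is not consulted
    again. That property is used to force connections, to grow sets of major vertices, and to show
    that certain neighbourhoods are not cliques. *)

Definition ol (T : Type) (p : seq T) : option T :=
  if p is x :: q then Some (last x q) else None.

(** * Induced paths and connectedness *)

Section Paths.
Variables (T : finType) (e : rel T).
Hypothesis e_sym : symmetric e.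
Hypothesis e_irr : irreflexive e.
Implicit Types (p q s : seq T) (x y z a b c d : T).

Lemma ol_cat p x q : ol (p ++ x :: q) = Some (last x q).
Proof. by case: p => //= y p; rewrite last_cat. Qed.

Lemma ol_rcons p x : ol (rcons p x) = Some x.
Proof. by rewrite -cats1 ol_cat. Qed.

Lemma ol_rev p : ol (rev p) = ohead p.
Proof. by case: p => //= x p; rewrite rev_cons ol_rcons. Qed.

Lemma ohead_rev p : ohead (rev p) = ol p.
Proof. by rewrite -ol_rev revK. Qed.

Lemma ohead_in p a : ohead p = Some a -> a \in p.
Proof. by case: p => //= x p [->]; rewrite mem_head. Qed.

Lemma ol_in p a : ol p = Some a -> a \in p.
Proof. by case: p => //= x p [<-]; rewrite mem_last. Qed.

(** Trades the index-based definition for a recursion on the head, which sees exactly the first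
    vertex of the rest. Later path manipulations go through this form or through [ipath_catP]. *)
Lemma ipath_cons x q : ipath e (x :: q) =
  [&& x \notin q, all (fun y => e x y == (ohead q == Some y)) q & ipath e q].
Proof.
rewrite /ipath cons_uniq -!andbA; case xq: (x \in q) => //=.
case uq: (uniq q) => //=; last by rewrite andbF.
rewrite eqxx /= e_irr /= .
have nx y : y \in q -> (x == y) = false.
  by move=> yq; apply/eqP => exy; rewrite exy yq in xq.
have h0 y : y \in q -> (index y q == 0) = (ohead q == Some y).
  case: q xq uq nx => //= z q _ _ _ _; rewrite -[Some z == Some y]/(z == y).
  by case: (z == y).
apply/andP/andP => [[h1 h2]|[h1 h2]]; split.
- apply/allP => y yq; move/allP: h1 => /(_ y yq); rewrite nx // => /eqP ->.
  by rewrite eqSS /= h0.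
- apply/allP => y yq; apply/allP => z zq.
  move/allP: h2 => /(_ y yq) /andP [_] /allP /(_ z zq) /eqP ->.
  by rewrite !nx // !eqSS.
- apply/allP => y yq; move/allP: h1 => /(_ y yq) /eqP ->.
  by rewrite nx // eqSS /= h0.
- apply/allP => y yq; apply/andP; split.
    move/allP: h1 => /(_ y yq) /eqP h; rewrite e_sym h nx // -h0 //.
    by rewrite orbF eqSS.
  apply/allP => z zq; move/allP: h2 => /(_ y yq) /allP /(_ z zq) /eqP ->.
  by rewrite !nx // !eqSS.
Qed.

Lemma ipath1 x : ipath e [:: x].
Proof. by rewrite ipath_cons. Qed.

(** The only edge between consecutive pieces joins the last vertex of the first to the head of the
    second; comparing options makes empty pieces harmless. *)
Lemma ipath_catP p q : reflect
  [/\ ipath e p, ipath e q, (forall x, x \in p -> x \notin q) &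
   forall x y, x \in p -> y \in q ->
     e x y = (ol p == Some x) && (ohead q == Some y)] (ipath e (p ++ q)).
Proof.
elim: p => [|x p IH] /=.
  by apply: (iffP idP) => [->|[]].
rewrite (ipath_cons x (p ++ q)); apply: (iffP and3P) => [[xpq /allP hx hpq]|].
  have [ip iq dpq cpq] := elimT IH hpq.
  move: xpq; rewrite mem_cat negb_or => /andP [xp xq].
  split => //.
  - rewrite ipath_cons xp ip andbT /=; apply/allP => y yp.
    have := hx y; rewrite mem_cat yp => /(_ isT) /eqP ->.
    by case: (p) yp.
  - by move=> y; rewrite inE => /orP [/eqP ->|/dpq].
  move=> y z; rewrite inE => /orP [/eqP ->|yp] zq.
    have := hx z; rewrite mem_cat zq orbT => /(_ isT) /eqP ->.
    case: (p) xp zq dpq => [|w p'] //= xp zq dpq; first by rewrite eqxx.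
    have -> : (Some w == Some z) = false.
      by apply/eqP => - [ewz]; have := dpq w (mem_head _ _); rewrite ewz zq.
    have -> : (Some (last w p') == Some x) = false => //.
    by apply/eqP => - [ewz]; rewrite -ewz mem_last in xp.
  by rewrite (cpq y z yp zq); case: (p) yp.
case; rewrite ipath_cons => /and3P [xp /allP hx ip] iq dpq cpq; split.
- by rewrite mem_cat negb_or xp dpq ?mem_head.
- apply/allP => y; rewrite mem_cat => /orP [yp|yq].
    by rewrite (eqP (hx y yp)); case: (p) yp.
  rewrite (cpq x y) ?mem_head //.
  case: (p) xp dpq => [|w p'] //= xp dpq; first by rewrite eqxx.
  have -> : (Some w == Some y) = false.
    by apply/eqP => - [ewz]; have := dpq w; rewrite !inE eqxx orbT ewz yq => /(_ isT).
  have -> : (Some (last w p') == Some x) = false => //.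
  by apply/eqP => - [ewz]; rewrite -ewz mem_last in xp.
apply/IH; split=> // [y yp|y z yp zq]; first by rewrite dpq // inE yp orbT.
by rewrite cpq ?inE ?yp ?orbT //; case: (p) yp.
Qed.

Lemma ipath_uniq p : ipath e p -> uniq p.
Proof. by case/andP. Qed.

Lemma ipath_rev p : ipath e (rev p) = ipath e p.
Proof.
suff H q : ipath e q -> ipath e (rev q).
  by apply/idP/idP => /H //; rewrite revK.
elim: q => [|x q IH] //; rewrite ipath_cons => /and3P [xq /allP hx iq].
rewrite rev_cons -cats1; apply/ipath_catP; split; rewrite ?ipath1 //.
- exact: IH.
- by move=> y; rewrite mem_rev inE => yq; apply: contra xq => /eqP <-.
move=> y z; rewrite mem_rev inE ol_rev => yq /eqP -> /=; rewrite eqxx andbT.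
by rewrite e_sym (eqP (hx y yq)).
Qed.

Definition pth p a b := [/\ ipath e p, ohead p = Some a & ol p = Some b].

Lemma pth1 x : pth [:: x] x x.
Proof. by split; rewrite ?ipath1. Qed.

Lemma pth_rev p a b : pth p a b -> pth (rev p) b a.
Proof. by case=> ip h l; split; rewrite ?ipath_rev ?ohead_rev ?ol_rev. Qed.

Lemma pth_in1 p a b : pth p a b -> a \in p. Proof. by case=> _ /ohead_in. Qed.
Lemma pth_in2 p a b : pth p a b -> b \in p. Proof. by case=> _ _ /ol_in. Qed.

Lemma pth_cat p a b q c d : pth p a b -> pth q c d ->
  (forall x, x \in p -> x \notin q) ->
  (forall x y, x \in p -> y \in q -> e x y = (x == b) && (y == c)) ->
  pth (p ++ q) a d.
Proof.
case=> ip hp lp [iq hq lq] dpq cpq; split.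
- apply/ipath_catP; split=> // x y xp yq; rewrite cpq // lp hq.
  by rewrite -[Some b == _]/(b == x) -[Some c == _]/(c == y) (eq_sym b) (eq_sym c).
- by case: (p) hp.
by case: (q) hq lq => //= z q' _ <-; rewrite ol_cat.
Qed.

Lemma pth_cons x p a b : pth p a b -> x \notin p ->
  (forall y, y \in p -> e x y = (y == a)) -> pth (x :: p) x b.
Proof.
move=> pp xp h; apply: (@pth_cat [:: x] x x p a b) => //; first exact: pth1.
- by move=> y; rewrite inE => /eqP ->.
by move=> y z; rewrite inE => /eqP -> zp; rewrite eqxx h.
Qed.

Lemma pth_rcons x p a b : pth p a b -> x \notin p ->
  (forall y, y \in p -> e x y = (y == b)) -> pth (rcons p x) a x.
Proof.
move=> pp xp h; rewrite -cats1; apply: (pth_cat pp (pth1 x)).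
- by move=> y yp; rewrite inE; apply: contra xp => /eqP <-.
by move=> y z yp; rewrite inE => /eqP ->; rewrite eqxx andbT e_sym h.
Qed.

Lemma pth_split p1 x p2 a b : pth (p1 ++ x :: p2) a b ->
  pth (rcons p1 x) a x /\ pth (x :: p2) x b.
Proof.
case=> ip hp lp.
have [_ i2 _ _] := ipath_catP _ _ ip.
move: ip; rewrite -cat_rcons => /ipath_catP [i1 _ _ _].
split; split => //; last by rewrite -lp ol_cat.
  by case: (p1) hp.
by rewrite ol_rcons.
Qed.

Lemma pth_size p a b : pth p a b -> 0 < size p.
Proof. by case=> _ h _; case: (p) h. Qed.

Lemma pth_eq p a : pth p a a -> p = [:: a].
Proof.
case: p => [|x p] [] //; rewrite ipath_cons => /and3P [xp _ _] [ex] [el].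
case: p xp el => [|y p] xp el; first by rewrite ex.
by rewrite /= in el; rewrite ex -{1}el mem_last in xp.
Qed.

Lemma pth_size2 p a b : pth p a b -> a != b -> 1 < size p.
Proof.
case: p => [|x [|y p]] [] // _ [<-] [<-]; by rewrite eqxx.
Qed.

Lemma pth_2 a b : e a b -> pth [:: a; b] a b.
Proof.
move=> eab; apply: (pth_cons (pth1 b)).
  by rewrite inE; apply: contraTneq eab => ->; rewrite e_irr.
by move=> y; rewrite inE => /eqP ->; rewrite eqxx.
Qed.

Lemma pth_adj p a b : pth p a b -> a != b -> e a b -> p = [:: a; b].
Proof.
case: p => [|x [|y p]] [] //; first by move=> _ [<-] [<-]; rewrite eqxx.
rewrite ipath_cons => /and3P [xp /allP h ip] [<-] [<-] nab eab.
have := h (last y p) (mem_last _ _); rewrite eab eq_sym => /eqP /eqP [eyl].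
case: p xp h ip nab eab eyl => // z p xp h ip nab eab eyl.
by move: ip; rewrite ipath_cons => /andP [] /=; rewrite {1}eyl /= mem_last.
Qed.

Lemma split_first (N : pred T) p : has N p ->
  exists s x t, [/\ p = s ++ x :: t, N x & forall y, y \in s -> ~~ N y].
Proof.
elim: p => //= x p IH; case Nx: (N x); first by exists [::], x, p.
move=> /= hp; have [s [y [t [-> Ny hs]]]] := IH hp.
exists (x :: s), y, t; split => // z; rewrite inE => /orP [/eqP ->|/hs //].
by rewrite Nx.
Qed.

Lemma split_last (N : pred T) p : has N p ->
  exists s x t, [/\ p = s ++ x :: t, N x & forall y, y \in t -> ~~ N y].
Proof.
rewrite -has_rev => /split_first [s [x [t [ep Nx hs]]]].
exists (rev t), x, (rev s); split=> //; last by move=> y; rewrite mem_rev => /hs.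
by rewrite -[p]revK ep rev_cat rev_cons cat_rcons.
Qed.

Lemma pth_first (N : pred T) p a b : pth p a b -> has N p ->
  exists s t x, [/\ p = s ++ t, pth s a x, N x &
    forall y, y \in s -> N y -> y = x].
Proof.
move=> pp /split_first [s [x [t [ep Nx hs]]]].
rewrite ep in pp; have [p1 p2] := pth_split pp.
exists (rcons s x), t, x; split => //; first by rewrite cat_rcons.
by move=> y; rewrite mem_rcons inE => /orP [/eqP //|/hs /negP].
Qed.

Lemma pth_last (N : pred T) p a b : pth p a b -> has N p ->
  exists s t x, [/\ p = s ++ t, pth t x b, N x &
    forall y, y \in t -> N y -> y = x].
Proof.
move=> pp /split_last [s [x [t [ep Nx hs]]]].
rewrite ep in pp; have [p1 p2] := pth_split pp.
exists s, (x :: t), x; split => //.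
by move=> y; rewrite inE => /orP [/eqP //|/hs /negP].
Qed.

Lemma pth_catl p q a b : pth (p ++ q) a b -> p != [::] ->
  exists c, pth p a c.
Proof.
case/lastP: p => // p x; rewrite cat_rcons => /pth_split [h _] _; by exists x.
Qed.

Lemma pth_catr p q a b : pth (p ++ q) a b -> q != [::] ->
  exists c, pth q c b.
Proof. by case: q => // x q /pth_split [_ h] _; exists x. Qed.

Lemma pth_cat_cross p q a b c d : pth (p ++ q) a b -> pth p a c -> pth q d b ->
  (forall x, x \in p -> x \notin q) /\
  forall x y, x \in p -> y \in q -> e x y = (x == c) && (y == d).
Proof.
case=> /ipath_catP [_ _ h1 h2] _ _ [_ _ l] [_ h _]; split=> // x y xp yq.
rewrite h2 // l h -[Some c == _]/(c == x) -[Some d == _]/(d == y).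
by rewrite (eq_sym c) (eq_sym d).
Qed.

Lemma pth_uniq p a b : pth p a b -> uniq p.
Proof. by case=> /ipath_uniq. Qed.

(** The walk is shortened recursively: a new first vertex either lies on the path already or is
    attached at its last neighbour there, which leaves no chord. *)
Lemma walk_pth p x : path e x p ->
  exists q, pth q x (last x p) /\ {subset q <= x :: p}.
Proof.
elim: p x => [|z p IH] x /=.
  by move=> _; exists [:: x]; split => //; exact: pth1.
case/andP => exz /IH [q [pq sq]].
case xq: (x \in q).
  case/splitPr: xq pq sq => q1 q2 pq sq; have [_ p2] := pth_split pq.
  exists (x :: q2); split => // y; rewrite inE => /orP [/eqP ->|yq].
    exact: mem_head.
  by rewrite inE sq ?orbT // mem_cat inE yq !orbT.
have hq : has (e x) q by apply/hasP; exists z => //; exact: pth_in1 pq.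
have [s [t [w [eq1 pt ew ht]]]] := pth_last pq hq.
have st : {subset t <= q} by move=> y yt; rewrite eq1 mem_cat yt orbT.
exists (x :: t); split; last first.
  move=> y; rewrite inE => /orP [/eqP ->|/st /sq yq]; first exact: mem_head.
  by rewrite inE yq orbT.
apply: (pth_cons pt); first by apply: contraFN xq => /st.
move=> y yt; apply/idP/eqP => [/(ht y yt) //|->//].
Qed.

End Paths.

Section Conn.
Variables (T : finType) (e : rel T).
Hypothesis e_sym : symmetric e.
Hypothesis e_irr : irreflexive e.
Implicit Types (p q s : seq T) (x y z a b c d : T) (S F : {set T}).

(** With this convention the empty set is connected, so a set that is not [conn] has two vertices in
    different components. *)
Definition conn S := forall x y, x \in S -> y \in S -> connect (restr e S) x y.

Lemma restr_sym S : symmetric (restr e S).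
Proof. by move=> x y; rewrite /restr e_sym; case: (x \in S); case: (y \in S). Qed.

Lemma restr_csym S : connect_sym (restr e S).
Proof. exact: sym_connect_sym (restr_sym S). Qed.

Lemma connect_pth S x y : x \in S -> connect (restr e S) x y ->
  exists q, pth e q x y /\ {subset q <= S}.
Proof.
move=> xS /connectP [p pp ->].
have [pe sp] : path e x p /\ {subset x :: p <= S}.
  elim: p x xS pp => [|z p IH] x xS /=.
    by move=> _; split => // w; rewrite inE => /eqP ->.
  case/andP => /and3P [_ zS exz] /(IH z zS) [h1 h2]; rewrite exz h1; split=> //.
  by move=> w; rewrite inE => /orP [/eqP -> //|/h2].
have [q [pq sq]] := walk_pth e_sym e_irr pe.
by exists q; split => // w /sq /sp.
Qed.

Lemma pth_connect S q x y : pth e q x y -> {subset q <= S} ->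
  connect (restr e S) x y.
Proof.
elim: q x => [|z q IH] x [] //; rewrite ipath_cons // => /and3P [zq /allP hz iq] [<-] hl sS.
case: q IH zq hz iq hl sS => [|w q] IH zq hz iq hl sS.
  by case: hl => <-; exact: connect0.
apply: (@connect_trans _ _ w).
  apply: connect1; rewrite /restr !sS ?inE ?eqxx ?orbT //=.
  by rewrite (eqP (hz w (mem_head _ _))) /= eqxx.
apply: IH; first by split.
by move=> u uq; apply: sS; rewrite inE uq orbT.
Qed.

Lemma conn_pth S x y : conn S -> x \in S -> y \in S ->
  exists q, pth e q x y /\ {subset q <= S}.
Proof. by move=> cS xS yS; apply: connect_pth => //; apply: cS. Qed.

Lemma restr_sub S S' x y : S \subset S' -> connect (restr e S) x y ->
  connect (restr e S') x y.
Proof.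
move=> sS; apply: connect_sub => u v /and3P [uS vS euv].
by apply: connect1; rewrite /restr euv !(subsetP sS).
Qed.

Lemma conn1 x : conn [set x].
Proof. by move=> y z; rewrite !inE => /eqP -> /eqP ->; exact: connect0. Qed.

Lemma conn_pset q a b : pth e q a b -> conn [set x in q].
Proof.
move=> pq.
have H x : x \in q -> connect (restr e [set x in q]) a x.
  move=> /splitPr h; case: h pq => q1 q2 pq.
  have [p1 _] := pth_split e_sym e_irr pq.
  apply: (pth_connect p1) => y; rewrite mem_rcons !inE mem_cat inE.
  by case: (y == x); case: (y \in q1); rewrite ?orbT.
move=> x y; rewrite !inE => /H hx /H hy.
by apply: connect_trans hy; rewrite restr_csym.
Qed.

Lemma connU S1 S2 x y : conn S1 -> conn S2 -> x \in S1 -> y \in S2 ->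
  (x == y) || e x y -> conn (S1 :|: S2).
Proof.
move=> c1 c2 xS yS exy.
have s1 : S1 \subset S1 :|: S2 by apply: subsetUl.
have s2 : S2 \subset S1 :|: S2 by apply: subsetUr.
have xy : connect (restr e (S1 :|: S2)) x y.
  case/orP: exy => [/eqP ->|exy]; first exact: connect0.
  by apply: connect1; rewrite /restr exy !inE xS yS orbT.
have H z : z \in S1 :|: S2 -> connect (restr e (S1 :|: S2)) x z.
  rewrite inE => /orP [zS|zS]; first exact: restr_sub s1 (c1 _ _ xS zS).
  by apply: connect_trans xy _; exact: restr_sub s2 (c2 _ _ yS zS).
move=> u v /H hu /H hv; apply: connect_trans hv; by rewrite restr_csym.
Qed.

Lemma connU1 S x y : conn S -> x \in S -> e x y -> conn (y |: S).
Proof.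
move=> cS xS exy; rewrite setUC; refine (connU cS (@conn1 y) xS (set11 y) _).
by rewrite exy orbT.
Qed.

Lemma not_conn S : ~ conn S -> disconnected_on e S.
Proof.
move=> nc; case: (boolP [forall x, forall y, (x \in S) ==> (y \in S) ==> connect (restr e S) x y]).
  move=> /forallP h; case: nc => x y xS yS.
  by have /forallP /(_ y) := h x; rewrite xS yS.
rewrite negb_forall => /existsP [x]; rewrite negb_forall => /existsP [y].
rewrite !negb_imply => /and3P [xS yS h]; by exists x, y.
Qed.

Definition ccomp S x : {set T} := [set y | connect (restr e S) x y].

Lemma comp_self S x : x \in ccomp S x. Proof. by rewrite inE connect0. Qed.

Lemma comp_sub S x : x \in S -> ccomp S x \subset S.
Proof.
move=> xS; apply/subsetP => y; rewrite inE => /(connect_pth xS) [q [pq sq]].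
exact: sq (pth_in2 pq).
Qed.

Lemma comp_conn S x : x \in S -> conn (ccomp S x).
Proof.
move=> xS.
have H y : y \in ccomp S x -> connect (restr e (ccomp S x)) x y.
  rewrite inE => /(connect_pth xS) [q [pq sq]]; apply: (pth_connect pq) => z zq.
  case/splitPr: zq pq sq => q1 q2 pq sq.
  have [p1 _] := pth_split e_sym e_irr pq; rewrite inE; apply: (pth_connect p1) => w.
  rewrite mem_rcons inE => h; apply: sq; rewrite mem_cat inE.
  by case/orP: h => ->; rewrite ?orbT.
move=> y z /H hy /H hz; apply: connect_trans hz; by rewrite restr_csym.
Qed.

Lemma comp_out S x y z : x \in S -> y \in ccomp S x -> z \in S -> e y z -> z \in ccomp S x.
Proof.
move=> xS yC zS eyz; have yS := subsetP (comp_sub xS) _ yC.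
rewrite inE in yC; rewrite inE; apply: connect_trans yC _; apply: connect1.
by rewrite /restr yS zS.
Qed.

(** Among the vertices other than [v0], take [v] whose removal leaves the largest component around
    [v0]. If some [u] were outside that component, removing [u] instead would keep the whole
    component and regain [v]. *)
Lemma noncut S v0 : conn S -> v0 \in S -> 1 < #|S| ->
  exists v, [/\ v \in S, v != v0 & conn (S :\ v)].
Proof.
move=> cS v0S S2.
have [w wS] : exists w, w \in S :\ v0.
  by apply/set0Pn; rewrite -card_gt0; move: S2; rewrite (cardsD1 v0) v0S.
pose f v := #|ccomp (S :\ v) v0|.
case: (arg_maxnP f wS) => v vin vmax.
have /setD1P [nv vS] : v \in S :\ v0 := vin.
have v0Sv : v0 \in S :\ v by rewrite !inE eq_sym nv.
exists v; split => //.
suff H u : u \in S :\ v -> u \in ccomp (S :\ v) v0.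
  move=> x y /H xC /H yC; apply: (restr_sub (comp_sub v0Sv)).
  exact: comp_conn.
move=> uS; apply: contraT => uC.
have [nuv uS'] : u != v /\ u \in S by move: uS; rewrite !inE => /andP [].
have nu0 : u != v0 by apply: contraNneq uC => ->; exact: comp_self.
have uSv0 : u \in S :\ v0 by rewrite !inE nu0.
have v0Su : v0 \in S :\ u by rewrite !inE eq_sym nu0.
have /= := vmax u uSv0; rewrite leqNgt => /negP []; rewrite /f.
apply: proper_card; apply/properP; split.
  apply/subsetP => y; rewrite inE => /(connect_pth v0Sv) [q [pq sq]].
  rewrite inE; apply: (pth_connect pq) => z zq; have := sq z zq.
  rewrite !inE => /andP [nzv ->]; rewrite andbT; apply: contraNneq uC => ezu.
  case/splitPr: zq pq sq => q1 q2 pq sq.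
  have [p1 _] := pth_split e_sym e_irr pq; rewrite inE -ezu; apply: (pth_connect p1) => k.
  rewrite mem_rcons inE => h; apply: sq; rewrite mem_cat inE.
  by case/orP: h => ->; rewrite ?orbT.
exists v; last first.
  by apply/negP => /(subsetP (comp_sub v0Sv)); rewrite !inE eqxx.
have [q [pq sq]] := conn_pth cS v0S vS.
have hv : has (pred1 v) q by rewrite has_pred1; exact: pth_in2 pq.
have [s [t [x [eq ps /eqP ex hx]]]] := pth_first e_sym e_irr pq hv.
rewrite ex in ps hx; rewrite inE; apply: (pth_connect ps) => z zs.
have zS : z \in S by apply: sq; rewrite eq mem_cat zs.
rewrite !inE zS andbT; apply: contraNneq uC => ezu.
case/splitPr: zs eq ps hx => s1 s2 eq ps hx.
have [p1 _] := pth_split e_sym e_irr ps.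
rewrite inE -ezu; apply: (pth_connect p1) => k.
rewrite mem_rcons inE => h; have ks : k \in s1 ++ z :: s2.
  by rewrite mem_cat inE; case/orP: h => ->; rewrite ?orbT.
rewrite !inE (sq k) ?andbT; last by rewrite eq mem_cat ks.
apply/eqP => ekv; rewrite ekv in h.
have us := pth_uniq ps.
have lv : v \in z :: s2.
  by move: (pth_in2 (pth_split e_sym e_irr ps).2).
have nz : z == v = false by rewrite ezu; apply: negbTE.
move: us; rewrite cat_uniq => /and3P [_ /hasPn hh _].
move: h; rewrite (eq_sym v) nz /= => vs1; by have := hh v lv; rewrite vs1.
Qed.

End Conn.

(** These three facts translate the cyclic adjacency of [hole] on a concatenation into adjacency
    inside each piece and across the two seams. *)
Lemma cycS_small i n m : i < n -> 0 < m ->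
 (i.+1 %% (n+m) = i.+1).
Proof. move=> *; apply: modn_small; lia. Qed.
Lemma cycS_cross i j n m : i < n -> j < m -> 0 < n -> 0 < m ->
 (i == (n+j).+1 %% (n+m)) || (n+j == i.+1 %% (n+m)) = (i == n.-1) && (j == 0) || (i == 0) && (j == m.-1).
Proof.
move=> lx ly n0 m0; rewrite (@modn_small i.+1); last lia.
case: (ltnP (n + j).+1 (n + m)) => h; first by rewrite modn_small //; lia.
have -> : (n + j).+1 = n + m by lia.
rewrite modnn; lia.
Qed.
Lemma cycS_same i j n m : i < m -> j < m -> 0 < n ->
 (n+i == (n+j).+1 %% (n+m)) || (n+j == (n+i).+1 %% (n+m)) = (i == j.+1) || (j == i.+1).
Proof.
move=> lx ly n0.
case: (ltnP (n + j).+1 (n + m)) => h; case: (ltnP (n + i).+1 (n + m)) => h'.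
- rewrite !modn_small //; lia.
- have ex : (n + i).+1 = n+m by lia.
  rewrite ex modnn modn_small //; lia.
- have ex : (n + j).+1 = n+m by lia.
  rewrite ex modnn modn_small //; lia.
have ex : (n + i).+1 = n+m by lia.
have ex' : (n + j).+1 = n+m by lia.
rewrite ex ex' modnn; lia.
Qed.

(** * Parity of holes and paths *)

Section Ladder.
Variables (T : finType) (e : rel T).
Hypothesis e_sym : symmetric e.
Hypothesis e_irr : irreflexive e.
Implicit Types (p q s : seq T) (x y z a b c d : T).

Lemma pth_index0 p a b x : pth e p a b -> x \in p -> (index x p == 0) = (x == a).
Proof.
case: p => [|y p] [] // _ [<-] _ _ /=; rewrite (eq_sym x).
by case: (y == x).
Qed.

Lemma pth_indexl p a b x : pth e p a b -> x \in p ->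
  (index x p == (size p).-1) = (x == b).
Proof.
case/lastP: p => [|p y] [] // ip _; rewrite ol_rcons => - [<-] xp.
rewrite size_rcons /= -cats1 index_cat.
have up := ipath_uniq ip; rewrite rcons_uniq in up.
case: ifP => xp'.
  rewrite ltn_eqF ?index_mem //; symmetry; apply/eqP => exy.
  by move: up; rewrite -exy xp'.
move: xp; rewrite mem_rcons inE xp' orbF => /eqP ->.
by rewrite /= eqxx addn0 eqxx.
Qed.

Lemma ipath_index p x y : ipath e p -> x \in p -> y \in p ->
  e x y = (index x p == (index y p).+1) || (index y p == (index x p).+1).
Proof. by case/andP => _ /allP h xp yp; have /allP /(_ y yp) /eqP := h x xp. Qed.

(** The two joining edges close the paths to a cycle. A single vertex is allowed as one of the
    paths, which covers a vertex seeing only the two ends of a path. *)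
Lemma ladder_hole p a b q c d : pth e p a b -> pth e q c d ->
  (forall x, x \in p -> x \notin q) ->
  (forall x y, x \in p -> y \in q ->
     e x y = ((x == a) && (y == c)) || ((x == b) && (y == d))) ->
  5 <= size p + size q -> hole e (p ++ rev q).
Proof.
move=> pp pq dpq cpq s5; have pr := pth_rev e_sym e_irr pq.
set r := rev q in pr *.
have sr : size r = size q by rewrite size_rev.
have rq x : x \in r = (x \in q) by rewrite mem_rev.
have sp0 := pth_size pp; have sq0 := pth_size pr.
have [ip _ _] := pp; have [ir _ _] := pr.
have sn : size (p ++ r) = size p + size r by rewrite size_cat.
apply/and3P; split; first by rewrite sn sr.
  rewrite cat_uniq (ipath_uniq ip) (ipath_uniq ir) /= andbT.
  by apply/hasPn => x xr; apply/negP => xp; have := dpq x xp; rewrite -rq xr.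
have key x y : x \in p ++ r -> y \in p ++ r -> (x \in p) || ~~ (y \in p) ->
  e x y = (index x (p ++ r) == (index y (p ++ r)).+1 %% size (p ++ r))
    || (index y (p ++ r) == (index x (p ++ r)).+1 %% size (p ++ r)).
  rewrite !mem_cat !index_cat sn => xc yc.
  case xp: (x \in p); case yp: (y \in p) => //= _.
  - have lx : index x p < size p by rewrite index_mem.
    have ly : index y p < size p by rewrite index_mem.
    by rewrite !(cycS_small (n := size p) (m := size r)) //; exact: ipath_index.
  - have yr : y \in r by move: yc; rewrite yp.
    have lx : index x p < size p by rewrite index_mem.
    have ly : index y r < size r by rewrite index_mem.
    rewrite cpq -?rq // -(pth_index0 pp) // -(pth_indexl pp) //.
    rewrite -(pth_index0 pr yr) -(pth_indexl pr yr).
    by rewrite cycS_cross // orbC.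
  - have yr : y \in r by move: yc; rewrite yp.
    have xr : x \in r by move: xc; rewrite xp.
    have lx : index x r < size r by rewrite index_mem.
    have ly : index y r < size r by rewrite index_mem.
    rewrite (ipath_index ir) //.
    by rewrite cycS_same.
apply/allP => x xc; apply/allP => y yc; apply/eqP.
case h: ((x \in p) || (y \notin p)); first exact: key.
by rewrite e_sym orbC key //; move: h; case: (x \in p) => //=; case: (y \in p).
Qed.

End Ladder.

Section Count.
Variables (T : finType).
Implicit Types (p q s : seq T) (x y z a b c d : T) (N M : pred T).

(* [ce N s] is the parity of the number of edges of the path [s] with both ends in [N]. *)
Fixpoint ce N s : bool :=
  if s is x :: s' then (N x && (if s' is y :: _ then N y else false)) (+) ce N s'
  else false.

Lemma ce_split N s1 x s2 : ce N (s1 ++ x :: s2) = ce N (rcons s1 x) (+) ce N (x :: s2).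
Proof.
elim: s1 => [|y s1 IH]; first by rewrite /= andbF.
case: s1 IH => [|z s1] IH; first by rewrite /= andbF /= addbF.
have E u : ce N (y :: z :: u) = (N y && N z) (+) ce N (z :: u) by [].
by move: IH; rewrite !cat_cons !rcons_cons !E => ->; rewrite addbA.
Qed.

Lemma ce_none N s : ~~ has N s -> ce N s = false.
Proof.
elim: s => //= x s IH; rewrite negb_or => /andP [nx hs].
by rewrite (negbTE nx) /= IH.
Qed.

Lemma ce_triml N s1 s2 : ~~ has N s1 -> ce N (s1 ++ s2) = ce N s2.
Proof.
elim: s1 => //= x s IH; rewrite negb_or => /andP [nx hs].
by rewrite (negbTE nx) /= IH.
Qed.

Lemma ce_rev N s : ce N (rev s) = ce N s.
Proof.
elim: s => // x s IH; case: s IH => [|y s] //= IH.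
rewrite !rev_cons -cats1 -cats1 -catA /= ce_split -rev_cons IH /=.
by rewrite andbF !addbF addbC [N x && _]andbC.
Qed.

Lemma ce_trimr N s1 s2 : ~~ has N s2 -> ce N (s1 ++ s2) = ce N s1.
Proof. by move=> h; rewrite -ce_rev rev_cat ce_triml ?has_rev // ce_rev. Qed.

Lemma ce_one N s1 x s2 : ~~ has N s1 -> ~~ has N s2 -> ce N (s1 ++ x :: s2) = false.
Proof.
move=> h1 h2; rewrite ce_triml // -cat1s ce_trimr //=; by rewrite andbF.
Qed.

Lemma ce_gap N s x0 x1 : ohead s = Some x0 -> ol s = Some x1 -> N x0 -> N x1 ->
  (forall s1 x m y s2, s = s1 ++ x :: m ++ y :: s2 -> N x -> N y -> ~~ has N m ->
     m = [::] \/ odd (size m)) ->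
  ce N s = ~~ odd (size s).
Proof.
have [n] := ubnP (size s); elim: n => // n IH in s x0 *.
case: s => // x s /= sn [<-] ls Nx Nx1 h.
case hs: (has N s); last first.
  case: s hs ls h sn => [|y s] hs ls h sn; first by rewrite /= andbF.
  case: ls => ls; have := hasPn (negbT hs) x1; rewrite -ls mem_last => /(_ isT).
  by rewrite ls Nx1.
have [m [y [s2 [es Ny hm]]]] := split_first hs.
have nm : ~~ has N m by apply/hasPn.
have ls2 : ol (y :: s2) = Some x1 by rewrite -ls es /= last_cat.
have sn2 : size (y :: s2) < n by move: sn; rewrite es size_cat /=; clear; lia.
have {}IH := IH (y :: s2) y sn2 erefl ls2 Ny Nx1.
have hg := h [::] x m y s2; rewrite es /= in hg; have {}hg := hg erefl Nx Ny nm.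
rewrite -[LHS]/(ce N (x :: s)) es -cat_cons ce_split IH; last first.
  move=> s1 u m' v s3 e1 Nu Nv hm'; apply: (h (x :: m ++ s1) u m' v s3) => //.
  by rewrite es e1 /= -catA.
have -> : ce N (rcons (x :: m) y) = (m == [::]).
  case: m nm {hm es hg} => [|w m] /=; first by rewrite Nx Ny.
  rewrite negb_or => /andP [nw nm]; rewrite (negbTE nw) andbF /=.
  rewrite -cats1 ce_triml //=; by rewrite andbF.
rewrite /= size_cat /= oddD /=; case: hg => [->|om] /=.
  by case: (odd _).
have -> : (m == [::]) = false by case: (m) om.
by rewrite om; case: (odd _).
Qed.

(** Cutting at the vertices of a second set [M] loses no edge. Later [N] consists of complete
    vertices, while [M] is the neighbourhood of a vertex or the set of vertices touching a path. *)
Lemma ce_pieces M N s x0 x1 : ohead s = Some x0 -> ol s = Some x1 -> M x0 -> M x1 ->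
  (forall s1 x m y s2, s = s1 ++ x :: m ++ y :: s2 -> M x -> M y -> ~~ has M m ->
     ce N (x :: rcons m y) = false) ->
  ce N s = false.
Proof.
have [n] := ubnP (size s); elim: n => // n IH in s x0 *.
case: s => // x s /= sn [<-] ls Nx Nx1 h.
case hs: (has M s); last first.
  case: s hs ls h sn => [|y s] hs ls h sn; first by rewrite /= andbF.
  case: ls => ls; have := hasPn (negbT hs) x1; rewrite -ls mem_last => /(_ isT).
  by rewrite ls Nx1.
have [m [y [s2 [es Ny hm]]]] := split_first hs.
have nm : ~~ has M m by apply/hasPn.
have ls2 : ol (y :: s2) = Some x1 by rewrite -ls es /= last_cat.
have sn2 : size (y :: s2) < n by move: sn; rewrite es size_cat /=; clear; lia.
have {}IH := IH (y :: s2) y sn2 erefl ls2 Ny Nx1.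
have hg : ce N (x :: rcons m y) = false by apply: (h [::] x m y s2) => //; rewrite es.
rewrite -[LHS]/(ce N (x :: s)) es -cat_cons ce_split IH; last first.
  move=> s1 u m' v s3 e1 Nu Nv hm'; apply: (h (x :: m ++ s1) u m' v s3) => //.
  by rewrite es e1 /= -catA.
by rewrite rcons_cons hg.
Qed.

End Count.

(** * The Roussel-Rubio lemma *)

Section Compl.
Variables (T : finType) (e : rel T).
Hypothesis e_sym : symmetric e.
Hypothesis e_irr : irreflexive e.
Lemma compl_sym : symmetric (compl e).
Proof. by move=> x y; rewrite /compl eq_sym e_sym. Qed.
Lemma compl_irr : irreflexive (compl e).
Proof. by move=> x; rewrite /compl eqxx. Qed.
Lemma ipath_ext (f : rel T) s : {in s &, e =2 f} -> ipath e s = ipath f s.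
Proof.
move=> h; congr (_ && _); apply: eq_in_all => x xs; apply: eq_in_all => y ys.
by rewrite h.
Qed.
Lemma pth_ext (f : rel T) s a b : {in s &, e =2 f} -> pth e s a b -> pth f s a b.
Proof. by move=> h [i1 h1 l1]; split; rewrite // -(ipath_ext h). Qed.

(** Removing one edge turns a hole containing it into an induced path, so that holes and paths are
    covered by the same statements. *)
Definition del a b : rel T :=
  fun x y => e x y && ~~ (((x == a) && (y == b)) || ((x == b) && (y == a))).
Lemma del_sym a b : symmetric (del a b).
Proof.
move=> x y; rewrite /del e_sym; congr (_ && ~~ _).
by rewrite orbC; congr (_ || _); rewrite andbC.
Qed.
Lemma del_irr a b : irreflexive (del a b).
Proof. by move=> x; rewrite /del e_irr. Qed.
Lemma delC a b : del a b =2 del b a.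
Proof. by move=> x y; rewrite /del orbC. Qed.
Lemma del_id a b : ~~ e a b -> del a b =2 e.
Proof.
move=> nab x y; rewrite /del; case exy: (e x y) => //=.
apply/negP => /orP [] /andP [/eqP ex /eqP ey]; move: nab; first by rewrite -ex -ey exy.
by rewrite -ex -ey e_sym exy.
Qed.
Lemma del_off a b x y : ~~ ((x == a) && (y == b)) -> ~~ ((x == b) && (y == a)) ->
  del a b x y = e x y.
Proof. by rewrite /del negb_or => -> ->; rewrite !andbT. Qed.

Definition cross2 (p : seq T) a b (q : seq T) c d := (forall x, x \in p -> x \notin q) /\
  (forall x y, x \in p -> y \in q ->
     e x y = ((x == a) && (y == c)) || ((x == b) && (y == d))).

Lemma cross2C p a b q c d : cross2 p a b q c d -> cross2 q c d p a b.
Proof.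
case=> h1 h2; split=> [x xq|x y xq yp]; first by apply: contraL xq => /h1.
by rewrite e_sym h2 //; congr (_ || _); rewrite andbC.
Qed.

Lemma cross2_rev p a b q c d : cross2 p a b q c d -> cross2 (rev p) b a (rev q) d c.
Proof.
case=> h1 h2; split=> [x|x y]; first by rewrite !mem_rev => /h1.
by rewrite !mem_rev => xp yq; rewrite h2 // orbC.
Qed.

(** Unlike [prism], every path carries both its ends, which makes it easy to permute the paths and
    to exchange the triangles. *)
Definition prism3 p1 a1 b1 p2 a2 b2 p3 a3 b3 :=
  [/\ pth e p1 a1 b1, pth e p2 a2 b2, pth e p3 a3 b3 &
  [/\ a1 != b1, a2 != b2, a3 != b3 &
  [/\ cross2 p1 a1 b1 p2 a2 b2, cross2 p1 a1 b1 p3 a3 b3 & cross2 p2 a2 b2 p3 a3 b3]]].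

Definition cpl (X : {set T}) w := [forall h in X, e h w].
Lemma cplP (X : {set T}) w : reflect (forall h, h \in X -> e h w) (cpl X w).
Proof. exact: forall_inP. Qed.

End Compl.

Section Class.
Variables (T : finType) (e : rel T).
Hypothesis e_sym : symmetric e.
Hypothesis e_irr : irreflexive e.
Hypothesis noodd : forall c, hole e c -> ~~ odd (size c).
Hypothesis noanti : forall c, ~~ hole (compl e) c.
Hypothesis noprism : forall a1 a2 a3 q1 q2 q3, ~~ odd_prism e a1 a2 a3 q1 q2 q3.
Implicit Types (p q s : seq T) (x y z a b c d u v w h : T) (X Y : {set T}).

(** A cycle on four vertices is even anyway; from five vertices on it is a hole. *)
Lemma ladder_even p a b q c d : pth e p a b -> pth e q c d ->
  cross2 e p a b q c d -> 4 <= size p + size q -> ~~ odd (size p + size q).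
Proof.
move=> pp pq [h1 h2]; rewrite leq_eqVlt => /orP [/eqP <- //|s5].
by have := noodd (ladder_hole e_sym e_irr pp pq h1 h2 s5); rewrite size_cat size_rev.
Qed.

Lemma ladder_anti p a b q c d : pth (compl e) p a b -> pth (compl e) q c d ->
  cross2 (compl e) p a b q c d -> 5 <= size p + size q -> False.
Proof.
move=> pp pq [h1 h2] s5.
by have := noanti (p ++ rev q); rewrite (ladder_hole (compl_sym e_sym) (compl_irr e) pp pq h1 h2 s5).
Qed.

Lemma fan_even s u v y : pth e s u v -> y \notin s ->
  (forall w, w \in s -> e y w = (w == u) || (w == v)) -> 3 <= size s -> odd (size s).
Proof.
move=> ps ys h s3.
have := @ladder_even [:: y] y y s u v (pth1 e_sym e_irr y) ps.
rewrite /= => /(_ _ s3); rewrite negbK; apply; split=> [w|w w'].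
  by rewrite inE => /eqP ->.
by rewrite inE => /eqP -> w's; rewrite eqxx /= h.
Qed.

(** Any two of the paths bound an even cycle, so the three sizes have one parity; even sizes, that
    is odd lengths, would give an odd prism. *)
Lemma prism3_even p1 a1 b1 p2 a2 b2 p3 a3 b3 : prism3 e p1 a1 b1 p2 a2 b2 p3 a3 b3 ->
  [/\ odd (size p1), odd (size p2) & odd (size p3)].
Proof.
case=> P1 P2 P3 [n1 n2 n3] [c12 c13 c23].
have s1 := pth_size2 P1 n1; have s2 := pth_size2 P2 n2; have s3 := pth_size2 P3 n3.
have := ladder_even P1 P2 c12; have := ladder_even P1 P3 c13.
move=> /(_ (leq_add s1 s3)) h13 /(_ (leq_add s1 s2)) h12.
suff: odd (size p1) by move=> o1; split => //; move: o1 h12 h13; rewrite !oddD; clear; case: (odd _); case: (odd _); case: (odd _).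
apply: contraT => e1.
case: p1 p2 p3 P1 P2 P3 c12 c13 c23 s1 s2 s3 h12 h13 e1 =>
  [|x1 q1] [|x2 q2] [|x3 q3] // [i1 [<-] [l1]] [i2 [<-] [l2]] [i3 [<-] [l3]] [d12 c12] [d13 c13] [d23 c23] s1 s2 s3 h12 h13 e1.
have := noprism x1 x2 x3 q1 q2 q3; rewrite /odd_prism /prism i1 i2 i3 /=.
have dj (x y : T) (q q' : seq T) : (forall w, w \in x :: q -> w \notin y :: q') -> [disjoint x :: q & y :: q'].
  by move=> h; rewrite disjoint_has; apply/hasPn.
have cj x q y q' : (forall w w', w \in x :: q -> w' \in y :: q' -> e w w' =
    ((w == x) && (w' == y)) || ((w == last x q) && (w' == last y q'))) ->
    prism_cross e x q y q'.
  by move=> h; apply/allP => w wq; apply/allP => w' wq'; rewrite h.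
rewrite -l1 -l2 in c12; rewrite -l1 -l3 in c13; rewrite -l2 -l3 in c23.
rewrite !dj // (cj _ _ _ _ c12) // (cj _ _ _ _ c13) // (cj _ _ _ _ c23) //.
have -> : (q1 != [::]) by case: (q1) s1.
have -> : (q2 != [::]) by case: (q2) s2.
have -> : (q3 != [::]) by case: (q3) s3.
rewrite /=; move: h12 h13 e1 => /=; rewrite !oddD /=; case: (odd (size q1)); case: (odd (size q2)); by case: (odd (size q3)).
Qed.

Definition anticonn X := conn (compl e) X.

(* A path whose ends may be adjacent: [del e a b] removes the closing edge. *)
Definition roussel_rubio_cyclic X := forall a t b x z, pth (del e a b) (a :: rcons t b) a b ->
  ohead t = Some x -> ol t = Some z -> 1 < size t -> ~~ odd (size t) ->
  (e a b -> 2 < size t) ->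
  (forall w, w \in a :: rcons t b -> w \notin X) ->
  cpl e X a -> cpl e X b ->
  (exists2 w, w \in t & cpl e X w) \/
  (e a b /\ ((exists2 h, h \in X & forall w, w \in t -> ~~ e h w) \/
   exists h1 h2, [/\ h1 \in X, h2 \in X, (h1 != h2) && ~~ e h1 h2,
     forall w, w \in t -> e h1 w = (w == x) &
     forall w, w \in t -> e h2 w = (w == z)])).

Definition RR X := forall s u v, pth e s u v -> (forall w, w \in s -> w \notin X) ->
  cpl e X u -> cpl e X v -> (forall w, w \in s -> cpl e X w -> (w == u) || (w == v)) ->
  2 < size s -> odd (size s).

Lemma clp_facts a t b x z : pth (del e a b) (a :: rcons t b) a b ->
  ohead t = Some x -> ol t = Some z ->
  [/\ uniq t, a \notin t, b \notin t, a != b &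
  [/\ forall w, w \in t -> e a w = (w == x), forall w, w \in t -> e b w = (w == z) &
   pth e t x z]].
Proof.
move=> pp hx lz; have := pth_uniq pp.
rewrite /= mem_rcons rcons_uniq inE negb_or => /andP [/andP [nab nat] /andP [nbt ut]].
have sd := del_sym e_sym a b; have ird := del_irr e_irr a b.
have [+ _ _] := pp; rewrite (ipath_cons sd ird) => /and3P [_ /allP ha].
rewrite -cats1 => /(ipath_catP sd ird) [it _ _ hb].
have off c w w' : c \notin t -> w \in t -> ~~ ((w == c) && (w' == c)) by move=> nc wt; apply: contra nc => /andP [/eqP <-].
split=> //; split.
- move=> w wt; have := ha w; rewrite mem_rcons inE wt orbT => /(_ isT) /eqP.
  have -> : ohead (rcons t b) = Some x by case: (t) hx.
  rewrite -[Some x == _]/(x == w) (eq_sym x) => <-; rewrite del_off //.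
    by apply/negP => /andP [_ /eqP ew]; move: nbt; rewrite -ew wt.
  by rewrite (negbTE nab).
- move=> w wt; have := hb w b wt (mem_head _ _); rewrite lz /= eqxx andbT.
  rewrite -[Some z == _]/(z == w) (eq_sym z) => <-; rewrite del_off 1?e_sym //.
    by apply/negP => /andP [/eqP ew _]; move: nat; rewrite -ew wt.
  by apply/negP => /andP [/eqP ew _]; move: nbt; rewrite -ew wt.
have pd : pth (del e a b) t x z by split.
apply: pth_ext pd => w w' wt wt'; apply: del_off; apply/negP => /andP [/eqP ew /eqP ew'].
  by move: nat; rewrite -ew wt.
by move: nbt; rewrite -ew wt.
Qed.

(** For nonadjacent ends both exceptional outcomes are void, and the remaining one is excluded by
    the hypothesis on the interior. *)
Lemma roussel_rubio_open X : roussel_rubio_cyclic X -> RR X.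
Proof.
move=> G s u v ps dX cu cv hc s2; apply: contraT => os.
case: s ps dX hc s2 os => [|a s] // ps dX hc s2 os.
case/lastP: s ps dX hc s2 os => [|t b] // ps dX hc s2 os.
have [ip [ea]] := ps; rewrite -rcons_cons ol_rcons => - [eb].
subst a b; move: s2 os; rewrite /= size_rcons !ltnS negbK /= => s2 os.
have s1 : 1 < size t by case: (size t) s2 os => [|[]].
have [x hx] : exists x, ohead t = Some x by case: (t) s1 => // x t' _; exists x.
have [z lz] : exists z, ol t = Some z by case: (t) s1 => // y t' _; exists (last y t').
have nuv : ~~ e u v.
  apply/negP => euv; have nuv : u != v by apply: contraTneq euv => ->; rewrite e_irr.
  have := congr1 size (pth_adj e_sym e_irr ps nuv euv); rewrite /= size_rcons.
  by case: (size t) s2.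
have pd : pth (del e u v) (u :: rcons t v) u v.
  by apply: pth_ext ps => w w' _ _; rewrite del_id.
have [ut ut' vt' nv _] := clp_facts pd hx lz.
case: (G u t v x z pd hx lz s1) => //.
- by move=> euv; rewrite euv in nuv.
- case=> w wt cw; have := hc w; rewrite inE mem_rcons inE wt !orbT => /(_ isT cw) /orP [] /eqP ew.
    by rewrite -ew wt in ut'.
  by rewrite -ew wt in vt'.
by case=> euv; rewrite euv in nuv.
Qed.

End Class.

Section Class.
Variables (T : finType) (e : rel T).
Hypothesis e_sym : symmetric e.
Hypothesis e_irr : irreflexive e.
Hypothesis noodd : forall c, hole e c -> ~~ odd (size c).
Hypothesis noanti : forall c, ~~ hole (compl e) c.
Hypothesis noprism : forall a1 a2 a3 q1 q2 q3, ~~ odd_prism e a1 a2 a3 q1 q2 q3.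
Implicit Types (p q s t : seq T) (x y z a b c d u v w h : T) (X Y : {set T}).

Lemma clp_sub a t b x z s1 s s2 u v : pth (del e a b) (a :: rcons t b) a b ->
  ohead t = Some x -> ol t = Some z ->
  a :: rcons t b = s1 ++ s ++ s2 -> ohead s = Some u -> ol s = Some v ->
  (s1 != [::]) || (s2 != [::]) -> pth e s u v.
Proof.
move=> pp hx lz ep hs ls ns; have up := pth_uniq pp.
have sd := del_sym e_sym a b; have ird := del_irr e_irr a b.
have [+ _ _] := pp; rewrite ep => /(ipath_catP sd ird) [_ +  _ _].
move=> /(ipath_catP sd ird) [is1 _ _ _].
have ps : pth (del e a b) s u v by split.
have : (a \notin s) || (b \notin s).
  case/orP: ns => [n1|n2].
    case: s1 n1 ep {pp} => // c s1 _ [ea er]; apply/orP; left.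
    by move: up; rewrite /= er mem_cat mem_cat !negb_or => /andP [/and3P [_ -> _]].
  apply/orP; right; move: up; rewrite ep; case/lastP: s2 n2 ep {pp} => // s2 c _.
  rewrite -!rcons_cat -rcons_cons => /rcons_inj [_ <-]; rewrite rcons_uniq.
  by rewrite !mem_cat !negb_or => /andP [/and3P [_ -> _]].
move=> nn; apply: pth_ext ps => w w' ws ws'; apply: del_off.
  by apply/negP => /andP [/eqP e1 /eqP e2]; move: nn; rewrite -e1 -e2 ws ws'.
by apply/negP => /andP [/eqP e1 /eqP e2]; move: nn; rewrite -e1 -e2 ws ws'.
Qed.

Lemma uniq_ol s1 b s2 : uniq (s1 ++ b :: s2) -> ol (s1 ++ b :: s2) = Some b -> s2 = [::].
Proof.
rewrite ol_cat cat_uniq => /and3P [_ _ /= /andP [nb _]] [el].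
by case: s2 nb el => //= c s2 nb el; rewrite -[X in X \notin _]el mem_last in nb.
Qed.

Lemma clp_rev a t b : pth (del e a b) (a :: rcons t b) a b ->
  pth (del e b a) (b :: rcons (rev t) a) b a.
Proof.
move=> /(pth_rev (del_sym e_sym a b) (del_irr e_irr a b)).
rewrite rev_cons rev_rcons => pp.
by apply: pth_ext pp => w w' _ _; rewrite delC.
Qed.

(** The piece from [u] to [v] lies between consecutive neighbours of [y], and [w1] is its part
    before the first vertex complete to [X :\ y]. Entering [u] from [a] or [b] through [y] gives a
    path whose ends are complete to [X :\ y] and whose interior has no complete vertex, so [w1] has
    even size. This fails only if the relevant part sees both [a] and [b], which is the second
    outcome. *)
Lemma left_piece X y a t b x z s1 u g v s2 (w1 : seq T) i0 (w2 : seq T) :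
  RR e (X :\ y) -> y \in X -> ~~ cpl e (X :\ y) y ->
  pth (del e a b) (a :: rcons t b) a b -> ohead t = Some x -> ol t = Some z ->
  (forall w, w \in a :: rcons t b -> w \notin X) ->
  cpl e X a -> cpl e X b ->
  a :: rcons t b = s1 ++ (u :: rcons g v) ++ s2 ->
  (s1 != [::]) || (s2 != [::]) ->
  e y u -> ~~ has (e y) g -> u :: rcons g v = w1 ++ i0 :: w2 ->
  cpl e (X :\ y) i0 -> ~~ has (cpl e (X :\ y)) w1 -> has (cpl e (X :\ y)) w2 ->
  ~~ odd (size w1) \/
  ((forall w, w \in t -> e y w = (w == x)) /\ cpl e (X :\ y) z).
Proof.
move=> RRX yX ny pp hx lz dX ca cb ep ns eyu hg ew Ni hw1 hw2.
set N := cpl e (X :\ y) in ny Ni hw1 hw2 *.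
have Nc w : cpl e X w -> N w.
  by move=> /cplP h; apply/cplP => k /setD1P [_ /h].
have cle w : cpl e X w -> e y w by move=> /cplP; apply.
have [ut nat nbt nab [fa fb ptx]] := clp_facts e_sym e_irr pp hx lz.
case: w1 ew hw1 => [|u' w1] ew hw1; first by left.
have [eu ew'] : u' = u /\ rcons g v = w1 ++ i0 :: w2 by case: ew => -> ->.
subst u'.
have pw : pth e (u :: rcons g v) u v by apply: (clp_sub pp hx lz ep) => //=; rewrite last_rcons.
have pw1 : pth e (rcons (u :: w1) i0) u i0.
  by move: pw; rewrite ew => /(pth_split e_sym e_irr) [].
have [w2' ew2] : exists w2' : seq T, g = w1 ++ i0 :: w2'.
  case/lastP: w2 hw2 ew' {ew} => // w2 c _; rewrite -rcons_cons -rcons_cat.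
  by move=> /rcons_inj [-> _]; exists w2.
have Nu : ~~ N u by move: hw1; rewrite /= negb_or => /andP [].
have nua : u != a by apply: contraNneq Nu => ->; apply: Nc.
case: s1 ep ns => [|a' s1] ep ns; first by case: ep nua => ->; rewrite eqxx.
have ea : a' = a by case: ep.
subst a'; case: ep => ep.
have [vs [et evs]] : exists vs, t = s1 ++ (u :: g) ++ vs /\ rcons vs b = v :: s2.
  move: ep; have -> : s1 ++ (u :: rcons g v) ++ s2 = (s1 ++ u :: g) ++ v :: s2.
    by rewrite -cat_rcons rcons_cat rcons_cons -catA.
  rewrite (lastI v s2) -rcons_cat => /rcons_inj [-> ->].
  by exists (belast v s2); rewrite -catA.
have sg : {subset rcons (u :: w1) i0 <= u :: g}.
  by move=> w; rewrite ew2 -cat_cons mem_rcons mem_cat !inE => /or3P [->|->|->]; rewrite ?orbT.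
have st : {subset u :: g <= t} by move=> w wg; rewrite et !mem_cat wg orbT.
have gen c : (c == a) || (c == b) -> (forall w, w \in rcons (u :: w1) i0 -> e c w = false) ->
    ~~ odd (size (u :: w1)).
  move=> cab cw.
  have [cX cp nct] : [/\ cpl e X c, c \in a :: rcons t b & c \notin t].
    by case/orP: cab => /eqP ->; split => //; rewrite !inE ?mem_rcons ?inE ?eqxx ?orbT.
  have sp : {subset rcons (u :: w1) i0 <= a :: rcons t b}.
    by move=> w /sg /st wt; rewrite inE mem_rcons inE wt !orbT.
  have nc : c \notin rcons (u :: w1) i0 by apply: contra nct => /sg /st.
  have py : pth e (y :: rcons (u :: w1) i0) y i0.
    apply: (pth_cons e_sym e_irr pw1).
      by apply/negP => /sp /dX; rewrite yX.
    move=> w /sg; rewrite inE => /orP [/eqP ->|wg]; first by rewrite eyu eqxx.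
    rewrite (negbTE (hasPn hg _ wg)); symmetry; apply/eqP => ewu.
    by have := pth_uniq pw; rewrite /= mem_rcons inE negb_or -ewu wg andbF.
  have pc : pth e (c :: y :: rcons (u :: w1) i0) c i0.
    apply: (pth_cons e_sym e_irr py).
      rewrite inE negb_or nc andbT; apply: contraTneq yX => <-; exact: dX.
    move=> w; rewrite inE => /orP [/eqP ->|ww]; first by rewrite eqxx e_sym cle.
    rewrite cw //; symmetry; apply/eqP => ewy; have := dX w (sp w ww); by rewrite ewy yX.
  have : odd (size (c :: y :: rcons (u :: w1) i0)).
    2: by rewrite /= size_rcons /= !negbK.
  apply: (RRX _ _ _ pc _ (Nc _ cX) Ni) => // w; rewrite inE => /orP [/eqP ->|].
  - by rewrite !inE (negbTE (dX _ cp)) andbF.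
  - rewrite inE => /orP [/eqP ->|ww]; first by rewrite !inE eqxx.
    by rewrite !inE (negbTE (dX _ (sp w ww))) andbF.
  - by rewrite eqxx.
  rewrite inE => /orP [/eqP ->|]; first by rewrite -/(N y) (negbTE ny).
  rewrite mem_rcons inE => /orP [-> _|ww]; first by rewrite orbT.
  by rewrite -/(N w) (negbTE (hasPn hw1 _ ww)).
case: s1 et {ep ns} => [|x' s1] et.
  have exu : x = u by move: hx; rewrite et => - [].
  case zw : (z \in rcons (u :: w1) i0); last first.
    left; apply: (gen b); rewrite ?eqxx ?orbT // => w ww; rewrite fb ?(st _ (sg _ ww)) //.
    by apply/eqP => ewz; rewrite -ewz ww in zw.
  right; case: vs et evs => [|v' vs] et evs; last first.
    have : z \in v' :: vs by apply: ol_in; move: lz; rewrite et cat0s ol_cat.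
    move: ut; rewrite et cat0s cat_uniq => /and3P [_ /hasPn hh _] zv.
    by have := hh z zv; rewrite /= (sg _ zw).
  rewrite cats0 /= in et; split.
    move=> w; rewrite et exu inE => /orP [/eqP ->|wg]; first by rewrite eyu eqxx.
    rewrite (negbTE (hasPn hg _ wg)); symmetry; apply/eqP => ewu.
    by move: ut; rewrite et /= -ewu wg.
  have zi : z \in i0 :: w2' by apply: ol_in; move: lz; rewrite et ew2 -cat_cons ol_cat.
  move: ut; rewrite et ew2 -cat_cons cat_uniq => /and3P [_ /hasPn /(_ z zi) nz _].
  by move: zw; rewrite mem_rcons inE (negbTE nz) orbF => /eqP ->.
left; apply: (gen a); rewrite ?eqxx // => w ww; rewrite fa ?(st _ (sg _ ww)) //.
apply/eqP => ewx; have wg := sg _ ww; move: hx ut; rewrite et => - [ex].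
by rewrite cat_cons cons_uniq mem_cat mem_cat ex -ewx wg orbT.
Qed.

Lemma anti_nonnbr X y : anticonn e X -> y \in X -> 1 < #|X| ->
  exists2 h, h \in X & compl e y h.
Proof.
move=> cX yX X2.
have [w /setD1P [nwy wX]] : exists w, w \in X :\ y.
  by apply/set0Pn; rewrite -card_gt0; move: X2; rewrite (cardsD1 y) yX.
have [q [[iq hq lq] sq]] := conn_pth (compl_sym e_sym) (compl_irr e) cX yX wX.
case: q iq hq lq sq => // y' [|h q] iq [ey]; first by case=> ewy; rewrite -ewy ey eqxx in nwy.
move=> _ sq; exists h; first by apply: sq; rewrite !inE eqxx orbT.
move: iq; rewrite (ipath_cons (compl_sym e_sym) (compl_irr e)) => /and3P [_ /allP /(_ h (mem_head _ _)) /eqP + _].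
by rewrite ey /= => ->; rewrite eqxx.
Qed.

(** Counts the edges with both ends complete to [X :\ y] in two ways. The lemma for [X :\ y] makes
    the count odd along the whole sequence; cutting at the neighbours of [y] makes it even on each
    piece, unless one of the two exceptions occurs. *)
Lemma exceptional X y a t b x z :
  roussel_rubio_cyclic e (X :\ y) -> y \in X -> anticonn e X -> 1 < #|X| ->
  pth (del e a b) (a :: rcons t b) a b -> ohead t = Some x -> ol t = Some z ->
  1 < size t -> ~~ odd (size t) ->
  (forall w, w \in a :: rcons t b -> w \notin X) ->
  cpl e X a -> cpl e X b ->
  (forall w, w \in t -> ~~ cpl e X w) ->
  has (e y) t -> has (cpl e (X :\ y)) t ->
  ((forall w, w \in t -> e y w = (w == x)) /\ cpl e (X :\ y) z) \/
  ((forall w, w \in t -> e y w = (w == z)) /\ cpl e (X :\ y) x).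
Proof.
move=> G yX acX X2 pp hx lz t1 ot dX ca cb nc hy hN.
have RRX := roussel_rubio_open e_sym e_irr G.
set N := cpl e (X :\ y) in hN *.
have ny : ~~ N y.
  have [h hX /andP [nyh neyh]] := anti_nonnbr acX yX X2.
  by apply/negP => /cplP /(_ h); rewrite !inE eq_sym nyh hX => /(_ isT); rewrite e_sym (negbTE neyh).
have Nc w : cpl e X w -> N w.
  by move=> /cplP h; apply/cplP => k /setD1P [_ /h].
have cle w : cpl e X w -> e y w by move=> /cplP; apply.
have NM w : w \in t -> N w -> e y w -> False.
  move=> wt Nw eyw; have /negP := nc w wt; case; apply/cplP => h hX.
  by case: (eqVneq h y) => [->//|nhy]; move/cplP: Nw; apply; rewrite !inE nhy.
have [ut nat nbt nab [fa fb ptx]] := clp_facts e_sym e_irr pp hx lz.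
case: (boolP (N z && all (fun w => e y w == (w == x)) t)) => [/andP [Nz /allP hh]|n1].
  by left; split=> // w /hh /eqP.
case: (boolP (N x && all (fun w => e y w == (w == z)) t)) => [/andP [Nz /allP hh]|n2].
  by right; split=> // w /hh /eqP.
exfalso.
have proper (M : pred T) s1 u g v s2 : has M t -> ~~ has M g ->
    a :: rcons t b = s1 ++ (u :: rcons g v) ++ s2 -> (s1 != [::]) || (s2 != [::]).
  move=> hM hg ep; case: (s1) ep => // -[] _ ep; case: (s2) ep => //.
  rewrite cats0 => /rcons_inj [et _]; by rewrite et (negbTE hg) in hM.
have gap s1 u g v s2 : a :: rcons t b = s1 ++ (u :: rcons g v) ++ s2 -> N u -> N v ->
    ~~ has N g -> g = [::] \/ odd (size g).
  move=> ep Nu Nv hg; have ps := proper N _ _ _ _ _ hN hg ep.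
  have pw : pth e (u :: rcons g v) u v by apply: (clp_sub pp hx lz ep) => //=; rewrite last_rcons.
  case: g ep hg ps pw => [|c g] ep hg ps pw; [by left|right].
  have : odd (size (u :: rcons (c :: g) v)); last by rewrite /= size_rcons /= !negbK.
  apply: (RRX _ _ _ pw _ Nu Nv) => [w ww|w|]; last by rewrite /= size_rcons.
    rewrite !inE negb_and negbK; apply/orP; right; apply: dX.
    by rewrite ep !mem_cat ww orbT.
  rewrite inE mem_rcons inE => /or3P [->|->|wg] //; first by rewrite orbT.
  by rewrite -/(N w) (negbTE (hasPn hg _ wg)).
have ceN : ce N (a :: rcons t b).
  have -> : ce N (a :: rcons t b) = ~~ odd (size (a :: rcons t b)).
    apply: (ce_gap (x0 := a) (x1 := b)) => //; rewrite ?Nc //.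
      by rewrite /= last_rcons.
    by move=> s1 u g v s2 ep; apply: (gap s1 u g v s2); rewrite ep /= cat_rcons.
  by rewrite /= size_rcons /= negbK.
have : ce N (a :: rcons t b) = false; last by rewrite ceN.
have lab : ol (a :: rcons t b) = Some b by rewrite /= last_rcons.
apply: (ce_pieces (M := e y) (x0 := a) (x1 := b) _ lab) => //; rewrite ?cle //.
move=> s1 u g v s2 ep0 eyu eyv hg.
have ep : a :: rcons t b = s1 ++ (u :: rcons g v) ++ s2 by rewrite ep0 /= cat_rcons.
have ps := proper (e y) _ _ _ _ _ hy hg ep.
have pw : pth e (u :: rcons g v) u v by apply: (clp_sub pp hx lz ep) => //=; rewrite last_rcons.
have mp w : w \in u :: rcons g v -> [\/ w = a, w = b | w \in t].
  move=> ww; have : w \in a :: rcons t b by rewrite ep !mem_cat ww orbT.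
  rewrite inE mem_rcons inE => /or3P [/eqP ->|/eqP ->|->]; [exact: Or31|exact: Or32|exact: Or33].
case: g ep ep0 hg pw ps mp => [|c g] ep ep0 hg pw ps mp.
  rewrite /= andbF !addbF; apply/negbTE/negP => /andP [Nu Nv].
  have euv : e u v by apply/idP; have [] := pw; rewrite ipath_cons // => /and3P [_ /allP /(_ v (mem_head _ _)) /eqP ->].
  case: (mp u (mem_head _ _)) => [eu|eu|ut1]; last exact: NM ut1 Nu eyu.
  - have vw : v \in u :: rcons [::] v by rewrite !inE eqxx orbT.
    case: (mp v vw) => [ev|ev|vt]; last exact: NM vt Nv eyv.
      by move: euv; rewrite eu ev e_irr.
    have := congr1 size ep; move: ep; rewrite eu ev.
    have up := pth_uniq pp.
    case: s1 {ep0 ps} => [|k s1] ep; last first.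
      by move: up; rewrite ep; case: ep => <- _; rewrite /= mem_cat inE eqxx orbT.
    case/lastP: s2 ep => [|s2 k] ep; first by rewrite /= size_rcons; case: (size t) t1.
    have := congr1 behead ep; rewrite /= -rcons_cons => /rcons_inj [et _].
    by move: nbt; rewrite et mem_head.
  have up := pth_uniq pp; rewrite ep eu /= in up.
  have lb : ol (s1 ++ b :: v :: s2) = Some b.
    by have := congr1 (@ol T) ep; rewrite eu -rcons_cons ol_rcons.
  by have := uniq_ol up lb.
(* A long piece closes with [y] to a cycle, so its size is odd. By [left_piece] the parts outside
   the outermost vertices of [N] have even size, so the middle part has odd size and an even
   count. *)
have sw : odd (size (u :: rcons (c :: g) v)).
  apply: (fan_even e_sym e_irr noodd pw (y := y)).
  - apply/negP => yw; have : y \in a :: rcons t b by rewrite ep !mem_cat yw orbT.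
    by move/dX; rewrite yX.
  - move=> w; rewrite inE mem_rcons inE => /or3P [/eqP ->|/eqP ->|wg].
    + by rewrite eyu eqxx.
    + by rewrite eyv eqxx orbT.
    rewrite (negbTE (hasPn hg _ wg)); symmetry; apply/negbTE.
    have := pth_uniq pw; rewrite cons_uniq mem_rcons rcons_uniq inE negb_or -andbA negb_or.
    case/and4P => _ n3 n4 _; apply/andP; split; apply: contraTneq wg => -> //.
  by rewrite /= size_rcons.
set w := u :: rcons (c :: g) v in ep pw sw *.
case hw : (has N w); last by apply: ce_none; rewrite hw.
have [w1 [i0 [w2 [ew Ni h1]]]] := split_first hw.
have hw1 : ~~ has N w1 by apply/hasPn.
case hw2 : (has N w2); last by rewrite ew ce_one // hw2.
have [w3 [j0 [w4 [ew2 Nj h4]]]] := split_last hw2.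
have hw4 : ~~ has N w4 by apply/hasPn.
have L : ~~ odd (size w1).
  case: (left_piece RRX yX ny pp hx lz dX ca cb ep ps eyu hg ew Ni hw1 hw2) => //.
  case=> hM Nz; move: n1; rewrite -/N in Nz; rewrite Nz /=; case/negP; apply/allP => k kt.
  by rewrite hM.
have R : ~~ odd (size w4).
  have epr : b :: rcons (rev t) a = rev s2 ++ (v :: rcons (rev (c :: g)) u) ++ rev s1.
    have := congr1 rev ep; rewrite rev_cons rev_rcons rcons_cons => ->.
    by rewrite !rev_cat /w rev_cons rev_rcons -catA.
  have dXr k : k \in b :: rcons (rev t) a -> k \notin X.
    rewrite inE mem_rcons inE mem_rev => h; apply: dX; rewrite inE mem_rcons inE.
    by rewrite orbCA.
  have hxr : ohead (rev t) = Some z by rewrite ohead_rev.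
  have lzr : ol (rev t) = Some x by rewrite ol_rev.
  have ewr : v :: rcons (rev (c :: g)) u = rev w4 ++ j0 :: (rev w3 ++ i0 :: rev w1).
    have := congr1 rev ew; rewrite /w rev_cons rev_rcons rcons_cons => ->.
    rewrite ew2 !rev_cat !rev_cons !rev_cat !rev_cons -!cats1 -!catA.
    by [].
  have psr : (rev s2 != [::]) || (rev s1 != [::]).
    by rewrite orbC -!size_eq0 !size_rev !size_eq0.
  rewrite -size_rev.
  case: (left_piece RRX yX ny (clp_rev pp) hxr lzr dXr cb ca epr psr eyv _ ewr Nj) => //.
  - by rewrite has_rev.
  - by rewrite has_rev.
  - by rewrite has_cat /= -/N Ni orbT.
  case=> hM Nz; move: n2; rewrite -/N in Nz; rewrite Nz /=; case/negP; apply/allP => k kt.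
  by rewrite hM ?mem_rev.
rewrite ew ew2 ce_triml // -cat_cons -cat_rcons ce_trimr //.
have up := pth_uniq pp.
have ep2 : a :: rcons t b = (s1 ++ w1) ++ (i0 :: rcons w3 j0) ++ (w4 ++ s2).
  by rewrite ep ew ew2 -!catA /= -!cat_rcons -!catA /= cat_rcons.
rewrite (ce_gap (N := N) (x0 := i0) (x1 := j0)) //=; rewrite ?last_rcons ?size_rcons //=.
  rewrite negbK; move: sw; rewrite ew ew2 !size_cat /= size_cat /=.
  by move: L R; rewrite !oddD /= !oddD /=; case: (odd (size w1)); case: (odd (size w3)); case: (odd (size w4)).
move=> k1 u' m' v' k2 ek; apply: (gap ((s1 ++ w1) ++ k1) u' m' v' (k2 ++ (w4 ++ s2))).
by rewrite ep2 ek -!catA /= cat_rcons -!catA.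
Qed.

Lemma roussel_rubio_cyclic_exc X (y1 : T) a t b x z : roussel_rubio_cyclic e (X :\ y1) -> y1 \in X -> anticonn e X -> 1 < #|X| ->
  pth (del e a b) (a :: rcons t b) a b -> ohead t = Some x -> ol t = Some z ->
  1 < size t -> ~~ odd (size t) -> (e a b -> 2 < size t) ->
  (forall w, w \in a :: rcons t b -> w \notin X) ->
  cpl e X a -> cpl e X b ->
  (forall w, w \in t -> ~~ cpl e X w) -> (forall h, h \in X -> has (e h) t) ->
  (e a b /\ exists h1 h2, [/\ h1 \in X, h2 \in X, (h1 != h2) && ~~ e h1 h2,
     forall w, w \in t -> e h1 w = (w == x) &
     forall w, w \in t -> e h2 w = (w == z)]) \/
  ((forall w, w \in t -> e y1 w = (w == x)) /\ cpl e (X :\ y1) z) \/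
  ((forall w, w \in t -> e y1 w = (w == z)) /\ cpl e (X :\ y1) x).
Proof.
move=> G yX acX X2 pp hx lz t1 ot h2 dX ca cb nc hall.
case hN : (has (cpl e (X :\ y1)) t).
  by right; apply: (exceptional G yX acX X2 pp hx lz t1 ot dX ca cb nc (hall _ yX) hN).
left; case: (G a t b x z pp hx lz t1 ot h2).
- by move=> w /dX wX; rewrite !inE negb_and wX orbT.
- by apply/cplP => h /setD1P [_ hX]; move/cplP: ca; apply.
- by apply/cplP => h /setD1P [_ hX]; move/cplP: cb; apply.
- by case=> w wt cw; move/hasP: hN; case; exists w.
case=> eab [[h /setD1P [_ hX] hh]|[g1 [g2 [/setD1P [_ g1X] /setD1P [_ g2X] g12 q1 q2]]]].
  by have /hasP [w wt] := hall h hX; rewrite (negbTE (hh w wt)).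
by split=> //; exists g1, g2.
Qed.

(** Induction on the size of [X], removing either of two vertices that do not cut [X] in the
    complement. Each of them then sees only one end of [t] while the rest of [X] is complete to the
    other end, and the two must favour different ends. *)
Theorem roussel_rubio_cyclicP X : anticonn e X -> X != set0 -> roussel_rubio_cyclic e X.
Proof.
have [n] := ubnP #|X|; elim: n => // n IH in X *; rewrite ltnS => Xn acX X0.
move=> a t b x z pp hx lz t1 ot h2 dX ca cb.
case: (boolP (has (cpl e X) t)) => [/hasP [w wt cw]|/hasPn nc]; first by left; exists w.
right; have [ut nat nbt nab [fa fb ptx]] := clp_facts e_sym e_irr pp hx lz.
have pth_e : ~~ e a b -> pth e (a :: rcons t b) a b.
  by move=> nab'; apply: pth_ext pp => w w' _ _; rewrite del_id.
(* A vertex with no neighbour in [t] is the first exception when [a b] is an edge; otherwise it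
   closes the path to an odd hole. *)
case: (boolP [exists h in X, ~~ has (e h) t]) => [/exists_inP [h hX /hasPn hh]|hall0].
  case eab : (e a b); first by split=> //; left; exists h.
  have := fan_even e_sym e_irr noodd (pth_e (negbT eab)) (y := h).
  rewrite /= size_rcons /= negbK (negbTE ot) => F; exfalso; apply: notF; apply: F => //.
  - by apply/negP => /dX; rewrite hX.
  2: by move: t1; case: (size t).
  move=> w; rewrite inE mem_rcons inE => /or3P [/eqP ->|/eqP ->|wt].
  - by rewrite eqxx (cplP _ _ _ ca).
  - by rewrite eqxx orbT (cplP _ _ _ cb).
  rewrite (negbTE (hh w wt)); symmetry; apply/negbTE; rewrite negb_or.
  by apply/andP; split; apply: contraTneq wt => ->.
have hall h : h \in X -> has (e h) t.
  by move=> hX; apply: contraNT hall0 => hh; apply/exists_inP; exists h.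
have [v0 v0X] := set0Pn _ X0.
have X2 : 1 < #|X|.
  rewrite ltnNge; apply/negP => X1; have /hasP [w wt ew] := hall v0 v0X.
  have /negP := nc w wt; case; apply/cplP => h hX.
  by rewrite (card_le1P X1 v0 v0X) in hX; rewrite (eqP hX).
have [y1 [y1X _ cy1]] := noncut (compl_sym e_sym) (compl_irr e) acX v0X X2.
have [y2 [y2X ny cy2]] := noncut (compl_sym e_sym) (compl_irr e) acX y1X X2.
have GX y : y \in X -> conn (compl e) (X :\ y) -> roussel_rubio_cyclic e (X :\ y).
  move=> yX cy; apply: IH => //; first by move: Xn; rewrite (cardsD1 y) yX.
  by rewrite -card_gt0; move: X2; rewrite (cardsD1 y) yX.
have K y yX cy := roussel_rubio_cyclic_exc (GX y yX cy) yX acX X2 pp hx lz t1 ot h2 dX ca cb nc hall.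
have nxz : x != z.
  by apply/negP => /eqP exz; rewrite exz in ptx; rewrite (pth_eq e_sym e_irr ptx) in t1.
have xt := pth_in1 ptx; have zt := pth_in2 ptx.
case: (K y1 y1X cy1) => [[eab ?]|K1]; first by split=> //; right.
case: (K y2 y2X cy2) => [[eab ?]|K2]; first by split=> //; right.
have : exists h1 h2, [/\ h1 \in X, h2 \in X, h1 != h2,
   (forall w, w \in t -> e h1 w = (w == x)) /\ cpl e (X :\ h1) z &
   (forall w, w \in t -> e h2 w = (w == z)) /\ cpl e (X :\ h2) x].
  case: K1 => K1; case: K2 => K2.
  - have := cplP _ _ _ K1.2 y2; rewrite !inE ny y2X => /(_ isT).
    by rewrite K2.1 // eq_sym (negbTE nxz).
  - by exists y1, y2; split=> //; rewrite eq_sym.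
  - by exists y2, y1.
  have := cplP _ _ _ K1.2 y2; rewrite !inE ny y2X => /(_ isT).
  by rewrite K2.1 // (negbTE nxz).
case=> h1 [h2' [h1X h2X nh [f1 c1] [f2 c2]]].
have nX w : w \in t -> w \notin X by move=> wt; apply: dX; rewrite inE mem_rcons inE wt !orbT.
have aX : a \notin X by apply: dX; rewrite inE eqxx.
have bX : b \notin X by apply: dX; rewrite inE mem_rcons inE eqxx orbT.
have ne w w' : w \in X -> w' \notin X -> w != w' by move=> wX; apply: contraNneq => <-.
have Ca := cplP _ _ _ ca; have Cb := cplP _ _ _ cb.
(* If nonadjacent, [h1] and [h2'] form the second exception or, when [a b] is not an edge, an odd
   prism with triangles [h1 a x] and [b h2' z]. *)
case e12 : (e h1 h2'); last first.
  case eab : (e a b).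
    by split=> //; right; exists h1, h2'; rewrite nh e12.
  exfalso; suff [] : [/\ odd 2, odd 2 & odd (size t)] by [].
  apply: (@prism3_even _ e e_sym e_irr noodd noprism [:: h1; b] h1 b [:: a; h2'] a h2' t x z).
  split; [by apply: pth_2 => //; rewrite Cb|by apply: pth_2 => //; rewrite e_sym Ca|done|].
  have nw w : w \in t -> w != h1 by move=> wt; rewrite eq_sym ne // nX.
  have nw2 w : w \in t -> w != h2' by move=> wt; rewrite eq_sym ne // nX.
  have ha : a != h1 by rewrite eq_sym ne.
  have hb : b != h1 by rewrite eq_sym ne.
  have hb2 : b != h2' by rewrite eq_sym ne.
  have ha2 : a != h2' by rewrite eq_sym ne.
  split; [exact: ne|exact: ha2|exact: nxz|split].
  - split=> [w|w w'].
      rewrite !inE => /orP [] /eqP ->; rewrite negb_or; first by rewrite (eq_sym h1) ha nh.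
      by rewrite (eq_sym b) nab hb2.
    rewrite !inE => /orP [] /eqP -> /orP [] /eqP ->.
    + by rewrite Ca // !eqxx.
    + by rewrite e12 eqxx (negbTE (ne _ _ h1X bX)) /= eq_sym (negbTE ha2).
    + by rewrite e_sym eab (negbTE hb) /= (negbTE ha2) andbF.
    by rewrite e_sym Cb // !eqxx orbT.
  - split=> [w|w w'].
      rewrite !inE => /orP [] /eqP -> //; apply/negP => h1t; by rewrite (negbTE (nX _ h1t)) in h1X.
    rewrite !inE => /orP [] /eqP -> w't; first by rewrite f1 // eqxx (negbTE (ne _ _ h1X bX)) orbF.
    by rewrite fb // eqxx (negbTE hb).
  split=> [w|w w'].
    rewrite !inE => /orP [] /eqP -> //; apply/negP => h1t; by rewrite (negbTE (nX _ h1t)) in h2X.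
  rewrite !inE => /orP [] /eqP -> w't; first by rewrite fa // eqxx (negbTE ha2) orbF.
  by rewrite f2 // eqxx (negbTE (ne _ _ h2X aX)).
exfalso.
(* An antipath of [X] from [h1] to [h2'] has at least three vertices. It closes to an antihole
   through [z x], or through [z a b x] when [x z] is an edge. *)
have [q [pq qX]] := conn_pth (compl_sym e_sym) (compl_irr e) acX h1X h2X.
have sq : 2 < size q.
  have := pth_size2 pq nh; rewrite leq_eqVlt => /orP [/eqP eq2|//].
  case: q pq qX eq2 => [|k [|l [|]]] // [iq [ek] [el]] _ _.
  move: iq; rewrite (ipath_cons (compl_sym e_sym) (compl_irr e)) => /and3P [_ /allP /(_ l (mem_head _ _)) /eqP + _].
  by rewrite /= eqxx ek el /compl e12 andbF.
have cr w r : w \in q -> r \in [:: z; a; b; x] ->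
    compl e w r = (w == h1) && (r == z) || (w == h2') && (r == x).
  move=> wq; have wX := qX w wq.
  rewrite /compl !inE => /or4P [] /eqP ->.
  - rewrite ne ?nX // eqxx andbT (eq_sym z) (negbTE nxz) andbF orbF.
    case: (eqVneq w h1) => [->|nw]; first by rewrite f1 // eq_sym nxz.
    by rewrite (cplP _ _ _ c1) // !inE nw wX.
  - rewrite ne // Ca //=; symmetry; apply/negbTE; rewrite negb_or !negb_and.
    by apply/andP; split; apply/orP; right; [apply: contraNneq nat => ->| apply: contraNneq nat => ->].
  - rewrite ne // Cb //=; symmetry; apply/negbTE; rewrite negb_or !negb_and.
    by apply/andP; split; apply/orP; right; [apply: contraNneq nbt => ->| apply: contraNneq nbt => ->].
  rewrite ne ?nX // eqxx andbT (negbTE nxz) andbF /=.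
  case: (eqVneq w h2') => [->|nw]; first by rewrite f2 // nxz.
  by rewrite (cplP _ _ _ c2) // !inE nw wX.
have cs := compl_sym e_sym; have ci := compl_irr e.
case exz : (e x z); last first.
  have pr : pth (compl e) [:: z; x] z x.
    by apply: (pth_2 cs ci); rewrite /compl eq_sym nxz e_sym exz.
  apply: (ladder_anti e_sym noanti pq pr); last by rewrite (leq_add (m1 := 3) (m2 := 2)).
  split=> [w wq|w r wq roussel_rubioP].
    rewrite !inE negb_or; have wX := qX w wq; by rewrite !ne ?nX.
  by apply: cr => //; move: roussel_rubioP; rewrite !inE => /orP [] ->; rewrite ?orbT.
have et := pth_adj e_sym e_irr ptx nxz exz.
have neab : ~~ e a b by apply/negP => /h2; rewrite et.
have nza : z != a by apply: contraNneq nat => <-.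
have nzb : z != b by apply: contraNneq nbt => <-.
have nxa : x != a by apply: contraNneq nat => <-.
have nxb : x != b by apply: contraNneq nbt => <-.
have pr : pth (compl e) [:: z; a; b; x] z x.
  apply: (pth_cons cs ci).
    apply: (pth_cons cs ci (p := [:: b; x]) (a := b)).
      by apply: (pth_2 cs ci); rewrite /compl eq_sym nxb fb //=.
    - by rewrite !inE negb_or nab eq_sym nxa.
    move=> w; rewrite !inE /compl => /orP [] /eqP ->; first by rewrite eqxx nab neab.
    by rewrite fa // eqxx andbF (negbTE nxb).
  - by rewrite !inE !negb_or nza nzb eq_sym nxz.
  move=> w; rewrite !inE /compl => /or3P [] /eqP ->.
  - by rewrite eqxx nza e_sym fa // eq_sym nxz.
  - by rewrite e_sym fb // eqxx andbF eq_sym (negbTE nab).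
  by rewrite e_sym exz andbF (negbTE nxa).
apply: (ladder_anti e_sym noanti pq pr); last by rewrite (leq_add (m1 := 3) (m2 := 2)).
split=> [w wq|w r wq roussel_rubioP]; last exact: cr.
rewrite !inE !negb_or; have wX := qX w wq; by rewrite (ne _ z wX (nX z zt)) (ne _ a wX aX) (ne _ b wX bX) (ne _ x wX (nX x xt)).
Qed.

Corollary roussel_rubioP X : anticonn e X -> X != set0 -> RR e X.
Proof. by move=> acX X0; apply: roussel_rubio_open => //; apply: roussel_rubio_cyclicP. Qed.

End Class.

(** * Inner parts of paths, minimal connecting paths, separations *)

Section Tools.
Variables (T : finType) (e : rel T).
Hypothesis e_sym : symmetric e.
Hypothesis e_irr : irreflexive e.
Implicit Types (p q s t : seq T) (x y z a b c d u v w h : T) (X Y S : {set T}).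

Lemma pth_inner q a b : pth e q a b -> a != b -> ~~ e a b ->
  exists t x z, [/\ q = a :: rcons t b, pth e t x z, a \notin t, b \notin t &
   (forall w, w \in t -> e a w = (w == x)) /\ (forall w, w \in t -> e b w = (w == z))].
Proof.
move=> pq nab eab; have := pq; case: q pq => [|a' q] pq [] // _ [ea]; subst a'.
have s2 := pth_size2 pq nab; case/lastP: q pq s2 => // t b' pq s2.
rewrite -rcons_cons ol_rcons => - [eb]; subst b'.
case: t pq s2 => [|x t] pq s2.
  have [+ _ _] := pq; rewrite ipath_cons // => /and3P [_ /allP /(_ b (mem_head _ _)) /eqP].
  by rewrite /= eqxx (negbTE eab).
have pd : pth (del e a b) (a :: rcons (x :: t) b) a b.
  by apply: pth_ext pq => w w' _ _; rewrite del_id.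
have [ut nat nbt _ [fa fb pt]] := clp_facts e_sym e_irr pd (x := x) (z := last x t) erefl erefl.
by exists (x :: t), x, (last x t).
Qed.

Lemma pth_neq q a b : pth e q a b -> 1 < size q -> a != b.
Proof. by move=> pq; apply: contraTneq => eab; rewrite eab in pq; rewrite (pth_eq e_sym e_irr pq). Qed.

Lemma pth_nbr q a b w : pth e q a b -> 1 < size q -> w \in q -> exists2 w', w' \in q & e w w'.
Proof.
move=> pq q2 /splitPr wq; case: wq pq q2 => p1 p2; case: p2 => [|y p2] pq q2.
  case/lastP: p1 pq q2 => // p1 y; rewrite cat_rcons => /(pth_split e_sym e_irr) [_ [+ _ _]] _.
  rewrite ipath_cons // => /and3P [_ /allP /(_ w (mem_head _ _)) /eqP]; rewrite /= eqxx => h _.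
  by exists y; rewrite ?mem_cat ?inE ?eqxx ?orbT // e_sym h.
move: pq => /(pth_split e_sym e_irr) [_ [+ _ _]].
rewrite ipath_cons // => /and3P [_ /allP /(_ y (mem_head _ _)) /eqP]; rewrite /= eqxx => h _.
by exists y; rewrite ?mem_cat ?inE ?eqxx ?orbT.
Qed.

(** Cut a path at its last vertex in [N1], then at the first one in [N2]. The result may be a single
    vertex with both properties. *)
Lemma conn_link S (N1 N2 : pred T) x y : conn e S -> x \in S -> N1 x -> y \in S -> N2 y ->
  exists r c d, [/\ pth e r c d, {subset r <= S}, N1 c, N2 d &
   (forall w, w \in r -> N1 w = (w == c)) /\ (forall w, w \in r -> N2 w = (w == d))].
Proof.
move=> cS xS Nx yS Ny; have [q [pq qS]] := conn_pth e_sym e_irr cS xS yS.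
have h1 : has N1 q by apply/hasP; exists x => //; apply: pth_in1 pq.
have [s [t [c [eq pt Nc hc]]]] := pth_last e_sym e_irr pq h1.
have h2 : has N2 t by apply/hasP; exists y => //; apply: pth_in2 pt.
have [r [r' [d [et pr Nd hd]]]] := pth_first e_sym e_irr pt h2.
exists r, c, d; split=> //.
- by move=> w wr; apply: qS; rewrite eq et !mem_cat wr orbT.
split=> // w wr; apply/idP/eqP => [Nw|-> //]; last exact: hd.
by apply: hc => //; rewrite et mem_cat wr.
Qed.

Lemma sep_conn S X Y (x y : T) : S \subset X :|: Y -> x \in S :&: X -> y \in S :&: Y ->
  [disjoint X & Y] -> (forall u v, u \in X -> v \in Y -> ~~ e u v) -> ~ conn e S.
Proof.
move=> /subsetP sS /setIP [xS xX] /setIP [yS yY] /pred0P dXY n cS.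
have [q [pq qS]] := conn_pth e_sym e_irr cS xS yS.
have hX : has [pred w | w \in X] q by apply/hasP; exists x => //; apply: pth_in1 pq.
have [s [t [c [eq pt Nc hc]]]] := pth_last e_sym e_irr pq hX.
case: t pt eq hc => [|c' [|d t]] [it [ec]] // et eq hc.
  by case: et => ecy; have := dXY c; rewrite /= in Nc *; rewrite Nc -ec ecy yY.
subst c'; have dS : d \in S by apply: qS; rewrite eq mem_cat !inE eqxx !orbT.
have dq : d \in c :: d :: t by rewrite !inE eqxx orbT.
have ecd : e c d.
  by move: it; rewrite ipath_cons // => /and3P [_ /allP /(_ d (mem_head _ _)) /eqP ->]; rewrite /= eqxx.
have := sS d dS; rewrite inE => /orP [dX|dY].
  by have := hc d dq dX => edc; rewrite edc e_irr in ecd.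
by have := n c d Nc dY; rewrite ecd.
Qed.

Lemma disconn_del S v w : ~ conn e S -> v \in S -> w \in S -> e v w -> ~ conn e (S :\ v).
Proof.
move=> nS vS wS evw cS; apply: nS.
have -> : S = v |: (S :\ v) by rewrite setD1K.
refine (connU1 e_sym cS (x := w) _ _); last by rewrite e_sym.
by rewrite !inE wS andbT; apply: contraTneq evw => ->; rewrite e_irr.
Qed.

End Tools.

(** * Skew-partitions *)

Section Skew.
Variables (T : finType) (e : rel T).
Hypothesis e_sym : symmetric e.
Hypothesis e_irr : irreflexive e.
Hypothesis noodd : forall c, hole e c -> ~~ odd (size c).
Hypothesis noanti : forall c, ~~ hole (compl e) c.
Hypothesis noprism : forall a1 a2 a3 q1 q2 q3, ~~ odd_prism e a1 a2 a3 q1 q2 q3.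
Hypothesis noBSP : ~ exists A : {set T}, skew_partition e A /\ balanced e A.
Implicit Types (p q s t : seq T) (x y z a b c d u v w h : T) (X Y S B : {set T}).

Let csym := compl_sym e_sym.
Let cirr := compl_irr e.

Let good B := ~ conn (compl e) B /\ ~ conn e (~: B).

Lemma other_anticomp B u : ~ conn (compl e) B -> u \in B ->
  exists X, [/\ anticonn e X, X != set0, X \subset B, u \notin X &
   forall x w, x \in X -> w \in B -> w \notin X -> e x w].
Proof.
move=> nB uB; have [w wB nw] : exists2 w, w \in B & w \notin ccomp (compl e) B u.
  apply/exists_inP; apply: contraT; rewrite negb_exists_in => /forall_inP h; case: nB.
  move=> x y xB yB; have := h x xB; have := h y yB; rewrite !negbK !inE => hy hx.
  by apply: connect_trans hy; rewrite (restr_csym csym).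
have cX := @comp_conn _ _ csym cirr B w wB.
exists (ccomp (compl e) B w); split=> //.
- by apply/set0Pn; exists w; apply: comp_self.
- exact: comp_sub.
- by move: nw; rewrite !inE (restr_csym csym).
move=> x y xX yB yX; apply: contraR yX => nxy.
case: (eqVneq x y) => [<-//|nexy].
by apply: (comp_out csym cirr wB xX yB); rewrite /compl nexy.
Qed.

(** A vertex complete to [X] leaves [X] cut off from the rest in the complement, and its neighbour
    [a] outside [B] guarantees that removing it does not reconnect the other side. Maximality will
    forbid this move. *)
Lemma good_move B X v a : good B -> X != set0 -> X \subset B ->
  (forall x w, x \in X -> w \in B -> w \notin X -> e x w) ->
  v \notin B -> cpl e X v -> a \notin B -> e v a -> good (v |: B).
Proof.
case=> nB nA X0 XB hX vB cv aB eva; split; last first.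
  rewrite setCU setIC -setDE; apply: (disconn_del e_sym e_irr nA _ _ eva); by rewrite inE.
have [x xX] := set0Pn _ X0.
have vX : v \notin X by apply: contra vB => /(subsetP XB).
have XvB : v |: B = (X :|: ((v |: B) :\: X)).
  apply/setP => k; rewrite !inE; case kX: (k \in X) => //=.
  by rewrite (subsetP XB _ kX) orbT.
apply: (@sep_conn _ _ csym cirr _ X ((v |: B) :\: X) x v).
- by rewrite -XvB.
- by rewrite !inE xX (subsetP XB) // orbT.
- by rewrite !inE eqxx vX.
- by rewrite -setI_eq0 setDE setICA setICr setI0.
move=> y w yX; rewrite !inE negb_and negbK => /andP [wX /orP [/eqP ->|wB]].
  by rewrite (cplP _ _ _ cv) ?orbT.
by rewrite (hX y w) ?orbT.
Qed.

(** For a largest counterexample [M], a long odd path with interior outside [M] has nonadjacent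
    ends, so both are complete to an anticomponent [X] avoiding them; Roussel-Rubio yields an inner
    vertex complete to [X], which could be moved into [M]. For an odd antipath with interior in [M],
    maximality gives both ends nonneighbours in [X], and an antipath through [X] closes an
    antihole. *)
Lemma antidisconnected_no_cut B : disconnected_on (compl e) B -> conn e (~: B).
Proof.
pose bad (B : {set T}) := ~~ [forall x in B, forall y in B, connect (restr (compl e) B) x y] &&
  ~~ [forall x in ~: B, forall y in ~: B, connect (restr e (~: B)) x y].
have badP B' : reflect (good B') (bad B').
  have H f S : reflect (conn f S) [forall x in S, forall y in S, connect (restr f S) x y].
    apply: (iffP forall_inP) => [h x y xS yS|h x xS]; first exact: (forall_inP (h x xS)).
    by apply/forall_inP => y yS; exact: h.
  by apply: (iffP andP) => [[/H h1 /H h2]|[h1 h2]]; split=> //; apply/H.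
move=> dB; suff nb : ~ exists B, bad B.
  move=> x y xA yA; apply: contraT => nxy; case: nb; exists B; apply/badP; split.
    by case: dB => u [v [uB vB nuv]] /(_ u v uB vB); rewrite (negbTE nuv).
  by move/(_ x y xA yA); rewrite (negbTE nxy).
case=> B0 bB0; have [M /badP bM hM] := @arg_maxnP _ B0 bad (fun S => #|S|) bB0.
have mx v X : v \notin M -> X != set0 -> X \subset M ->
    (forall x w, x \in X -> w \in M -> w \notin X -> e x w) -> cpl e X v ->
    (exists2 a, a \notin M & e v a) -> False.
  move=> vM X0 XM hX cv [a aM eva].
  have bv : bad (v |: M) by apply/badP; apply: (@good_move M X v a).
  by have := hM _ bv; rewrite /= cardsU1 vM add1n ltnn.
case: noBSP; exists (~: M); split.
  by rewrite /skew_partition setCK; split; apply: not_conn; case: bM.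
rewrite /balanced setCK; split=> u q iq q2 oq uM vM /allP hi.
- have pq : pth e (u :: q) u (last u q) by split.
  have nuv : u != last u q by apply: (pth_neq e_sym e_irr pq); rewrite ltnS ltnW.
  have nadj : ~~ e u (last u q).
    by apply/negP => euv; have [eq] := pth_adj e_sym e_irr pq nuv euv; move: q2; rewrite eq.
  have [t [x [z [et pt ut vt [hu hv]]]]] := pth_inner e_sym e_irr pq nuv nadj.
  have tA w : w \in t -> w \notin M.
    move=> wt; have := hi w; rewrite inE; apply; rewrite /interior.
    case: et => ->; rewrite belast_rcons /=; exact: wt.
  have [X [cX X0 XM uX hX]] := other_anticomp bM.1 uM.
  have eq : size q = (size t).+1 by have := congr1 size et; rewrite /= size_rcons => -[].
  have vX : last u q \notin X.
    by apply/negP => vX; have := hX _ _ vX uM uX; rewrite e_sym (negbTE nadj).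
  have t2 : 1 < size t by move: q2 oq; rewrite eq; case: (size t) => [|[]].
  case: (boolP (has (cpl e X) t)) => [/hasP [w wt cw]|/hasPn nc].
    apply: (mx w X (tA w wt) X0 XM hX cw).
    by have [a at' ewa] := pth_nbr e_sym e_irr pt t2 wt; exists a; rewrite ?tA.
  have dX w : w \in u :: q -> w \notin X.
    rewrite et inE mem_rcons inE => /or3P [/eqP ->|/eqP ->|/tA] //.
    by apply: contra => /(subsetP XM).
  have cu : cpl e X u by apply/cplP => h hX'; apply: hX.
  have cv : cpl e X (last u q) by apply/cplP => h hX'; apply: hX.
  have := roussel_rubioP e_sym e_irr noodd noanti noprism cX X0 pq dX cu cv _ q2.
  rewrite /= oq => F; suff: false by []. apply: F => w.
  rewrite et inE mem_rcons inE => /or3P [-> //|->|wt]; first by rewrite orbT.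
  by move=> cw; have := nc w wt; rewrite cw.
have pq : pth (compl e) (u :: q) u (last u q) by split.
have nuv : u != last u q by apply: (pth_neq csym cirr pq); rewrite ltnS ltnW.
have nadj : ~~ compl e u (last u q).
  by apply/negP => euv; have [eq] := pth_adj csym cirr pq nuv euv; move: q2; rewrite eq.
have euv : e u (last u q) by move: nadj; rewrite /compl nuv negbK.
have [t [x [z [et pt ut vt [hu hv]]]]] := pth_inner csym cirr pq nuv nadj.
have eq : size q = (size t).+1 by have := congr1 size et; rewrite /= size_rcons => -[].
have t2 : 1 < size t by move: q2 oq; rewrite eq; case: (size t) => [|[]].
have tM w : w \in t -> w \in M.
  move=> wt; apply: hi; rewrite /interior.
  case: et => ->; rewrite belast_rcons /=; exact: wt.
have [X [cX X0 XM xX hX]] := other_anticomp bM.1 (tM x (pth_in1 pt)).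
have tX w : w \in t -> w \notin X.
  move=> wt; apply/negP => wX.
  have := conn_pset csym cirr pt; apply: (@sep_conn _ _ csym cirr _ X (M :\: X) w x).
  - by apply/subsetP => y; rewrite !inE => /tM ->; rewrite andbT orbN.
  - by rewrite !inE wt.
  - by rewrite !inE (pth_in1 pt) xX tM ?(pth_in1 pt).
  - by rewrite -setI_eq0 setDE setICA setICr setI0.
  by move=> y k yX /setDP [kM kX]; rewrite /compl negb_and negbK hX ?orbT.
have cpt w h : w \in t -> h \in X -> e h w by move=> wt hX'; apply: hX => //; [exact: tM|exact: tX].
have nb k k' : k \notin M -> e k k' -> k' \notin M -> exists2 h, h \in X & compl e k h.
  move=> kM ekk k'M; case: (boolP (cpl e X k)) => [ck|].
    by case: (mx k X kM X0 XM hX ck); exists k'.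
  rewrite negb_forall_in => /exists_inP [h hX' nek]; exists h => //.
  by rewrite /compl e_sym nek andbT; apply: contraNneq kM => ->; apply: (subsetP XM).
rewrite inE in uM; rewrite inE in vM.
have [h1 h1X c1] := nb _ _ uM euv vM.
have evu : e (last u q) u by rewrite e_sym.
have [h2 h2X c2] := nb _ _ vM evu uM.
have [r [c [d [pr rX Nc Nd [rc rd]]]]] := conn_link csym cirr cX h1X c1 h2X c2.
apply: (ladder_anti e_sym noanti pq pr); last by rewrite /= eq; exact: (leq_add t2 (pth_size pr)).
split=> [w|w w'].
  rewrite et inE mem_rcons inE => /or3P [/eqP ->|/eqP ->|wt]; apply/negP => /rX wX.
  - by rewrite (subsetP XM _ wX) in uM.
  - by rewrite (subsetP XM _ wX) in vM.
  by have := tX _ wt; rewrite wX.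
have uX k : k \in r -> (u == k) = false by move=> /rX kX; apply: contraNF uM => /eqP ->; apply: (subsetP XM).
rewrite et inE mem_rcons inE => /or3P [/eqP ->|/eqP ->|wt] w'r.
- by rewrite rc // eqxx (negbTE nuv) orbF.
- by rewrite rd // eqxx (eq_sym (last u q) u) (negbTE nuv).
rewrite /compl (e_sym w) (cpt w w' wt (rX _ w'r)) andbF.
symmetry; apply/negbTE; rewrite negb_or; apply/andP; split; apply: contraTN wt => /andP [/eqP -> _] //.
Qed.

End Skew.

(** * Prisms created by hats *)

Section Hat.
Variables (T : finType) (e : rel T).
Hypothesis e_sym : symmetric e.
Hypothesis e_irr : irreflexive e.
Hypothesis noodd : forall c, hole e c -> ~~ odd (size c).
Hypothesis noanti : forall c, ~~ hole (compl e) c.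
Hypothesis noprism : forall a1 a2 a3 q1 q2 q3, ~~ odd_prism e a1 a2 a3 q1 q2 q3.
Implicit Types (p q s t : seq T) (x y z a b c d u v w h : T) (X Y S : {set T}).

Lemma sub_pth s1 s s2 a b u v : pth e (s1 ++ s ++ s2) a b -> ohead s = Some u ->
  ol s = Some v -> pth e s u v.
Proof.
case=> + _ _ hs ls; move=> /(ipath_catP e_sym e_irr) [_ + _ _].
by move=> /(ipath_catP e_sym e_irr) [is1 _ _ _].
Qed.

(** Roussel-Rubio applied to every gap between consecutive complete vertices fixes the parity of the
    number of edges joining complete vertices. *)
Lemma rr_ce X s u v : anticonn e X -> X != set0 -> pth e s u v ->
  (forall w, w \in s -> w \notin X) -> cpl e X u -> cpl e X v ->
  ce (cpl e X) s = ~~ odd (size s).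
Proof.
move=> aX X0 ps dX cu cv; have [_ hs ls] := ps.
apply: (ce_gap hs ls cu cv) => s1 x m y s2 es cx cy hm.
case: m es hm => [|w m] es hm; [by left|right].
have es' : s = s1 ++ (x :: rcons (w :: m) y) ++ s2 by rewrite es [in RHS]cat_cons cat_rcons.
have px : pth e (x :: rcons (w :: m) y) x y.
  by rewrite es' in ps; apply: (sub_pth ps) => //=; rewrite last_rcons.
have := roussel_rubioP e_sym e_irr noodd noanti noprism aX X0 px _ cx cy.
rewrite /= size_rcons /= negbK => -> // => [k kk|k].
  by apply: dX; rewrite es' !mem_cat kk orbT.
rewrite inE -rcons_cons mem_rcons inE => /or3P [->|->|km] //; first by rewrite orbT.
by rewrite (negbTE (hasPn hm _ km)).
Qed.

(** The same count around a hole opened at [a b]. The complete vertex in [t] ensures that every gap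
    is a proper part of the hole, hence an induced path. *)
Lemma rr_cyc X a t b x z : anticonn e X -> X != set0 ->
  pth (del e a b) (a :: rcons t b) a b -> ohead t = Some x -> ol t = Some z ->
  (forall w, w \in a :: rcons t b -> w \notin X) -> cpl e X a -> cpl e X b ->
  has (cpl e X) t -> ce (cpl e X) (a :: rcons t b) = ~~ odd (size t).
Proof.
move=> aX X0 pp hx lz dX ca cb ht.
have -> : ~~ odd (size t) = ~~ odd (size (a :: rcons t b)) by rewrite /= size_rcons /= negbK.
have lb : ol (a :: rcons t b) = Some b by rewrite /= last_rcons.
apply: (ce_gap _ lb) => // s1 u m v s2 es cu cv hm.
case: m es hm => [|w m] es hm; [by left|right].
have es' : a :: rcons t b = s1 ++ (u :: rcons (w :: m) v) ++ s2 by rewrite es [in RHS]cat_cons cat_rcons.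
have pr : (s1 != [::]) || (s2 != [::]).
  apply: contraT; rewrite negb_or !negbK => /andP [/eqP e1 /eqP e2].
  have : rcons t b = rcons (w :: m) v by have := congr1 behead es'; rewrite e1 e2 cats0.
  move=> /rcons_inj [et _].
  by rewrite et (negbTE hm) in ht.
have px : pth e (u :: rcons (w :: m) v) u v.
  by apply: (clp_sub e_sym e_irr pp hx lz es') => //=; rewrite last_rcons.
have := roussel_rubioP e_sym e_irr noodd noanti noprism aX X0 px _ cu cv.
rewrite /= size_rcons /= negbK => -> // => [k kk|k].
  by apply: dX; rewrite es' !mem_cat kk orbT.
rewrite inE -rcons_cons mem_rcons inE => /or3P [->|->|km] //; first by rewrite orbT.
by rewrite (negbTE (hasPn hm _ km)).
Qed.

(** Opens the cycle formed by [s] and [r] at an edge of [s], listing the other vertices in cyclic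
    order from [c'] to [c]. *)
Lemma ladder_open s u v r h l s1 c c' s2 : pth e s u v -> pth e r h l -> cross2 e s u v r h l ->
  s = s1 ++ c :: c' :: s2 ->
  pth (del e c' c) (c' :: rcons (s2 ++ rev r ++ s1) c) c' c.
Proof.
move=> ps pr [dsr csr] es.
have [p1 p2] : pth e (rcons s1 c) u c /\ pth e (c' :: s2) c' v.
  have es1 : s = rcons s1 c ++ c' :: s2 by rewrite es cat_rcons.
  split; first by move: ps; rewrite es => /(pth_split e_sym e_irr) [].
  by move: ps; rewrite es1 => /(pth_split e_sym e_irr) [].
have ps' := ps; rewrite es -cat_rcons in ps'.
have [d12 c12] := pth_cat_cross e_sym e_irr ps' p1 p2.
have ins w : w \in s = (w \in rcons s1 c) || (w \in c' :: s2) by rewrite es -cat_rcons mem_cat.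
have sd := del_sym e_sym c' c; have ird := del_irr e_irr c' c.
have nc w : w \in c' :: s2 -> w != c.
  by move=> ww; apply: contraTneq ww => ->; apply: d12; rewrite mem_rcons mem_head.
have nc' w : w \in rcons s1 c -> w != c'.
  by move=> ww; apply: contraTneq ww => ->; apply: contraL (mem_head c' s2) => /d12.
have nr w : w \in r -> w != c /\ w != c'.
  move=> wr; split; apply: contraTneq wr => ->; apply: dsr; rewrite ins.
    by rewrite mem_rcons mem_head.
  by rewrite mem_head orbT.
have P2 : pth (del e c' c) (c' :: s2) c' v.
  by apply: pth_ext p2 => w w' ws ws'; rewrite del_off // negb_and (nc _ ws, nc _ ws') ?orbT.
have P1 : pth (del e c' c) (rcons s1 c) u c.
  by apply: pth_ext p1 => w w' ws ws'; rewrite del_off // negb_and (nc' _ ws, nc' _ ws') ?orbT.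
have R : pth (del e c' c) (rev r) l h.
  apply: pth_ext (pth_rev e_sym e_irr pr) => w w'; rewrite !mem_rev => wr wr'.
  by rewrite del_off // negb_and ?(nr _ wr).1 ?(nr _ wr).2.
rewrite !rcons_cat -cat_cons.
apply: (pth_cat sd ird P2 (pth_cat sd ird R P1 _ _)).
- by move=> w; rewrite mem_rev => wr; apply: contraL wr => ws; apply: dsr; rewrite ins ws.
- move=> w w'; rewrite mem_rev => wr ws'.
  rewrite del_off ?negb_and ?(nr _ wr).1 ?(nr _ wr).2 //.
  rewrite e_sym csr ?ins ?ws' //; have -> : (w' == v) = false.
    apply/eqP => ev; have := d12 v; rewrite -{1}ev ws' => /(_ isT) /negP; case.
    exact: pth_in2 p2.
  by rewrite orbF andbC.
- move=> w ws; rewrite mem_cat negb_or mem_rev; apply/andP; split.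
    by apply: dsr; rewrite ins ws orbT.
  by apply: contraL ws => /d12.
move=> w w' ws; rewrite mem_cat mem_rev => /orP [wr|ws'].
  rewrite del_off ?negb_and ?(nr _ wr).1 ?(nr _ wr).2 ?orbT //.
  rewrite csr ?ins ?ws ?orbT //; case: (w =P u) => // eu.
  by have := d12 u (pth_in1 p1); rewrite -eu ws.
have -> : (w' == l) = false.
  by apply/eqP => el; have := dsr w'; rewrite ins ws' el (pth_in2 pr) => /(_ isT).
rewrite andbF /del e_sym c12 //.
by case: (w' =P c) => //= _; case: (w =P c').
Qed.

(** The vertex [x] sees the edge [c c'] of an even cycle and nothing else of it. A minimal path from
    [x] through [G] reaches [t] from some vertex [d]; parity excludes that [d] has a single
    neighbour on [t], or that its first and last neighbours there are not consecutive. What remains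
    is a prism with triangle [c c' x]. *)
Lemma hat_prism c t c' x z h l (G : {set T}) : pth (del e c c') (c :: rcons t c') c c' -> e c c' ->
  ohead t = Some h -> ol t = Some l -> ~~ odd (size t) ->
  x \notin t -> e x c -> e x c' -> (forall w, w \in t -> ~~ e x w) ->
  conn e G -> (forall y, y \in G -> ~~ e y c /\ ~~ e y c') -> z \in G -> e x z ->
  (exists2 y, y \in G & (y \in t) || has (e y) t) ->
  exists p1 b1 p2 b2 p3 b3, prism3 e p1 c b1 p2 c' b2 p3 x b3.
Proof.
move=> pp ecc hh lh ot xt xc xc' nx cG nG zG exz [y yG ty].
have [ut ct c't nc [fc fc' pt]] := clp_facts e_sym e_irr pp hh lh.
have [f [f1 [d [pf fG N1 N2 [h1 h2]]]]] := conn_link e_sym e_irr cG zG exz yG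
  (N2 := fun y => (y \in t) || has (e y) t) ty.
have xf : x \notin f by apply/negP => /fG /nG [/negP]; case.
have cf : c \notin f by apply/negP => /fG /nG [_ /negP].
have c'f : c' \notin f by apply/negP => /fG /nG []; rewrite e_sym ecc.
have px : pth e (x :: f) x d by apply: (pth_cons e_sym e_irr pf xf).
have dt : d \notin t.
  apply/negP => dt; case: (ltnP 1 (size f)) => [f2|].
    have [w wf edw] := pth_nbr e_sym e_irr pf f2 (pth_in2 pf).
    have := h2 w wf; have -> : has (e w) t by apply/hasP; exists d; rewrite // e_sym.
    by rewrite orbT => /esym /eqP ewd; rewrite ewd e_irr in edw.
  case: f pf {h1 h2 fG xf cf c'f px} => [|w [|]] // [] //= _ [ew] [ed] _.
  by have := nx d dt; rewrite -ed ew N1.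
have hd : has (e d) t by move: N2; rewrite (negbTE dt).
have ft w : w \in f -> w \notin t.
  move=> wf; have := h2 w wf; case: (eqVneq w d) => [-> //|_] /negbT.
  by rewrite negb_or => /andP [].
have fe w w' : w \in f -> w' \in t -> e w w' = (w == d) && e d w'.
  move=> wf wt; have := h2 w wf; case: (eqVneq w d) => [-> //|_] /negbT.
  by rewrite negb_or => /andP [_ /hasPn /(_ w' wt) /negbTE].
have [l1 [hi [l2 [et dhi hl1]]]] := split_first hd.
have dxn : x == d = false by apply/eqP => exd; rewrite exd (pth_in2 pf) in xf.
have hcross k q k1 g : pth e (k :: q) k g -> pth e q k1 g -> e x k ->
    (forall w, w \in f -> e w k = false) -> k \notin f ->
    {subset q <= t} -> (forall w, w \in q -> e d w = (w == g)) -> k \notin t ->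
    cross2 e (x :: f) x d (k :: q) k g.
  move=> pq pq1 exk fk kf qt qd kt.
  have gk : k == g = false by apply/eqP => ek; move: kt; rewrite ek qt // (pth_in2 pq1).
  have kx : k == x = false by apply/eqP => ek; move: exk; rewrite ek e_irr.
  split=> [w|w w'].
    rewrite !inE => /orP [/eqP ->|wf]; rewrite negb_or; first by rewrite eq_sym kx; apply: contra xt => /qt.
    rewrite (contraNneq _ kf) => [|<- //]; apply/negP => /qt; exact/negP/ft.
  rewrite !inE => /orP [/eqP ->|wf] /orP [/eqP ->|wq].
  - by rewrite exk !eqxx.
  - rewrite (negbTE (nx _ (qt _ wq))) dxn eqxx orbF /=; symmetry; apply/eqP => ewk.
    by move: kt; rewrite -ewk qt.
  - rewrite fk // gk !andbF orbF eqxx andbT; symmetry; apply/eqP => ewx.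
    by move: xf; rewrite -ewx wf.
  have -> : (w == x) = false by apply/eqP => ewx; move: xf; rewrite -ewx wf.
  by rewrite fe ?qt // qd.
have half k q k1 g : pth e (k :: q) k g -> pth e q k1 g ->
    cross2 e (x :: f) x d (k :: q) k g -> odd (size f) = odd (size q).
  move=> pq pq1 cr; have := ladder_even e_sym e_irr noodd px pq cr.
  rewrite /= addSn addnS /= negbK !ltnS (leq_add (pth_size pf) (pth_size pq1)) oddD => /(_ isT).
  by case: (odd _); case: (odd _).
have fc0 w : w \in f -> e w c = false by move=> /fG /nG [/negbTE].
have fc1 w : w \in f -> e w c' = false by move=> /fG /nG [_ /negbTE].
have pct : pth e (c :: t) c l := pth_cons e_sym e_irr pt ct fc.
have prt := pth_rev e_sym e_irr pt.
have pct' : pth e (c' :: rev t) c' h.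
  by apply: (pth_cons e_sym e_irr prt) => [|w]; rewrite mem_rev //; apply: fc'.
set q1 := rcons l1 hi.
have Pq1 : pth e q1 h hi by move: pt; rewrite et => /(pth_split e_sym e_irr) [].
have Pc1 : pth e (c :: q1) c hi by move: pct; rewrite et -cat_cons => /(pth_split e_sym e_irr) [].
have q1t : {subset q1 <= t} by move=> w; rewrite et -cat_rcons mem_cat => ->.
have dq1 w : w \in q1 -> e d w = (w == hi).
  rewrite mem_rcons inE => /orP [/eqP ->|wl]; first by rewrite eqxx.
  rewrite (negbTE (hl1 _ wl)); symmetry; apply/eqP => ewi.
  by have := pth_uniq Pq1; rewrite rcons_uniq -ewi wl.
have cr1 := hcross _ _ _ _ Pc1 Pq1 xc fc0 cf q1t dq1 ct.
have od1 := half _ _ _ _ Pc1 Pq1 cr1.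
have right hj l3 l4 : t = l3 ++ hj :: l4 -> e d hj -> ~~ has (e d) l4 ->
    exists2 q2, q2 = rcons (rev l4) hj & [/\ pth e (c' :: q2) c' hj,
     cross2 e (x :: f) x d (c' :: q2) c' hj & odd (size f) = ~~ odd (size l4)].
  move=> et' dhj hl4; exists (rcons (rev l4) hj) => //.
  have ert : rev t = rev l4 ++ hj :: rev l3 by rewrite et' rev_cat rev_cons cat_rcons.
  have Pq2 : pth e (rcons (rev l4) hj) l hj by move: prt; rewrite ert => /(pth_split e_sym e_irr) [].
  have Pc2 : pth e (c' :: rcons (rev l4) hj) c' hj.
    by move: pct'; rewrite ert -cat_cons => /(pth_split e_sym e_irr) [].
  have q2t : {subset rcons (rev l4) hj <= t}.
    by move=> w; rewrite -[w \in t]mem_rev ert -cat_rcons mem_cat => ->.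
  have dq2 w : w \in rcons (rev l4) hj -> e d w = (w == hj).
    rewrite mem_rcons inE => /orP [/eqP ->|]; first by rewrite eqxx.
    rewrite mem_rev => wl; rewrite (negbTE (hasPn hl4 _ wl)); symmetry; apply/eqP => ewi.
    by have := pth_uniq Pq2; rewrite rcons_uniq mem_rev -ewi wl.
  have cr2 := hcross _ _ _ _ Pc2 Pq2 xc' fc1 c'f q2t dq2 c't.
  split=> //; by rewrite (half _ _ _ _ Pc2 Pq2 cr2) size_rcons size_rev.
rewrite /q1 size_rcons /= in od1.
case hl2 : (has (e d) l2); last first.
  have [_ _ [_ _ od2]] := right _ _ _ et dhi (negbT hl2).
  by move: ot od1 od2; rewrite et size_cat /= oddD /= => + -> ; case: (odd _); case: (odd _).
have [l3 [hj [l4 [el2 dhj hl4]]]] := split_last hl2.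
have et' : t = (l1 ++ hi :: l3) ++ hj :: l4 by rewrite et el2 -catA.
have [q2 eq2 [Pc2 cr2 od2]] := right _ _ _ et' dhj (introT hasPn hl4).
have pctt : pth e ((c :: q1) ++ (l3 ++ hj :: l4)) c l by rewrite cat_cons cat_rcons -el2 -et.
have [k Pk] : exists k, pth e (l3 ++ hj :: l4) k l.
  by apply: (pth_catr e_sym e_irr pctt); case: (l3).
have [d12 c12] := pth_cat_cross e_sym e_irr pctt Pc1 Pk.
have q2in w : w \in q2 -> w \in hj :: l4 by rewrite eq2 mem_rcons !inE mem_rev.
have tin w : w \in l3 ++ hj :: l4 -> w \in t by move=> wl; rewrite et mem_cat inE el2 wl !orbT.
have q2in' w : w \in q2 -> w \in l3 ++ hj :: l4 by move=> /q2in; rewrite mem_cat => ->; rewrite orbT.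
have cq2 : forall w, w \in c :: q1 -> w \notin c' :: q2.
  move=> w wc; rewrite inE negb_or; apply/andP; split; last by apply: contra (d12 _ wc) => /q2in'.
  move: wc; rewrite inE => /orP [/eqP -> //|/q1t wt]; by apply: contraNneq c't => <-.
have lq1 : l \notin c :: q1 by apply: contraL (pth_in2 Pk) => /d12.
have hik w w' : w \in c :: q1 -> w' \in c' :: q2 -> e w w' = (w == c) && (w' == c') || (w == hi) && (w' == k).
  have hic : hi == c = false by apply/eqP => ehc; move: ct; rewrite -ehc q1t // mem_rcons mem_head.
  move=> wc; rewrite inE => /orP [/eqP ->|wq2].
    have -> : (c' == k) = false by apply/eqP => eck; move: c't; rewrite eck tin // (pth_in1 Pk).
    rewrite eqxx andbT andbF orbF; move: (wc); rewrite inE => /orP [/eqP ->|wq1]; first by rewrite ecc eqxx.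
    rewrite e_sym fc' ?q1t //; have -> : (w == l) = false by apply: contraNF lq1 => /eqP <-.
    by symmetry; apply: contraNF ct => /eqP <-; rewrite q1t.
  rewrite c12 ?q2in' //; have -> : (w' == c') = false.
    by apply/eqP => ewc; move: c't; rewrite -ewc tin ?q2in'.
  by rewrite andbF.
(* An empty [l3] makes the first and last neighbours of [d] consecutive, so that they form the
   second triangle with [d]; otherwise [c :: q1] and [c' :: q2] followed by [d] bound an odd
   cycle. *)
case: l3 et' el2 Pk pctt d12 c12 q2in' tin => [|k' l3] et' el2 Pk pctt d12 c12 q2in' tin.
  have ek : k = hj by case: Pk => _ [->].
  exists (c :: q1), hi, (c' :: q2), hj, (x :: f), d; split=> //; split.
  - by apply: contraNneq ct => ->; rewrite q1t // mem_rcons mem_head.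
  - by apply: contraNneq c't => ->; rewrite et' mem_cat mem_head orbT.
  - by rewrite dxn.
  split; [|exact: cross2C|exact: cross2C].
  by split=> // w w' wc wc'; rewrite hik // ek.
exfalso.
have nk : forall w', w' \in q2 -> (w' == k) = false.
  move=> w' /q2in wq; have [_ [ek] _] := Pk; have := pth_uniq Pk; rewrite /= mem_cat negb_or ek.
  by move=> /andP [/andP [_ kq] _]; apply: contraNF kq => /eqP <-.
have dnc : (d == c) = false by apply: contraNF cf => /eqP <-; exact: pth_in2 pf.
have dnc' : (d == c') = false by apply: contraNF c'f => /eqP <-; exact: pth_in2 pf.
have Pd : pth e (rcons (c' :: q2) d) c' d.
  apply: (pth_rcons e_sym e_irr Pc2).
    rewrite inE dnc' /=; apply: contra dt => /q2in'; exact: tin.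
  move=> w; rewrite inE => /orP [/eqP ->|wq].
    rewrite fc1 ?(pth_in2 pf) //; symmetry; apply: contraNF c't => /eqP ->; apply: tin.
    by apply: q2in'; rewrite eq2 mem_rcons mem_head.
  move: (wq); rewrite eq2 mem_rcons inE mem_rev => /orP [/eqP ->|wl]; first by rewrite eqxx dhj.
  rewrite (negbTE (hl4 _ wl)); symmetry; apply/eqP => ewi.
  by have := pth_uniq Pc2; rewrite /= eq2 rcons_uniq mem_rev -ewi wl andbF.
have := ladder_even e_sym e_irr noodd Pc1 Pd.
have sq1 : size (c :: q1) = (size l1).+2 by rewrite /= size_rcons.
have sq2 : size (rcons (c' :: q2) d) = (size l4).+3 by rewrite /= size_rcons eq2 size_rcons size_rev.
rewrite sq1 sq2 => hE; have : odd (size l1) = odd (size l4).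
  by move: od2; rewrite od1; case: (odd _); case: (odd _).
suff : ~~ odd ((size l1).+2 + (size l4).+3).
  by rewrite !addSn !addnS /= !negbK oddD => + h3; rewrite h3; case: (odd _).
apply: hE; last by rewrite !addSn !addnS.
split=> [w wc|w w' wc].
  rewrite mem_rcons inE negb_or cq2 // andbT; apply: contraTneq wc => ->.
  by rewrite inE dnc /=; apply: contra dt => /q1t.
rewrite mem_rcons inE => /orP [/eqP ->|wq]; last first.
  rewrite hik //; have -> : (w' == d) = false.
    apply/eqP => ewd; move: wq; rewrite ewd inE dnc' /= => /q2in' /tin; by rewrite (negbTE dt).
  rewrite andbF; congr orb; case: (w =P hi) => //= _.
  move: wq; rewrite inE => /orP [/eqP ->|/nk ->] //.
  by apply: contraNF c't => /eqP ->; apply: tin (pth_in1 Pk).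
rewrite dnc' eqxx andbF andbT /= e_sym; move: wc; rewrite inE => /orP [/eqP ->|wq].
  rewrite fc0 ?(pth_in2 pf) //; symmetry; apply: contraNF ct => /eqP ->; apply: q1t.
  by rewrite mem_rcons mem_head.
exact: dq1.
Qed.

End Hat.

Section Hat2.
Variables (T : finType) (e : rel T).
Hypothesis e_sym : symmetric e.
Hypothesis e_irr : irreflexive e.
Hypothesis noodd : forall c, hole e c -> ~~ odd (size c).
Hypothesis noanti : forall c, ~~ hole (compl e) c.
Hypothesis noprism : forall a1 a2 a3 q1 q2 q3, ~~ odd_prism e a1 a2 a3 q1 q2 q3.
Implicit Types (p q s t : seq T) (x y z a b c d u v w h : T) (X Y S : {set T}).

Lemma anticonn2 d d' : d != d' -> ~~ e d d' -> anticonn e [set d; d'].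
Proof.
move=> nd ed; refine (connU (compl_sym e_sym) _ _ (set11 d) (set11 d') _).
- exact: conn1.
- exact: conn1.
by rewrite /compl nd ed orbT.
Qed.

Lemma cpl_notin X w : cpl e X w -> w \notin X.
Proof. by move=> /cplP h; apply/negP => /h; rewrite e_irr. Qed.

(** Rules out the second exception of the cyclic lemma: [h1 t h2] would be an odd path with ends
    complete to the nonadjacent pair [d d'] and no such vertex inside. When [t] is a single edge the
    cyclic lemma does not apply; then a minimal antipath of [X] between nonneighbours of its ends is
    either one vertex, the desired hat, or closes an antihole with the help of [d] and [d']. *)
Lemma hat X a t b x z d d' : anticonn e X -> X != set0 ->
  pth (del e a b) (a :: rcons t b) a b -> ohead t = Some x -> ol t = Some z ->
  1 < size t -> ~~ odd (size t) -> e a b ->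
  (forall w, w \in a :: rcons t b -> w \notin X) -> cpl e X a -> cpl e X b ->
  (forall w, w \in t -> ~~ cpl e X w) ->
  cpl e X d -> cpl e X d' -> d != d' -> ~~ e d d' ->
  (forall w, w \in t -> ~~ (e d w && e d' w)) ->
  exists2 h, h \in X & forall w, w \in t -> ~~ e h w.
Proof.
move=> aX X0 pp hx lz t1 ot eab dX ca cb nc cd cd' ndd edd nD.
have cs := compl_sym e_sym; have ci := compl_irr e.
have [ut nat nbt nab [fa fb ptx]] := clp_facts e_sym e_irr pp hx lz.
have aD := anticonn2 ndd edd; have D0 : [set d; d'] != set0 by apply/set0Pn; exists d; rewrite !inE eqxx.
have tD w : w \in t -> w \notin [set d; d'].
  by move=> wt; rewrite !inE negb_or; apply/andP; split; apply: contraNneq (nc w wt) => ->.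
have XD h : h \in X -> cpl e [set d; d'] h.
  by move=> hX; apply/cplP => k; rewrite !inE => /orP [] /eqP ->; rewrite e_sym; [move/cplP: cd|move/cplP: cd']; apply.
have tX w : w \in t -> w \notin X by move=> wt; apply: dX; rewrite inE mem_rcons inE wt !orbT.
have XDn h : h \in X -> h \notin [set d; d'] by move=> hX; apply: cpl_notin (XD h hX).
case: (ltnP 2 (size t)) => t2.
  case: (roussel_rubio_cyclicP e_sym e_irr noodd noanti noprism aX X0 pp hx lz t1 ot _ dX ca cb) => //.
    by case=> w wt cw; have := nc w wt; rewrite cw.
  case=> _ [//|[h1 [h2 [h1X h2X /andP [n12 e12] l1 l2]]]]; exfalso.
  have p1 : pth e (h1 :: t) h1 z.
    by apply: (pth_cons e_sym e_irr ptx) => //; apply: contraL h1X => /tX.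
  have p2 : pth e (rcons (h1 :: t) h2) h1 h2.
    apply: (pth_rcons e_sym e_irr p1).
      by rewrite inE negb_or eq_sym n12; apply: contraL h2X => /tX.
    move=> w; rewrite inE => /orP [/eqP ->|/l2 //].
    rewrite e_sym (negbTE e12); symmetry; apply/eqP => e1z.
    by have := tX z (pth_in2 ptx); rewrite -e1z h1X.
  have := roussel_rubioP e_sym e_irr noodd noanti noprism aD D0 p2 _ (XD _ h1X) (XD _ h2X).
  rewrite /= size_rcons /= negbK (negbTE ot) => F; apply: notF; apply: F => //.
  - move=> w; rewrite inE mem_rcons inE => /or3P [/eqP ->|/eqP ->|/tD //]; exact: XDn.
  - move=> w; rewrite inE mem_rcons inE => /or3P [->|->|wt] //; first by rewrite orbT.
    move=> /cplP cw; have := nD w wt; by rewrite !cw // !inE eqxx ?orbT.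
  - by rewrite !ltnS ltnW.
have {t2} et : t = [:: x; z].
  by move: hx lz t1 t2; clear; case: t => [|k [|l []]] //= [->] [->].
have [xt zt] : x \in t /\ z \in t by rewrite et !inE !eqxx orbT.
have exz : e x z.
  by case: ptx; rewrite et ipath_cons // => /and3P [_ /allP /(_ z (mem_head _ _)) /eqP ->]; rewrite /= eqxx.
have nn w : w \in t -> exists2 h, h \in X & compl e w h.
  move=> wt; have := nc w wt; rewrite negb_forall_in => /exists_inP [h hX' nek]; exists h => //.
  by rewrite /compl e_sym nek andbT; apply: contraTneq hX' => <-; exact: tX.
have nD' w : w \in t -> exists2 h, h \in [set d; d'] & compl e w h.
  move=> wt; have := nD w wt; rewrite negb_and => /orP [] hh; [exists d|exists d']; rewrite ?inE ?eqxx ?orbT //.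
    by rewrite /compl e_sym hh andbT; apply: contraTneq (tD w wt) => ->; rewrite !inE eqxx.
  by rewrite /compl e_sym hh andbT; apply: contraTneq (tD w wt) => ->; rewrite !inE eqxx orbT.
have [h1 h1X c1] := nn x xt; have [h2 h2X c2] := nn z zt.
have [r [c [l [pr rX Nc Nl [rc rl]]]]] := conn_link cs ci aX h1X c1 h2X c2.
case: (ltnP 1 (size r)) => r1; last first.
  have er : r = [:: c].
    by case: (r) pr r1 => [|k []] // [] // _ [->].
  move: rl pr Nl; rewrite er => rl [_ _ [el]] Nl; exists c; first by apply: rX; rewrite er mem_head.
  by move=> w; rewrite et !inE e_sym => /orP [] /eqP ->; [case/andP: Nc|move: Nl; rewrite -el => /andP []].
exfalso.
have [k1 k1D d1] := nD' x xt; have [k2 k2D d2] := nD' z zt.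
have [r' [g [g' [pr' rD Ng Ng' [rg rg']]]]] := conn_link cs ci aD k1D d1 k2D d2.
have p1 : pth (compl e) (x :: r) x l.
  by apply: (pth_cons cs ci pr); [apply/negP => /rX; rewrite (negbTE (tX _ xt))|exact: rc].
have nxz : z != x by apply: contraTneq exz => ->; rewrite e_irr.
have xl : (x == l) = false by apply/eqP => exl; have := tX x xt; rewrite exl rX // (pth_in2 pr).
have p2 : pth (compl e) (rcons (x :: r) z) x z.
  apply: (pth_rcons cs ci p1).
    by rewrite inE negb_or nxz; apply/negP => /rX; rewrite (negbTE (tX _ zt)).
  move=> w; rewrite inE => /orP [/eqP ->|/rl //].
  by rewrite /compl e_sym exz andbF xl.
apply: (ladder_anti e_sym noanti p2 pr'); last first.
  by rewrite /= size_rcons; exact: (leq_add r1 (pth_size pr')).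
split=> [w|w w'].
  rewrite inE mem_rcons inE => ww; apply/negP => /rD; apply/negP.
  by case/or3P: ww => [/eqP ->|/eqP ->|/rX /XDn //]; apply: tD.
rewrite inE mem_rcons inE => /or3P [/eqP ->|/eqP ->|wr] w'r.
- by rewrite rg // eqxx (eq_sym x) (negbTE nxz) orbF.
- by rewrite rg' // eqxx (negbTE nxz).
have wX := rX w wr; rewrite /compl e_sym (cplP _ _ _ (XD w wX)) ?rD // andbF.
by symmetry; apply/negbTE; rewrite negb_or !negb_and; apply/andP; split; apply/orP; left;
  apply: contraTneq wX => ->; apply: tX.
Qed.

End Hat2.

(** * Even pairs in common neighbourhoods *)

Section MT.
Variables (T : finType) (e : rel T).
Hypothesis e_sym : symmetric e.
Hypothesis e_irr : irreflexive e.
Hypothesis noodd : forall c, hole e c -> ~~ odd (size c).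
Hypothesis noanti : forall c, ~~ hole (compl e) c.
Hypothesis noprism : forall a1 a2 a3 q1 q2 q3, ~~ odd_prism e a1 a2 a3 q1 q2 q3.
Implicit Types (p q s t : seq T) (x y z a b c d u v w h : T) (S G : {set T}).

Lemma ce_ex (N : pred T) s : ce N s -> exists s1 c c' s2, [/\ s = s1 ++ c :: c' :: s2, N c & N c'].
Proof.
elim: s => // x s IH; case: s IH => [|y s] IH; first by rewrite /= andbF.
case xy : (N x && N y); first by case/andP: xy => Nx Ny; exists [::], x, y, s.
rewrite -[ce N _]/((N x && N y) (+) ce N (y :: s)) xy /= => /IH [s1 [c [c' [s2 [-> Nc Nc']]]]].
by exists (x :: s1), c, c', s2.
Qed.

Lemma ce_sep (N : pred T) s1 s2 r : ~~ has N r -> r != [::] -> ce N (s1 ++ r ++ s2) = ce N s1 (+) ce N s2.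
Proof.
case: r => // x r h _; have /= := h; rewrite negb_or => /andP [nx hr].
rewrite /= ce_split -cat_cons ce_triml // -cats1 ce_trimr //=; by rewrite (negbTE nx).
Qed.

Lemma pth_mid q a b w : pth e q a b -> a != b -> ~~ e a b -> w \in q -> e a w -> e b w -> q = [:: a; w; b].
Proof.
move=> pq nab eab; have [t [x [z [-> pt _ _ [ha hb]]]]] := pth_inner e_sym e_irr pq nab eab.
rewrite inE mem_rcons inE => /or3P [/eqP ->|/eqP ->|wt]; rewrite ?e_irr // => h1 h2.
move: h1 h2; rewrite ha // hb // => /eqP -> /eqP exz.
by rewrite -exz in pt; rewrite (pth_eq e_sym e_irr pt).
Qed.

Lemma max_ex (R : T -> T -> Prop) : (forall a b c, R a b -> R b c -> R a c) -> (forall a, ~ R a a) ->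
  forall S x0, x0 \in S -> exists2 m, m \in S & forall y, y \in S -> ~ R m y.
Proof.
move=> tr ir S; have [n] := ubnP #|S|; elim: n => // n IH in S *; rewrite ltnS => Sn x xS.
case: (set_0Vmem (S :\ x)) => [S0|[y yS]].
  exists x => // y yS; case: (eqVneq y x) => [-> //|nyx].
  by have := in_set0 y; rewrite -S0 !inE nyx yS.
have [|m mS hm] := IH (S :\ x) _ y yS; first by move: Sn; rewrite (cardsD1 x) xS.
have [nmx mS'] := setD1P mS.
case: (classic (R m x)) => [Rmx|nR].
  exists x => // z zS Rxz; case: (eqVneq z x) => [ezx|nzx]; first by apply: (ir x); rewrite -{2}ezx.
  by apply: (hm z); rewrite ?inE ?nzx //; apply: tr Rmx Rxz.
exists m => // z zS; case: (eqVneq z x) => [-> //|nzx].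
by apply: hm; rewrite !inE nzx.
Qed.

Variables (X : {set T}).
Let C := cpl e X.
Hypothesis aX : anticonn e X.
Hypothesis X0 : X != set0.
(** Maximality of [X] in another form: a vertex outside [X] with two nonadjacent neighbours in [C]
    could be added to [X] unless it is itself in [C]. *)
Hypothesis hR : forall r c c', r \notin X -> ~~ C r -> C c -> C c' -> e r c -> e r c' -> c != c' -> e c c'.
Hypothesis star : forall p1 a1 b1 p2 a2 b2 p3 a3 b3,
  prism3 e p1 a1 b1 p2 a2 b2 p3 a3 b3 -> C a1 -> C a2 -> False.

(** What [hat_prism] needs behind a hat over the edge [c c']: a hat in [X] sees the vertex of [C] in
    [G], and [G] touches every vertex of [p], hence any hole using part of [p]. *)
Definition link_set p G c c' := [/\ conn e G, forall y, y \in G -> ~~ e y c /\ ~~ e y c',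
  exists2 z, z \in G & C z & forall w, w \in p -> exists2 y, y \in G & (y == w) || e y w].

Lemma link_setC p G c c' : link_set p G c c' -> link_set p G c' c.
Proof. by case=> h1 h2 h3 h4; split=> // y /h2 []. Qed.

Lemma link_set_rev p G c c' : link_set (rev p) G c c' -> link_set p G c c'.
Proof. by case=> h1 h2 h3 h4; split=> // w wp; apply: h4; rewrite mem_rev. Qed.

Lemma link_all p x z c c' y : pth e p x z -> C y -> has (e y) p -> ~~ e y c -> ~~ e y c' ->
  ~~ has (e c) p -> ~~ has (e c') p -> exists G, link_set p G c c'.
Proof.
move=> pp Cy /hasP [w wp eyw] yc yc' hc hc'; exists (y |: [set w in p]); split.
- by apply: (connU1 e_sym (conn_pset e_sym e_irr pp) (x := w)); rewrite ?inE // e_sym.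
- move=> k; rewrite !inE => /orP [/eqP -> //|kp].
  by rewrite !(e_sym k) (hasPn hc) ?(hasPn hc').
- by exists y; rewrite // !inE eqxx.
by move=> k kp; exists k; rewrite ?eqxx // !inE kp orbT.
Qed.

(** Here [c] sees the first vertex of [p], so that vertex is left out of [G]; it is still touched by
    the second one. *)
Lemma link_end p x z c c' y : pth e p x z -> 1 < size p -> C y -> e y z -> ~~ e y c -> ~~ e y c' ->
  (forall w, w \in p -> e c w = (w == x)) -> ~~ has (e c') p -> exists G, link_set p G c c'.
Proof.
move=> pp; have := pp; case: p pp => [|x' [|x2 p]] pp [] // ip [ex] lz _ Cy eyz yc yc' hc hc'; subst x'.
have p2 : pth e (x2 :: p) x2 z by move: pp; rewrite -cat1s => /(pth_split e_sym e_irr) [].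
exists (y |: [set w in x2 :: p]); split.
- apply: (connU1 e_sym (conn_pset e_sym e_irr p2) (x := z)); last by rewrite e_sym.
  by rewrite inE (pth_in2 p2).
- move=> k; rewrite !inE -in_cons => /orP [/eqP -> //|kp].
  have kp' : k \in x :: x2 :: p by rewrite inE kp orbT.
  rewrite !(e_sym k) hc // (hasPn hc') //; split=> //; apply: contraTneq kp => ->.
  by have := pth_uniq pp; rewrite cons_uniq => /andP [].
- by exists y; rewrite // !inE eqxx.
move=> k; rewrite inE => /orP [/eqP ->|kp]; last by exists k; rewrite ?eqxx // !inE -in_cons kp orbT.
exists x2; first by rewrite !inE eqxx orbT.
move: ip; rewrite ipath_cons // => /and3P [_ /allP /(_ x2 (mem_head _ _)) /eqP + _].
by rewrite /= eqxx e_sym => ->; rewrite orbT.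
Qed.

(** Only the interior of the outgoing path is the list [p]; the ends are kept apart because they
    will be exchanged for other vertices of [C]. *)
Definition outg p x z a b := [/\ pth e p x z, forall w, w \in p -> (w \notin X) && ~~ C w,
  [/\ C a, C b, a != b & ~~ e a b], forall w, w \in p -> e a w = (w == x) &
  forall w, w \in p -> e b w = (w == z)].

Lemma outg_rev p x z a b : outg p x z a b -> outg (rev p) z x b a.
Proof.
case=> pp hp [Ca Cb nab eab] ha hb; split; first exact: pth_rev.
- by move=> w; rewrite mem_rev; apply: hp.
- by split; rewrite // 1?eq_sym // e_sym.
- by move=> w; rewrite mem_rev; apply: hb.
by move=> w; rewrite mem_rev; apply: ha.
Qed.

Section Fixed.
Variables (p : seq T) (x1 xk a0 b0 : T).
Hypothesis op : outg p x1 xk a0 b0.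
Hypothesis pmin : forall q y z c d, outg q y z c d -> size p <= size q.

Let A c := [&& C c, e c x1 & ~~ e c b0].
Let B c := [&& C c, e c xk & ~~ e c a0].
Let pp : pth e p x1 xk. Proof. by case: op. Qed.
Let hp w : w \in p -> (w \notin X) && ~~ C w. Proof. by case: op => _ + _ _ _; apply. Qed.
Let x1p := pth_in1 pp.
Let xkp := pth_in2 pp.

Lemma C_notinX c : C c -> c \notin X. Proof. exact: cpl_notin. Qed.

Lemma Cp c : C c -> c \notin p.
Proof. by move=> cc; apply/negP => /hp; rewrite cc andbF. Qed.

(** A single inner vertex would see two nonadjacent vertices of [C], against [hR]. The parity is
    Roussel-Rubio applied to the whole outgoing path. *)
Lemma size_p3 : 2 < size p /\ odd (size p).
Proof.
have [_ _ [Ca Cb nab eab] ha hb] := op.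
have x1k : x1 != xk.
  apply/eqP => exk; have /andP [h1 h2] := hp x1p.
  have := hR h1 h2 Ca Cb; rewrite !(e_sym x1) ha // hb // exk eqxx (negbTE eab).
  by move=> F; apply/notF/F.
have s2 : 1 < size p by apply: (pth_size2 pp).
have osp : odd (size p).
  have ap : a0 \notin p by apply: Cp.
  have bp : b0 \notin p by apply: Cp.
  have p1 : pth e (a0 :: p) a0 xk by apply: (pth_cons e_sym e_irr pp).
  have p2 : pth e (rcons (a0 :: p) b0) a0 b0.
    apply: (pth_rcons e_sym e_irr p1); first by rewrite inE negb_or eq_sym nab.
    move=> w; rewrite inE => /orP [/eqP ->|/hb //].
    by rewrite e_sym (negbTE eab); symmetry; apply: contraNF ap => /eqP ->.
  have := roussel_rubioP e_sym e_irr noodd noanti noprism aX X0 p2 _ Ca Cb.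
  rewrite /= size_rcons /= negbK; apply=> // [w|w|]; last by rewrite !ltnS ltnW.
    rewrite inE mem_rcons inE.
    by move=> /or3P [/eqP ->|/eqP ->|/hp /andP []] //; apply: C_notinX.
  rewrite inE mem_rcons inE.
  by move=> /or3P [->|->|/hp /andP [_ /negbTE]] //; rewrite ?orbT // /C => ->.
by split=> //; case: (size p) s2 osp => [|[|[]]].
Qed.

Lemma x1k : x1 != xk.
Proof. by apply: (pth_neq e_sym e_irr pp); case: size_p3 => /ltnW. Qed.

(** The first neighbour of [c] on [p] ends an outgoing path from [a] to [c], and minimality of [p]
    puts this neighbour at the far end. *)
Lemma touch_r a b c : outg p x1 xk a b -> C c -> c != a -> ~~ e c a -> has (e c) p ->
  forall w, w \in p -> e c w = (w == xk).
Proof.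
case=> _ _ [Ca _ _ _] ha _ Cc nca eca hc.
have [s [t [x [ep ps ecx hx]]]] := pth_first e_sym e_irr pp hc.
have : outg s x1 x a c.
  have sp w : w \in s -> w \in p by rewrite ep mem_cat => ->.
  split=> //; try by move=> w /sp; [apply: hp|apply: ha].
  - by move=> w /sp; apply: hp.
  - by split; rewrite // 1?eq_sym // e_sym.
  - by move=> w /sp; apply: ha.
  by move=> w ws; apply/idP/eqP => [/(hx w ws) //|-> //].
move/pmin; rewrite {1}ep size_cat -{2}[size s]addn0 leq_add2l leqn0 size_eq0 => /eqP et.
rewrite et cats0 in ep; have exk : x = xk by case: ps; case: pp => _ _; rewrite -ep => -> _ _ [].
by move=> w wp; apply/idP/eqP => [|-> //]; rewrite -?exk //; apply: hx; rewrite -ep.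
Qed.

End Fixed.

Section Fixed2.
Variables (p : seq T) (x1 xk a0 b0 : T).
Hypothesis op : outg p x1 xk a0 b0.
Hypothesis pmin : forall q y z c d, outg q y z c d -> size p <= size q.

(** Used from both ends: [A] and [B] turn out to be vertices of [C] attaching to [p] only at [x1],
    respectively only at [xk] ([A_nb], [B_nb]). *)
Definition sideA (x1 b0 c : T) := [&& C c, e c x1 & ~~ e c b0].
Let A := sideA x1 b0.
Let B := sideA xk a0.
Let pp : pth e p x1 xk. Proof. by case: op. Qed.
Let hp w : w \in p -> (w \notin X) && ~~ C w. Proof. by case: op => _ + _ _ _; apply. Qed.
Let x1p := pth_in1 pp.
Let xkp := pth_in2 pp.
Let x1k := x1k op.
Let opr := outg_rev op.

Lemma touch_l a b c : outg p x1 xk a b -> C c -> c != b -> ~~ e c b -> has (e c) p ->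
  forall w, w \in p -> e c w = (w == x1).
Proof.
move=> oab Cc ncb ecb hc w wp; have oab' := outg_rev oab.
apply: (touch_r oab' _ oab' Cc ncb ecb); rewrite ?has_rev ?mem_rev // => *.
by rewrite size_rev; apply: pmin; eassumption.
Qed.

Lemma A_C c : A c -> C c. Proof. by case/and3P. Qed.
Lemma B_C c : B c -> C c. Proof. by case/and3P. Qed.

Lemma A_nb c : A c -> forall w, w \in p -> e c w = (w == x1).
Proof.
case/and3P => Cc ec1 ecb; apply: (touch_l op) => //; last by apply/hasP; exists x1.
apply: contraTneq ec1 => ->; case: op => _ _ _ _ -> //; exact: x1k.
Qed.

Lemma B_nb c : B c -> forall w, w \in p -> e c w = (w == xk).
Proof.
case/and3P => Cc ec1 ecb; apply: (touch_r op _ op) => //; last by apply/hasP; exists xk.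
apply: contraTneq ec1 => ->; case: op => _ _ _ -> // _; rewrite eq_sym; exact: x1k.
Qed.

Lemma A_clique a a' : A a -> A a' -> a != a' -> e a a'.
Proof.
case/and3P => Ca e1 _ /and3P [Ca' e1' _]; have /andP [h1 h2] := hp x1p.
by apply: (hR h1 h2) => //; rewrite e_sym.
Qed.

Lemma AB_neq a b : A a -> B b -> a != b.
Proof. by move=> Aa Bb; apply: contraTneq x1k => eab; rewrite negbK -(B_nb Bb x1p) -eab (A_nb Aa) ?eqxx. Qed.

(** An edge [a b] would close [p], which has odd size, to an odd hole. *)
Lemma side_odd a b : C a -> C b -> (forall w, w \in p -> e a w = (w == x1)) ->
  (forall w, w \in p -> e b w = (w == xk)) -> ~~ e a b.
Proof.
move=> Ca Cb ha hb; apply/negP => eab.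
have := ladder_even e_sym e_irr noodd pp (pth_2 e_sym e_irr eab).
have [s3 os] := size_p3 op.
rewrite /= addnC /= os => F; apply/notF/F; last by rewrite !ltnS ltnW.
split=> [w wp|w w' wp]; first by rewrite !inE negb_or; apply/andP; split; apply: contraTneq wp => ->; [exact: (Cp op Ca)|exact: (Cp op Cb)].
have nab : a != b by apply: contraTneq eab => ->; rewrite e_irr.
rewrite !inE e_sym => /orP [] /eqP ->; first by rewrite ha // eqxx andbT (negbTE nab) andbF orbF.
by rewrite hb // eqxx andbT (eq_sym b) (negbTE nab) andbF.
Qed.

Lemma AB_nadj a b : A a -> B b -> ~~ e a b.
Proof. by move=> Aa Bb; apply: side_odd; [apply: A_C|apply: B_C|apply: A_nb|apply: B_nb]. Qed.

Lemma AB_outg a b : A a -> B b -> outg p x1 xk a b.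
Proof.
move=> Aa Bb; split=> //; [|exact: A_nb|exact: B_nb].
by split; [apply: A_C|apply: B_C|apply: AB_neq|apply: AB_nadj].
Qed.

Lemma A_a0 : A a0.
Proof. by case: op => _ _ [Ca Cb nab eab] ha hb; rewrite /A /sideA Ca ha // eqxx eab. Qed.
Lemma B_b0 : B b0.
Proof. by case: op => _ _ [Ca Cb nab eab] ha hb; rewrite /B /sideA Cb hb // eqxx e_sym eab. Qed.

(** A vertex of [C] touching [p] and missing some vertex of [A] attaches only at [xk], which puts it
    in [B]. *)
Lemma D_A c a : C c -> has (e c) p -> ~~ A c -> ~~ B c -> A a -> e a c.
Proof.
move=> Cc hc nA nB Aa; apply: contraNT nB => eac; rewrite e_sym in eac.
have nca : c != a by apply: contraNneq nA => ->.
have hcx := touch_r op pmin (AB_outg Aa B_b0) Cc nca eac hc.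
rewrite /B /sideA Cc hcx // eqxx /= e_sym; apply: side_odd => //; first exact: A_C A_a0.
exact: A_nb A_a0.
Qed.

(** The inner vertices allowed between [A] and [B]. Touching vertices of [C] outside both sides are
    excluded because by [D_A], used from both ends, they see all of [A] and all of [B]. *)
Definition free w := [&& w \notin X, ~~ A w, ~~ B w & C w ==> ~~ has (e w) p].
Definition dir q a b := [/\ pth e q a b, A a, B b &
  forall w, w \in q -> [\/ w = a, w = b | free w]].
Definition touch w := (w \in p) || has (e w) p.

(** The segment closes with a subpath of [p] to an even cycle. Suppose its count is odd and open the
    cycle at an edge inside [C]: a further vertex of [C] contradicts [rr_cyc], and without one there
    is a hat over that edge, which with the link set gives a prism forbidden by [star]. *)
Lemma seg_even s u v : pth e s u v -> 2 < size s -> u \notin p -> v \notin p ->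
  has (e u) p -> has (e v) p -> (forall w, w \in s -> w != u -> w != v -> ~~ touch w) ->
  (forall w, w \in s -> w \notin X) ->
  (forall s1 c c' s2, s = s1 ++ c :: c' :: s2 -> C c -> C c' ->
     (forall w, w \in s1 ++ s2 -> ~~ C w) -> exists G, link_set p G c c') ->
  ce C s = false.
Proof.
move=> ps s3 up vp hu hv hint dX HG; apply/negbTE/negP => hce.
have [/hasP [u' u'p euu'] /hasP [v' v'p evv']] := (hu, hv).
have cW := conn_pset e_sym e_irr pp.
have [r [h [l [pr rp _ _ [rh rl]]]]] := conn_link e_sym e_irr cW (N1 := e u) (N2 := e v)
  (x := u') (y := v') (eq_ind_r _ u'p (in_set _ u')) euu' (eq_ind_r _ v'p (in_set _ v')) evv'.
have rp' w : w \in r -> w \in p by move=> /rp; rewrite inE.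
have nuv := pth_neq e_sym e_irr ps (ltnW s3).
have sp w : w \in s -> w \notin p.
  move=> ws; case: (eqVneq w u) => [-> //|nu]; case: (eqVneq w v) => [-> //|nv].
  by have := hint w ws nu nv; rewrite negb_or => /andP [].
have cr : cross2 e s u v r h l.
  split=> [w ws|w w' ws wr]; first by apply: contra (sp w ws) => /rp'.
  case: (eqVneq w u) => [->|nu]; first by rewrite rh // (negbTE nuv) orbF.
  case: (eqVneq w v) => [->|nv]; first by rewrite rl.
  have := hint w ws nu nv; rewrite negb_or => /andP [_ /hasPn /(_ w' (rp' _ wr)) /negbTE ->].
  by [].
have ev := ladder_even e_sym e_irr noodd ps pr cr (leq_add s3 (pth_size pr)).
have [s1 [c [c' [s2 [es Nc Nc']]]]] := ce_ex hce.
have pd := ladder_open e_sym e_irr ps pr cr es.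
set t := s2 ++ rev r ++ s1 in pd.
have st : (size t).+2 = size s + size r.
  by rewrite es /t !size_cat size_rev /=; clear; lia.
have t2 : 1 < size t by rewrite -ltnS -ltnS st -[4]/(3+1) leq_add ?(pth_size pr).
have ot : ~~ odd (size t) by rewrite -[odd _]negbK -[~~ odd _]/(odd (size t).+1) -[~~ odd _]/(odd (size t).+2) st.
have [x hx] : exists x, ohead t = Some x by case: (t) t2 => // k t' _; exists k.
have [z lz] : exists z, ol t = Some z by case: (t) t2 => // k t' _; exists (last k t').
have dXt w : w \in c' :: rcons t c -> w \notin X.
  rewrite inE mem_rcons inE mem_cat mem_cat mem_rev => hw.
  have [ws|wr] : w \in s \/ w \in r.
    rewrite es mem_cat !inE; case/or3P: hw => [->|->|/or3P [->|->|->]]; rewrite ?orbT; auto.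
    exact: dX.
  by case/andP: (hp (rp' _ wr)).
have ecc : e c' c.
  have := ps; rewrite es => /(pth_split e_sym e_irr) [_ [+ _ _]].
  by rewrite ipath_cons // => /and3P [_ /allP /(_ c' (mem_head _ _)) /eqP + _]; rewrite /= eqxx e_sym.
have nr : ~~ has C (rev r).
  by rewrite has_rev; apply/hasPn => w /rp' /hp /andP [].
case hC : (has C t).
  have := rr_cyc e_sym e_irr noodd noanti noprism aX X0 pd hx lz dXt Nc' Nc hC.
  rewrite ot /t !rcons_cat -cat_cons ce_sep //; last by rewrite -size_eq0 size_rev -lt0n (pth_size pr).
  by move: hce; rewrite es ce_split -[ce _ (c :: _)]/((C c && C c') (+) ce C (c' :: s2)) Nc Nc'; case: (ce _ _); case: (ce _ _).
have nC : forall w, w \in t -> ~~ C w by move=> w wt; apply: (hasPn (negbT hC)).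
have [_ _ [Ca Cb nab eab] _ _] := op.
have [h0 h0X hh] : exists2 h, h \in X & forall w, w \in t -> ~~ e h w.
  apply: (hat e_sym e_irr noodd noanti noprism aX X0 pd hx lz t2 ot ecc dXt Nc' Nc nC Ca Cb nab eab).
  move=> w wt; apply/negP => /andP [e1 e2]; have := hR (dXt w _) (nC w wt) Ca Cb.
  rewrite !(e_sym w) e1 e2 nab (negbTE eab) => F; apply/notF/F => //.
  by rewrite inE mem_rcons inE wt !orbT.
have [G [cG nG [k kG Ck] tG]] : exists G, link_set p G c c'.
  apply: (HG s1 c c' s2) => // w; rewrite mem_cat => ws; apply: nC.
  by rewrite !mem_cat; case/orP: ws => ->; rewrite ?orbT.
have [y yG hy] := tG h (rp' _ (pth_in1 pr)).
have ht : h \in t by rewrite !mem_cat mem_rev (pth_in1 pr) orbT.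
have [p1 [b1 [p2 [b2 [p3 [b3 pr3]]]]]] : exists p1 b1 p2 b2 p3 b3, prism3 e p1 c' b1 p2 c b2 p3 h0 b3.
  apply: (hat_prism e_sym e_irr noodd pd ecc hx lz ot _ _ _ hh cG _ kG).
  - by apply: contraL h0X => h0t; apply: dXt; rewrite inE mem_rcons inE h0t !orbT.
  - exact: (cplP _ _ _ Nc').
  - exact: (cplP _ _ _ Nc).
  - by move=> g /nG [].
  - exact: (cplP _ _ _ Ck).
  exists y => //; case/orP: hy => [/eqP ->|ey]; first by rewrite ht.
  by apply/orP; right; apply/hasP; exists h.
exact: (star pr3 Nc' Nc).
Qed.

Lemma seg_even_touch s u v : pth e s u v -> 2 < size s -> touch u -> touch v ->
  (forall w, w \in s -> w != u -> w != v -> ~~ touch w) -> (forall w, w \in s -> w \notin X) ->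
  (forall c c', c \in s -> c' \in s -> C c -> C c' -> e c c' ->
     (forall w, w \in s -> C w -> (w == c) || (w == c')) -> exists G, link_set p G c c') ->
  ce C s = false.
Proof.
move=> ps s3 tu tv hint dX key.
have us : u \in s by exact: pth_in1 ps.
have vs : v \in s by exact: pth_in2 ps.
have nuv := pth_neq e_sym e_irr ps (ltnW s3).
have neuv : ~~ e u v.
  by apply/negP => euv; move: s3; rewrite (pth_adj e_sym e_irr ps nuv euv).
have up k : k \in s -> (k == u) || (k == v) -> touch k -> k \notin p /\ has (e k) p.
  move=> ks kuv; rewrite /touch; case kp : (k \in p) => //= _; exfalso.
  have [w ws ekw] := pth_nbr e_sym e_irr ps (ltnW s3) ks.
  have /negP [] : ~~ touch w.
    apply: hint => //; apply: contraTneq ekw => ->; case/orP: kuv => /eqP ->; rewrite ?e_irr //.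
    by rewrite e_sym.
  by apply/orP; right; apply/hasP; exists k; rewrite // e_sym.
have [up1 up2] : u \notin p /\ has (e u) p by apply: up; rewrite ?eqxx.
have [vp1 vp2] : v \notin p /\ has (e v) p by apply: up; rewrite ?eqxx ?orbT.
apply: (seg_even ps s3 up1 vp1 up2 vp2 hint dX).
move=> s1' c c' s2' es' Cc Cc' hn; apply: key => //; rewrite ?es' ?mem_cat ?inE ?eqxx ?orbT //.
    have := ps; rewrite es' => /(pth_split e_sym e_irr) [_ [+ _ _]].
    by rewrite ipath_cons // => /and3P [_ /allP /(_ c' (mem_head _ _)) /eqP + _]; rewrite /= eqxx.
  move=> w; rewrite mem_cat !inE => /or4P [ws|->|->|ws]; rewrite ?orbT //.
    by rewrite (negbTE (hn w _)) // mem_cat ws.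
  by rewrite (negbTE (hn w _)) // mem_cat ws orbT.
Qed.

Lemma dir_X q a b w : dir q a b -> w \in q -> w \notin X.
Proof.
by case=> _ Aa Bb h /h [->|->|/and4P []] //; apply: C_notinX; [apply: A_C|apply: B_C].
Qed.

Lemma dir_C q a b w : dir q a b -> w \in q -> C w -> [\/ w = a, w = b | ~~ has (e w) p].
Proof.
case=> _ Aa Bb h /h [->|->|/and4P [_ _ _ /implyP hh]] //; [by constructor|by constructor|].
by move=> /hh; constructor.
Qed.

(** The prefix is cut at the vertices touching [p], and [seg_even_touch] handles the pieces. The
    work is to supply a link set for an edge inside [C], according to whether it contains an end of
    the path. *)
Lemma dir_prefix q a b q1 q2 z : dir q a b -> q = q1 ++ q2 -> ol q1 = Some z -> touch z ->
  ce C q1 = false.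
Proof.
move=> dq eq lz tz; have [pq Aa Bb _] := dq.
have tA : has (e a) p by apply/hasP; exists x1 => //; case/and3P: Aa.
have tB : has (e b) p by apply/hasP; exists xk => //; case/and3P: Bb.
have nab := AB_neq Aa Bb; have eab := AB_nadj Aa Bb.
have hq1 : ohead q1 = Some a by move: pq lz; rewrite eq; case: (q1) => // k q' [_ [->] _].
have tc w : C w -> touch w = has (e w) p by move=> /(Cp op) /negbTE; rewrite /touch => ->.
apply: (ce_pieces (M := touch) hq1 lz) => //; first by rewrite tc // A_C.
move=> s1 u m v s2 es tu tv hm.
have eq' : q = s1 ++ (u :: rcons m v) ++ (s2 ++ q2) by rewrite eq es -!catA /= cat_rcons -catA.
set s := u :: rcons m v in eq' *.
have ps : pth e s u v by rewrite eq' in pq; apply: (sub_pth e_sym e_irr pq) => //=; rewrite last_rcons.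
have sq w : w \in s -> w \in q by move=> ws; rewrite eq' !mem_cat ws orbT.
have tC w : w \in s -> C w -> touch w -> w = a \/ w = b.
  move=> /sq wq Cw; rewrite tc // => tw; case: (dir_C dq wq Cw) => [->|->|]; [by left|by right|].
  by rewrite tw.
have us : u \in s by exact: pth_in1 ps.
have vs : v \in s by exact: pth_in2 ps.
have sm w : w \in s -> w != u -> w != v -> w \in m.
  by rewrite inE mem_rcons inE => /or3P [->|->|].
case em : m => [|w0 m'].
  rewrite /s em /= andbF !addbF; apply/negbTE/negP => /andP [Cu Cv].
  have euv : e u v.
    by case: ps; rewrite /s em ipath_cons // => /and3P [_ /allP /(_ v (mem_head _ _)) /eqP + _]; rewrite /= eqxx.
  case: (tC u us Cu tu) euv => ->; case: (tC v vs Cv tv) => ->; rewrite ?e_irr ?(negbTE eab) //.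
  by rewrite e_sym (negbTE eab).
have s3 : 2 < size s by rewrite /s em /= size_rcons.
have hint w : w \in s -> w != u -> w != v -> ~~ touch w.
  by move=> ws wu wv; apply: (hasPn hm); apply: sm.
apply: (seg_even_touch ps s3 tu tv hint) => [w /sq|]; first exact: dir_X dq.
(* When [c] is an end of the path, the opposite end is the vertex of [C] used in the link set. It
   misses [c'], since a vertex seeing both ends would be the only inner vertex of the path. *)
have endcase c c' : c \in s -> c' \in s -> C c -> C c' -> e c c' ->
   (forall w, w \in s -> C w -> (w == c) || (w == c')) -> (c == a) || (c == b) ->
   exists G, link_set p G c c'.
  move=> cs cs' Cc Cc' ecc hn hab.
  have mid : ~~ (e a c' && e b c').
    apply/negP => /andP [e1 e2]; have eq3 := pth_mid pq nab eab (sq _ cs') e1 e2.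
    have [] := uniq_min_size (pth_uniq ps) sq; first by rewrite eq3.
    move=> _ sqi; have := hn a; rewrite sqi (pth_in1 pq) A_C // => /(_ isT isT).
    have := hn b; rewrite sqi (pth_in2 pq) B_C // => /(_ isT isT).
    case/orP: hab => /eqP ->; rewrite ?eqxx ?(eq_sym b a) (negbTE nab) /=.
      by move=> /eqP eb; rewrite -eb e_irr in e2.
    by move=> _ /eqP ea; rewrite -ea e_irr in e1.
  have [c'a c'b] : c' != a /\ c' != b.
    by split; apply: contraTneq ecc => ->; case/orP: hab => /eqP ->; rewrite ?e_irr // e_sym.
  have nt : ~~ has (e c') p.
    by case: (dir_C dq (sq _ cs') Cc') c'a c'b => [->|->|//]; rewrite ?eqxx.
  have [[[p3 _] Ca] Cb] := (size_p3 op, A_C Aa, B_C Bb).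
  case/orP: hab => /eqP eca; subst c.
    apply: (link_end pp (ltnW p3) Cb) => //; first by case/and3P: Bb.
    - by rewrite e_sym.
    - by move: mid; rewrite ecc.
    - exact: A_nb.
  have [G lG] : exists G, link_set (rev p) G b c'.
    apply: (link_end (pth_rev e_sym e_irr pp) _ Ca) => //.
    - by rewrite size_rev ltnW.
    - by case/and3P: Aa.
    - by move: mid; rewrite ecc andbT.
    - by move=> w; rewrite mem_rev; apply: B_nb.
    - by rewrite has_rev.
  by exists G; apply: link_set_rev.
move=> c c' cs cs' Cc Cc' ecc hn.
case hc : ((c == a) || (c == b)); first exact: endcase.
case hc' : ((c' == a) || (c' == b)).
  have ecc' : e c' c by rewrite e_sym.
  have hn' w : w \in s -> C w -> (w == c') || (w == c) by move=> ws /(hn w ws); rewrite orbC.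
  have [G lG] := endcase c' c cs' cs Cc' Cc ecc' hn' hc'.
  by exists G; apply: link_setC.
have un k : k \in s -> C k -> (k == a) || (k == b) = false -> ~~ has (e k) p.
  by move=> ks Ck; case: (dir_C dq (sq _ ks) Ck) => [->|->|//]; rewrite eqxx ?orbT.
have as' : a \notin s.
  apply/negP => as_; have := hn a as_ (A_C Aa); rewrite !(eq_sym a).
  by move: hc hc'; case: eqP => // _ _; case: eqP.
have am k : k \in s -> C k -> (k == a) || (k == b) = false -> ~~ e a k.
  move=> ks Ck kab; have ku : k != u.
    by apply: contraTneq tu => <-; rewrite tc // un.
  have s10 : s1 != [::].
    apply: contraNneq as' => s10; move: hq1; rewrite es s10 /= => - [<-]; exact: us.
  have pq' := pq; rewrite eq' in pq'.
  have [k1 P1] := pth_catl e_sym e_irr pq' s10.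
  have [k2 P2] : exists k2, pth e (s ++ s2 ++ q2) k2 b by apply: (pth_catr e_sym e_irr pq').
  have [_ cr] := pth_cat_cross e_sym e_irr pq' P1 P2.
  have ek : k2 = u by case: P2 => _ [->].
  rewrite cr ?(pth_in1 P1) ?mem_cat ?ks // ek (negbTE ku) andbF //.
have ac := am c cs Cc hc; have ac' := am c' cs' Cc' hc'.
by apply: (link_all pp (A_C Aa) tA) => //; apply: un.
Qed.

(** The count of edges inside [C] is even by [dir_prefix] and has the parity of the length by
    [rr_ce]. *)
Lemma dir_even q a b : dir q a b -> odd (size q).
Proof.
move=> dq; have [pq Aa Bb _] := dq.
have [_ _ lq] := pq.
have := dir_prefix dq (esym (cats0 q)) lq.
rewrite (rr_ce e_sym e_irr noodd noanti noprism aX X0 pq (fun w => dir_X dq (w := w)) (A_C Aa) (B_C Bb)).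
move=> /(_ _)/negbFE; apply.
by rewrite /touch; apply/orP; right; apply/hasP; exists xk => //; case/and3P: Bb.
Qed.

Lemma free_p w : w \in p -> free w.
Proof.
by move=> /hp /andP [wX /negbTE cw]; rewrite /free wX /A /B /sideA cw.
Qed.

Lemma free_nC w : free w -> touch w -> ~~ C w.
Proof.
case/and4P => _ _ _ /implyP h tw; apply/negP => Cw; move: tw.
by rewrite /touch (negbTE (Cp op Cw)) (negbTE (h Cw)).
Qed.

Lemma dir_free q a b w : dir q a b -> w \in q -> w != a -> w != b -> free w.
Proof. by case=> _ _ _ h /h [->|->|//]; rewrite eqxx. Qed.

Lemma touch_A a : A a -> has (e a) p.
Proof. by case/and3P => _ h _; apply/hasP; exists x1. Qed.
Lemma B_clique b b' : B b -> B b' -> b != b' -> e b b'.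
Proof.
case/and3P => Ca e1 _ /and3P [Ca' e1' _]; have /andP [h1 h2] := hp xkp.
by apply: (hR h1 h2) => //; rewrite e_sym.
Qed.

Lemma prism_rot p1 a1 b1 p2 a2 b2 p3 a3 b3 :
  prism3 e p1 a1 b1 p2 a2 b2 p3 a3 b3 -> prism3 e p2 a2 b2 p3 a3 b3 p1 a1 b1.
Proof.
by case=> P1 P2 P3 [n1 n2 n3] [c12 c13 c23]; split=> //; split=> //; split=> //; apply: cross2C.
Qed.

Lemma C_adjX c h : C c -> h \in X -> e h c. Proof. by move=> /cplP hc /hc. Qed.

Lemma tailW : exists x2, [/\ conn e [set w in behead p], x2 \in behead p, e x1 x2, xk \in behead p
  & forall w, w \in behead p -> w \in p /\ w != x1].
Proof.
have [s3 _] := size_p3 op; have := pp; case: p s3 pp xkp => [|k [|x2 q]] // _ pp' kq [ip [ek] lk].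
subst k; have p2 : pth e (x2 :: q) x2 xk by move: pp'; rewrite -cat1s => /(pth_split e_sym e_irr) [].
exists x2; split=> /=.
- exact: conn_pset p2.
- by rewrite mem_head.
- by move: ip; rewrite ipath_cons // => /and3P [_ /allP /(_ x2 (mem_head _ _)) /eqP + _]; rewrite /= eqxx.
- exact: pth_in2 p2.
move=> w wq; split; first by rewrite inE wq orbT.
by apply: contraTneq wq => ->; have := pth_uniq pp'; rewrite cons_uniq => /andP [].
Qed.

Lemma no_hat c t c' h l x G : pth (del e c c') (c :: rcons t c') c c' -> e c c' ->
  ohead t = Some h -> ol t = Some l -> ~~ odd (size t) ->
  x \notin t -> e x c -> e x c' -> (forall w, w \in t -> ~~ e x w) ->
  conn e G -> (forall y, y \in G -> ~~ e y c /\ ~~ e y c') -> (exists2 z, z \in G & e x z) ->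
  (exists2 y, y \in G & (y \in t) || has (e y) t) ->
  C c' -> C c \/ C x -> False.
Proof.
move=> pd ecc hh lh ot xt xc xc' nx cG nG [z zG exz] tG Cc' Cc.
have [p1 [b1 [p2 [b2 [p3 [b3 pr]]]]]] := hat_prism e_sym e_irr noodd pd ecc hh lh ot xt xc xc' nx cG nG zG exz tG.
case: Cc => [Cc|Cx]; first exact: star pr Cc Cc'.
exact: star (prism_rot pr) Cc' Cx.
Qed.

Lemma hat_X a t b x z : pth (del e a b) (a :: rcons t b) a b -> ohead t = Some x -> ol t = Some z ->
  1 < size t -> ~~ odd (size t) -> e a b -> (forall w, w \in t -> w \notin X) -> C a -> C b ->
  (forall w, w \in t -> ~~ C w) -> exists2 h, h \in X & forall w, w \in t -> ~~ e h w.
Proof.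
move=> pd hx lz t2 ot eab tX Ca Cb nC; have [_ _ [Ca0 Cb0 nab0 eab0] _ _] := op.
apply: (hat e_sym e_irr noodd noanti noprism aX X0 pd hx lz t2 ot eab _ Ca Cb nC Ca0 Cb0 nab0 eab0).
  by move=> w; rewrite inE mem_rcons inE => /or3P [/eqP ->|/eqP ->|/tX //]; apply: C_notinX.
move=> w wt; apply/negP => /andP [e1 e2]; have := hR (tX w wt) (nC w wt) Ca0 Cb0.
by rewrite !(e_sym w) e1 e2 nab0 (negbTE eab0) => F; apply/notF/F.
Qed.

Lemma open_edge a a' r y y' : pth e r y y' -> e a a' -> a \notin r -> a' \notin r ->
  (forall w, w \in r -> e a w = (w == y)) -> (forall w, w \in r -> e a' w = (w == y')) ->
  pth (del e a a') (a :: rcons r a') a a'.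
Proof.
move=> pr eaa ar a'r ha ha'; have naa : a != a' by apply: contraTneq eaa => ->; rewrite e_irr.
have pa : pth e [:: a'; a] a' a by apply: pth_2; rewrite // e_sym.
have := @ladder_open _ _ e_sym e_irr [:: a'; a] a' a (rev r) y' y [::] a' a [::] pa (pth_rev e_sym e_irr pr).
rewrite /= cats0 revK; apply=> //; split=> [w|w w'].
  by rewrite !inE mem_rev => /orP [] /eqP ->.
rewrite !inE mem_rev => /orP [] /eqP -> wr; rewrite eqxx.
  by rewrite ha' // (eq_sym a') (negbTE naa) orbF.
by rewrite ha // (negbTE naa).
Qed.

Lemma edge_even a a' r y y' : pth e r y y' -> e a a' -> a \notin r -> a' \notin r ->
  (forall w, w \in r -> e a w = (w == y)) -> (forall w, w \in r -> e a' w = (w == y')) ->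
  1 < size r -> ~~ odd (size r).
Proof.
move=> pr eaa ar a'r ha ha' r2; have naa : a != a' by apply: contraTneq eaa => ->; rewrite e_irr.
have := ladder_even e_sym e_irr noodd (pth_2 e_sym e_irr eaa) pr.
rewrite /= negbK => F; apply: F; last by rewrite !ltnS.
split=> [w|w w']; first by rewrite !inE => /orP [] /eqP ->.
rewrite !inE => /orP [] /eqP -> wr; rewrite eqxx; first by rewrite ha // (negbTE naa) orbF.
by rewrite ha' // (eq_sym a') (negbTE naa).
Qed.

Lemma head_nb a q y b w : pth e (a :: q) a b -> ohead q = Some y -> w \in q -> e a w = (w == y).
Proof.
case=> + _ _ hy; rewrite ipath_cons // => /and3P [_ /allP h _] /h /eqP ->.
by rewrite hy; apply/eqP/eqP => [[]|->].
Qed.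

Lemma head_nin a q b : pth e (a :: q) a b -> a \notin q.
Proof. by move=> /(pth_uniq (e := e)); rewrite cons_uniq => /andP []. Qed.

Lemma free_X w : free w -> w \notin X. Proof. by case/and4P. Qed.

(** The configuration that [prec_asym] cannot treat uniformly: the inner vertex [y] of [a y b] is in
    [C], so [b] sees [y] and is useless in a link set for the edge [a y]. Detours through [x1] take
    its place. *)
Lemma short_rung a a' y b b' (v1 m2 : seq T) y1 j1 :
  dir [:: a; y; b] a b -> dir (a' :: v1 ++ m2) a' b' -> a != a' -> ~~ e a' y ->
  (forall w, w \in v1 ++ m2 -> ~~ e a w) -> m2 != [::] -> C y -> pth e v1 y1 j1 ->
  (forall w, w \in v1 -> e y w = (w == j1)) -> has (e x1) v1 -> False.
Proof.
move=> dq dq' naa ea'y hav m20 Cy pv hy hx1.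
have [pq Aa Bb _] := dq; have [pq' Aa' Bb' _] := dq'.
have [Ca Ca' Cb'] : [/\ C a, C a' & C b'] by split; [apply: A_C|apply: A_C|apply: B_C].
have eaa := A_clique Aa Aa' naa.
have eay : e a y by rewrite (head_nb pq (y := y)) ?inE ?eqxx.
have fy : free y.
  have := pth_uniq pq; rewrite /= !inE negb_or -!andbA => /and4P [n1 _ n2 _].
  by apply: (dir_free dq); rewrite ?inE ?eqxx ?orbT // eq_sym.
have tY : ~~ touch y by apply: contraL Cy; apply: free_nC.
have yp : y \notin p by move: tY; rewrite negb_or => /andP [].
have yW w : w \in p -> ~~ e y w by move: tY; rewrite negb_or => /andP [_ /hasPn]; apply.
have a'v := head_nin pq'; rewrite mem_cat negb_or in a'v; have {a'v}/andP [a'v a'm] := a'v.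
have pm2 : exists k, pth e m2 k b'.
  by have := pq'; rewrite -cat_cons => /(pth_catr e_sym e_irr); apply.
have [k pk] := pm2.
have pav : pth e (a' :: v1) a' j1.
  have := pq'; rewrite -cat_cons -[X in X ++ _]cat0s -catA => h0.
  by apply: (sub_pth e_sym e_irr h0) => //; case: pv => _ _; case: (v1) => //= ? ? [->].
have hv1 : ohead v1 = Some y1 by case: pv.
have ha' w : w \in v1 -> e a' w = (w == y1) by apply: head_nb pav hv1.
have cr : forall w w', w \in a' :: v1 -> w' \in m2 -> e w w' = (w == j1) && (w' == k).
  by have := pq'; rewrite -cat_cons => h0; have [] := pth_cat_cross e_sym e_irr h0 pav pk.
have dis : forall w, w \in a' :: v1 -> w \notin m2.
  by have := pq'; rewrite -cat_cons => h0; have [] := pth_cat_cross e_sym e_irr h0 pav pk.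
have fv w : w \in v1 -> free w.
  move=> wv; apply: (dir_free dq'); first by rewrite inE mem_cat wv orbT.
    by apply: contraNneq a'v => <-.
  apply: contraTneq (pth_in2 pk) => <-; apply: dis; by rewrite inE wv orbT.
have av w : w \in v1 -> ~~ e a w by move=> wv; apply: hav; rewrite mem_cat wv.
have yv : y \notin v1 by apply: contraL eay; apply: av.
have ya' : y != a' by apply: contraNneq tY => ->; rewrite /touch touch_A ?orbT.
have aW := A_nb Aa; have a'W := A_nb Aa'.
have eax : e a x1 by rewrite aW ?eqxx. have ea'x : e a' x1 by rewrite a'W ?eqxx.
have xv : x1 \notin v1 by apply: contraL eax; apply: av.
have nav : a \notin v1.
  by apply/negP => avv; case/and4P: (fv a avv) => _ /negP [].
have pva := pth_rev e_sym e_irr pv.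
have pr : pth e (y :: rev v1) y y1.
  by apply: (pth_cons e_sym e_irr pva) => [|w]; rewrite mem_rev //; apply: hy.
have nay : a != y by apply: contraTneq eay => ->; rewrite e_irr.
have ov : odd (size v1).
  have := edge_even pr eaa; rewrite /= size_rev negbK => -> //.
  - by rewrite inE mem_rev negb_or nay.
  - by rewrite inE mem_rev negb_or eq_sym ya'.
  - move=> w; rewrite inE mem_rev => /orP [/eqP ->|wv]; first by rewrite eay eqxx.
    by rewrite (negbTE (av _ wv)); symmetry; apply: contraNF yv => /eqP <-.
  - move=> w; rewrite inE mem_rev => /orP [/eqP ->|wv]; last by rewrite ha'.
    by rewrite (negbTE ea'y); symmetry; apply: contraNF yv => /eqP ->; apply: pth_in1 pv.
  by rewrite ltnS (pth_size pv).
have [k1 [sl [k2 [ev exs hk2]]]] := split_last hx1.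
have nk2 : ~~ has (e x1) k2 by apply/hasPn.
have kv w : w \in sl :: k2 -> w \in v1 by rewrite ev mem_cat => ->; rewrite orbT.
have psl : pth e (sl :: k2) sl j1 by move: pv; rewrite ev => /(pth_split e_sym e_irr) [].
have tsl : touch sl by apply/orP; right; apply/hasP; exists x1; rewrite // e_sym.
have pr2 : pth e (y :: rev (sl :: k2)) y sl.
  apply: (pth_cons e_sym e_irr (pth_rev e_sym e_irr psl)) => [|w]; rewrite mem_rev.
    by apply: contra yv => /kv.
  by move=> /kv; apply: hy.
have xy : x1 != y by apply: contraNneq yp => <-.
have exy : e x1 y = false by rewrite e_sym; apply/negbTE/yW.
have x1r : forall w, w \in y :: rev (sl :: k2) -> e x1 w = (w == sl).
  move=> w; rewrite inE mem_rev inE => /or3P [/eqP ->|/eqP ->|wk].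
  - by rewrite exy; symmetry; apply: contraNF yv => /eqP ->; apply: kv; rewrite mem_head.
  - by rewrite exs eqxx.
  rewrite (negbTE (hk2 _ wk)); symmetry; apply/eqP => ews.
  by have := pth_uniq psl; rewrite /= -ews wk.
have xr2 : x1 \notin y :: rev (sl :: k2).
  by rewrite inE mem_rev negb_or xy; apply: contra xv => /kv.
have ok2 : ~~ odd (size k2).
  have := edge_even pr2 eax; rewrite /= size_rev /= negbK => -> //.
  - by rewrite inE mem_rev negb_or nay; apply: contra nav => /kv.
  - move=> w; rewrite inE mem_rev => /orP [/eqP ->|/kv wv]; first by rewrite eay eqxx.
    by rewrite (negbTE (av _ wv)); symmetry; apply: contraNF yv => /eqP <-.
(* The count along [a' v1 y] is even by [rr_ce], and its prefix up to [sl] is even because [sl]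
   touches [p]; the remainder is therefore even. *)
have ce0 : ce C (rcons (sl :: k2) y) = false.
  have pz : pth e (rcons (y :: rev v1) a') y a'.
    apply: (pth_rcons e_sym e_irr pr); first by rewrite inE mem_rev negb_or eq_sym ya'.
    move=> w; rewrite inE mem_rev => /orP [/eqP ->|wv]; last by rewrite ha'.
    by rewrite (negbTE ea'y); symmetry; apply: contraNF yv => /eqP ->; apply: pth_in1 pv.
  have ce1 : ce C (rcons (y :: rev v1) a') = false.
    rewrite (rr_ce e_sym e_irr noodd noanti noprism aX X0 pz _ Cy Ca'); first by rewrite /= size_rcons size_rev /= ov.
    move=> w; rewrite mem_rcons !inE mem_rev => /or3P [/eqP ->|/eqP ->|/fv /free_X //]; exact: C_notinX.
  have ez : rcons (y :: rev v1) a' = rev (a' :: rcons v1 y) by rewrite rev_cons rev_rcons.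
  rewrite ez ce_rev in ce1; rewrite -[RHS]ce1.
  rewrite ev rcons_cat -cat_cons rcons_cons [RHS]ce_split.
  rewrite (dir_prefix dq' (q1 := rcons (a' :: k1) sl) (q2 := k2 ++ m2) (z := sl)) //.
    by rewrite ev cat_rcons /= -catA.
  by rewrite ol_rcons.
have ce0' : ce C (y :: rev (sl :: k2)) = false by rewrite -rev_rcons ce_rev.
have nx1 : ~~ has C [:: x1] by rewrite /= orbF; case/andP: (hp x1p).
(* If [sl] is not the first vertex of [v1], the path from [y] back to [sl] and on through [x1] to
   [a'] is odd but has an even count. Otherwise [x1] sees only that first vertex of [v1], and [y],
   [v1], [x1], [a] form a hole. *)
case: k1 ev => [|k10 k1] ev; last first.
  have y1k : y1 = k10 by move: hv1; rewrite ev => - [].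
  have y1s : y1 \notin sl :: k2.
    have := pth_uniq pv; rewrite ev cat_uniq => /and3P [_ /hasPn h0 _].
    by apply/negP => /h0; rewrite /= y1k mem_head.
  have a's : a' \notin y :: rev (sl :: k2).
    by rewrite inE mem_rev negb_or eq_sym ya'; apply: contra a'v => /kv.
  have a'e w : w \in y :: rev (sl :: k2) -> e a' w = false.
    rewrite inE mem_rev => /orP [/eqP ->|wk]; first exact: negbTE.
    by rewrite ha' ?kv //; apply: contraNF y1s => /eqP <-.
  have pz1 := pth_rcons e_sym e_irr pr2 xr2 x1r.
  have pz : pth e (rcons (rcons (y :: rev (sl :: k2)) x1) a') y a'.
    apply: (pth_rcons e_sym e_irr pz1).
      by rewrite mem_rcons inE negb_or a's andbT; apply: contraTneq ea'x => ->; rewrite e_irr.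
    move=> w; rewrite mem_rcons inE => /orP [/eqP ->|wk]; first by rewrite ea'x eqxx.
    by rewrite a'e //; symmetry; apply: contraNF xr2 => /eqP <-.
  have : ce C (rcons (rcons (y :: rev (sl :: k2)) x1) a') = true.
    rewrite (rr_ce e_sym e_irr noodd noanti noprism aX X0 pz _ Cy Ca').
      by rewrite !size_rcons /= size_rev /= !negbK (negbTE ok2).
    move=> w; rewrite mem_rcons inE => /orP [/eqP ->|]; first exact: C_notinX.
    rewrite mem_rcons inE => /orP [/eqP ->|]; first by case/andP: (hp x1p).
    by rewrite inE mem_rev => /orP [/eqP ->|/kv /fv /free_X //]; apply: C_notinX.
  by rewrite -!cats1 -catA ce_sep // ce0' /= andbF.
have esl : y1 = sl by move: hv1; rewrite ev => - [].
rewrite /= in ev.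
set t := rcons (rev v1) x1.
have tm w : w \in t = (w == x1) || (w \in v1) by rewrite mem_rcons inE mem_rev.
have x1v w : w \in v1 -> e x1 w = (w == sl).
  by move=> wv; apply: x1r; rewrite inE mem_rev -ev wv orbT.
have pt : pth e t j1 x1.
  apply: (pth_rcons e_sym e_irr pva); first by rewrite mem_rev.
  by move=> w; rewrite mem_rev esl; apply: x1v.
have eya : e y a by rewrite e_sym.
have nyx : ~~ e y x1 by rewrite e_sym exy.
have yt : forall w, w \in t -> e y w = (w == j1).
  move=> w; rewrite tm => /orP [/eqP ->|]; last exact: hy.
  by rewrite (negbTE nyx); symmetry; apply: contraNF xv => /eqP ->; apply: pth_in2 pv.
have at_ : forall w, w \in t -> e a w = (w == x1).
  move=> w; rewrite tm => /orP [/eqP ->|wv]; first by rewrite eax eqxx.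
  by rewrite (negbTE (av _ wv)); symmetry; apply: contraNF xv => /eqP <-.
have pd : pth (del e y a) (y :: rcons t a) y a.
  apply: (open_edge pt eya) => //; first by rewrite tm negb_or eq_sym xy.
  by rewrite tm negb_or nav andbT; apply: contraTneq eax => ->; rewrite e_irr.
have [_ hjt ljt] := pt.
have ot : ~~ odd (size t) by rewrite size_rcons size_rev /= ov.
have t2 : 1 < size t by rewrite size_rcons size_rev ltnS (pth_size pv).
have tX w : w \in t -> w \notin X.
  by rewrite tm => /orP [/eqP ->|/fv /free_X //]; case/andP: (hp x1p).
case hC : (has C t).
  have : ce C (y :: rcons t a) = true.
    rewrite (rr_cyc e_sym e_irr noodd noanti noprism aX X0 pd hjt ljt _ Cy Ca hC) //.
    move=> w; rewrite inE mem_rcons inE => /or3P [/eqP ->|/eqP ->|/tX //]; exact: C_notinX.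
  rewrite /t -!cats1 -!cat_cons -catA ev ce_sep // ce0' /= andbF //.
have nC w : w \in t -> ~~ C w by move=> wt; apply: (hasPn (negbT hC)).
have [x xX hx] := hat_X pd hjt ljt t2 ot eya tX Cy Ca nC.
have xt : x \notin t by apply: contraL xX; apply: tX.
have [x2 [cW x2W ex2 xkW hW]] := tailW.
have noG G : conn e G -> (forall g, g \in G -> ~~ e g y /\ ~~ e g a) -> (exists2 z, z \in G & e x z) ->
    {subset behead p <= G} -> False.
  move=> cG nG hz sG; apply: (no_hat pd eya hjt ljt ot xt _ _ hx cG nG hz _ Ca (or_introl Cy)); try exact: C_adjX.
  exists x2; first exact: sG.
  by apply/orP; right; apply/hasP; exists x1; rewrite ?tm ?eqxx // e_sym.
have Wya g : g \in behead p -> ~~ e g y /\ ~~ e g a.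
  by move=> /hW [gp gx]; rewrite !(e_sym g) yW // aW // gx.
case hxp : (has (e x) (behead p)).
  case/hasP: hxp => z zp exz; apply: (noG [set w in behead p]) => //.
  - by move=> g; rewrite inE; apply: Wya.
  - by exists z; rewrite ?inE.
  - by move=> w; rewrite inE.
have b'k : e b' xk by case/and3P: Bb'.
(* If [y] misses [b'], then [b'] with the rest of [p] links the hat [x] to the hole. If [y] sees
   [b'], then [b'] becomes a hat itself, over the edge [x y]. *)
case eyb : (e y b'); last first.
  apply: (noG (b' |: [set w in behead p])).
  - by apply: (connU1 e_sym cW (x := xk)); rewrite ?inE // e_sym.
  - move=> g; rewrite !inE => /orP [/eqP ->|]; last exact: Wya.
    by rewrite e_sym eyb e_sym AB_nadj.
  - by exists b'; [rewrite !inE eqxx|exact: C_adjX].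
  by move=> w wp; rewrite !inE wp orbT.
have b'v w : w \in v1 -> ~~ e b' w.
  move=> wv; apply/negP => ebw; have := cr w b' _ (pth_in2 pk).
  rewrite e_sym ebw inE wv orbT => /(_ isT) /esym /andP [_ /eqP ebk].
  rewrite -ebk in pk; have em2 := pth_eq e_sym e_irr pk.
  have x1b' : e x1 b' = false by rewrite e_sym B_nb // (negbTE x1k).
  have b'm : b' \in m2 by rewrite em2 mem_head.
  have pQ2 : pth e (v1 ++ m2) y1 b'.
    apply: (@sub_pth _ _ e_sym e_irr [:: a'] (v1 ++ m2) [::] a' b'); rewrite ?cats0 //.
      by case: (v1) hv1.
    by rewrite em2 cats1 ol_rcons.
  have x1e w' : w' \in v1 ++ m2 -> e x1 w' = (w' == y1).
    rewrite mem_cat => /orP [w'v|]; first by rewrite esl x1v.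
    rewrite em2 inE => /eqP ->; rewrite x1b'; symmetry; apply/eqP => eby.
    by have := dis y1; rewrite inE (pth_in1 pv) orbT -eby b'm => /(_ isT).
  have xvm : x1 \notin v1 ++ m2.
    rewrite mem_cat negb_or xv em2 inE; apply/eqP => exb.
    by have := Cp op Cb'; rewrite -exb x1p.
  have pxQ : pth e (x1 :: v1 ++ m2) x1 b'.
    exact: (pth_cons e_sym e_irr pQ2).
  have paQ : pth e (a :: x1 :: v1 ++ m2) a b'.
    apply: (pth_cons e_sym e_irr pxQ).
      rewrite inE negb_or mem_cat negb_or nav em2 inE (AB_neq Aa Bb') !andbT.
      by apply: contraTneq eax => ->; rewrite e_irr.
    move=> w'; rewrite inE => /orP [/eqP ->|w'v]; first by rewrite eax eqxx.
    by rewrite (negbTE (hav _ w'v)); symmetry; apply: contraNF xvm => /eqP <-.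
  have : odd (size (a :: x1 :: v1 ++ m2)).
    apply: (@dir_even _ a b'); split=> // w'; rewrite !inE mem_cat em2 inE.
    case/or4P => [/eqP ->|/eqP ->|/fv fw|/eqP ->]; [by constructor| |by constructor|by constructor].
    by constructor; apply: free_p.
  by have := dir_even dq'; rewrite /= => /negbTE ->.
have pd2 : pth (del e x y) (x :: rcons (a' :: v1) y) x y.
  apply: (open_edge pav) => //; first exact: C_adjX.
  - rewrite inE negb_or; apply/andP; split; last by apply: contra xt; rewrite tm orbC => ->.
    by apply: contraTneq xX => ->; apply: C_notinX.
  - by rewrite inE negb_or ya'.
  - move=> w; rewrite inE => /orP [/eqP ->|wv]; first by rewrite C_adjX ?eqxx.
    by rewrite (negbTE (hx w _)) ?tm ?wv ?orbT //; symmetry; apply: contraNF a'v => /eqP <-.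
  move=> w; rewrite inE => /orP [/eqP ->|wv]; last exact: hy.
  by rewrite e_sym (negbTE ea'y); symmetry; apply: contraNF a'v => /eqP ->; apply: pth_in2 pv.
have [_ hh lh] := pav; have exy' : e x y by exact: C_adjX.
apply: (no_hat pd2 exy' erefl lh _ _ _ _ _ (conn_pset e_sym e_irr pp) (x := b')) => //.
- by rewrite /= ov.
- rewrite inE negb_or eq_sym (AB_neq Aa' Bb') /=; apply/negP => b'v'.
  by have := dis b'; rewrite inE b'v' orbT (pth_in2 pk) => /(_ isT).
- by rewrite e_sym C_adjX.
- by rewrite e_sym.
- move=> w; rewrite inE => /orP [/eqP ->|/b'v //]; by rewrite e_sym AB_nadj.
- move=> g; rewrite inE => gp; rewrite !(e_sym g) yW //; split=> //.
  case: (eqVneq g x1) => [->|gx]; first by rewrite hx // tm eqxx.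
  apply: (hasPn (negbT hxp)); move: gp gx; case: pp => _; case: (p) => // k' p' [->] _.
  by rewrite inE /= => /orP [->|].
- by exists xk; rewrite ?inE.
- by exists x1; rewrite ?inE // /= (e_sym x1) ea'x orbT.
by right; exact: B_C.
Qed.

(** Chosen so that a maximal [a] cannot be bypassed: if a path leaves [a] for another vertex [x] of
    [A] and goes on as a directed path, its part after [x] avoids the neighbours of [a] and
    witnesses [prec a x]. *)
Definition prec a a' := [/\ A a, A a', a != a' & exists q b, dir (a' :: q) a' b /\
  forall w, w \in q -> ~~ e a w].

Lemma dir_memA q a b w : dir q a b -> A w -> w \in q -> w = a.
Proof.
case=> _ Aa Bb h Aw /h [//|ewb|/and4P [_ /negP //]].
by have := AB_neq Aw Bb; rewrite ewb eqxx.
Qed.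

Lemma dir_seg q a b c k s' s1 s2 : dir q a b -> q = s1 ++ s' ++ s2 -> ohead s' = Some c -> ol s' = Some k ->
  pth e s' c k.
Proof. by case=> pq _ _ _ eq hs ls; rewrite eq in pq; apply: (sub_pth e_sym e_irr pq). Qed.

(** Going from [a'] through [x] to the last neighbour [g] of [x] is again a directed path, so the
    tail from [g] has odd size; if [g] is [a], the tail is the whole path. *)
Lemma dir_detour a a' x s b : dir (a :: s) a b -> A a' -> (forall w, w \in s -> ~~ e a' w) ->
  x \in p -> e a' x -> a' != a -> has (e x) (a :: s) -> exists n g n2, [/\ a :: s = n ++ g :: n2, e x g,
    ~~ has (e x) n2, odd (size (g :: n2)) & pth e (g :: n2) g b].
Proof.
move=> dq Aa' hs xp ea'x naa hx; have [n [g [n2 [eq exg hn2]]]] := split_last hx.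
have [pq Aa Bb _] := dq.
have pg : pth e (g :: n2) g b by rewrite eq in pq; have [] := pth_split e_sym e_irr pq.
have nh : ~~ has (e x) n2 by apply/hasPn.
exists n, g, n2; split=> //.
case: n eq => [|a1 n] eq; first by have := dir_even dq; rewrite eq.
have es : s = n ++ g :: n2 by case: eq.
have gs w : w \in g :: n2 -> w \in s by move=> ww; rewrite es mem_cat ww orbT.
have xs : x \notin s by apply: contraL ea'x => /hs.
have x1g : forall w, w \in g :: n2 -> e x w = (w == g).
  move=> w; rewrite inE => /orP [/eqP ->|wn]; first by rewrite exg eqxx.
  rewrite (negbTE (hn2 _ wn)); symmetry; apply/eqP => ewg.
  by have := head_nin pg; rewrite -ewg wn.
have p1 : pth e (x :: g :: n2) x b.
  by apply: (pth_cons e_sym e_irr pg) => //; apply: contra xs => /gs.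
have a's : a' \notin s.
  by apply/negP => a's; have := dir_memA dq Aa' (_ : a' \in a :: s); rewrite inE a's orbT => /(_ isT) /eqP; rewrite (negbTE naa).
have p2 : pth e (a' :: x :: g :: n2) a' b.
  apply: (pth_cons e_sym e_irr p1).
    rewrite inE negb_or; apply/andP; split; last by apply: contra a's => /gs.
    by apply: contraTneq ea'x => ->; rewrite e_irr.
  move=> w; rewrite inE => /orP [/eqP ->|/gs ws]; first by rewrite ea'x eqxx.
  by rewrite (negbTE (hs _ ws)); symmetry; apply: contraNF xs => /eqP <-.
have : odd (size (a' :: x :: g :: n2)); last by rewrite /= !negbK.
apply: (@dir_even _ a' b); split=> // w; rewrite inE => /orP [/eqP ->|]; first by constructor.
rewrite inE => /orP [/eqP ->|/gs ws]; first by constructor; apply: free_p.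
have wq : w \in a :: s by rewrite inE ws orbT.
case: (eqVneq w b) => [->|nwb]; first by constructor.
constructor; apply: (dir_free dq wq) => //.
by apply: contraTneq ws => ->; apply: (head_nin pq).
Qed.

(** Two directed paths, each avoiding the other's start, are joined at their first contact [si],
    [j1]; with the edge [a a'] this gives an even cycle. Every continuation leads to a cycle or
    directed path of wrong parity, or to a hat whose prism has a triangle edge inside [C]. *)
Lemma prec_asym a a' : prec a a' -> prec a' a -> False.
Proof.
move=> [Aa Aa' naa [s' [b' [dq' has_]]]] [_ _ _ [s [b [dq hs]]]].
have [pq _ Bb _] := dq; have [pq' _ Bb' _] := dq'.
have [Ca Ca' Cb Cb'] : [/\ C a, C a', C b & C b'] by split; [apply: A_C|apply: A_C|apply: B_C|apply: B_C].
have eaa := A_clique Aa Aa' naa.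
have nab := AB_neq Aa Bb; have nab' := AB_neq Aa' Bb'.
have bs : b \in s by move: (pth_in2 pq); rewrite inE eq_sym (negbTE nab).
have bs' : b' \in s' by move: (pth_in2 pq'); rewrite inE eq_sym (negbTE nab').
have as_ := head_nin pq; have as'_ := head_nin pq'.
have as' : a \notin s'.
  apply/negP => h0; have := dir_memA dq' Aa (_ : a \in a' :: s'); rewrite inE h0 orbT => /(_ isT) /eqP.
  by rewrite (negbTE naa).
have a's : a' \notin s.
  apply/negP => h0; have := dir_memA dq Aa' (_ : a' \in a :: s); rewrite inE h0 orbT => /(_ isT) /eqP.
  by rewrite eq_sym (negbTE naa).
have os : ~~ odd (size s) by have := dir_even dq.
have os' : ~~ odd (size s') by have := dir_even dq'.
have fs w : w \in s -> w != b -> free w.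
  move=> ws wb; apply: (dir_free dq) => //; first by rewrite inE ws orbT.
  by apply: contraTneq ws => ->.
have fs' w : w \in s' -> w != b' -> free w.
  move=> ws wb; apply: (dir_free dq') => //; first by rewrite inE ws orbT.
  by apply: contraTneq ws => ->.
have hN : has (fun w => (w \in s') || has (e w) s') s.
  apply/hasP; exists b => //; case: (eqVneq b b') => [->|nbb]; first by rewrite bs'.
  by apply/orP; right; apply/hasP; exists b'; rewrite ?B_clique.
have [l1 [si [l2 [es Ni hl1]]]] := split_first hN.
have sis' : si \notin s'.
  apply/negP => sis'; have siq : si \in s by rewrite es mem_cat mem_head orbT.
  case/lastP: l1 es hl1 => [|l1 k] es hl1.
    have := head_nb pq (y := si) (w := si); rewrite es => /(_ erefl (mem_head _ _)).
    by rewrite (negbTE (has_ _ sis')) eqxx.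
  have := hl1 k; rewrite mem_rcons mem_head => /(_ isT) /negP; case; apply/orP; right.
  apply/hasP; exists si => //; move: pq; rewrite es cat_rcons -cat_cons => /(pth_split e_sym e_irr) [_ [+ _ _]].
  by rewrite ipath_cons // => /and3P [_ /allP /(_ si (mem_head _ _)) /eqP + _]; rewrite /= eqxx.
have hsi : has (e si) s' by move: Ni; rewrite (negbTE sis').
have [m1 [j1 [m2 [es' eij hm1]]]] := split_first hsi.
set u1 := rcons l1 si; set v1 := rcons m1 j1.
have esu : s = u1 ++ l2 by rewrite cat_rcons.
have esv : s' = v1 ++ m2 by rewrite cat_rcons.
have us w : w \in u1 -> w \in s by rewrite esu mem_cat => ->.
have vs w : w \in v1 -> w \in s' by rewrite esv mem_cat => ->.
have [y1 hy1] : exists y, ohead u1 = Some y by rewrite /u1; case: (l1) => [|k ?]; [exists si|exists k].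
have [y1' hy1'] : exists y, ohead v1 = Some y by rewrite /v1; case: (m1) => [|k ?]; [exists j1|exists k].
have hs1 : ohead s = Some y1 by rewrite esu; case: (u1) hy1.
have hs1' : ohead s' = Some y1' by rewrite esv; case: (v1) hy1'.
have pu : pth e u1 y1 si.
  by apply: (dir_seg (s1 := [:: a]) (s2 := l2) dq) => //; rewrite ?esu // ol_rcons.
have pv : pth e v1 y1' j1.
  by apply: (dir_seg (s1 := [:: a']) (s2 := m2) dq') => //; rewrite ?esv // ol_rcons.
have uus := pth_uniq pq; rewrite /= es cat_uniq /= in uus.
have cuv w w' : w \in u1 -> w' \in v1 -> e w w' = (w == si) && (w' == j1).
  rewrite mem_rcons inE => /orP [/eqP ->|wl] w'v.
    move: w'v; rewrite eqxx mem_rcons inE => /orP [/eqP ->|w'm]; first by rewrite eqxx.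
    rewrite (negbTE (hm1 _ w'm)); symmetry; apply/eqP => ewj.
    by have := pth_uniq pv; rewrite rcons_uniq -ewj w'm.
  have := hl1 w wl; rewrite negb_or => /andP [_ /hasPn /(_ w' (vs _ w'v)) /negbTE ->].
  symmetry; apply/negbTE; rewrite negb_and; apply/orP; left; apply: contraTneq wl => ->.
  by have := pth_uniq pu; rewrite rcons_uniq => /andP [].
have us' w : w \in u1 -> w \notin s'.
  by rewrite mem_rcons inE => /orP [/eqP -> //|/hl1]; rewrite negb_or => /andP [].
have duv w : w \in u1 -> w \notin v1 by move=> /us'; apply: contra => /vs.
have ha w : w \in s -> e a w = (w == y1) by apply: (head_nb pq).
have ha' w : w \in s' -> e a' w = (w == y1') by apply: (head_nb pq').
set r := u1 ++ rev v1.
have pr : pth e r y1 y1'.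
  apply: (pth_cat e_sym e_irr pu (pth_rev e_sym e_irr pv)).
    by move=> w wu; rewrite mem_rev; apply: duv.
  by move=> w w' wu; rewrite mem_rev; apply: cuv.
have rm w : (w \in r) = (w \in u1) || (w \in v1) by rewrite mem_cat mem_rev.
have ar : a \notin r by rewrite rm negb_or; apply/andP; split; [apply: contra as_ => /us|apply: contra as' => /vs].
have a'r : a' \notin r by rewrite rm negb_or; apply/andP; split; [apply: contra a's => /us|apply: contra as'_ => /vs].
have har w : w \in r -> e a w = (w == y1).
  rewrite rm => /orP [/us|wv]; first exact: ha.
  rewrite (negbTE (has_ _ (vs _ wv))); symmetry; apply/eqP => ewy.
  by have := duv y1 (pth_in1 pu); rewrite -ewy wv.
have ha'r w : w \in r -> e a' w = (w == y1').
  rewrite rm => /orP [wu|/vs]; last exact: ha'.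
  rewrite (negbTE (hs _ (us _ wu))); symmetry; apply/eqP => ewy.
  by have := duv w wu; rewrite ewy (pth_in1 pv).
have pd := open_edge pr eaa ar a'r har ha'r.
have [_ hr lr] := pr.
have r2 : 1 < size r by rewrite size_cat size_rev (leq_add (pth_size pu) (pth_size pv)).
have or_ : ~~ odd (size r) := edge_even pr eaa ar a'r har ha'r r2.
have [x2 [cW x2W ex2 xkW hW]] := tailW.
have eax : e a x1 by rewrite A_nb ?eqxx.
have ea'x : e a' x1 by rewrite A_nb ?eqxx.
have x1s : x1 \notin s by apply: contraL ea'x => /hs.
have x1s' : x1 \notin s' by apply: contraL eax => /has_.
have x1r : x1 \notin r by rewrite rm negb_or; apply/andP; split; [apply: contra x1s => /us|apply: contra x1s' => /vs].
have aW g : g \in behead p -> ~~ e g a /\ ~~ e g a'.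
  by move=> /hW [gp gx]; rewrite !(e_sym g) !A_nb // gx.
have Xr : forall w, w \in r -> w \notin X.
  move=> w; rewrite rm => /orP [/us|/vs] ws.
    by apply: (dir_X dq); rewrite inE ws orbT.
  by apply: (dir_X dq'); rewrite inE ws orbT.
have eb'k : e b' xk by case/and3P: Bb'. have ebk : e b xk by case/and3P: Bb.
have noG x G : x \notin r -> e x a -> e x a' -> (forall w, w \in r -> ~~ e x w) ->
    conn e G -> (forall g, g \in G -> ~~ e g a /\ ~~ e g a') -> (exists2 z, z \in G & e x z) ->
    (exists2 y, y \in G & (y \in r) || has (e y) r) -> False.
  move=> xr xa xa' hx cG nG hz tG.
  exact: (no_hat pd eaa hr lr or_ xr xa xa' hx cG nG hz tG Ca' (or_introl Ca)).
(* If the first path has no contact before its end [b], parity of directed paths forces [j1] to be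
   [b']. Then either [x1] sees only [a a'] on the cycle and is a hat, or the tails behind its last
   neighbours bound an odd cycle. *)
case: l2 es esu uus => [|l20 l2] es esu uus.
  have esib : si = b by case: pq => _ _; rewrite es -cat_cons ol_cat => - [].
  have sub : s = u1 by rewrite esu cats0.
  have ejb : j1 = b'.
    apply/eqP/negPn/negP => njb; have b'm : b' \in m2.
      have [_ _] := pq'; rewrite es' -cat_cons ol_cat => - [lq'].
      by have := mem_last j1 m2; rewrite lq' inE eq_sym (negbTE njb).
    have b'v : b' \notin v1.
      have := pth_uniq pq'; rewrite /= esv cat_uniq => /and4P [_ _ /hasPn h0 _]; exact: h0.
    have pav : pth e (a' :: v1) a' j1.
      by apply: (dir_seg (s1 := [::]) (s2 := m2) dq'); rewrite ?esv //= ?last_rcons //.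
    have pavb : pth e (rcons (a' :: v1) b) a' b.
      apply: (pth_rcons e_sym e_irr pav).
        rewrite inE negb_or eq_sym (AB_neq Aa' Bb); apply: contraL bs => bv; rewrite sub.
        by apply: contraL bv => /duv.
      move=> w; rewrite inE => /orP [/eqP ->|wv].
        rewrite e_sym (negbTE (AB_nadj Aa' Bb)); symmetry; apply: contraNF as'_ => /eqP ->.
        exact: (vs _ (pth_in2 pv)).
      by rewrite -esib cuv // ?eqxx // /u1 mem_rcons mem_head.
    have : odd (size (rcons (a' :: v1) b)).
      apply: (@dir_even _ a' b); split=> // w; rewrite mem_rcons !inE => /or3P [/eqP ->|/eqP ->|wv]; try by constructor.
      by constructor; apply: fs' (vs _ wv) _; apply: contraTneq wv => ->.
    move: or_ os; rewrite sub /r /= size_cat size_rev size_rcons !oddD /= /v1 /u1 !size_rcons /=.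
    by case: (odd (size m1)); case: (odd (size l1)).
  have em2 : m2 = [::].
    have := pth_uniq pq'; rewrite es' -cat_cons => h0; apply: (uniq_ol h0).
    by have [_ _] := pq'; rewrite es' -cat_cons ejb.
  have svb : s' = v1 by rewrite esv em2 cats0.
  have ex1a : e x1 a by rewrite e_sym. have ex1a' : e x1 a' by rewrite e_sym.
  have na'a : a' != a by rewrite eq_sym.
  have hh : has (e x1) (a :: s) by rewrite /= ex1a.
  have hh' : has (e x1) (a' :: s') by rewrite /= ex1a'.
  have [n [g [n2 [eg exg hn2 og pg]]]] := dir_detour dq Aa' hs x1p ea'x na'a hh.
  have [n' [g' [n2' [eg' exg' hn2' og' pg']]]] := dir_detour dq' Aa has_ x1p eax naa hh'.
  have gq w : w \in g :: n2 -> w \in a :: s by rewrite eg mem_cat => ->; rewrite orbT.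
  have gq' w : w \in g' :: n2' -> w \in a' :: s' by rewrite eg' mem_cat => ->; rewrite orbT.
  have gaE : a \in g :: n2 -> g = a /\ n2 = s.
    case: n eg => [|w0 w] eg ag; first by case: eg => -> ->.
    by case: eg => _ es0; move: as_; rewrite es0 mem_cat ag orbT.
  have gaE' : a' \in g' :: n2' -> g' = a' /\ n2' = s'.
    case: n' eg' => [|w0 w] eg' ag; first by case: eg' => -> ->.
    by case: eg' => _ es0; move: as'_; rewrite es0 mem_cat ag orbT.
  case: (boolP ((a \in g :: n2) && (a' \in g' :: n2'))) => [/andP [ag ag']|nn].
    have [_ en] := gaE ag; have [_ en'] := gaE' ag'.
    apply: (noG x1 [set w in behead p]) => //.
    - move=> w; rewrite rm => /orP [/us|/vs] ww; first by apply: (hasPn hn2); rewrite en.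
      by apply: (hasPn hn2'); rewrite en'.
    - by move=> k; rewrite inE; apply: aW.
    - by exists x2; rewrite ?inE.
    exists xk; rewrite ?inE //; apply/orP; right; apply/hasP; exists b; last by rewrite e_sym.
    by rewrite rm -sub bs.
  have xg : x1 \notin g :: n2.
    apply/negP => /gq; rewrite inE (negbTE x1s) orbF => /eqP exa; by rewrite exa e_irr in ex1a.
  have xg' : x1 \notin g' :: n2'.
    apply/negP => /gq'; rewrite inE (negbTE x1s') orbF => /eqP exa; by rewrite exa e_irr in ex1a'.
  have x1g w : w \in g :: n2 -> e x1 w = (w == g).
    rewrite inE => /orP [/eqP ->|wn]; first by rewrite exg eqxx.
    rewrite (negbTE (hasPn hn2 _ wn)); symmetry; apply/eqP => ewg.
    by have := head_nin pg; rewrite -ewg wn.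
  have x1g' w : w \in g' :: n2' -> e x1 w = (w == g').
    rewrite inE => /orP [/eqP ->|wn]; first by rewrite exg' eqxx.
    rewrite (negbTE (hasPn hn2' _ wn)); symmetry; apply/eqP => ewg.
    by have := head_nin pg'; rewrite -ewg wn.
  have px := pth_cons e_sym e_irr pg xg x1g.
  have x1b : ~~ e x1 b by rewrite e_sym B_nb // (negbTE x1k).
  have ngb : g != b by apply: contraNneq x1b => <-.
  have sg := pth_size2 pg ngb; have sg' := pth_size pg'.
  have := ladder_even e_sym e_irr noodd px pg' _ (leq_add (sg : 2 < size (x1 :: g :: n2)) sg').
  rewrite oddD -[size (x1 :: g :: n2)]/(size (g :: n2)).+1 oddS og og' => F; apply/notF/F.
  split=> [w|w w'].
    rewrite inE => /orP [/eqP -> //|wg]; apply/negP => wg'.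
    have := gq _ wg; have := gq' _ wg'; rewrite !inE => /orP [/eqP ->|ws'] /orP [/eqP ews|ws].
    - by rewrite ews eqxx in naa.
    - by rewrite ws in a's.
    - by rewrite -ews ws' in as'.
    by rewrite sub in ws; have := us' w ws; rewrite ws'.
  rewrite inE => /orP [/eqP ->|wg] wg'.
    rewrite x1g' // eqxx /=; have -> : (x1 == b) = false by apply: contraNF x1s => /eqP ->.
    by rewrite orbF.
  have -> : (w == x1) = false by apply: contraNF xg => /eqP <-.
  have := gq _ wg; have := gq' _ wg'; rewrite !inE => /orP [/eqP ew'|ws'] /orP [/eqP ew|ws].
  - by case/negP: nn; rewrite -ew -ew' wg wg'.
  - rewrite ew' e_sym (negbTE (hs _ ws)) (negbTE nab') andbF //.
  - by rewrite ew (negbTE (has_ _ ws')) (negbTE nab).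
  by rewrite sub in ws; rewrite svb in ws'; rewrite cuv // esib ejb.
set L2 := l20 :: l2 in es esu.
have bL : b \in L2.
  by have [_ _] := pq; rewrite es -cat_cons ol_cat => - [<-]; rewrite /= mem_last.
have us0 : uniq (u1 ++ L2) by rewrite -esu; have := pth_uniq pq; rewrite cons_uniq => /andP [].
have us0' : uniq (v1 ++ m2) by rewrite -esv; have := pth_uniq pq'; rewrite cons_uniq => /andP [].
have bu : b \notin u1.
  by move: us0; rewrite cat_uniq => /and3P [_ /hasPn h0 _]; apply: h0.
have pau : pth e (a :: u1) a si.
  by apply: (dir_seg (s1 := [::]) (s2 := L2) dq); rewrite ?esu //= ?last_rcons.
have fu w : w \in u1 -> free w by move=> wu; apply: fs (us _ wu) _; apply: contraNneq bu => <-.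
(* The directed path from [a] that changes over to the second path at the last neighbour of [si]. If
   [j1] is the only neighbour, its parity contradicts that of the hole. *)
have joint (w : seq T) k (n2 : seq T) : s' = w ++ k :: n2 -> e si k -> ~~ has (e si) n2 -> odd (size (a :: u1) + size (k :: n2)).
  move=> ew esk hn2; have pk : pth e (k :: n2) k b'.
    by have := pq'; rewrite ew -cat_cons => /(pth_split e_sym e_irr) [].
  have ks z : z \in k :: n2 -> z \in s' by move=> zk; rewrite ew mem_cat zk orbT.
  rewrite -size_cat; apply: (@dir_even _ a b'); split=> //.
    apply: (pth_cat e_sym e_irr pau pk).
      move=> z; rewrite inE => /orP [/eqP ->|/us' zs]; first by apply: contra as' => /ks.
      by apply: contra zs => /ks.
    move=> z z'; rewrite inE => /orP [/eqP ->|zu] zk.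
      rewrite (negbTE (has_ _ (ks _ zk))); symmetry; apply/negbTE; rewrite negb_and; apply/orP; left.
      by apply: contraNneq as_ => ->; apply: us; apply: pth_in2 pu.
    have zi z0 : z0 \in k :: n2 -> e si z0 = (z0 == k).
      rewrite inE => /orP [/eqP ->|zn]; first by rewrite eqxx.
      rewrite (negbTE (hasPn hn2 _ zn)); symmetry; apply/eqP => ezk.
      by have := head_nin pk; rewrite -ezk zn.
    move: zu; rewrite mem_rcons inE => /orP [/eqP ->|zl]; first by rewrite eqxx zi.
    have := hl1 z zl; rewrite negb_or => /andP [_ /hasPn /(_ z' (ks _ zk)) /negbTE ->].
    symmetry; apply/negbTE; rewrite negb_and; apply/orP; left; apply: contraTneq zl => ->.
    by have := pth_uniq pu; rewrite rcons_uniq => /andP [].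
  move=> z; rewrite mem_cat inE => /orP [/orP [/eqP ->|/fu]|/ks zs]; [by constructor|by constructor|].
  by case: (eqVneq z b') => [->|zb]; [constructor|constructor; apply: fs'].
have par : odd (size l1) = odd (size m1).
  move: or_; rewrite size_cat size_rev !size_rcons !addSn !addnS /= negbK oddD.
  by case: (odd _); case: (odd _).
case hm2 : (has (e si) m2); last first.
  have := joint _ _ _ es' eij (negbT hm2).
  move: os'; rewrite es' size_cat /= size_rcons addnS !addSn !addnS /= !oddD par.
  by case: (odd _); case: (odd _).
have [m3 [j2 [n2 [em2 eij2 hn2]]]] := split_last hm2.
have bw w : w \in j2 :: n2 -> w \in m2 by rewrite em2 mem_cat => ->; rewrite orbT.
have bws w : w \in j2 :: n2 -> w \in s' by rewrite esv mem_cat => /bw ->; rewrite orbT.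
have pbeta : pth e (j2 :: n2) j2 b'.
  have := pq'; have -> : a' :: s' = (a' :: v1 ++ m3) ++ j2 :: n2 by rewrite esv em2 /= -catA.
  by move=> /(pth_split e_sym e_irr) [].
have vm w : w \in v1 -> w \notin m2.
  by move=> wv; move: us0'; rewrite cat_uniq => /and3P [_ /hasPn h0 _]; apply: contraL wv => /h0.
have b'm : b' \in m2 := bw _ (pth_in2 pbeta).
have fv w : w \in v1 -> free w.
  move=> wv; apply: fs' (vs _ wv) _; apply: contraTneq b'm => <-; exact: vm.
have fr w : w \in r -> free w by rewrite rm => /orP [/fu|/fv].
have bG g : g \in j2 :: n2 -> ~~ e g a /\ ~~ e g a'.
  move=> gb; rewrite !(e_sym g) has_ ?bws // ha' ?bws //; split=> //.
  by apply: contraTneq (bw _ gb) => ->; apply: vm (pth_in1 pv).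
have sir : si \in r by rewrite rm (pth_in2 pu).
have j2r : (j2 \in r) || has (e j2) r by apply/orP; right; apply/hasP; exists si; rewrite // e_sym.
have cB := conn_pset e_sym e_irr pbeta.
(* If [x1] sees nothing of [r], it is a hat over [a a'], linked to the hole by the rest of [p]
   together with the tail of the second path. *)
case hx1 : (has (e x1) r); last first.
  apply: (noG x1 ([set w in behead p] :|: [set w in j2 :: n2])) => //; try by rewrite e_sym.
  - by move=> w wr; apply: (hasPn (negbT hx1)).
  - apply: (connU e_sym cW cB (x := xk) (y := b')); rewrite ?inE //; last by rewrite e_sym eb'k orbT.
    by have := pth_in2 pbeta; rewrite inE.
  - by move=> g; rewrite !in_setU !in_set => /orP [/aW|/bG].
  - by exists x2; rewrite // in_setU in_set x2W.
  by exists j2; rewrite // in_setU !in_set mem_head orbT.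
have m20 : m2 != [::] by case: (m2) b'm.
have hys w : w \in s' -> ~~ e a w by exact: has_.
case h1 : ((size s == 2) && C y1).
  case/andP: h1 => /eqP s2 Cy1.
  have [l10 l20' ] : l1 = [::] /\ l2 = [::].
    by move: s2; rewrite es size_cat /= => s2; split; apply: size0nil; move: s2; clear; lia.
  have eys : y1 = si by move: hy1; rewrite /u1 l10 => - [].
  have elb : l20 = b by move: bL; rewrite /L2 l20' inE => /eqP.
  have dq2 : dir [:: a; si; b] a b by move: dq; rewrite es l10 /L2 l20' elb.
  have dq3 : dir (a' :: v1 ++ m2) a' b' by rewrite -esv.
  rewrite eys in Cy1; apply: (short_rung dq2 dq3 naa _ _ m20 Cy1 pv) => //.
  - by apply: hs; apply: us; apply: pth_in2 pu.
  - by move=> w; rewrite -esv; apply: has_.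
  - by move=> w wv; rewrite cuv ?eqxx // (pth_in2 pu).
  case/hasP: hx1 => w; rewrite rm => /orP [|wv exw]; last by apply/hasP; exists w.
  rewrite /u1 l10 /= inE => /eqP ews exw; have := free_nC (fu si (pth_in2 pu)).
  rewrite Cy1 => /(_ _)/negP F; exfalso; apply: F => //.
  by apply/orP; right; apply/hasP; exists x1; rewrite // e_sym -ews.
case h2 : ((size s' == 2) && C y1').
  case/andP: h2 => /eqP s2 Cy1.
  have m2s : 0 < size m2 by case: (m2) m20.
  have [m10 m2s1] : m1 = [::] /\ size m2 = 1.
    by move: s2; rewrite es' size_cat /= => s2; split; [apply: size0nil|]; move: s2 m2s; clear; lia.
  have eys : y1' = j1 by move: hy1'; rewrite /v1 m10 => - [].
  have em2b : m2 = [:: b'].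
    by move: m2s1 b'm; clear; case: m2 => [|k []] //= _; rewrite inE => /eqP ->.
  have dq2 : dir [:: a'; j1; b'] a' b' by move: dq'; rewrite es' m10 em2b.
  have dq3 : dir (a :: u1 ++ L2) a b by rewrite -esu.
  have na' : a' != a by rewrite eq_sym.
  rewrite eys in Cy1; apply: (short_rung dq2 dq3 na' _ _ _ Cy1 pu) => //.
  - by apply: has_; apply: vs; apply: pth_in2 pv.
  - by move=> w; rewrite -esu; apply: hs.
  - by move=> w wv; rewrite e_sym cuv ?eqxx ?andbT // (pth_in2 pv).
  case/hasP: hx1 => w; rewrite rm => /orP [wv exw|]; first by apply/hasP; exists w.
  rewrite /v1 m10 /= inE => /eqP ews exw; have := free_nC (fv j1 (pth_in2 pv)).
  rewrite Cy1 => /(_ _)/negP F; exfalso; apply: F => //.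
  by apply/orP; right; apply/hasP; exists x1; rewrite // e_sym -ews.
have tA k : A k -> touch k by move=> Ak; rewrite /touch touch_A ?orbT.
have hL : has touch (a :: u1) by rewrite /= tA.
have hL' : has touch (a' :: v1) by rewrite /= tA.
(* The cycle is cut at the last touching vertices [g] and [k] of its two halves. The outer parts are
   prefixes of directed paths and the interior of the middle part [M] does not touch [p], so the
   total count is even. *)
have [g1 [g [g2 [eL tg hg2]]]] := split_last hL.
have [k1 [k [k2 [eL' tk hk2]]]] := split_last hL'.
pose M := g :: rcons (g2 ++ rev k2) k.
have E1 : a :: rcons r a' = g1 ++ M ++ rev k1.
  have -> : a :: rcons r a' = (a :: u1) ++ rev (a' :: v1) by rewrite rev_cons /r rcons_cat.
  by rewrite eL eL' rev_cat rev_cons /M -!cats1 /= -!catA.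
have ug := pth_uniq pd; rewrite E1 in ug.
have nCr w : w \in r -> touch w -> ~~ C w by move=> /fr; apply: free_nC.
have g1a : g1 = [::] -> g = a /\ g2 = u1 by move=> e0; move: eL; rewrite e0 => - [-> ->].
have k1a : k1 = [::] -> k = a' /\ k2 = v1 by move=> e0; move: eL'; rewrite e0 => - [-> ->].
have nb : (g1 != [::]) || (rev k1 != [::]).
  have -> : (rev k1 != [::]) = (k1 != [::]) by rewrite -!size_eq0 size_rev.
  apply: contraT; rewrite negb_or !negbK => /andP [/eqP /g1a [_ e2] /eqP /k1a [_ e4]].
  case/hasP: hx1 => w wr exw; have tw : touch w by apply/orP; right; apply/hasP; exists x1; rewrite // e_sym.
  by move: wr; rewrite rm -e2 -e4 => /orP [/hg2|/hk2]; rewrite tw.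
have lM : ol M = Some k by rewrite /= last_rcons.
have PM : pth e M g k := clp_sub e_sym e_irr pd hr lr E1 erefl lM nb.
have Mm w : w \in M -> [\/ w = a, w = a' | w \in r].
  move=> wM; have : w \in a :: rcons r a' by rewrite E1 !mem_cat wM orbT.
  by rewrite inE mem_rcons inE => /or3P [/eqP ->|/eqP ->|->]; constructor.
have aM : a \in M -> g1 = [::].
  case: g1 eL ug {E1 g1a nb} => // w g1 [<- _] ug aM; move: ug.
  by rewrite cat_cons cons_uniq !mem_cat aM orbT.
have a'M : a' \in M -> k1 = [::].
  case: k1 eL' ug {E1 k1a nb} => // w k1 [<- _] ug aM'; move: ug.
  rewrite rev_cons catA cat_uniq => /and3P [_ /hasPn h0 _].
  have := h0 a'; rewrite mem_rcons mem_head => /(_ isT) /negP; case.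
  by rewrite -[X in is_true X]/(a' \in g1 ++ M) mem_cat aM' orbT.
have gM : g \in M by rewrite mem_head. have kM : k \in M by rewrite inE mem_rcons mem_head orbT.
have nbM : a \in M -> a' \in M -> False.
  move=> /aM e0 /a'M e0'; move: nb; by rewrite e0 e0'.
have gC : C g -> g = a.
  move=> Cg; have : g \in a :: u1 by rewrite eL mem_cat mem_head orbT.
  rewrite inE => /orP [/eqP //|gu]; have := nCr g; rewrite rm gu Cg tg => /(_ isT isT) //.
have kC : C k -> k = a'.
  move=> Cg; have : k \in a' :: v1 by rewrite eL' mem_cat mem_head orbT.
  rewrite inE => /orP [/eqP //|gu]; have := nCr k; rewrite rm gu orbT Cg tk => /(_ isT isT) //.
have K : ce C (a :: rcons r a') = false.
  rewrite E1 /M /= cat_rcons ce_split -[g :: _ ++ _ :: _]/((g :: (g2 ++ rev k2)) ++ k :: rev k1).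
  rewrite [X in _ (+) X]ce_split.
  have -> : ce C (k :: rev k1) = ce C (rcons k1 k) by rewrite -ce_rev rev_cons revK.
  rewrite (dir_prefix dq (q1 := rcons g1 g) (q2 := g2 ++ L2) (z := g)) ?ol_rcons //; last first.
    by rewrite esu cat_rcons -cat_cons eL -catA.
  rewrite (dir_prefix dq' (q1 := rcons k1 k) (q2 := k2 ++ m2) (z := k)) ?ol_rcons //; last first.
    by rewrite esv cat_rcons -cat_cons eL' -catA.
  rewrite addbF /= -/M.
  case: (ltnP 2 (size M)) => sM; last first.
    have e0 : g2 ++ rev k2 = [::] by apply: size0nil; move: sM; rewrite /= size_rcons; case: (size _).
    rewrite /M e0 /= !andbF !addbF; apply/negbTE/negP => /andP [/gC ga /kC ka].
    by apply: nbM; rewrite -?ga -?ka.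
  apply: (seg_even_touch PM sM tg tk).
  - move=> w; rewrite inE mem_rcons inE => /or3P [->|->|] //.
    by rewrite mem_cat mem_rev => /orP [/hg2|/hk2].
  - by move=> w /Mm [->|->|/Xr //]; apply: C_notinX.
  have un w : w \in M -> C w -> w != a -> w != a' -> w \in r /\ ~~ touch w.
    move=> wM Cw wa wa'; have wr : w \in r by case: (Mm w wM) wa wa' => [->|->|//]; rewrite eqxx.
    by split=> //; apply: contraTN Cw; apply: nCr.
  have unh w : ~~ touch w -> ~~ has (e w) p by rewrite negb_or => /andP [].
  have p2 : 1 < size p by case: (size_p3 op) => /ltnW.
  have keyA c : a \in M -> c \in M -> C c -> e a c -> exists G, link_set p G a c.
    move=> aM' cM Cc eac; have ca' : c != a' by apply/eqP => ec; apply: nbM aM' _; rewrite -ec.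
    have ca : c != a by apply: contraTneq eac => ->; rewrite e_irr.
    have [cr ntc] := un c cM Cc ca ca'; have ecy : c = y1 by apply/eqP; rewrite -har.
    apply: (link_end pp p2 Cb ebk) => //; [by rewrite e_sym AB_nadj| |exact: A_nb|exact: unh].
    apply/negP => ebc; have ps : pth e s y1 b.
      by apply: (dir_seg (s1 := [:: a]) (s2 := [::]) dq); rewrite ?cats0 //; have [_ _] := pq; case: (s) bs.
    have yb : y1 != b by apply: contraNneq bu => <-; apply: pth_in1 pu.
    have := pth_adj e_sym e_irr ps yb; rewrite -ecy e_sym ebc => /(_ isT) es2.
    by move: h1; rewrite es2 /= -ecy Cc.
  have keyA' c : a' \in M -> c \in M -> C c -> e a' c -> exists G, link_set p G a' c.
    move=> aM' cM Cc eac; have ca' : c != a by apply/eqP => ec; apply: nbM aM'; rewrite -ec.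
    have ca : c != a' by apply: contraTneq eac => ->; rewrite e_irr.
    have [cr ntc] := un c cM Cc ca' ca; have ecy : c = y1' by apply/eqP; rewrite -ha'r.
    apply: (link_end pp p2 Cb' eb'k) => //; [by rewrite e_sym AB_nadj| |exact: A_nb|exact: unh].
    apply/negP => ebc; have ps : pth e s' y1' b'.
      by apply: (dir_seg (s1 := [:: a']) (s2 := [::]) dq'); rewrite ?cats0 //; have [_ _] := pq'; case: (s') bs'.
    have yb : y1' != b' by apply: contraTneq b'm => <-; apply: vm (pth_in1 pv).
    have := pth_adj e_sym e_irr ps yb; rewrite -ecy e_sym ebc => /(_ isT) es2.
    by move: h2; rewrite es2 /= -ecy Cc.
  have flip c c' : (exists G, link_set p G c' c) -> exists G, link_set p G c c'.
    by case=> G lG; exists G; apply: link_setC.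
  move=> c c' cM c'M Cc Cc' ecc hn.
  case aMb : (a \in M).
    case/orP: (hn a aMb Ca) => /eqP eac; subst; first exact: keyA.
    by apply: flip; apply: keyA; rewrite // e_sym.
  case aMb' : (a' \in M).
    case/orP: (hn a' aMb' Ca') => /eqP eac; subst; first exact: keyA'.
    by apply: flip; apply: keyA'; rewrite // e_sym.
  have far z : z \in M -> C z -> ~~ e a z /\ ~~ has (e z) p.
    move=> zM Cz; have za : z != a by apply: contraFneq aMb => <-.
    have za' : z != a' by apply: contraFneq aMb' => <-.
    have [zr ntz] := un z zM Cz za za'; split; last exact: unh.
    rewrite har //; apply/eqP => ezy; subst z.
    case: g1 eL E1 g1a ug {nb aM} => [|w g1] eL E1 g1a ug; first by case: (g1a erefl) => ga; rewrite -ga gM in aMb.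
    case: eL => _ eu; case: g1 eu {E1 g1a} ug => [|w' g1] eu ug.
      by have ey : g = y1 by [move: hy1; rewrite eu => - []]; rewrite -ey tg in ntz.
    have ey : w' = y1 by move: hy1; rewrite eu => - [].
    move: ug; rewrite ey 2!cat_cons 2!cons_uniq => /and3P [_ h0 _].
    by move: h0; rewrite !mem_cat zM orbT.
  have [eac nc] := far c cM Cc; have [eac' nc'] := far c' c'M Cc'.
  exact: (link_all pp Ca (touch_A Aa)).
(* A vertex of [C] on [r] would make the count odd. Without one there is a hat in [X] over [a a'],
   and the tail [j2 :: n2], which contains [b'], links it to the hole. *)
case hC : (has C r).
  have := rr_cyc e_sym e_irr noodd noanti noprism aX X0 pd hr lr _ Ca Ca' hC.
  rewrite -/C K or_ => F; suff: false by []. rewrite {1}F // => w.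
  rewrite inE mem_rcons inE => /or3P [/eqP ->|/eqP ->|/Xr //]; exact: C_notinX.
have nC w : w \in r -> ~~ C w by move=> wt; apply: (hasPn (negbT hC)).
have [x xX hx] := hat_X pd hr lr r2 or_ eaa Xr Ca Ca' nC.
apply: (noG x [set w in j2 :: n2]) => //; try exact: C_adjX.
- by apply: contraL xX; apply: Xr.
- by move=> g0; rewrite in_set; apply: bG.
- by exists b'; [rewrite in_set; apply: pth_in2 pbeta|apply: C_adjX].
by exists j2; rewrite // in_set mem_head.
Qed.

(** Either the path witnessing [prec a' a''] avoids the neighbours of [a], or its part from the last
    such neighbour, preceded by [a], witnesses [prec a' a], against asymmetry. *)
Lemma prec_trans a a' a'' : prec a a' -> prec a' a'' -> prec a a''.
Proof.
move=> h1 h2; have [Aa Aa' naa _] := h1; have [_ Aa'' naa' [q [b [dq hq]]]] := h2.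
have na : a != a'' by apply: contra_notN (prec_asym h2) => /eqP <-.
split=> //; case ha : (has (e a) q); last first.
  by exists q, b; split=> // w wq; apply: (hasPn (negbT ha)).
case: (prec_asym h1); split; rewrite 1?eq_sym //.
have [n [g [n2 [eq eag hn2]]]] := split_last ha; have [pq _ Bb _] := dq.
have gq w : w \in g :: n2 -> w \in q by move=> wg; rewrite eq mem_cat wg orbT.
have pg : pth e (g :: n2) g b.
  have := pq; rewrite eq -cat_cons => /(pth_split e_sym e_irr) [] //.
exists (g :: n2), b; split; last by move=> w /gq /hq.
split=> //; first apply: (pth_cons e_sym e_irr pg).
- apply/negP => /gq agq; have := dir_memA dq Aa (_ : a \in a'' :: q).
  by rewrite inE agq orbT => /(_ isT) /eqP; rewrite (negbTE na).
- move=> w; rewrite inE => /orP [/eqP ->|wn]; first by rewrite eag eqxx.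
  rewrite (negbTE (hn2 _ wn)); symmetry; apply/eqP => ewg.
  by have := head_nin pg; rewrite -ewg wn.
move=> w; rewrite inE => /orP [/eqP ->|/gq wq]; first by constructor.
case: (eqVneq w b) => [->|wb]; first by constructor.
constructor; apply: (dir_free dq) => //; first by rewrite inE wq orbT.
by apply: contraTneq wq => ->; apply: (head_nin pq).
Qed.

Lemma prec_irr a : ~ prec a a.
Proof. by case=> _ _; rewrite eqxx. Qed.

Lemma prec_max : exists2 a, A a & forall a', ~ prec a a'.
Proof.
have [m Sm hm] := max_ex prec_trans prec_irr (S := [set a | A a]) (x0 := a0) (eq_ind_r _ A_a0 (in_set _ a0)).
exists m; first by rewrite inE in Sm.
by move=> a' pa; apply: (hm a') => //; rewrite inE; case: pa.
Qed.

End Fixed2.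

(** An odd path between maximal elements has its second and its last but one vertex as the only
    further candidates for [A] and [B]. If neither or both of them belong, the path or its interior
    is directed, hence even; if exactly one does, it witnesses that [a] or [b] was not maximal. *)
Theorem mt_pair p x1 xk a0 b0 : outg p x1 xk a0 b0 ->
  (forall q y z c d, outg q y z c d -> size p <= size q) -> exists u v, even_pair e u v.
Proof.
move=> op pmin; have opr := outg_rev op.
have pminr q y z c d : outg q y z c d -> size (rev p) <= size q by rewrite size_rev; apply: pmin.
have [a Aa amax] := prec_max op pmin; have [b Bb bmax] := prec_max opr pminr.
have nab := AB_neq op pmin Aa Bb; have eab := AB_nadj op pmin Aa Bb.
have [Ca Cb] := (A_C Aa, B_C Bb).
exists a, b; split=> // q iq lq; apply/negP => oq.
have pq : pth e (a :: q) a b by split; rewrite //= lq.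
have mid w : w \in a :: q -> e a w -> e b w -> False.
  by move=> wq e1 e2; have [eq] := pth_mid pq nab eab wq e1 e2; rewrite eq in oq.
(* A vertex seeing both ends would make the path of length two; this excludes vertices of [X] and,
   by [D_A] from both ends, touching vertices of [C] outside both sides. *)
have cl w : w \in a :: q -> [\/ sideA x1 b0 w, sideA xk a0 w | free p x1 xk a0 b0 w].
  move=> wq; case Aw : (sideA x1 b0 w); first by constructor.
  case Bw : (sideA xk a0 w); first by constructor.
  constructor; rewrite /free Aw Bw /= ; apply/andP; split.
    by apply/negP => wX; apply: (mid w wq); rewrite e_sym; [move/cplP: Ca|move/cplP: Cb]; apply.
  apply/implyP => Cw; apply/negP => hw; apply: (mid w wq).
    exact: (D_A op pmin Cw hw (negbT Aw) (negbT Bw) Aa).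
  by apply: (D_A opr pminr Cw _ (negbT Bw) (negbT Aw) Bb); rewrite has_rev.
have [t [x [z [eq pt at_ bt [ha hb]]]]] := pth_inner e_sym e_irr pq nab eab.
have [eqt] := eq; rewrite eqt size_rcons /= in oq.
have tq w : w \in t -> w \in a :: q by move=> wt; rewrite eq inE mem_rcons inE wt !orbT.
have [xt zt] := (pth_in1 pt, pth_in2 pt).
have tA w : w \in t -> sideA x1 b0 w -> w = x.
  move=> wt Aw; have wa : a != w by apply: contraNneq at_ => ->.
  by apply/eqP; rewrite -ha //; apply: (A_clique op Aa Aw wa).
have tB w : w \in t -> sideA xk a0 w -> w = z.
  move=> wt Aw; have wa : b != w by apply: contraNneq bt => ->.
  by apply/eqP; rewrite -hb //; apply: (A_clique opr Bb Aw wa).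
case Ax : (sideA x1 b0 x); case Bz : (sideA xk a0 z).
- have : odd (size t).
    apply: (dir_even op pmin (a := x) (b := z)); split=> // w wt.
    by case: (cl w (tq w wt)) => [/(tA w wt) ->|/(tB w wt) ->|]; constructor.
  by move=> ot; rewrite ot in oq.
- have ptb : pth e (rcons t b) x b by apply: (pth_rcons e_sym e_irr pt).
  apply: (amax x); split=> //; first by apply: contraNneq at_ => ->.
  case: t pt {pq eq eqt} at_ bt ha hb tq xt zt tA tB ptb oq => // x' t pt at_ bt ha hb tq xt zt tA tB ptb oq.
  have exx : x' = x by case: pt => _ [].
  subst x'; exists (rcons t b), b; split; last first.
    move=> w; rewrite mem_rcons inE => /orP [/eqP -> //|wt].
    rewrite ha ?inE ?wt ?orbT //; apply: contraTneq wt => ->; exact: head_nin pt.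
  split=> // w; rewrite -rcons_cons mem_rcons inE => /orP [/eqP ->|wt]; first by constructor.
  case: (cl w (tq w wt)) => [/(tA w wt) ->|Bw|]; try by constructor.
  by move: (tB w wt Bw) Bz => <-; rewrite Bw.
- have ptb : pth e (rcons (rev t) a) z a.
    by apply: (pth_rcons e_sym e_irr (pth_rev e_sym e_irr pt)) => [|w]; rewrite mem_rev //; apply: ha.
  have fr w : free p x1 xk a0 b0 w -> free (rev p) xk x1 b0 a0 w.
    by case/and4P => h1 h2 h3 h4; rewrite /free has_rev h1 h2 h3 h4.
  apply: (bmax z); split=> //; first by apply: contraNneq bt => ->.
  have hrt : ohead (rev t) = Some z by case: (pth_rev e_sym e_irr pt).
  have prt := pth_rev e_sym e_irr pt.
  case ert : (rev t) hrt ptb prt => [|z' t'] // [ez] ptb prt; subst z'.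
  have tm w : w \in z :: t' -> w \in t by rewrite -ert mem_rev.
  exists (rcons t' a), a; split; last first.
    move=> w; rewrite mem_rcons inE => /orP [/eqP ->|wt]; first by rewrite e_sym.
    have wzt : w \in z :: t' by rewrite inE wt orbT.
    by rewrite hb ?tm //; apply: contraTneq wt => ->; apply: head_nin prt.
  split=> // w; rewrite -rcons_cons mem_rcons inE => /orP [/eqP ->|wz]; first by constructor.
  have wt := tm w wz.
  case: (cl w (tq w wt)) => [Aw|/(tB w wt) ->|/fr ?]; try by constructor.
  by move: (tA w wt Aw) Ax => <-; rewrite Aw.
have : odd (size (a :: q)).
  apply: (dir_even op pmin (a := a) (b := b)); split=> // w wq.
  move: (wq); rewrite eq inE mem_rcons inE => /or3P [/eqP ->|/eqP ->|wt]; try by constructor.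
  case: (cl w wq) => [Aw|Bw|]; [| |by move=> ?; constructor].
  - by move: (tA w wt Aw) Ax => <-; rewrite Aw.
  by move: (tB w wt Bw) Bz => <-; rewrite Bw.
by rewrite eqt /= size_rcons /= negbK (negbTE oq).
Qed.

End MT.

Section MT2.
Variables (T : finType) (e : rel T).
Hypothesis e_sym : symmetric e.
Hypothesis e_irr : irreflexive e.
Hypothesis noodd : forall c, hole e c -> ~~ odd (size c).
Hypothesis noanti : forall c, ~~ hole (compl e) c.
Hypothesis noprism : forall a1 a2 a3 q1 q2 q3, ~~ odd_prism e a1 a2 a3 q1 q2 q3.
Hypothesis NS : forall B, disconnected_on (compl e) B -> conn e (~: B).
Implicit Types (p q s t : seq T) (x y z a b c d u v w h : T) (S G K N : {set T}).

Lemma min_ex (I : Type) (f : I -> nat) (P : I -> Prop) i0 : P i0 ->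
  exists2 m, P m & forall i, P i -> f m <= f i.
Proof.
have [n] := ubnP (f i0); elim: n => // n IH in i0 *; rewrite ltnS => fn Pi.
case: (classic (exists2 i, P i & f i < f i0)) => [[i Pi' fi]|h].
  by apply: (IH i); rewrite // (leq_trans fi fn).
exists i0 => // i Pi'; rewrite leqNgt; apply/negP => fi; by apply: h; exists i.
Qed.

Variables (X : {set T}).
Let C := cpl e X.
Hypothesis aX : anticonn e X.
Hypothesis X0 : X != set0.
Hypothesis hR : forall r c c', r \notin X -> ~~ C r -> C c -> C c' -> e r c -> e r c' -> c != c' -> e c c'.
Hypothesis star : forall p1 a1 b1 p2 a2 b2 p3 a3 b3,
  prism3 e p1 a1 b1 p2 a2 b2 p3 a3 b3 -> C a1 -> C a2 -> False.

Lemma anti_sep N : {in N, forall c, C c} -> N != set0 -> disconnected_on (compl e) (X :|: N).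
Proof.
move=> NC /set0Pn [n nN]; have [x xX] := set0Pn _ X0.
apply: not_conn; apply: (sep_conn (compl_sym e_sym) (compl_irr e) (subxx _) (x := x) (y := n)).
- by rewrite !inE xX.
- by rewrite !inE nN orbT.
- apply/pred0P => k /=; apply/negP => /andP [kX /NC Ck].
  by have := cpl_notin e_irr Ck; rewrite kX.
by move=> u v uX /NC /cplP Cv; rewrite /compl Cv // andbF.
Qed.

(** If a vertex outside [X] and [C] sees [C], its component attaches to all of [C]: otherwise [X]
    with the attached vertices would be an antidisconnected cutset. So there is an outgoing path. If
    no such vertex exists, [c] and [c'] are themselves an even pair. *)
Theorem mt_even_pair c c' : C c -> C c' -> c != c' -> ~~ e c c' -> exists u v, even_pair e u v.
Proof.
move=> Cc Cc' ncc ecc.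
suff : (exists u v, even_pair e u v) \/ exists q y z c d, outg e X q y z c d.
  case=> // -[q [y [z [a [b o]]]]].
  pose P (i : seq T * (T * T * (T * T))) := outg e X i.1 i.2.1.1 i.2.1.2 i.2.2.1 i.2.2.2.
  have [[m [[x1 xk] [a0 b0]]] /= om hm] := @min_ex _ (fun i => size i.1) P (q, ((y, z), (a, b))) o.
  apply: (mt_pair e_sym e_irr noodd noanti noprism aX X0 hR star om).
  by move=> q' y' z' a' b' o'; apply: (hm (q', ((y', z'), (a', b')))).
pose R := [set r | (r \notin X) && ~~ C r].
case: (boolP [exists r in R, exists d, C d && e r d]) => [/exists_inP [r rR /existsP [d /andP [Cd erd]]]|nR].
  right; set K := ccomp e R r.
  have KR : {subset K <= R} by apply/subsetP; apply: comp_sub.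
  have rK : r \in K by apply: comp_self.
  have cK : conn e K by apply: comp_conn.
  pose N := [set k | C k && [exists y in K, e k y]].
  have dN : d \in N by rewrite inE Cd; apply/exists_inP; exists r; rewrite // e_sym.
  have NC : {in N, forall k, C k} by move=> k; rewrite inE => /andP [].
  have cB : conn e (~: (X :|: N)) by apply: NS; apply: anti_sep NC _; apply/set0Pn; exists d.
  have all_N k : C k -> k \in N.
    move=> Ck; apply: contraT => kN; exfalso; move: cB.
    apply: (sep_conn e_sym e_irr (X := K) (Y := ~: (X :|: N) :\: K) (x := r) (y := k)).
    - by apply/subsetP => u uS; rewrite !inE in uS *; rewrite uS andbT orbN.
    - rewrite inE rK andbT !inE negb_or; have := KR _ rK; rewrite inE => /andP [-> nC].
      by rewrite (negbTE nC).
    - have kK : k \notin K by apply/negP => /KR; rewrite inE Ck andbF.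
      have kX : k \notin X by apply: cpl_notin Ck.
      by rewrite in_setI in_setD kK in_setC in_setU negb_or kX kN.
    - by rewrite -setI_eq0 setDE setICA setICr setI0.
    move=> u v uK; rewrite in_setD in_setC in_setU negb_or => /and3P [vK vX vN].
    apply/negP => euv; case Cv : (C v).
      by move: vN; rewrite inE Cv /= => /exists_inP; case; exists u; rewrite // e_sym.
    have vR : v \in R by rewrite inE vX Cv.
    by move: vK; rewrite (comp_out e_sym e_irr rR uK vR euv).
  have [y yK ey] : exists2 y, y \in K & e c y by have := all_N c Cc; rewrite inE => /andP [_ /exists_inP].
  have [y' yK' ey'] : exists2 y, y \in K & e c' y by have := all_N c' Cc'; rewrite inE => /andP [_ /exists_inP].
  have [q [x [z [pq qK _ _ [h1 h2]]]]] := conn_link e_sym e_irr cK yK ey yK' ey'.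
  exists q, x, z, c, c'; split=> // w /qK /KR; by rewrite inE.
left; exists c, c'; split=> // q iq lq.
have pq : pth e (c :: q) c c' by split; rewrite //= lq.
have nb k x : C k -> e k x -> (x \in X) || C x.
  move=> Ck ekx; apply: contraNT nR; rewrite negb_or => xR.
  by apply/exists_inP; exists x; [rewrite inE|apply/existsP; exists k; rewrite Ck e_sym].
have [t [x [z [eq pt ct c't [h1 h2]]]]] := pth_inner e_sym e_irr pq ncc ecc.
have xt := pth_in1 pt; have ecx : e c x by rewrite h1 // eqxx.
case: (boolP [exists d, [&& C d, d != c & d != c']]) => [/existsP [d /and3P [Cd dc dc']]|nd]; last first.
  case/orP: (nb c x Cc ecx) => [xX|Cx].
    have xq : x \in c :: q by rewrite eq inE mem_rcons inE xt !orbT.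
    have ec'x : e c' x by rewrite e_sym; move/cplP: Cc'; apply.
    by have [->] := pth_mid e_sym e_irr pq ncc ecc xq ecx ec'x.
  case/existsP: nd; exists x; rewrite Cx /=; apply/andP; split; first by apply: contraTneq ecx => ->; rewrite e_irr.
  by apply: contraTneq ecx => ->.
(* With a third vertex in [C], deleting [X] and all of [C] except [c] and [c'] removes an
   antidisconnected set, yet leaves [c] without neighbours. *)
exfalso; pose N := [set k | C k && (k != c) && (k != c')].
have NC : {in N, forall k, C k} by move=> k; rewrite inE -andbA => /and3P [].
have cB : conn e (~: (X :|: N)).
  by apply: NS; apply: anti_sep NC _; apply/set0Pn; exists d; rewrite inE Cd dc dc'.
have cX k : C k -> k \notin X by apply: cpl_notin.
have cS : c \in ~: (X :|: N) by rewrite !inE negb_or cX // eqxx andbF.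
have c'S : c' \in ~: (X :|: N) by rewrite !inE negb_or cX // eqxx !andbF.
have [q' [pq' qS]] := conn_pth e_sym e_irr cB cS c'S.
have [t' [x' [z' [eq' pt' _ _ [h1' _]]]]] := pth_inner e_sym e_irr pq' ncc ecc.
have x't := pth_in1 pt'; have ecx' : e c x' by rewrite h1' // eqxx.
have := qS x'; rewrite eq' inE mem_rcons inE x't !orbT => /(_ isT).
rewrite !inE negb_or => /andP [x'X]; case/orP: (nb c x' Cc ecx') => [x'X'|Cx]; first by rewrite x'X' in x'X.
rewrite -/C Cx /=; case: eqP => [ex|_]; first by rewrite ex e_irr in ecx'.
by case: eqP => // ex; rewrite ex (negbTE ecc) in ecx'.
Qed.

End MT2.

(** * Vertices and paths attaching to a prism *)

Section Prism.
Variables (T : finType) (e : rel T).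
Hypothesis e_sym : symmetric e.
Hypothesis e_irr : irreflexive e.
Hypothesis noodd : forall c, hole e c -> ~~ odd (size c).
Hypothesis noanti : forall c, ~~ hole (compl e) c.
Hypothesis noprism : forall a1 a2 a3 q1 q2 q3, ~~ odd_prism e a1 a2 a3 q1 q2 q3.
Implicit Types (s t Q R F P : seq T) (x y z a b c d u v w h f p q : T) (X Y S : {set T}).

Lemma prism_swap Q1 a1 b1 Q2 a2 b2 Q3 a3 b3 :
  prism3 e Q1 a1 b1 Q2 a2 b2 Q3 a3 b3 -> prism3 e Q2 a2 b2 Q1 a1 b1 Q3 a3 b3.
Proof.
by case=> P1 P2 P3 [n1 n2 n3] [c12 c13 c23]; split=> //; split=> //; split=> //; apply: cross2C.
Qed.

Lemma prism_flip Q1 a1 b1 Q2 a2 b2 Q3 a3 b3 :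
  prism3 e Q1 a1 b1 Q2 a2 b2 Q3 a3 b3 -> prism3 e (rev Q1) b1 a1 (rev Q2) b2 a2 (rev Q3) b3 a3.
Proof.
case=> P1 P2 P3 [n1 n2 n3] [c12 c13 c23]; split; try exact: pth_rev.
by split; rewrite 1?eq_sym //; split; apply: cross2_rev.
Qed.

Lemma size1_pth s a b : pth e s a b -> size s = 1 -> b = a.
Proof. by case: s => [|? []] // [] _ [->] [->]. Qed.

Section Alpha.
Variables (Q1 Q2 Q3 F : seq T) (a1 b1 a2 b2 a3 b3 f1 fk : T).
Hypothesis K : prism3 e Q1 a1 b1 Q2 a2 b2 Q3 a3 b3.
Hypothesis pF : pth e F f1 fk.
Hypothesis dF : forall w, w \in F -> [/\ w \notin Q1, w \notin Q2 & w \notin Q3].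
Hypothesis t1 : forall w v, w \in F -> w != f1 -> v \in Q1 -> ~~ e w v.
Hypothesis t2 : forall w v, w \in F -> w != fk -> v \in Q2 -> ~~ e w v.
Hypothesis t3 : forall w v, w \in F -> v \in Q3 -> ~~ e w v.

Lemma alpha_ext P p : pth e P a1 p -> {subset P <= Q1} -> (forall w, w \in P -> e f1 w = (w == p)) ->
  pth e (P ++ F) a1 fk.
Proof.
move=> pP sP hP; apply: (pth_cat e_sym e_irr pP pF).
  by move=> w /sP wQ; apply/negP => /dF []; rewrite wQ.
move=> w w' wP w'F; case: (eqVneq w' f1) => [->|n1]; first by rewrite e_sym hP // andbT.
by rewrite andbF e_sym; apply/negbTE; apply: t1 => //; apply: sP.
Qed.

(** [F] and the initial parts of the two rungs close through the edge [a1 a2]. The last two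
    hypotheses exclude the chord [b1 b2] and a mere triangle. *)
Lemma alpha_A12 P p P' q : pth e P a1 p -> {subset P <= Q1} -> (forall w, w \in P -> e f1 w = (w == p)) ->
  pth e P' a2 q -> {subset P' <= Q2} -> (forall w, w \in P' -> e fk w = (w == q)) ->
  ~~ ((b1 \in P) && (b2 \in P')) -> (f1 == fk -> ~~ ((p == a1) && (q == a2))) ->
  ~~ odd (size P + size F + size P').
Proof.
move=> pP sP hP pP' sP' hP' nb k1; have pPF := alpha_ext pP sP hP.
have [_ _ _ [_ _ _ [[d12 c12] _ _]]] := K.
rewrite -size_cat; apply: (ladder_even e_sym e_irr noodd pPF pP').
  split=> [w|w w']; rewrite mem_cat.
    by case/orP => [/sP /d12|/dF [_ + _]]; apply: contra => /sP'.
  move=> wPF w'P'; have [wP|wF] := orP wPF.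
    have -> : (w == fk) = false.
      by apply/eqP => ef; have [+ _ _] := dF (pth_in2 pF); rewrite -ef sP.
    rewrite c12 ?sP ?sP' // orbF; case: (w =P b1) => [eb|_]; last by rewrite orbF.
    rewrite orbC; case: eqP => //= eb'; move: nb; by rewrite -eb -eb' wP w'P'.
  have -> : (w == a1) = false.
    by apply/eqP => ea; have [+ _ _] := dF wF; rewrite ea sP // (pth_in1 pP).
  case: (eqVneq w fk) => [->|nk] /=; first by rewrite hP'.
  by apply/negbTE/t2 => //; apply: sP'.
rewrite size_cat; have s1 := pth_size pP; have s2 := pth_size pF; have s3 := pth_size pP'.
case: (ltnP 3 (size P + size F + size P')) => // le3; exfalso.
have [e1 e2 e3] : [/\ size P = 1, size F = 1 & size P' = 1].
  by move: s1 s2 s3 le3; clear; move=> *; split; lia.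
have := k1; rewrite (size1_pth pP e1) (size1_pth pF e2) (size1_pth pP' e3) !eqxx.
by move=> /(_ isT).
Qed.

(** The cycle meets both triangles: it uses the part of [Q1] at [a1], then [F], the part of [Q2] at
    [b2], and returns along all of [Q3]. *)
Lemma alpha_AB P p P' q : pth e P a1 p -> {subset P <= Q1} -> (forall w, w \in P -> e f1 w = (w == p)) ->
  pth e P' b2 q -> {subset P' <= Q2} -> (forall w, w \in P' -> e fk w = (w == q)) ->
  b1 \notin P -> a2 \notin P' -> ~~ odd (size P + size F + size Q3 + size P').
Proof.
move=> pP sP hP pP' sP' hP' nb na; have pPF := alpha_ext pP sP hP.
have [p1 p2 p3 [n1 n2 n3 [[d12 c12] [d13 c13] [d23 c23]]]] := K.
have p3P : pth e (Q3 ++ P') a3 q.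
  apply: (pth_cat e_sym e_irr p3 pP') => [w w3|w w' w3 w'P].
    by apply: contraL w3 => /sP'; apply: d23.
  rewrite e_sym c23 ?sP' //; have -> : (w' == a2) = false by apply: contraNF na => /eqP <-.
  by rewrite /= andbC.
rewrite -!size_cat -catA size_cat size_cat -size_cat.
apply: (ladder_even e_sym e_irr noodd pPF p3P); last first.
  have := pth_size pP; have := pth_size pF; have := pth_size2 p3 n3; have := pth_size pP'.
  by rewrite !size_cat; clear; lia.
have [f1F fkF] := (pth_in1 pF, pth_in2 pF).
split=> [w|w w']; rewrite mem_cat.
  case/orP => [/sP w1|/dF [_ w2 w3]]; rewrite mem_cat negb_or.
    by rewrite d13 //=; apply: contra (d12 _ w1) => /sP'.
  by rewrite w3 /=; apply: contra w2 => /sP'.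
move=> wPF; rewrite mem_cat => w'P; have [wP|wF] := orP wPF.
  have -> : (w == fk) = false.
    by apply/eqP => ef; have [+ _ _] := dF fkF; rewrite -ef sP.
  have nwb : (w == b1) = false by apply: contraNF nb => /eqP <-.
  rewrite orbF; case/orP: w'P => [w3|w2]; first by rewrite c13 ?sP // nwb orbF.
  rewrite c12 ?sP ?sP' // nwb orbF; have -> : (w' == a2) = false by apply: contraNF na => /eqP <-.
  rewrite andbF; symmetry; apply/negbTE; rewrite negb_and; apply/orP; right.
  by apply: contraTneq w2 => ->; apply: contraL (pth_in1 p3) => /sP'; apply: d23.
have -> : (w == a1) = false.
  by apply/eqP => ea; have [+ _ _] := dF wF; rewrite ea sP // (pth_in1 pP).
case/orP: w'P => [w3|w2] /=.
  rewrite (negbTE (t3 wF w3)); symmetry; apply/negbTE; rewrite negb_and; apply/orP; right.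
  by apply: contraTneq w3 => ->; apply: d23; apply: sP'; apply: pth_in2 pP'.
case: (eqVneq w fk) => [->|nk] /=; first by rewrite hP'.
by apply/negbTE/t2 => //; apply: sP'.
Qed.

(** The vertex [f1] replaces a nonempty middle part of [Q1], and the new path closes with [Q3]. *)
Lemma alpha_span P p P' p' : pth e P a1 p -> {subset P <= Q1} -> (forall w, w \in P -> e f1 w = (w == p)) ->
  pth e P' p' b1 -> {subset P' <= Q1} -> (forall w, w \in P' -> e f1 w = (w == p')) ->
  (forall w, w \in P -> w \notin P') -> (forall w w', w \in P -> w' \in P' -> ~~ e w w') ->
  ~~ odd (size P + (size P').+1 + size Q3).
Proof.
move=> pP sP hP pP' sP' hP' dPP nPP.
have [p1 p2 p3 [n1 n2 n3 [_ [d13 c13] _]]] := K.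
have f1F := pth_in1 pF; have [fQ1 _ fQ3] := dF f1F.
have pf : pth e (f1 :: P') f1 b1.
  by apply: (pth_cons e_sym e_irr pP') => //; apply: contra fQ1 => /sP'.
have nap : (a1 \in P') = false by apply/negbTE/dPP/(pth_in1 pP).
have nbp : (b1 \in P) = false by apply: contraTF (pth_in2 pP') => /dPP.
have pz : pth e (P ++ f1 :: P') a1 b1.
  apply: (pth_cat e_sym e_irr pP pf) => [w wP|w w' wP].
    by rewrite inE negb_or dPP // andbT; apply: contraNneq fQ1 => <-; apply: sP.
  rewrite inE => /orP [/eqP ->|w'P]; first by rewrite e_sym hP // eqxx andbT.
  rewrite (negbTE (nPP _ _ wP w'P)); symmetry; apply/negbTE; rewrite negb_and; apply/orP; right.
  by apply: contraNneq fQ1 => <-; apply: sP'.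
have sz w : w \in P ++ f1 :: P' -> w = f1 \/ w \in Q1.
  by rewrite mem_cat inE => /or3P [/sP ->|/eqP ->|/sP' ->]; [right|left|right].
have -> : size P + (size P').+1 = size (P ++ f1 :: P') by rewrite size_cat.
apply: (ladder_even e_sym e_irr noodd pz p3).
  split=> [w /sz [->|/d13 //]|w w' /sz [->|wQ] w3] //; last exact: c13.
  rewrite (negbTE (t3 f1F w3)); symmetry; apply/negbTE; rewrite negb_or !negb_and.
  by apply/andP; split; apply/orP; left; apply: contraNneq fQ1 => ->; [apply: pth_in1 p1|apply: pth_in2 p1].
rewrite size_cat /=; have := pth_size pP; have := pth_size pP'; have := pth_size2 p3 n3.
by clear; lia.
Qed.

(** When [f1] sees just two consecutive vertices [p p'] of [Q1], these three form the second
    triangle of a prism whose first triangle is [a1 a3 a2]; its paths are even. *)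
Lemma alpha_prism P p P' p' R q : Q1 = P ++ P' -> pth e P a1 p -> pth e P' p' b1 ->
  (forall w, w \in P -> e f1 w = (w == p)) -> (forall w, w \in P' -> e f1 w = (w == p')) ->
  pth e R a2 q -> {subset R <= Q2} -> (forall w, w \in R -> e fk w = (w == q)) ->
  a1 != p -> b2 \notin R -> odd (size P).
Proof.
move=> eQ pP pP' hP hP' pR sR hR nap nbR.
have [p1 p2 p3 [n1 n2 n3 [[d12 c12] [d13 c13] [d23 c23]]]] := K.
have [f1F fkF] := (pth_in1 pF, pth_in2 pF); have [fQ1 _ fQ3] := dF f1F.
have sP : {subset P <= Q1} by move=> w wP; rewrite eQ mem_cat wP.
have sP' : {subset P' <= Q1} by move=> w wP; rewrite eQ mem_cat wP orbT.
have [dPP cPP] : (forall w, w \in P -> w \notin P') /\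
    (forall w w', w \in P -> w' \in P' -> e w w' = (w == p) && (w' == p')).
  by rewrite eQ in p1; apply: (pth_cat_cross e_sym e_irr p1 pP pP').
have nap' : (a1 \in P') = false by apply/negbTE/dPP/(pth_in1 pP).
have nbP : (b1 \in P) = false by apply: contraTF (pth_in2 pP') => /dPP.
have nb1 w : w \in P -> (w == b1) = false by move=> wP; apply: contraFF nbP => /eqP <-.
have na1 w : w \in P' -> (w == a1) = false by move=> wP; apply: contraFF nap' => /eqP <-.
have nbr w : w \in R -> (w == b2) = false by move=> wP; apply: contraNF nbR => /eqP <-.
have b3a3 : (b3 == a3) = false by rewrite eq_sym (negbTE n3).
have r2 : pth e (Q3 ++ rev P') a3 p'.
  apply: (pth_cat e_sym e_irr p3 (pth_rev e_sym e_irr pP')) => [w w3|w w' w3]; rewrite mem_rev.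
    by apply: contraL w3 => /sP'; apply: d13.
  by move=> w'P; rewrite e_sym c13 ?sP' // na1 //= andbC.
have r3 : pth e (R ++ rev F) a2 f1.
  apply: (pth_cat e_sym e_irr pR (pth_rev e_sym e_irr pF)) => [w wR|w w' wR]; rewrite mem_rev.
    by apply/negP => /dF [_]; rewrite sR.
  move=> w'F; rewrite e_sym; case: (eqVneq w' fk) => [->|nk]; first by rewrite hR // andbT.
  by rewrite andbF; apply/negbTE/t2 => //; apply: sR.
have tri : e f1 p by rewrite hP ?eqxx // (pth_in2 pP).
have FQ1 w v : w \in F -> v \in Q1 -> w != f1 -> e w v = false.
  by move=> wF vQ nw; apply/negbTE/t1.
suff [] : [/\ odd (size P), odd (size (Q3 ++ rev P')) & odd (size (R ++ rev F))] by [].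
apply: (prism3_even e_sym e_irr noodd noprism (a1 := a1) (b1 := p) (a2 := a3) (b2 := p') (a3 := a2) (b3 := f1)).
split=> //; split=> //.
- by apply: contraTneq (pth_in1 p3) => ->; apply: d13; apply: sP'; apply: pth_in1 pP'.
- by have [_ + _] := dF f1F; apply: contraNneq => <-; apply: sR; apply: pth_in1 pR.
split.
- split=> [w wP|w w' wP]; rewrite mem_cat ?mem_rev ?negb_or; first by rewrite d13 ?sP // dPP.
  case/orP => [w3|w'P].
    rewrite c13 ?sP // nb1 //= ?orbF; have -> : (w' == p') = false.
      by apply: contraTF w3 => /eqP ->; apply: d13; apply: sP'; apply: pth_in1 pP'.
    by rewrite andbF ?orbF.
  rewrite cPP //; have -> : (w' == a3) = false by apply: contraTF (pth_in1 p3) => /eqP <-; apply: d13; apply: sP'.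
  by rewrite andbF.
- split=> [w wP|w w' wP]; rewrite mem_cat ?mem_rev ?negb_or.
    apply/andP; split; first by apply: contra (d12 _ (sP _ wP)) => /sR.
    by apply/negP => /dF []; rewrite sP.
  case/orP => [wR|wF].
    rewrite c12 ?sP ?sR // nb1 //= orbF; have -> : (w' == f1) = false.
      by have [_ + _] := dF f1F; apply: contraNF => /eqP <-; apply: sR.
    by rewrite andbF orbF.
  have -> : (w' == a2) = false by have [_ + _] := dF wF; apply: contraNF => /eqP ->; apply: sR (pth_in1 pR).
  rewrite andbF /= e_sym; case: (eqVneq w' f1) => [->|nw]; first by rewrite hP // andbT.
  by rewrite andbF FQ1 // sP.
split=> [w|w w']; rewrite mem_cat ?mem_rev ?negb_or.
  move=> w3P; rewrite mem_cat mem_rev negb_or; apply/andP; split; apply/negP => h0.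
    by case/orP: w3P => [w3|/sP' /d12]; [have := d23 w (sR _ h0); rewrite w3|rewrite sR].
  by have [g1 _ g3] := dF h0; case/orP: w3P => [w3|/sP' w1]; [rewrite w3 in g3|rewrite w1 in g1].
rewrite mem_cat mem_rev => w3P w'RF; rewrite e_sym.
have a2Q : a2 \in Q2 by apply: sR (pth_in1 pR).
case/orP: w3P => [w3|wP]; case/orP: w'RF => [w'R|w'F].
- rewrite c23 ?sR // nbr //= orbF andbC; have -> : (w == p') = false.
    by apply: contraTF w3 => /eqP ->; apply: d13; apply: sP'; apply: pth_in1 pP'.
  by rewrite /= orbF.
- rewrite (negbTE (t3 w'F w3)); symmetry; apply/negbTE; rewrite negb_or !negb_and; apply/andP; split; apply/orP.
    by right; have [_ + _] := dF w'F; apply: contraNneq => ->.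
  by left; apply: contraTneq w3 => ->; apply: d13; apply: sP'; apply: pth_in1 pP'.
- rewrite e_sym c12 ?sP' ?sR // na1 // nbr // andbF /=; symmetry; apply/negbTE; rewrite negb_or !negb_and.
  apply/andP; split; apply/orP.
    by left; apply: contraTneq (pth_in1 p3) => <-; apply: d13; apply: sP'.
  by right; have [_ + _] := dF f1F; apply: contraNneq => <-; apply: sR.
have -> : (w == a3) = false by apply: contraTF (pth_in1 p3) => /eqP <-; apply: d13; apply: sP'.
rewrite /=; case: (eqVneq w' f1) => [->|nw]; first by rewrite hP' // andbT.
by rewrite andbF FQ1 // sP'.
Qed.

End Alpha.
Lemma pref_last s a b (l : seq T) q m : pth e s a b -> s = l ++ q :: m -> b \in rcons l q -> m = [::] /\ q = b.
Proof.
move=> ps es bl; have us := pth_uniq ps; have [_ _ lb] := ps.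
case: m es => [|y m] es; first by move: lb; rewrite es ol_cat => - [].
have bm : b \in y :: m by apply: ol_in; move: lb; rewrite es -cat_rcons ol_cat.
by move: us; rewrite es -cat_rcons cat_uniq => /and3P [_ /hasPn /(_ b bm) /negP].
Qed.

Lemma suf_head s a b n q o : pth e s a b -> s = n ++ q :: o -> a \in q :: o -> n = [::] /\ q = a.
Proof.
move=> ps es aq; have us := pth_uniq ps; have [_ ha _] := ps.
case: n es => [|y n] es; first by move: ha; rewrite es => - [].
have an : a \in y :: n by apply: ohead_in; move: ha; rewrite es.
by move: us; rewrite es cat_uniq => /and3P [_ /hasPn /(_ a aq) /negP].
Qed.

Lemma first_nb f s (l : seq T) q m : uniq s -> s = l ++ q :: m -> e f q -> (forall w, w \in l -> ~~ e f w) ->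
  forall w, w \in rcons l q -> e f w = (w == q).
Proof.
move=> us es efq hl w; rewrite mem_rcons inE => /orP [/eqP ->|wl]; first by rewrite efq eqxx.
rewrite (negbTE (hl _ wl)); symmetry; apply: contraTF wl => /eqP ->.
by move: us; rewrite es -cat_rcons cat_uniq rcons_uniq => /and3P [/andP []].
Qed.

Lemma last_nb f s n q (o : seq T) : uniq s -> s = n ++ q :: o -> e f q -> (forall w, w \in o -> ~~ e f w) ->
  forall w, w \in q :: o -> e f w = (w == q).
Proof.
move=> us es efq ho w; rewrite inE => /orP [/eqP ->|wl]; first by rewrite efq eqxx.
rewrite (negbTE (ho _ wl)); symmetry; apply: contraTF wl => /eqP ->.
by move: us; rewrite es cat_uniq /= => /and4P [_ _ ->].
Qed.

(** Parities of cycles through [F] show that the parts of [Q1] before the first and after the last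
    neighbour of [f1] have odd total size. If these neighbours are not consecutive, [alpha_span]
    contradicts this; if they are, [alpha_prism] and its mirror image force both parts to be odd. *)
Theorem alpha Q1 a1 b1 Q2 a2 b2 Q3 a3 b3 F f1 fk x y x' y' :
  prism3 e Q1 a1 b1 Q2 a2 b2 Q3 a3 b3 -> pth e F f1 fk ->
  (forall w, w \in F -> [/\ w \notin Q1, w \notin Q2 & w \notin Q3]) ->
  (forall w v, w \in F -> w != f1 -> v \in Q1 -> ~~ e w v) ->
  (forall w v, w \in F -> w != fk -> v \in Q2 -> ~~ e w v) ->
  (forall w v, w \in F -> v \in Q3 -> ~~ e w v) ->
  x \in Q1 -> e f1 x -> y \in Q2 -> e fk y -> ~~ ((x == a1) && (y == a2)) ->
  x' \in Q1 -> e f1 x' -> y' \in Q2 -> e fk y' -> ~~ ((x' == b1) && (y' == b2)) ->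
  (f1 == fk -> ~~ (e f1 a1 && e f1 a2) && ~~ (e f1 b1 && e f1 b2)) -> False.
Proof.
move=> K pF dF t1 t2 t3 xQ ex yQ ey nxy x'Q ex' y'Q ey' nxy' k1.
have [p1 p2 p3 [n1 n2 n3 _]] := K.
have [u1 u2] := (pth_uniq p1, pth_uniq p2).
have [oQ1 oQ2 oQ3] := prism3_even e_sym e_irr noodd noprism K.
have h1 : has (e f1) Q1 by apply/hasP; exists x.
have h2 : has (e fk) Q2 by apply/hasP; exists y.
have [l [p [m [eQ1 ep hl]]]] := split_first h1.
have [n [p' [o [epm ep' ho]]]] : exists n p' o, [/\ p :: m = n ++ p' :: o, e f1 p' & forall y, y \in o -> ~~ e f1 y].
  by have [|n [p' [o h]]] := @split_last _ (e f1) (p :: m); [rewrite /= ep|exists n, p', o].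
have [l2 [q [m2 [eQ2 eq hl2]]]] := split_first h2.
have [n2' [q' [o2 [eQ2' eq' ho2]]]] := split_last h2.
have eQ1' : Q1 = (l ++ n) ++ p' :: o by rewrite eQ1 epm catA.
set P := rcons l p; set P' := p' :: o; set R := rcons l2 q; set R' := q' :: o2.
have pP : pth e P a1 p by move: p1; rewrite eQ1 => /(pth_split e_sym e_irr) [].
have pP' : pth e P' p' b1 by move: p1; rewrite eQ1' => /(pth_split e_sym e_irr) [].
have pR : pth e R a2 q by move: p2; rewrite eQ2 => /(pth_split e_sym e_irr) [].
have pR' : pth e R' q' b2 by move: p2; rewrite eQ2' => /(pth_split e_sym e_irr) [].
have sP : {subset P <= Q1} by move=> w; rewrite eQ1 -cat_rcons mem_cat => ->.
have sP' : {subset P' <= Q1} by move=> w; rewrite eQ1' mem_cat => ->; rewrite orbT.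
have sR : {subset R <= Q2} by move=> w; rewrite eQ2 -cat_rcons mem_cat => ->.
have sR' : {subset R' <= Q2} by move=> w; rewrite eQ2' mem_cat => ->; rewrite orbT.
have hP := first_nb u1 eQ1 ep hl. have hP' := last_nb u1 eQ1' ep' ho.
have hR := first_nb u2 eQ2 eq hl2. have hR' := last_nb u2 eQ2' eq' ho2.
have bP : b1 \in P -> forall v, v \in Q1 -> e f1 v -> v = b1.
  move=> /(pref_last p1 eQ1) [m0 <-] v; rewrite eQ1 m0 mem_cat inE => /orP [/hl /negbTE ->|/eqP ->] //.
have bR : b2 \in R -> forall v, v \in Q2 -> e fk v -> v = b2.
  move=> /(pref_last p2 eQ2) [m0 <-] v; rewrite eQ2 m0 mem_cat inE => /orP [/hl2 /negbTE ->|/eqP ->] //.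
have aP : a1 \in P' -> forall v, v \in Q1 -> e f1 v -> v = a1.
  move=> /(suf_head p1 eQ1') [m0 <-] v; rewrite eQ1' m0 /= inE => /orP [/eqP ->|/ho /negbTE ->] //.
have aR : a2 \in R' -> forall v, v \in Q2 -> e fk v -> v = a2.
  move=> /(suf_head p2 eQ2') [m0 <-] v; rewrite eQ2' m0 /= inE => /orP [/eqP ->|/ho2 /negbTE ->] //.
have Kf := prism_flip K.
have dFf w : w \in F -> [/\ w \notin rev Q1, w \notin rev Q2 & w \notin rev Q3] by rewrite !mem_rev; apply: dF.
have t1f w v : w \in F -> w != f1 -> v \in rev Q1 -> ~~ e w v by rewrite mem_rev; apply: t1.
have t2f w v : w \in F -> w != fk -> v \in rev Q2 -> ~~ e w v by rewrite mem_rev; apply: t2.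
have t3f w v : w \in F -> v \in rev Q3 -> ~~ e w v by rewrite mem_rev; apply: t3.
have rP := pth_rev e_sym e_irr pP'; have rR := pth_rev e_sym e_irr pR'.
have srP : {subset rev P' <= rev Q1} by move=> w; rewrite !mem_rev; apply: sP'.
have srR : {subset rev R' <= rev Q2} by move=> w; rewrite !mem_rev; apply: sR'.
have srR0 : {subset rev R <= rev Q2} by move=> w; rewrite !mem_rev; apply: sR.
have hrP w : w \in rev P' -> e f1 w = (w == p') by rewrite mem_rev; apply: hP'.
have hrR w : w \in rev R' -> e fk w = (w == q') by rewrite mem_rev; apply: hR'.
have hrR0 w : w \in rev R -> e fk w = (w == q) by rewrite mem_rev; apply: hR.
have nb12 : ~~ ((b1 \in P) && (b2 \in R)).
  by apply: contra nxy' => /andP [h3 h4]; rewrite (bP h3 _ x'Q ex') (bR h4 _ y'Q ey') !eqxx.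
have na12 : ~~ ((a1 \in rev P') && (a2 \in rev R')).
  by rewrite !mem_rev; apply: contra nxy => /andP [h3 h4]; rewrite (aP h3 _ xQ ex) (aR h4 _ yQ ey) !eqxx.
have k1a : f1 == fk -> ~~ ((p == a1) && (q == a2)).
  move=> ef; have /andP [h3 _] := k1 ef; apply: contra h3 => /andP [/eqP <- /eqP <-].
  by rewrite ep (eqP ef) eq.
have k1b : f1 == fk -> ~~ ((p' == b1) && (q' == b2)).
  move=> ef; have /andP [_ h3] := k1 ef; apply: contra h3 => /andP [/eqP <- /eqP <-].
  by rewrite ep' (eqP ef) eq'.
have E1 := alpha_A12 K pF dF t1 t2 pP sP hP pR sR hR nb12 k1a.
have E2 := alpha_A12 Kf pF dFf t1f t2f rP srP hrP rR srR hrR na12 k1b.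
rewrite !size_rev in E2.
(* The cycles through a single triangle only relate the two sums; one through both triangles and
   [Q3] determines them. One of its two mirror images is always available, since otherwise all
   neighbours would sit at a forbidden combination of corners. *)
have [odd1 odd2] : odd (size P + size P') /\ odd (size R + size R').
  case: (boolP ((b1 \notin P) && (a2 \notin R'))) => [/andP [h3 h4]|nAB].
    have h4' : a2 \notin rev R' by rewrite mem_rev.
    have hrR' w : w \in rev R' -> e fk w = (w == q') by rewrite mem_rev; apply: hR'.
    have srR'' : {subset rev R' <= Q2} by move=> w; rewrite mem_rev; apply: sR'.
    have := alpha_AB K pF dF t1 t2 t3 pP sP hP rR srR'' hrR h3 h4'.
    by move: E1 E2 oQ3; rewrite !size_rev; clear; lia.
  have [h3 h4] : a1 \notin P' /\ b2 \notin R.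
    split; apply/negP => h3; case/negP: nAB; apply/andP; split; apply/negP => h4.
    - by move: n1; rewrite -(bP h4 _ xQ ex) (aP h3 _ xQ ex) eqxx.
    - by move: nxy; rewrite (aP h3 _ xQ ex) (aR h4 _ yQ ey) !eqxx.
    - by move: nxy'; rewrite (bP h4 _ x'Q ex') (bR h3 _ y'Q ey') !eqxx.
    by move: n2; rewrite -(bR h3 _ yQ ey) {1}(aR h4 _ yQ ey) eqxx.
  have h3' : a1 \notin rev P' by rewrite mem_rev.
  have sR2 : {subset R <= rev Q2} by move=> w; rewrite mem_rev; apply: sR.
  have := alpha_AB Kf pF dFf t1f t2f t3f rP srP hrP pR sR2 hR h3' h4.
  by move: E1 E2 oQ3; rewrite !size_rev; clear; lia.
have sQ1 : size Q1 = size l + (size m).+1 by rewrite eQ1 size_cat.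
have sm : (size m).+1 = size n + (size o).+1 by have := congr1 size epm; rewrite /= size_cat.
have sP1 : size P = (size l).+1 by rewrite size_rcons.
case: n epm eQ1' sm => [|p0 n] epm eQ1' sm.
  by move: odd1 oQ1; rewrite sP1 sQ1 sm /=; clear; lia.
have [ep0 em] : p0 = p /\ m = n ++ p' :: o by case: epm => <- <-.
case: n em epm eQ1' sm => [|p2' n] em epm eQ1' sm; last first.
  have eQ : Q1 = P ++ ((p2' :: n) ++ P') by rewrite eQ1 -cat_rcons em.
  have [k pk] : exists k, pth e ((p2' :: n) ++ P') k b1 by rewrite eQ in p1; apply: (pth_catr e_sym e_irr p1).
  have [dPP cPP] : (forall w, w \in P -> w \notin ((p2' :: n) ++ P')) /\
     (forall w w', w \in P -> w' \in ((p2' :: n) ++ P') -> e w w' = (w == p) && (w' == k)).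
    by rewrite eQ in p1; apply: (pth_cat_cross e_sym e_irr p1 pP pk).
  have ek : k = p2' by case: pk => _ [].
  have := alpha_span K pF dF t3 pP sP hP pP' sP' hP' _ _.
  have -> : ~~ odd (size P + (size P').+1 + size Q3) = false by move: odd1 oQ3; clear; lia.
  suff [h3 h4] : (forall w, w \in P -> w \notin P') /\ (forall w w', w \in P -> w' \in P' -> ~~ e w w').
    by move=> /(_ h3 h4).
  split=> [w /dPP|w w' wP w'P]; first by rewrite mem_cat negb_or => /andP [].
  rewrite cPP ?mem_cat ?w'P ?orbT // negb_and ek; apply/orP; right.
  apply: contraTneq w'P => ->; have := pth_uniq pk.
  by rewrite cat_cons cons_uniq mem_cat negb_or => /andP [/andP []].
have eQ : Q1 = P ++ P' by rewrite eQ1 -cat_rcons em.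
have nbR : b2 \notin R.
  apply/negP => /[dup] bRR /(pref_last p2 eQ2) [m0 _].
  have q'b : q' = b2 by apply: (bR bRR _ (sR' _ (mem_head _ _))).
  have o0 : o2 = [::] by have := pR'; rewrite /R' q'b => /(pth_eq e_sym e_irr) [].
  by move: odd2 oQ2; rewrite /R /R' o0 eQ2 m0 size_rcons size_cat /=; clear; lia.
have naR : a2 \notin R'.
  apply/negP => /[dup] aRR /(suf_head p2 eQ2') [m0 _].
  have qa : q = a2 by apply: (aR aRR _ (sR _ _)); rewrite // mem_rcons mem_head.
  have o0 : l2 = [::].
    have := pR; rewrite qa => /(pth_eq e_sym e_irr) /(congr1 size); rewrite size_rcons => -[].
    exact: size0nil.
  by move: odd2 oQ2; rewrite /R /R' o0 eQ2' m0 /=; clear; lia.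
case o1 : (odd (size P)); last first.
  have nap : a1 != p.
    apply: contraFneq o1 => ea; have ap : a1 \in p :: m by rewrite ea mem_head.
    by have [l0 _] := suf_head p1 eQ1 ap; rewrite /P l0.
  by have := alpha_prism K pF dF t1 t2 t3 eQ pP pP' hP hP' pR sR hR nap nbR; rewrite o1.
have nbp : b1 != p'.
  apply: contraTneq o1 => eb.
  have o0 : o = [::] by have := pP'; rewrite eb /P' => /(pth_eq e_sym e_irr) [].
  by move: odd1; rewrite /P' o0 /=; clear; lia.
have eQf : rev Q1 = rev P' ++ rev P by rewrite eQ rev_cat.
have pPr := pth_rev e_sym e_irr pP.
have hPr w : w \in rev P -> e f1 w = (w == p) by rewrite mem_rev; apply: hP.
have naR' : a2 \notin rev R' by rewrite mem_rev.
have := alpha_prism Kf pF dFf t1f t2f t3f eQf rP pPr hrP hPr rR srR hrR nbp naR'.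
by rewrite size_rev => oP'; move: odd1; rewrite oddD o1 oP'.
Qed.

End Prism.

(** * Single vertices attached to a prism; replacing one of its paths *)

Section Vertex.
Variables (T : finType) (e : rel T).
Hypothesis e_sym : symmetric e.
Hypothesis e_irr : irreflexive e.
Hypothesis noodd : forall c, hole e c -> ~~ odd (size c).
Hypothesis noanti : forall c, ~~ hole (compl e) c.
Hypothesis noprism : forall a1 a2 a3 q1 q2 q3, ~~ odd_prism e a1 a2 a3 q1 q2 q3.
Implicit Types (s t Q R F P : seq T) (x y z a b c d u v w h f m p q : T) (X Y S : {set T}).

(** Two adjacent vertices seeing only opposite ends of a path of odd size close an odd hole. *)
Lemma noskip Q a b m z : pth e Q a b -> odd (size Q) -> a != b -> m \notin Q -> z \notin Q -> e m z ->
  (forall v, v \in Q -> e m v = (v == a)) -> (forall v, v \in Q -> e z v = (v == b)) -> False.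
Proof.
move=> pQ oQ nab mQ zQ emz hm hz.
have nmz : m != z by apply: contraTneq emz => ->; rewrite e_irr.
have := ladder_even e_sym e_irr noodd pQ (pth_2 e_sym e_irr emz).
rewrite /= addnC /= oQ => F; apply/notF/F.
  split=> [w wQ|w w' wQ]; first by rewrite !inE negb_or; apply/andP; split; apply: contraTneq wQ => ->.
  rewrite !inE e_sym => /orP [] /eqP ->.
    by rewrite hm // eqxx (negbTE nmz) andbT andbF orbF.
  by rewrite hz // eqxx andbT (eq_sym z) (negbTE nmz) andbF.
by have := pth_size2 pQ nab; case: (size Q) oQ => [|[|[]]].
Qed.

Definition two3 (b1 b2 b3 : bool) := [|| b1 && b2, b1 && b3 | b2 && b3].

Lemma two3C12 (b1 b2 b3 : bool) : two3 b1 b2 b3 = two3 b2 b1 b3.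
Proof. by case: b1; case: b2; case: b3. Qed.
Lemma two3rot (b1 b2 b3 : bool) : two3 b1 b2 b3 = two3 b2 b3 b1.
Proof. by case: b1; case: b2; case: b3. Qed.

Lemma last_piece f Q a b : pth e Q a b -> has (e f) Q -> exists x P,
  [/\ pth e P x b, {subset P <= Q}, forall w, w \in P -> e f w = (w == x), e f x &
   a \in P -> [/\ x = a, P = Q & forall w, w \in Q -> e f w = (w == a)]].
Proof.
move=> pQ /split_last [n [x [o [eQ efx ho]]]]; exists x, (x :: o).
have hl := last_nb (pth_uniq pQ) eQ efx ho.
have px : pth e (x :: o) x b by move: pQ; rewrite eQ => /(pth_split e_sym e_irr) [].
split=> //; first by move=> w; rewrite eQ mem_cat => ->; rewrite orbT.
move=> /(suf_head pQ eQ) [n0 ea]; rewrite eQ n0 -ea; split=> // w; exact: hl.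
Qed.

(** Look at the tails behind the last neighbours of [f]. Unless two of them are whole rungs seen
    only at their [a] ends, any two of the three sizes have odd sum, which is impossible. *)
Lemma touch3 Q1 a1 b1 Q2 a2 b2 Q3 a3 b3 f : prism3 e Q1 a1 b1 Q2 a2 b2 Q3 a3 b3 ->
  f \notin Q1 -> f \notin Q2 -> f \notin Q3 -> has (e f) Q1 -> has (e f) Q2 -> has (e f) Q3 ->
  ~~ two3 (e f b1) (e f b2) (e f b3) ->
  let A Q a := forall w, w \in Q -> e f w = (w == a) in
  [\/ A Q1 a1 /\ A Q2 a2, A Q1 a1 /\ A Q3 a3 | A Q2 a2 /\ A Q3 a3].
Proof.
move=> K f1 f2 f3 h1 h2 h3 nb A; have [q1 q2 q3 [n1 n2 n3 _]] := K.
have [x1 [P1 [p1 s1 l1 e1 A1]]] := last_piece q1 h1.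
have [x2 [P2 [p2 s2 l2 e2 A2]]] := last_piece q2 h2.
have [x3 [P3 [p3 s3 l3 e3 A3]]] := last_piece q3 h3.
have pr Q1' a1' b1' Q2' a2' b2' Q3' a3' b3' x1' x2' P1' P2' :
    prism3 e Q1' a1' b1' Q2' a2' b2' Q3' a3' b3' -> f \notin Q1' -> f \notin Q2' -> f \notin Q3' ->
    pth e P1' x1' b1' -> {subset P1' <= Q1'} -> (forall w, w \in P1' -> e f w = (w == x1')) -> e f x1' ->
    pth e P2' x2' b2' -> {subset P2' <= Q2'} -> (forall w, w \in P2' -> e f w = (w == x2')) -> e f x2' ->
    ~~ (e f b1' && e f b2') -> ~~ ((a1' \in P1') && (a2' \in P2')) -> odd (size P1' + size P2').
  move=> /(prism_flip e_sym e_irr) K' g1 g2 g3 r1 t1 m1 ex1 r2 t2 m2 ex2 nb12 na12.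
  have : ~~ odd (size (rev P1') + size [:: f] + size (rev P2')).
    apply: (alpha_A12 e_sym e_irr noodd K' (pth1 e_sym e_irr f) _ _ _ (p := x1') (q := x2')); rewrite ?mem_rev //.
    - by move=> w; rewrite inE !mem_rev => /eqP ->.
    - by move=> w v; rewrite inE => /eqP ->; rewrite eqxx.
    - by move=> w v; rewrite inE => /eqP ->; rewrite eqxx.
    - exact: pth_rev.
    - by move=> w; rewrite !mem_rev; apply: t1.
    - by move=> w; rewrite mem_rev; apply: m1.
    - exact: pth_rev.
    - by move=> w; rewrite !mem_rev; apply: t2.
    - by move=> w; rewrite mem_rev; apply: m2.
    by move=> _; apply: contra nb12 => /andP [/eqP <- /eqP <-]; rewrite ex1 ex2.
  by rewrite !size_rev addn1 addSn /= negbK.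
move: nb; rewrite /two3 !negb_or => /and3P [nb12 nb13 nb23].
case: (boolP ((a1 \in P1) && (a2 \in P2))) => [/andP [/A1 [_ _ k1] /A2 [_ _ k2]]|m12]; first by constructor.
case: (boolP ((a1 \in P1) && (a3 \in P3))) => [/andP [/A1 [_ _ k1] /A3 [_ _ k2]]|m13]; first by constructor.
case: (boolP ((a2 \in P2) && (a3 \in P3))) => [/andP [/A2 [_ _ k1] /A3 [_ _ k2]]|m23]; first by constructor.
have o12 := pr _ _ _ _ _ _ _ _ _ _ _ _ _ K f1 f2 f3 p1 s1 l1 e1 p2 s2 l2 e2 nb12 m12.
have o23 := pr _ _ _ _ _ _ _ _ _ _ _ _ _ (prism_rot e_sym K) f2 f3 f1 p2 s2 l2 e2 p3 s3 l3 e3 nb23 m23.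
have K13 := prism_swap e_sym (prism_rot e_sym (prism_rot e_sym K)).
have o13 := pr _ _ _ _ _ _ _ _ _ _ _ _ _ K13 f1 f3 f2 p1 s1 l1 e1 p3 s3 l3 e3 nb13 m13.
by move: o12 o23 o13; clear; lia.
Qed.

(** Cycles through the missed path [Q3] make both tails odd, whereas the cycle through [b1 b2] needs
    their sizes to have odd sum. *)
Lemma untouch3A Q1 a1 b1 Q2 a2 b2 Q3 a3 b3 f x y : prism3 e Q1 a1 b1 Q2 a2 b2 Q3 a3 b3 ->
  f \notin Q1 -> f \notin Q2 -> f \notin Q3 -> ~~ has (e f) Q3 -> e f a1 -> e f a2 ->
  ~~ (e f b1 && e f b2) -> x \in Q1 -> y \in Q2 -> e f x -> e f y -> ~~ ((x == a1) && (y == a2)) -> False.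
Proof.
move=> K f1 f2 f3 h3 ea1 ea2 nb xQ yQ efx efy nxy; have [q1 q2 q3 [n1 n2 n3 _]] := K.
have h1 : has (e f) Q1 by apply/hasP; exists x.
have h2 : has (e f) Q2 by apply/hasP; exists y.
have [x1 [P1 [p1 s1 l1 e1 A1]]] := last_piece q1 h1.
have [x2 [P2 [p2 s2 l2 e2 A2]]] := last_piece q2 h2.
have [o1 o2 o3] := prism3_even e_sym e_irr noodd noprism K.
have pf := pth1 e_sym e_irr f.
have side Q1' a1' b1' Q2' a2' b2' P1' x1' : prism3 e Q1' a1' b1' Q2' a2' b2' Q3 a3 b3 ->
    f \notin Q1' -> f \notin Q2' -> pth e P1' x1' b1' -> {subset P1' <= Q1'} ->
    (forall w, w \in P1' -> e f w = (w == x1')) -> e f a2' ->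
    (a1' \in P1' -> P1' = Q1') -> odd (size P1').
  move=> K' g1 g2 r1 t1 m1 ea2' AA.
  have [_ r2 _ [_ n2' _ _]] := K'.
  case: (boolP (a1' \in P1')) => [/AA ->|na]; first by case: (prism3_even e_sym e_irr noodd noprism K').
  have : ~~ odd (size (rev P1') + size [:: f] + size (rev Q3) + size [:: a2']).
    apply: (alpha_AB e_sym e_irr noodd (prism_flip e_sym e_irr K') pf _ _ _ _ (p := x1') (q := a2')); rewrite ?mem_rev //.
    - by move=> w; rewrite inE !mem_rev => /eqP ->.
    - by move=> w v; rewrite inE => /eqP ->; rewrite eqxx.
    - by move=> w v; rewrite inE => /eqP ->; rewrite eqxx.
    - by move=> w v; rewrite inE mem_rev => /eqP -> v3; apply: (hasPn h3).
    - exact: pth_rev.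
    - by move=> w; rewrite !mem_rev; apply: t1.
    - by move=> w; rewrite mem_rev; apply: m1.
    - exact: pth1.
    - by move=> w; rewrite inE mem_rev => /eqP ->; apply: pth_in1 r2.
    - by move=> w; rewrite inE => /eqP ->; rewrite eqxx.
    by rewrite inE eq_sym.
  by rewrite !size_rev !addn1 addSn /= negbK oddD o3; case: (odd _).
have A1' : a1 \in P1 -> P1 = Q1 by case/A1.
have A2' : a2 \in P2 -> P2 = Q2 by case/A2.
have o1' := side _ _ _ _ _ _ _ _ K f1 f2 p1 s1 l1 ea2 A1'.
have o2' := side _ _ _ _ _ _ _ _ (prism_swap e_sym K) f2 f1 p2 s2 l2 ea1 A2'.
have : ~~ odd (size (rev P1) + size [:: f] + size (rev P2)).
  apply: (alpha_A12 e_sym e_irr noodd (prism_flip e_sym e_irr K) pf _ _ _ (p := x1) (q := x2)); rewrite ?mem_rev //.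
  - by move=> w; rewrite inE !mem_rev => /eqP ->.
  - by move=> w v; rewrite inE => /eqP ->; rewrite eqxx.
  - by move=> w v; rewrite inE => /eqP ->; rewrite eqxx.
  - exact: pth_rev.
  - by move=> w; rewrite !mem_rev; apply: s1.
  - by move=> w; rewrite mem_rev; apply: l1.
  - exact: pth_rev.
  - by move=> w; rewrite !mem_rev; apply: s2.
  - by move=> w; rewrite mem_rev; apply: l2.
  - apply: contra nxy => /andP [/A1 [_ _ k1] /A2 [_ _ k2]].
    by rewrite -k1 // -k2 // efx efy.
  by move=> _; apply: contra nb => /andP [/eqP <- /eqP <-]; rewrite e1 e2.
by rewrite !size_rev addn1 addSn /= negbK oddD o1' o2'.
Qed.

Lemma untouch3 Q1 a1 b1 Q2 a2 b2 Q3 a3 b3 f x y : prism3 e Q1 a1 b1 Q2 a2 b2 Q3 a3 b3 ->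
  f \notin Q1 -> f \notin Q2 -> f \notin Q3 -> ~~ has (e f) Q3 ->
  ~~ ((e f a1 && e f a2) && (e f b1 && e f b2)) ->
  x \in Q1 -> y \in Q2 -> e f x -> e f y -> ~~ ((x == a1) && (y == a2)) ->
  ~~ ((x == b1) && (y == b2)) -> False.
Proof.
move=> K f1 f2 f3 h3 nm xQ yQ efx efy na nb.
case: (boolP (e f a1 && e f a2)) => [ea|nea].
  have [e1 e2] := andP ea; rewrite ea /= in nm.
  exact: (untouch3A K f1 f2 f3 h3 e1 e2 nm xQ yQ efx efy na).
case: (boolP (e f b1 && e f b2)) => [/andP [e1 e2]|neb].
  by apply: (untouch3A (x := x) (y := y) (prism_flip e_sym e_irr K) _ _ _ _ e1 e2); rewrite ?mem_rev ?has_rev.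
apply: (alpha e_sym e_irr noodd noprism (F := [:: f]) K (pth1 e_sym e_irr f) _ _ _ _ xQ efx yQ efy na xQ efx yQ efy nb).
- by move=> w; rewrite inE => /eqP ->.
- by move=> w v; rewrite inE => /eqP ->; rewrite eqxx.
- by move=> w v; rewrite inE => /eqP ->; rewrite eqxx.
- by move=> w v; rewrite inE => /eqP -> v3; apply: (hasPn h3).
by rewrite nea neb.
Qed.

(** Such a vertex behaves like a substitute for the corner [a]; in a maximal structure it could be
    added to that side. *)
Definition special f Q a Q2 a2 Q3 a3 := [/\ forall v, v \in Q2 -> e f v = (v == a2),
  forall v, v \in Q3 -> e f v = (v == a3) & exists2 v, v \in Q & (v != a) && e f v].

(** By [untouch3] the vertex has neighbours on all three paths, and [touch3], used away from a
    triangle of which it sees at most one corner, gives the special form. *)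
Lemma vertex_types Q1 a1 b1 Q2 a2 b2 Q3 a3 b3 f x y : prism3 e Q1 a1 b1 Q2 a2 b2 Q3 a3 b3 ->
  f \notin Q1 -> f \notin Q2 -> f \notin Q3 ->
  ~~ (two3 (e f a1) (e f a2) (e f a3) && two3 (e f b1) (e f b2) (e f b3)) ->
  x \in Q1 -> y \in Q2 -> e f x -> e f y -> ~~ ((x == a1) && (y == a2)) ->
  ~~ ((x == b1) && (y == b2)) ->
  (special f Q1 a1 Q2 a2 Q3 a3 \/ special f Q2 a2 Q1 a1 Q3 a3) \/
  (special f Q1 b1 Q2 b2 Q3 b3 \/ special f Q2 b2 Q1 b1 Q3 b3).
Proof.
move=> K f1 f2 f3 nm xQ yQ efx efy na nb.
have h1 : has (e f) Q1 by apply/hasP; exists x.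
have h2 : has (e f) Q2 by apply/hasP; exists y.
case h3 : (has (e f) Q3); last first.
  exfalso; apply: (untouch3 K f1 f2 f3 (negbT h3) _ xQ yQ efx efy na nb).
  by apply: contra nm => /andP [/andP [-> ->] /andP [-> ->]].
move: nm; rewrite negb_and orbC => /orP [nm|nm]; [left|right].
  case: (touch3 K f1 f2 f3 h1 h2 h3 nm) => -[k1 k2].
  - by case/negP: na; rewrite -k1 // -k2 // efx efy.
  - right; split=> //; exists y => //; rewrite efy andbT; apply: contraNneq na => ->.
    by rewrite -k1 // efx eqxx.
  left; split=> //; exists x => //; rewrite efx andbT; apply: contraNneq na => ->.
  by rewrite -k1 // efy eqxx.
have rv Q k : (forall w, w \in rev Q -> e f w = (w == k)) -> forall w, w \in Q -> e f w = (w == k).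
  by move=> h0 w wQ; apply: h0; rewrite mem_rev.
case: (touch3 (prism_flip e_sym e_irr K) _ _ _ _ _ _ nm); rewrite ?mem_rev ?has_rev //; move=> [/rv k1 /rv k2].
- by case/negP: nb; rewrite -k1 // -k2 // efx efy.
- right; split=> //; exists y => //; rewrite efy andbT; apply: contraNneq nb => ->.
  by rewrite -k1 // efx eqxx.
left; split=> //; exists x => //; rewrite efx andbT; apply: contraNneq nb => ->.
by rewrite -k1 // efy eqxx.
Qed.

Lemma prism_in Q1 a1 b1 Q2 a2 b2 Q3 a3 b3 : prism3 e Q1 a1 b1 Q2 a2 b2 Q3 a3 b3 ->
  [/\ a1 \in Q1, b1 \in Q1, a1 != b1, odd (size Q1) & pth e Q1 a1 b1].
Proof.
move=> K; have [o1 _ _] := prism3_even e_sym e_irr noodd noprism K.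
by case: K => p1 _ _ [n1 _ _ _]; split=> //; [apply: pth_in1 p1|apply: pth_in2 p1].
Qed.

Lemma prism_end Q1 a1 b1 Q2 a2 b2 Q3 a3 b3 v : prism3 e Q1 a1 b1 Q2 a2 b2 Q3 a3 b3 -> v \in Q2 ->
  [/\ v \notin Q1, e a1 v = (v == a2) & e b1 v = (v == b2)].
Proof.
case=> p1 p2 p3 [n1 n2 n3 [[d12 c12] _ _]] vQ; split.
- by apply: contraL vQ => /d12.
- by rewrite c12 ?(pth_in1 p1) // eqxx (negbTE n1) orbF.
by rewrite c12 ?(pth_in2 p1) // eqxx eq_sym (negbTE n1).
Qed.

Section Replace.
Variables (Q1 R1 Q2 Q3 : seq T) (a1 b1 c1 d1 a2 b2 a3 b3 m : T).
Hypothesis K : prism3 e Q1 a1 b1 Q2 a2 b2 Q3 a3 b3.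
Hypothesis K' : prism3 e R1 c1 d1 Q2 a2 b2 Q3 a3 b3.
Hypothesis m1 : m \notin Q1.
Hypothesis m1' : m \notin R1.
Hypothesis m2 : m \notin Q2.
Hypothesis m3 : m \notin Q3.
Hypothesis nm : ~~ (two3 (e m c1) (e m a2) (e m a3) && two3 (e m d1) (e m b2) (e m b3)).

Let R := prism_rot e_sym K'.
Let nmR : ~~ (two3 (e m a2) (e m a3) (e m c1) && two3 (e m b2) (e m b3) (e m d1)).
Proof. by move: nm; rewrite two3rot (two3rot (e m d1)). Qed.
Let RS := prism_swap e_sym K'.

Let K13 := prism_swap e_sym (prism_rot e_sym (prism_rot e_sym K)).

(** In this and the next lemma the corner pattern makes [m] special for the prism with [R1]; where
    that is consistent at all, a corner of the old path [Q1] seen by [m] gives the odd hole of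
    [noskip]. *)
Lemma replace_aab : e m a2 -> e m a3 -> e m b1 -> e m b2 -> False.
Proof.
move=> ea2 ea3 eb1 eb2; have [a2Q b2Q n2 o2 p2] := prism_in R.
have [a3Q b3Q n3 o3 p3] := prism_in (prism_rot e_sym R).
have [a1Q b1Q n1 o1 p1] := prism_in K.
have x1 : ~~ ((b2 == a2) && (a3 == a3)) by rewrite eq_sym (negbTE n2).
have x2 : ~~ ((b2 == b2) && (a3 == b3)) by rewrite (negbTE n3) andbF.
case: (vertex_types R m2 m3 m1' nmR b2Q a3Q eb2 ea3 x1 x2) => -[] [k1 k2 _].
- have b13 : b1 \notin Q3 by apply/negP => /(prism_end K13) []; rewrite b1Q.
  apply: (noskip p3 o3 n3 m3 b13 eb1 k1) => v v3.
  by have [_ _ ->] := prism_end K13 v3.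
- by move: (k1 b2 b2Q); rewrite eb2 eq_sym (negbTE n2).
- by move: (k1 a3 a3Q); rewrite ea3 (negbTE n3).
by move: (k1 a2 a2Q); rewrite ea2 (negbTE n2).
Qed.

Lemma replace_ab : e m a1 -> e m b1 -> e m a2 -> e m b3 -> False.
Proof.
move=> ea1 eb1 ea2 eb3; have [a2Q b2Q n2 o2 p2] := prism_in R.
have [a3Q b3Q n3 o3 p3] := prism_in (prism_rot e_sym R).
have [a1Q b1Q n1 o1 p1] := prism_in K.
have x1 : ~~ ((a2 == a2) && (b3 == a3)) by rewrite (eq_sym b3) (negbTE n3) andbF.
have x2 : ~~ ((a2 == b2) && (b3 == b3)) by rewrite (negbTE n2).
case: (vertex_types R m2 m3 m1' nmR a2Q b3Q ea2 eb3 x1 x2) => -[] [k1 k2 _].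
- by move: (k1 b3 b3Q); rewrite eb3 eq_sym (negbTE n3).
- have b12 : b1 \notin Q2 by apply/negP => /(prism_end K) []; rewrite b1Q.
  apply: (noskip p2 o2 n2 m2 b12 eb1 k1) => v v3.
  by have [_ _ ->] := prism_end K v3.
- have a13 : a1 \notin Q3 by apply/negP => /(prism_end K13) []; rewrite a1Q.
  have rp := pth_rev e_sym e_irr p3.
  have orp : odd (size (rev Q3)) by rewrite size_rev.
  have nba : b3 != a3 by rewrite eq_sym.
  have mr : m \notin rev Q3 by rewrite mem_rev.
  have ar : a1 \notin rev Q3 by rewrite mem_rev.
  apply: (noskip rp orp nba mr ar ea1) => v; rewrite mem_rev => v3; first exact: k1.
  by have [_ -> _] := prism_end K13 v3.
by move: (k1 a2 a2Q); rewrite ea2 (negbTE n2).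
Qed.

Lemma replace_full : e m a2 -> e m b2 -> ~~ e m a3 -> ~~ e m b3 -> ~~ has (e m) R1 /\ ~~ has (e m) Q3.
Proof.
move=> ea2 eb2 ea3 eb3; have [a2Q b2Q n2 o2 p2] := prism_in R.
have [a3Q b3Q n3 o3 p3] := prism_in (prism_rot e_sym R).
have pick c (k : T) : exists x, [/\ x \in Q2, e m x, ~~ ((x == a2) && (k == c)) & ~~ ((x == b2) && (k != c))].
  case: (eqVneq k c) => _; [exists b2|exists a2]; rewrite ?andbF ?andbT // ?(eq_sym b2) n2; by split.
split; apply/hasPn => k kQ; apply/negP => emk.
  have [x [xQ emx h1 h2]] := pick c1 k.
  have x2 : ~~ ((x == b2) && (k == d1)).
    apply: contra h2 => /andP [-> /eqP ->] /=; have [_ _ + _ _] := prism_in K'; by rewrite eq_sym.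
  have nm' : ~~ (two3 (e m a2) (e m c1) (e m a3) && two3 (e m b2) (e m d1) (e m b3)).
    by rewrite two3C12 (two3C12 (e m b2)).
  case: (vertex_types RS m2 m1' m3 nm' xQ kQ emx emk h1 x2) => -[] [k1 k2 _].
  - by move: (k2 a3 a3Q); rewrite (negbTE ea3) eqxx.
  - by move: (k1 b2 b2Q); rewrite eb2 eq_sym (negbTE n2).
  - by move: (k2 b3 b3Q); rewrite (negbTE eb3) eqxx.
  by move: (k1 a2 a2Q); rewrite ea2 (negbTE n2).
have [x [xQ emx h1 h2]] := pick a3 k.
have x2 : ~~ ((x == b2) && (k == b3)) by apply: contra h2 => /andP [-> /eqP ->] /=; rewrite eq_sym.
case: (vertex_types R m2 m3 m1' nmR xQ kQ emx emk h1 x2) => -[] [k1 k2 _].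
- by move: (k1 a3 a3Q); rewrite (negbTE ea3) eqxx.
- by move: (k1 b2 b2Q); rewrite eb2 eq_sym (negbTE n2).
- by move: (k1 b3 b3Q); rewrite (negbTE eb3) eqxx.
by move: (k1 a2 a2Q); rewrite ea2 (negbTE n2).
Qed.

End Replace.

(** After the excluded corner patterns and their mirror images, enumeration leaves only vertices
    that are full on the old path, miss the new one, and treat the other two in opposite ways. *)
Lemma replace_rung Q1 R1 Q2 Q3 a1 b1 c1 d1 a2 b2 a3 b3 m :
  prism3 e Q1 a1 b1 Q2 a2 b2 Q3 a3 b3 -> prism3 e R1 c1 d1 Q2 a2 b2 Q3 a3 b3 ->
  m \notin Q1 -> m \notin R1 -> m \notin Q2 -> m \notin Q3 ->
  two3 (e m a1) (e m a2) (e m a3) -> two3 (e m b1) (e m b2) (e m b3) ->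
  [\/ two3 (e m c1) (e m a2) (e m a3) /\ two3 (e m d1) (e m b2) (e m b3),
     [/\ e m a1 && e m b1, ~~ has (e m) R1, e m a2 && e m b2 & ~~ has (e m) Q3] |
     [/\ e m a1 && e m b1, ~~ has (e m) R1, e m a3 && e m b3 & ~~ has (e m) Q2]].
Proof.
move=> K K' m1 m1' m2 m3 ma mb.
case nm : (two3 (e m c1) (e m a2) (e m a3) && two3 (e m d1) (e m b2) (e m b3)).
  by constructor; apply/andP.
move/negbT: nm => nm.
have sw Q a b : prism3 e Q a b Q2 a2 b2 Q3 a3 b3 -> prism3 e Q a b Q3 a3 b3 Q2 a2 b2.
  by move=> h; apply: prism_swap => //; do 2!apply: prism_rot => //.
have fl Q a b : prism3 e Q a b Q2 a2 b2 Q3 a3 b3 -> prism3 e (rev Q) b a (rev Q2) b2 a2 (rev Q3) b3 a3.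
  exact: prism_flip.
have nm32 : ~~ (two3 (e m c1) (e m a3) (e m a2) && two3 (e m d1) (e m b3) (e m b2)).
  by move: nm; rewrite /two3; case: (e m c1); case: (e m a2); case: (e m a3); case: (e m d1); case: (e m b2); case: (e m b3).
have nmf : ~~ (two3 (e m d1) (e m b2) (e m b3) && two3 (e m c1) (e m a2) (e m a3)) by rewrite andbC.
have nmf32 : ~~ (two3 (e m d1) (e m b3) (e m b2) && two3 (e m c1) (e m a3) (e m a2)) by rewrite andbC.
have f1 := replace_aab K K' m1' m2 m3 nm.
have f2 := replace_aab (sw _ _ _ K) (sw _ _ _ K') m1' m3 m2 nm32.
have mr s : m \notin s -> m \notin rev s by rewrite mem_rev.
have f3 := replace_aab (fl _ _ _ K) (fl _ _ _ K') (mr _ m1') (mr _ m2) (mr _ m3) nmf.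
have f4 := replace_aab (prism_flip e_sym e_irr (sw _ _ _ K)) (prism_flip e_sym e_irr (sw _ _ _ K')) (mr _ m1') (mr _ m3) (mr _ m2) nmf32.
have f5 := replace_ab K K' m1' m2 m3 nm.
have f6 := replace_ab (sw _ _ _ K) (sw _ _ _ K') m1' m3 m2 nm32.
have f7 := replace_full K' m1' m2 m3 nm.
have f8 := replace_full (sw _ _ _ K') m1' m3 m2 nm32.
have F (b1' b2' b3' b4' : bool) : (b1' -> b2' -> b3' -> b4' -> False) -> ~~ [&& b1', b2', b3' & b4'].
  by case: b1'; case: b2'; case: b3'; case: b4' => // h0; case: (h0 isT isT isT isT).
move: ma mb nm (F _ _ _ _ f1) (F _ _ _ _ f2) (F _ _ _ _ f3) (F _ _ _ _ f4) (F _ _ _ _ f5) (F _ _ _ _ f6) f7 f8.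
clear; rewrite /two3.
case: (e m a1); case: (e m a2); case: (e m a3); case: (e m b1); case: (e m b2); case: (e m b3) => //=;
  rewrite ?orbT ?andbT //= => _ _ _ _ _ _ _ _ _ h1 h2.
- by have [h3 h4] := h1 isT isT isT isT; constructor 2.
by have [h3 h4] := h2 isT isT isT isT; constructor 3.
Qed.

(** If both fail, a minimal antipath [r] of [Y] between nonneighbours of [a1] and [a2] closes
    through any [b] complete to [r] to an antihole, so each [b] has a nonneighbour on [r]. The first
    vertex of [r] sees two of the [b]; an antipath between their nonneighbours on the rest of [r]
    closes through [a1], which is complete to that rest. *)
Lemma complete2 (Y : {set T}) a1 a2 b1 b2 b3 : anticonn e Y ->
  e a1 a2 -> e b1 b2 -> e b1 b3 -> e b2 b3 ->
  (forall a b, a \in [:: a1; a2] -> b \in [:: b1; b2; b3] -> (a != b) && ~~ e a b) ->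
  (forall w, w \in [:: a1; a2; b1; b2; b3] -> w \notin Y) ->
  (forall w, w \in Y -> e w a1 || e w a2) -> (forall w, w \in Y -> two3 (e w b1) (e w b2) (e w b3)) ->
  ~~ cpl e Y a1 -> ~~ cpl e Y a2 -> False.
Proof.
move=> aY e12 eb12 eb13 eb23 nab nY ha hb n1 n2.
have cs := compl_sym e_sym; have ci := compl_irr e.
have miss k : k \notin Y -> ~~ cpl e Y k -> exists2 w, w \in Y & compl e k w.
  move=> kY; rewrite negb_forall_in => /exists_inP [w wY ew]; exists w => //.
  by rewrite /compl e_sym ew andbT; apply: contraNneq kY => ->.
have [a1Y a2Y] : a1 \notin Y /\ a2 \notin Y by split; apply: nY; rewrite !inE eqxx ?orbT.
have [w1 w1Y c1] := miss _ a1Y n1; have [w2 w2Y c2] := miss _ a2Y n2.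
have [r [c [d [pr rY Nc Nd [rc rd]]]]] := conn_link cs ci aY w1Y c1 w2Y c2.
have bY b : b \in [:: b1; b2; b3] -> b \notin Y.
  by move=> bb; apply: nY; rewrite -[[:: a1, _ & _]]/([:: a1; a2] ++ [:: b1; b2; b3]) mem_cat bb orbT.
have ncd : c != d.
  apply: contraTneq (ha c (rY _ (pth_in1 pr))) => ecd; rewrite negb_or !(e_sym c).
  by rewrite -ecd in Nd; case/andP: Nc => _ ->; case/andP: Nd.
have r2 := pth_size2 pr ncd.
have bb_nadj b b' : b \in [:: b1; b2; b3] -> b' \in [:: b1; b2; b3] -> ~~ compl e b b'.
  rewrite /compl negb_and !negbK => h1 h2; case: (eqVneq b b') => //= nb.
  move: h1 h2 nb; rewrite !inE => /or3P [] /eqP -> /or3P [] /eqP ->; rewrite ?eqxx // e_sym //.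
have capb a b : a \in [:: a1; a2] -> b \in [:: b1; b2; b3] -> compl e a b.
  by move=> h1 h2; rewrite /compl; apply: nab.
have a12 : compl e a1 a2 = false by rewrite /compl e12 andbF.
have a1i : a1 \in [:: a1; a2] by rewrite mem_head.
have a2i : a2 \in [:: a1; a2] by rewrite !inE eqxx orbT.
have missb b : b \in [:: b1; b2; b3] -> exists2 w, w \in r & compl e b w.
  move=> bb; apply/exists_inP; apply: contraT; rewrite negb_exists_in => /forall_inP hh; exfalso.
  have nb w : w \in r -> compl e w b = false by move=> wr; rewrite cs; apply/negbTE/hh.
  have p3 : pth (compl e) [:: a1; b; a2] a1 a2.
    apply: (pth_cons cs ci (pth_2 cs ci (_ : compl e b a2))); first by rewrite cs capb.
      rewrite !inE negb_or; case/andP: (nab a1 b a1i bb) => -> _ /=.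
      by apply: contraTneq e12 => ->; rewrite e_irr.
    move=> w; rewrite !inE => /orP [] /eqP ->; first by rewrite capb ?eqxx.
    by rewrite a12; symmetry; apply/negbTE; have := capb a2 b a2i bb; apply: contraTneq => ->; rewrite ci.
  apply: (ladder_anti e_sym noanti pr p3); last by rewrite (leq_add r2 (isT : 2 < 3)).
  split=> [w /rY wY|w w' wr].
    by apply/negP; rewrite !inE => /or3P [] /eqP ew; move: wY; rewrite ew; apply/negP; [exact: a1Y|exact: bY|exact: a2Y].
  have ab a : a \in [:: a1; a2] -> (b == a) = false by move=> h0; rewrite eq_sym; apply/negbTE; case/andP: (nab a b h0 bb).
  have na12 : (a1 == a2) = false by apply/negbTE; apply: contraTneq e12 => ->; rewrite e_irr.
  rewrite !inE => /or3P [] /eqP ->.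
  - by rewrite cs rc // eqxx na12 andbT andbF orbF.
  - by rewrite nb // !ab // !andbF.
  by rewrite cs rd // eqxx (eq_sym a2) na12 andbT andbF.
case: r pr rY rc rd r2 missb => [|c' r] pr rY rc rd r2 missb; first by case: pr.
have ec : c' = c by case: pr => _ [].
subst c'; have pr' : exists k, pth (compl e) r k d.
  by have := pr; rewrite -cat1s => /(pth_catr cs ci); apply; case: (r) r2.
have [k pk] := pr'.
have cY := rY c (mem_head _ _).
have fin b b' : b \in [:: b1; b2; b3] -> b' \in [:: b1; b2; b3] -> b != b' -> e c b -> e c b' ->
    (forall w, w \in Y -> e w b || e w b') -> False.
  move=> bb bb' nbb ecb ecb' hbb.
  have onr b0 : b0 \in [:: b1; b2; b3] -> e c b0 -> exists2 w, w \in r & compl e b0 w.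
    move=> h0 h1; have [w] := missb b0 h0; rewrite inE => /orP [/eqP -> |wr cw]; last by exists w.
    by rewrite /compl e_sym h1 andbF.
  have [w wr cw] := onr b bb ecb; have [w' wr' cw'] := onr b' bb' ecb'.
  have cR := conn_pset cs ci pk.
  have wi : w \in [set x in r] by rewrite inE. have wi' : w' \in [set x in r] by rewrite inE.
  have [t [g [g' [pt tr Ng Ng' [tg tg']]]]] := conn_link cs ci cR wi cw wi' cw'.
  have tr' x : x \in t -> x \in c :: r by move=> /tr; rewrite inE => xr; rewrite inE xr orbT.
  have ngg : g != g'.
    apply: contraTneq (hbb g (rY _ (tr' _ (pth_in1 pt)))) => egg; rewrite negb_or !(e_sym g).
    by rewrite -egg in Ng'; case/andP: Ng => _ ->; case/andP: Ng'.
  have t2 := pth_size2 pt ngg.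
  have a1t x : x \in t -> compl e x a1 = false.
    move=> xt; have xc := tr' _ xt; rewrite cs rc //; apply/negbTE.
    apply: contraTneq (tr _ xt) => ->; rewrite inE.
    by have := pth_uniq pr; rewrite cons_uniq => /andP [].
  have p3 : pth (compl e) [:: b; a1; b'] b b'.
    apply: (pth_cons cs ci (pth_2 cs ci (capb _ _ a1i bb'))).
      rewrite !inE negb_or nbb andbT eq_sym; by case/andP: (nab a1 b a1i bb).
    move=> x; rewrite !inE => /orP [] /eqP ->; first by rewrite cs capb ?eqxx.
    rewrite (negbTE (bb_nadj _ _ bb bb')); symmetry; apply/negbTE.
    by have := capb a1 b' a1i bb'; apply: contraTneq => ->; rewrite ci.
  have ab b0 : b0 \in [:: b1; b2; b3] -> (a1 == b0) = false.
    by move=> h0; apply/negbTE; case/andP: (nab a1 b0 a1i h0).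
  apply: (ladder_anti e_sym noanti pt p3); last by rewrite (leq_add t2 (isT : 2 < 3)).
  split=> [x /tr' /rY xY|x x' xt].
    by apply/negP; rewrite !inE => /or3P [] /eqP ew; move: xY; rewrite ew; apply/negP; [exact: bY|exact: a1Y|exact: bY].
  rewrite !inE => /or3P [] /eqP ->.
  - by rewrite cs tg // eqxx (negbTE nbb) andbT andbF orbF.
  - by rewrite a1t // !ab // !andbF.
  by rewrite cs tg' // eqxx (eq_sym b') (negbTE nbb) andbT andbF.
have bi1 : b1 \in [:: b1; b2; b3] by rewrite mem_head.
have bi2 : b2 \in [:: b1; b2; b3] by rewrite !inE eqxx orbT.
have bi3 : b3 \in [:: b1; b2; b3] by rewrite !inE eqxx !orbT.
have ne x y : e x y -> x != y by move=> exy; apply: contraTneq exy => ->; rewrite e_irr.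
case/or3P: (hb c cY) => /andP [h1 h2].
- apply: (fin b1 b2 bi1 bi2 (ne _ _ eb12) h1 h2) => w /hb; rewrite /two3.
  by case: (e w b1); case: (e w b2); case: (e w b3).
- apply: (fin b1 b3 bi1 bi3 (ne _ _ eb13) h1 h2) => w /hb; rewrite /two3.
  by case: (e w b1); case: (e w b2); case: (e w b3).
apply: (fin b2 b3 bi2 bi3 (ne _ _ eb23) h1 h2) => w /hb; rewrite /two3.
by case: (e w b1); case: (e w b2); case: (e w b3).
Qed.

End Vertex.

(** * Maximal generalised prisms *)

Section Struct.
Variables (T : finType) (e : rel T).
Hypothesis e_sym : symmetric e.
Hypothesis e_irr : irreflexive e.
Hypothesis noodd : forall c, hole e c -> ~~ odd (size c).
Hypothesis noanti : forall c, ~~ hole (compl e) c.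
Hypothesis noprism : forall a1 a2 a3 q1 q2 q3, ~~ odd_prism e a1 a2 a3 q1 q2 q3.
Implicit Types (s t r q Q F P : seq T) (x y z a b c d u v w h f : T) (X Y S A B H : {set T}).

(* A pair is a link when it violates the rule that distinct units are joined exactly inside A and
   inside B; the units of H are the components of the link relation. *)
Definition both A B u v := (u \in A) && (v \in A) || (u \in B) && (v \in B).
Definition link A B u v := (u != v) && (e u v != both A B u v).
Definition same A B H u v := connect (restr (link A B) H) u v.
Definition rung A B H r a b := [/\ pth e r a b, a \in A, b \in B, {subset r <= H} &
  forall w, w \in r -> (w \in A -> w = a) /\ (w \in B -> w = b)].
(** The marked vertices certify three different units and stay fixed while the structure grows, so
    that maximality refers to them. *)
Definition valid A B H c1 c2 c3 := [/\ A \subset H, B \subset H, [disjoint A & B],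
  [/\ c1 \in H, c2 \in H, c3 \in H & [/\ ~~ same A B H c1 c2, ~~ same A B H c1 c3 & ~~ same A B H c2 c3]] &
  forall h, h \in H -> exists r a b, rung A B H r a b /\ h \in r].

Lemma both_sym A B : symmetric (both A B).
Proof. by move=> u v; rewrite /both; congr (_ || _); rewrite andbC. Qed.
Lemma both_swap A B u v : both B A u v = both A B u v.
Proof. by rewrite /both orbC. Qed.
Lemma link_sym A B : symmetric (link A B).
Proof. by move=> u v; rewrite /link eq_sym e_sym both_sym. Qed.
Lemma link_swap A B : link B A =2 link A B.
Proof. by move=> u v; rewrite /link both_swap. Qed.
Lemma same_sym A B H u v : same A B H u v = same A B H v u.
Proof. exact: (restr_csym (link_sym A B)). Qed.
Lemma same_trans A B H u v w : same A B H u v -> same A B H v w -> same A B H u w.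
Proof. exact: connect_trans. Qed.
Lemma same_refl A B H u : same A B H u u.
Proof. exact: connect0. Qed.
Lemma same_swap A B H u v : same B A H u v = same A B H u v.
Proof. by apply: eq_connect => x y; rewrite /restr link_swap. Qed.
Lemma same1 A B H u v : u \in H -> v \in H -> link A B u v -> same A B H u v.
Proof. by move=> uH vH l; apply: connect1; rewrite /restr uH vH. Qed.

Lemma rung_swap A B H r a b : rung A B H r a b -> rung B A H (rev r) b a.
Proof.
case=> pr aA bB rH hw; split=> //; first exact: pth_rev.
  by move=> w; rewrite mem_rev; apply: rH.
by move=> w; rewrite mem_rev => /hw [].
Qed.

Lemma valid_swap A B H c1 c2 c3 : valid A B H c1 c2 c3 -> valid B A H c1 c2 c3.
Proof.
case=> AH BH dAB [h1 h2 h3 [n1 n2 n3]] cov; split=> //; first by rewrite disjoint_sym.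
  by split=> //; split; rewrite same_swap.
move=> h hH; have [r [a [b [R hr]]]] := cov h hH.
by exists (rev r), b, a; split; [exact: rung_swap|rewrite mem_rev].
Qed.

Lemma valid_rot A B H c1 c2 c3 : valid A B H c1 c2 c3 -> valid A B H c2 c3 c1.
Proof. by case=> AH BH dAB [h1 h2 h3 [n1 n2 n3]] cov; split=> //; split=> //; split; rewrite // same_sym. Qed.

Lemma connect_exit (R : rel T) (P : T -> Prop) x y : connect R x y -> P x -> ~ P y ->
  exists u v, [/\ connect R x u, R u v, P u & ~ P v].
Proof.
move=> /connectP [q pq ->]; elim: q x pq => [|z q IH] x //= /andP [xz pq] Px nP.
case: (classic (P z)) => [Pz|nPz]; last by exists x, z; split; rewrite ?connect0.
have [u [v [c1 c2 c3 c4]]] := IH z pq Pz nP.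
by exists u, v; split=> //; apply: connect_trans (connect1 xz) c1.
Qed.

Section Valid.
Variables (A B H : {set T}) (c1 c2 c3 : T).
Hypothesis V : valid A B H c1 c2 c3.
Local Notation unit := (same A B H).
Local Notation rg := (rung A B H).

Lemma inAH u : u \in A -> u \in H.
Proof. by case: V => /subsetP h _ _ _ _; apply: h. Qed.
Lemma inBH u : u \in B -> u \in H.
Proof. by case: V => _ /subsetP h _ _ _; apply: h. Qed.
Lemma notAB u : u \in A -> u \notin B.
Proof. by case: V => _ _ /pred0P h _ _ uA; have := h u; rewrite /= uA /= => ->. Qed.
Lemma AB_ne a b : a \in A -> b \in B -> a != b.
Proof. by move=> aA; apply: contraTneq => <-; apply: notAB. Qed.

Lemma diffunit u v : u \in H -> v \in H -> ~~ unit u v -> e u v = both A B u v.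
Proof.
move=> uH vH nuv; apply/eqP; apply: contraNT nuv => l; case: (eqVneq u v) => [->|nuv]; first exact: same_refl.
by apply: same1; rewrite // /link nuv.
Qed.

Lemma unit_tr z u v : unit z u -> unit z v -> unit u v.
Proof. by move=> h1 h2; apply: same_trans h2; rewrite same_sym. Qed.

Lemma nunit_r u v w : ~~ unit u v -> unit v w -> ~~ unit u w.
Proof. by move=> n h; apply: contra n => h'; apply: same_trans h' _; rewrite same_sym. Qed.

Lemma nunit_l u v w : ~~ unit u v -> unit u w -> ~~ unit w v.
Proof. by move=> n h; apply: contra n; apply: same_trans. Qed.

Lemma rungAE r a b w : rg r a b -> w \in r -> (w \in A) = (w == a).
Proof. by case=> _ aA _ _ hw /hw [h _]; apply/idP/eqP => [//|->]. Qed.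

Lemma rungBE r a b w : rg r a b -> w \in r -> (w \in B) = (w == b).
Proof. by case=> _ _ bB _ hw /hw [_ h]; apply/idP/eqP => [//|->]. Qed.

Lemma rung_in r a b : rg r a b -> [/\ a \in r, b \in r, a \in A, b \in B & a != b].
Proof. by case=> pr aA bB _ _; split=> //; [exact: pth_in1 pr|exact: pth_in2 pr|exact: AB_ne]. Qed.

Lemma rungH r a b w : rg r a b -> w \in r -> w \in H.
Proof. by case=> _ _ _ h _; apply: h. Qed.

Lemma rung_unit r a b u v : rg r a b -> u \in r -> v \in r -> unit u v.
Proof.
case=> pr aA bB rH hw ur vr.
have := conn_pset e_sym e_irr pr => /(_ u v); rewrite !inE => /(_ ur vr).
apply: connect_sub => x y /and3P [+ + exy]; rewrite !inE => xr yr.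
have nxy: x != y by apply: contraTneq exy => ->; rewrite e_irr.
apply: same1; [exact: rH|exact: rH|rewrite /link nxy exy /=].
have [h1 h2] := hw x xr; have [h3 h4] := hw y yr.
apply/negP => /eqP/esym/orP [] /andP [xA yA]; case/eqP: nxy.
  by rewrite (h1 xA) (h3 yA).
by rewrite (h2 xA) (h4 yA).
Qed.

Lemma rung_cross r a b r' a' b' : rg r a b -> rg r' a' b' -> ~~ unit a a' -> cross2 e r a b r' a' b'.
Proof.
move=> R R' n; have [ar _ _ _ _] := rung_in R; have [ar' _ _ _ _] := rung_in R'.
have n' w w' : w \in r -> w' \in r' -> ~~ unit w w'.
  move=> wr wr'; apply: nunit_l (rung_unit R ar wr); exact: nunit_r n (rung_unit R' ar' wr').
split=> [w wr|w w' wr wr'].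
  by apply/negP => wr'; have := n' _ _ wr wr'; rewrite same_refl.
rewrite (diffunit (rungH R wr) (rungH R' wr') (n' _ _ wr wr')) /both.
by rewrite (rungAE R wr) (rungBE R wr) (rungAE R' wr') (rungBE R' wr').
Qed.

Lemma rungs_prism r1 a1 b1 r2 a2 b2 r3 a3 b3 : rg r1 a1 b1 -> rg r2 a2 b2 -> rg r3 a3 b3 ->
  ~~ unit a1 a2 -> ~~ unit a1 a3 -> ~~ unit a2 a3 -> prism3 e r1 a1 b1 r2 a2 b2 r3 a3 b3.
Proof.
move=> R1 R2 R3 n12 n13 n23.
have [_ _ _ _ d1] := rung_in R1; have [_ _ _ _ d2] := rung_in R2; have [_ _ _ _ d3] := rung_in R3.
split; [by case: R1|by case: R2|by case: R3|split=> //].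
by split; apply: rung_cross.
Qed.

Lemma on_rung h : h \in H -> exists r a b, rg r a b /\ h \in r.
Proof. by case: V => _ _ _ _; apply. Qed.

Lemma rungA a : a \in A -> exists r b, rg r a b.
Proof.
move=> aA; have [r [a' [b [R ar]]]] := on_rung (inAH aA).
by move: (aA); rewrite (rungAE R ar) => /eqP ->; exists r, b.
Qed.

Lemma rungB b : b \in B -> exists r a, rg r a b.
Proof.
move=> bB; have [r [a [b' [R br]]]] := on_rung (inBH bB).
by move: (bB); rewrite (rungBE R br) => /eqP ->; exists r, a.
Qed.

Lemma third u v : exists c, [/\ c \in [:: c1; c2; c3], c \in H, ~~ unit u c & ~~ unit v c].
Proof.
case: V => _ _ _ [h1 h2 h3 [n1 n2 n3]] _.
case: (boolP (unit u c1 || unit v c1)) => [p1|]; last first.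
  by rewrite negb_or => /andP [k1 k2]; exists c1; rewrite !inE eqxx.
case: (boolP (unit u c2 || unit v c2)) => [p2|]; last first.
  by rewrite negb_or => /andP [k1 k2]; exists c2; rewrite !inE eqxx orbT.
case: (boolP (unit u c3 || unit v c3)) => [p3|]; last first.
  by rewrite negb_or => /andP [k1 k2]; exists c3; rewrite !inE eqxx !orbT.
by case/orP: p1 => q1; case/orP: p2 => q2; case/orP: p3 => q3;
  first [by rewrite (unit_tr q1 q2) in n1 | by rewrite (unit_tr q1 q3) in n2 | by rewrite (unit_tr q2 q3) in n3].
Qed.

Lemma third_rung u v : exists r a b, [/\ rg r a b, ~~ unit u a & ~~ unit v a].
Proof.
have [c [_ cH n1 n2]] := third u v; have [r [a [b [R cr]]]] := on_rung cH.
have [ar _ _ _ _] := rung_in R; have h := rung_unit R cr ar.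
by exists r, a, b; split=> //; apply: nunit_r h.
Qed.

Lemma rung_odd r a b : rg r a b -> odd (size r).
Proof.
move=> R; have [r2 [a2 [b2 [R2 n2 _]]]] := third_rung a a.
have [r3 [a3 [b3 [R3 n3 n3']]]] := third_rung a a2.
by have [] := prism3_even e_sym e_irr noodd noprism (rungs_prism R R2 R3 n2 n3 n3').
Qed.

(** An edge between the sides would be a rung with two vertices, but rungs extend to prisms and so
    have odd size. *)
Lemma nadjAB a b : a \in A -> b \in B -> ~~ e a b.
Proof.
move=> aA bB; have aB := notAB aA; have bA : b \notin A by apply: contraL bB => /notAB.
apply/negP => eab.
suff R : rg [:: a; b] a b by have := rung_odd R.
split=> //; first exact: pth_2.
  by move=> w; rewrite !inE => /orP [] /eqP ->; [exact: inAH|exact: inBH].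
move=> w; rewrite !inE => /orP [] /eqP ->; split=> // k; last by rewrite k in bA.
by rewrite k in aB.
Qed.

Lemma nadjBA a b : a \in A -> b \in B -> ~~ e b a.
Proof. by rewrite e_sym; exact: nadjAB. Qed.

(** The part of [r] up to [u] and the part of [r'] from [v] form a connected set meeting the sides
    only in [a] and [b'], so an induced path between these is a rung. *)
Lemma splice r a b r' a' b' u v : rg r a b -> rg r' a' b' -> u \in r -> v \in r' ->
  u \notin B -> v \notin A -> (u == v) || e u v -> exists q, rg q a b'.
Proof.
move=> R R' ur vr' uB vA uv.
have [_ br _ bB _] := rung_in R; have [ar' _ aA' _ _] := rung_in R'.
have [s1 [s2 er]] : exists s1 s2, r = s1 ++ u :: s2 by case/splitPr: ur => s1 s2; exists s1, s2.
have [t1 [t2 er']] : exists t1 t2, r' = t1 ++ v :: t2 by case/splitPr: vr' => t1 t2; exists t1, t2.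
have [pr aA _ rH hw] := R; have [pr' _ bB' rH' hw'] := R'.
have [pu _] : pth e (rcons s1 u) a u /\ pth e (u :: s2) u b by apply: (pth_split e_sym e_irr); rewrite -er.
have [_ pv] : pth e (rcons t1 v) a' v /\ pth e (v :: t2) v b' by apply: (pth_split e_sym e_irr); rewrite -er'.
have ub: u != b by apply: contraNneq uB => ->.
have va: v != a' by apply: contraNneq vA => ->.
have nb : b \notin rcons s1 u.
  apply/negP => bs; have := pref_last pr er bs => -[_ eb]; by rewrite eb eqxx in ub.
have na : a' \notin v :: t2.
  apply/negP => bs; have := suf_head pr' er' bs => -[_ eb]; by rewrite eb eqxx in va.
have {}cS : conn e ([set x in rcons s1 u] :|: [set x in v :: t2]).
  apply: (connU e_sym (conn_pset e_sym e_irr pu) (conn_pset e_sym e_irr pv) (x:=u) (y:=v)) => //.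
    by rewrite inE mem_rcons mem_head.
  by rewrite inE mem_head.
have s1r w : w \in rcons s1 u -> w \in r by rewrite er mem_rcons inE mem_cat inE => /orP [->|->]; rewrite ?orbT.
have s2r w : w \in v :: t2 -> w \in r' by rewrite er' mem_cat => ->; rewrite orbT.
have [q [pq hq]] : exists q, pth e q a b' /\ {subset q <= [set x in rcons s1 u] :|: [set x in v :: t2]}.
  by apply: conn_pth => //; rewrite !in_setU !in_set; apply/orP; [left; exact: pth_in1 pu|right; exact: pth_in2 pv].
exists q; split=> // w /hq; rewrite in_setU !in_set => /orP [] wq.
- by apply: rH; apply: s1r.
- by apply: rH'; apply: s2r.
- split; first by case: (hw _ (s1r _ wq)).
  by move=> wB; case: (hw _ (s1r _ wq)) => _ /(_ wB) ew; rewrite -ew wq in nb.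
split; last by case: (hw' _ (s2r _ wq)).
by move=> wA; case: (hw' _ (s2r _ wq)) => /(_ wA) ew _; rewrite -ew wq in na.
Qed.

(* Splicing a full rung to a missed one along an edge would give a rung of mixed type, so the
   links between the two kinds of rungs are non-edges inside A or inside B. *)
Lemma split_unit (phi psi : pred T) z r0 a0 b0 r1 a1 b1 :
  (forall r a b, rg r a b -> unit z a -> phi a = psi b) ->
  rg r0 a0 b0 -> unit z a0 -> phi a0 -> rg r1 a1 b1 -> unit z a1 -> ~~ phi a1 ->
  exists r a b r' a' b', [/\ rg r a b, rg r' a' b', unit z a /\ unit z a', phi a && ~~ phi a' &
    (forall x y, x \in r -> y \in r' -> (x != y) && (e x y ==> both A B x y)) /\ ~~ e a a' || ~~ e b b'].
Proof.
move=> pure R0 z0 p0 R1 z1 p1.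
have mix r a b r' a' b' u v : rg r a b -> rg r' a' b' -> unit z a -> unit z a' -> phi a -> ~~ phi a' ->
  u \in r -> v \in r' -> (u != v) && (e u v ==> both A B u v).
  move=> R R' za za' pa pa' ur vr'.
  have pb: psi b by rewrite -(pure _ _ _ R).
  have pb': ~~ psi b' by rewrite -(pure _ _ _ R').
  have bothE : u = v -> ~~ both A B u v.
    move=> euv; rewrite -euv in vr' *; rewrite /both !andbb.
    rewrite (rungAE R ur) (rungBE R ur); apply/negP => /orP [] /eqP eu; move: vr'; rewrite eu => vr'.
      have := rungAE R' vr'; case: (rung_in R) => _ _ -> _ _ => /esym/eqP ea; by rewrite -ea pa in pa'.
    have := rungBE R' vr'; case: (rung_in R) => _ _ _ -> _ => /esym/eqP ea; by rewrite -ea pb in pb'.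
  apply: contraT; rewrite negb_and negbK negb_imply => uv.
  have nb : ~~ both A B u v by case/orP: uv => [/eqP /bothE|/andP []].
  have {bothE}uv : (u == v) || e u v by case/orP: uv => [->|/andP [->]]; rewrite ?orbT.
  have := nb; rewrite /both negb_or !negb_and => /andP [nA nB].
  case: (boolP ((u \notin B) && (v \notin A))) => [/andP [k1 k2]|k].
    have [q Q] := splice R R' ur vr' k1 k2 uv.
    by move: (pure _ _ _ Q za); rewrite pa (negPf pb').
  have uv' : (v == u) || e v u by rewrite eq_sym e_sym.
  have [k1 k2] : v \notin B /\ u \notin A.
    move: k; rewrite negb_and !negbK => /orP [kk|kk]; split.
    - by rewrite kk in nB.
    - by apply: contraL kk => /notAB.
    - exact: notAB.
    - by rewrite kk orbF in nA.
  have [q Q] := splice R' R vr' ur k1 k2 uv'.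
  by move: (pure _ _ _ Q za'); rewrite pb (negPf pa').
pose P w := exists r a b, [/\ rg r a b, w \in r, unit z a & phi a].
have [ar0 _ _ _ _] := rung_in R0; have [ar1 _ _ _ _] := rung_in R1.
have Pa0 : P a0 by exists r0, a0, b0.
have nPa1 : ~ P a1.
  move=> [r [a [b [R hr za pa]]]]; have := mix _ _ _ _ _ _ _ _ R R1 za z1 pa p1 hr ar1.
  by rewrite eqxx.
have [u [v [cu uv [r [a [b [R ur za pa]]]] nPv]]] := connect_exit (unit_tr z0 z1) Pa0 nPa1.
have /and3P [uH vH /andP [nuv luv]] := uv.
have [r' [a' [b' [R' vr']]]] := on_rung vH.
have [ar _ _ _ _] := rung_in R; have [ar' _ _ _ _] := rung_in R'.
have za' : unit z a'.
  apply: same_trans (rung_unit R' vr' ar'); apply: same_trans za _.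
  by apply: same_trans (rung_unit R ar ur) _; apply: connect1.
have pa' : ~~ phi a' by apply/negP => pa'; case: nPv; exists r', a', b'.
exists r, a, b, r', a', b'; split; rewrite ?pa //; split.
  by move=> x y xr yr; exact: mix R R' za za' pa pa' xr yr.
have := mix _ _ _ _ _ _ _ _ R R' za za' pa pa' ur vr'; rewrite nuv /=.
move=> k1.
have [euv k] : e u v = false /\ both A B u v by move: luv k1; case: (e u v); case: (both A B u v).
move: k; rewrite /both (rungAE R ur) (rungBE R ur) (rungAE R' vr') (rungBE R' vr').
by case/orP => /andP [/eqP eu /eqP ev]; rewrite -eu -ev euv ?orbT.
Qed.
End Valid.

Definition maxv A B H c1 c2 c3 := valid A B H c1 c2 c3 /\
  forall A' B' H', valid A' B' H' c1 c2 c3 -> A \subset A' -> B \subset B' -> H \subset H' -> H' \subset H.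

Lemma maxv_rot A B H c1 c2 c3 : maxv A B H c1 c2 c3 -> maxv A B H c2 c3 c1.
Proof.
case=> V M; split=> [|A' B' H' V']; first exact: valid_rot.
by apply: M; do 2!apply: valid_rot.
Qed.

Lemma maxv_swap A B H c1 c2 c3 : maxv A B H c1 c2 c3 -> maxv B A H c1 c2 c3.
Proof.
case=> V M; split=> [|A' B' H' V' k1 k2]; first exact: valid_swap.
by apply: M k2 k1; exact: valid_swap.
Qed.

(** Two marked units suffice: if their relation to [F] respects the rule, they remain units on their
    own, and the third marked vertex stays outside both whatever [F] merges with. *)
Lemma extend2 A B H c1 c2 c3 A' B' (F : {set T}) : maxv A B H c1 c2 c3 ->
  [disjoint F & H] -> F != set0 -> A \subset A' -> A' \subset A :|: F ->
  B \subset B' -> B' \subset B :|: F -> [disjoint A' & B'] ->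
  (forall f, f \in F -> exists r a b, rung A' B' (H :|: F) r a b /\ f \in r) ->
  (forall c h f, c \in [:: c1; c2] -> h \in H -> same A B H c h -> f \in F -> e h f = both A' B' h f) -> False.
Proof.
move=> [V M] dF F0 AA AF BB BF dAB cov cl.
have nFH h : h \in H -> h \in F = false by move=> hH; apply/negbTE; rewrite (disjointFl dF).
have inA h : h \in H -> (h \in A') = (h \in A).
  move=> hH; apply/idP/idP; last exact: (subsetP AA h).
  by move/(subsetP AF); rewrite inE nFH // orbF.
have inB h : h \in H -> (h \in B') = (h \in B).
  move=> hH; apply/idP/idP; last exact: (subsetP BB h).
  by move/(subsetP BF); rewrite inE nFH // orbF.
have [sAH sBH dd [h1 h2 h3 [n1 n2 n3]] cv] := V.
have key c w : c \in [:: c1; c2] -> c \in H -> same A' B' (H :|: F) c w -> same A B H c w.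
  move=> cc cH cw; apply: contraT => ncw.
  have nP : ~ (w \in H /\ same A B H c w) by case=> _ k; rewrite k in ncw.
  have [u [v [_ /and3P [_ vH' luv] [uH cu] nv]]] :=
    connect_exit (P:=fun w => w \in H /\ same A B H c w) cw (conj cH (same_refl _ _ _ _)) nP.
  case: nv; move: vH' luv; rewrite inE => /orP [vH|vF].
    rewrite /link /both !inA // !inB // => luv; split=> //.
    by apply: same_trans cu _; apply: same1.
  by rewrite /link (cl c) // eqxx andbF.
have Vn : valid A' B' (H :|: F) c1 c2 c3.
  split=> //.
  - by apply: subset_trans AF _; apply: setSU.
  - by apply: subset_trans BF _; apply: setSU.
  - split; rewrite ?inE ?h1 ?h2 ?h3 //; split.
    + by apply: contra n1; apply: key; rewrite ?inE ?eqxx.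
    + by apply: contra n2; apply: key; rewrite ?inE ?eqxx.
    by apply: contra n3; apply: key; rewrite ?inE ?eqxx ?orbT.
  move=> h; rewrite inE => /orP [hH|]; last exact: cov.
  have [r [a [b [[pr aA bB rH hw] hr]]]] := cv h hH; exists r, a, b; split=> //; split=> //.
  - exact: (subsetP AA).
  - exact: (subsetP BB).
  - by move=> w /rH wH; rewrite inE wH.
  by move=> w wr; rewrite inA ?inB ?rH //; exact: hw.
have := M _ _ _ Vn AA BB (subsetUl _ _); have /set0Pn [f fF] := F0.
by move/subsetP/(_ f); rewrite inE fF orbT (disjointFr dF fF) => /(_ isT).
Qed.

(** [F] may be absorbed by the unit of [u], which contains at most one marked vertex; the other two
    serve in [extend2]. *)
Lemma extend A B H c1 c2 c3 A' B' (F : {set T}) u : maxv A B H c1 c2 c3 ->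
  [disjoint F & H] -> F != set0 -> A \subset A' -> A' \subset A :|: F ->
  B \subset B' -> B' \subset B :|: F -> [disjoint A' & B'] ->
  (forall f, f \in F -> exists r a b, rung A' B' (H :|: F) r a b /\ f \in r) ->
  (forall h f, h \in H -> ~~ same A B H u h -> f \in F -> e h f = both A' B' h f) -> False.
Proof.
move=> M dF F0 AA AF BB BF dAB cov cl.
have V := proj1 M; have [_ _ _ [h1 h2 h3 [n1 n2 n3]] _] := V.
have cl' c h f : ~~ same A B H u c -> h \in H -> same A B H c h -> f \in F -> e h f = both A' B' h f.
  by move=> nc hH ch fF; apply: cl => //; apply: nunit_r ch.
case: (boolP (same A B H u c1)) => k1; last case: (boolP (same A B H u c2)) => k2.
- apply: (extend2 (maxv_rot M) dF F0 AA AF BB BF dAB cov) => c h f.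
  rewrite !inE => /orP [] /eqP ->; apply: cl'.
    by apply: contra n1; exact: unit_tr.
  by apply: contra n2; exact: unit_tr.
- apply: (extend2 (maxv_rot (maxv_rot M)) dF F0 AA AF BB BF dAB cov) => c h f.
  rewrite !inE => /orP [] /eqP ->; apply: cl' => //.
  by apply: contra n3; exact: unit_tr.
apply: (extend2 M dF F0 AA AF BB BF dAB cov) => c h f.
by rewrite !inE => /orP [] /eqP ->; apply: cl'.
Qed.
End Struct.

(** * Paths that would enlarge a maximal structure *)

Section Ext.
Variables (T : finType) (e : rel T).
Hypothesis e_sym : symmetric e.
Hypothesis e_irr : irreflexive e.
Hypothesis noodd : forall c, hole e c -> ~~ odd (size c).
Hypothesis noanti : forall c, ~~ hole (compl e) c.
Hypothesis noprism : forall a1 a2 a3 q1 q2 q3, ~~ odd_prism e a1 a2 a3 q1 q2 q3.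
Implicit Types (s t r q Q F P : seq T) (x y z a b c d u v w h f : T) (X Y S A B H : {set T}).

Local Notation rung := (rung e).
Local Notation valid := (valid e).
Local Notation maxv := (maxv e).
Local Notation same := (same e).

(** The three rungs depend on [f]; finding a common triple for many such vertices is the difficulty
    met later. *)
Definition major A B H f := exists r1 a1 b1 r2 a2 b2 r3 a3 b3,
  [/\ rung A B H r1 a1 b1, rung A B H r2 a2 b2, rung A B H r3 a3 b3,
   [/\ ~~ same A B H a1 a2, ~~ same A B H a1 a3 & ~~ same A B H a2 a3] &
   two3 (e f a1) (e f a2) (e f a3) && two3 (e f b1) (e f b2) (e f b3)].

Lemma major_swap A B H c1 c2 c3 f : valid A B H c1 c2 c3 -> major A B H f -> major B A H f.
Proof.
move=> V [r1 [a1 [b1 [r2 [a2 [b2 [r3 [a3 [b3 [R1 R2 R3 [n1 n2 n3] /andP [k1 k2]]]]]]]]]]].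
have u r a b : rung A B H r a b -> same A B H a b.
  by move=> R; have [? ? _ _ _] := rung_in V R; apply: (rung_unit e_sym e_irr) R _ _.
have nn r a b r' a' b' : rung A B H r a b -> rung A B H r' a' b' -> ~~ same A B H a a' -> ~~ same B A H b b'.
  move=> R R' n; rewrite same_swap; apply: nunit_l (u _ _ _ R); exact: (nunit_r e_sym) (u _ _ _ R').
exists (rev r1), b1, a1, (rev r2), b2, a2, (rev r3), b3, a3; split.
- exact: rung_swap.
- exact: rung_swap.
- exact: rung_swap.
- by split; [apply: nn n1|apply: nn n2|apply: nn n3]; eassumption.
by rewrite k1 k2.
Qed.

Lemma tail_piece f r a b y : pth e r a b -> y \in r -> e f y -> y != a ->
  exists x P, [/\ pth e P x b, {subset P <= r}, forall w, w \in P -> e f w = (w == x), e f x & a \notin P].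
Proof.
move=> pr yr fy ya; have hs : has (e f) r by apply/hasP; exists y.
have [x [P [pP sP hP fx ha]]] := last_piece e_sym e_irr pr hs.
exists x, P; split=> //; apply/negP => aP; have [_ _ k] := ha aP.
by move: fy; rewrite k // (negPf ya).
Qed.

Section Max.
Variables (A B H : {set T}) (c1 c2 c3 : T).
Hypothesis M : maxv A B H c1 c2 c3.
Local Notation unit := (same A B H).
Local Notation rg := (rung A B H).
Let V : valid A B H c1 c2 c3 := proj1 M.

Section Path.
Variables (F : seq T) (f1 fk : T).
Hypothesis pF : pth e F f1 fk.
Hypothesis FH : forall w, w \in F -> w \notin H.

Let f1F : f1 \in F. Proof. exact: pth_in1 pF. Qed.
Let fkF : fk \in F. Proof. exact: pth_in2 pF. Qed.
Let Hne w h : w \in F -> h \in H -> w != h.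
Proof. by move=> wF; apply: contraTneq => <-; apply: FH. Qed.
Let nA w : w \in F -> w \notin A.
Proof. by move=> /FH; apply: contra; exact: (inAH V). Qed.
Let nB w : w \in F -> w \notin B.
Proof. by move=> /FH; apply: contra; exact: (inBH V). Qed.

(** [f1] joins [A], and [F] continued by the tail of a rung behind the last neighbour of [fk] is a
    new rung, possibly merging with the unit of [u]. *)
Lemma extA u y :
  (forall a, a \in A -> ~~ unit u a -> e f1 a) ->
  (forall w h, w \in F -> h \in H -> ~~ unit u h -> e w h -> w = f1 /\ h \in A) ->
  (forall w h, w \in F -> w != fk -> h \in H -> unit u h -> e w h -> h \in A) ->
  y \in H -> y \notin A -> unit u y -> e fk y -> False.
Proof.
move=> hA hout hin yH yA uy fky; have [r [a [b [R yr]]]] := on_rung V yH.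
have ya : y != a by rewrite -(rungAE R yr).
have [pr aA bB _ _] := R.
have [x [P [pP sP hP fx aP]]] := tail_piece pr yr fky ya.
have uP w : w \in P -> unit u w by move=> /sP wr; apply: same_trans uy (rung_unit e_sym e_irr R yr wr).
have PH w : w \in P -> w \in H by move=> /sP; apply: rungH R.
have PA w : w \in P -> w \notin A.
  by move=> wP; rewrite (rungAE R (sP _ wP)); apply: contraNneq aP => <-.
have pq : pth e (F ++ P) f1 b.
  apply: (pth_cat e_sym e_irr pF pP) => [w wF|w v wF vP].
    by apply/negP => /PH; apply/negP; exact: FH.
  case: (eqVneq w fk) => [->|wk] /=; first exact: hP.
  by apply/negP => ewv; have := hin _ _ wF wk (PH _ vP) (uP _ vP) ewv; rewrite (negPf (PA _ vP)).
apply: (extend e_sym (A':=f1 |: A) (B':=B) (F:=[set w in F]) (u:=u) M) => //.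
- by rewrite disjoint_subset; apply/subsetP => w; rewrite inE => /FH.
- by apply/set0Pn; exists f1; rewrite inE.
- exact: subsetUr.
- by rewrite setUC setUS // sub1set inE.
- exact: subsetUl.
- rewrite disjoint_subset; apply/subsetP => w; rewrite !inE => /orP [/eqP ->|]; first exact: nB.
  exact: (notAB V).
- move=> f; rewrite inE => fF; exists (F ++ P), f1, b; split; last by rewrite mem_cat fF.
  split=> //; first by rewrite !inE eqxx.
    by move=> w; rewrite mem_cat !inE => /orP [->|/PH ->]; rewrite ?orbT.
  move=> w; rewrite mem_cat => /orP [wF|wP]; split.
  + by rewrite !inE (negPf (nA wF)) orbF => /eqP.
  + by rewrite (negPf (nB wF)).
  + by rewrite !inE (negPf (PA _ wP)) orbF => /eqP.
  by rewrite (rungBE R (sP _ wP)) => /eqP.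
move=> h f hH nu; rewrite inE => fF; rewrite /both !inE (negPf (nA fF)) (negPf (nB fF)) andbF !orbF.
rewrite eq_sym (negPf (Hne f1F hH)) /= e_sym; apply/idP/andP => [efh|[hhA /eqP ->]]; last exact: hA.
by have [-> ->] := hout _ _ fF hH nu efh.
Qed.

Hypothesis k2 : f1 != fk.

Let sF : 1 < size F. Proof. exact: pth_size2 pF k2. Qed.

Lemma no_path_unit_unit x y : x \in H -> y \in H -> ~~ unit x y -> ~~ both A B x y ->
  (forall w h, w \in F -> w != fk -> h \in H -> e w h -> unit x h) ->
  (forall w h, w \in F -> w != f1 -> h \in H -> e w h -> unit y h) ->
  e f1 x -> e fk y -> False.
Proof.
move=> xH yH nxy nb N1 N2 fx fy.
have [Q1 [a1 [b1 [R1 x1]]]] := on_rung V xH; have [Q2 [a2 [b2 [R2 y2]]]] := on_rung V yH.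
have [Q3 [a3 [b3 [R3 n1 n2]]]] := third_rung e_sym e_irr V x y.
have [i1 j1 A1 B1 _] := rung_in V R1; have [i2 j2 A2 B2 _] := rung_in V R2; have [i3 _ _ _ _] := rung_in V R3.
have u1 := rung_unit e_sym e_irr R1 x1; have u2 := rung_unit e_sym e_irr R2 y2.
have u3 := rung_unit e_sym e_irr R3 i3.
have K : prism3 e Q1 a1 b1 Q2 a2 b2 Q3 a3 b3.
  apply: (rungs_prism e_sym e_irr V R1 R2 R3).
  - by apply: nunit_l (u1 _ i1); apply: (nunit_r e_sym) (u2 _ i2).
  - exact: nunit_l (u1 _ i1).
  - exact: nunit_l (u2 _ i2).
apply: (alpha e_sym e_irr noodd noprism K pF _ _ _ _ x1 fx y2 fy _ x1 fx y2 fy).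
- move=> w wF; split; apply/negP.
  + by move/(rungH R1); apply/negP; apply: FH.
  + by move/(rungH R2); apply/negP; apply: FH.
  + by move/(rungH R3); apply/negP; apply: FH.
- move=> w v wF wf vQ; apply/negP => /(N2 _ _ wF wf (rungH R1 vQ)) k.
  by case/negP: nxy; apply: same_trans (u1 _ vQ) _; rewrite (same_sym e_sym).
- move=> w v wF wf vQ; apply/negP => /(N1 _ _ wF wf (rungH R2 vQ)) k.
  by case/negP: nxy; apply: same_trans k _; rewrite (same_sym e_sym); exact: u2.
- move=> w v wF vQ; have vH := rungH R3 vQ; apply/negP => ewv.
  case: (eqVneq w f1) => wf.
    have k := N1 _ _ wF _ vH ewv; rewrite wf in k; have {}k := k k2.
    by case/negP: n1; apply: same_trans k _; rewrite (same_sym e_sym); exact: u3.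
  have k := N2 _ _ wF wf vH ewv.
  by case/negP: n2; apply: same_trans k _; rewrite (same_sym e_sym); exact: u3.
- by apply: contra nb => /andP [/eqP -> /eqP ->]; rewrite /both A1 A2.
- by apply: contra nb => /andP [/eqP -> /eqP ->]; rewrite /both B1 B2 orbT.
- by rewrite (negPf k2).
Qed.

(** Parity forces [f1] to see all of [A] outside the unit of [y], and then [extA] enlarges the
    structure. *)
Lemma no_path_A_unit x y : x \in A -> y \in H -> y \notin A -> ~~ unit y x ->
  (forall w h, w \in F -> w != fk -> h \in H -> e w h -> h \in A) ->
  (forall w h, w \in F -> w != f1 -> h \in H -> e w h -> unit y h) ->
  e f1 x -> e fk y -> False.
Proof.
move=> xA yH yA nyx N1 N2 fx fy.
have [Q2 [a2 [b2 [R2 y2]]]] := on_rung V yH; have [i2 j2 A2 B2 _] := rung_in V R2.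
have ya : y != a2 by rewrite -(rungAE R2 y2).
have [pr2 _ _ _ _] := R2.
have [x' [P [pP sP hP fx' aP]]] := tail_piece pr2 y2 fy ya.
have u2 := rung_unit e_sym e_irr R2 y2.
have uP w : w \in P -> unit y w by move=> /sP; apply: u2.
have PH w : w \in P -> w \in H by move=> /sP; apply: rungH R2.
have PA w : w \in P -> w \notin A.
  by move=> wP; rewrite (rungAE R2 (sP _ wP)); apply: contraNneq aP => <-.
have pq : pth e (F ++ P) f1 b2.
  apply: (pth_cat e_sym e_irr pF pP) => [w wF|w v wF vP].
    by apply/negP => /PH; apply/negP; exact: FH.
  case: (eqVneq w fk) => [->|wk] /=; first exact: hP.
  by apply/negP => ewv; have := N1 _ _ wF wk (PH _ vP) ewv; rewrite (negPf (PA _ vP)).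
(* If [f1] saw [z] but not [a], the path [F ++ P] would close both with the rung at [z] and with [z]
   followed by the rung at [a]. Both rungs have odd size, so one of the cycles would be odd. *)
have key z a : z \in A -> a \in A -> ~~ unit y z -> ~~ unit y a -> ~~ unit z a -> e f1 z -> e f1 a.
  move=> zA aA nz na nza fz; apply: contraT => nfa.
  have [r1 [b1 R1]] := rungA V zA; have [r3 [b3 R3]] := rungA V aA.
  have [i1 j1 _ B1 d1] := rung_in V R1; have [i3 j3 _ B3 d3] := rung_in V R3.
  have c12 : cross2 e r1 z b1 Q2 a2 b2.
    apply: (rung_cross e_sym e_irr V R1 R2); rewrite (same_sym e_sym).
    by apply: nunit_l nz (u2 _ i2).
  have c32 : cross2 e r3 a b3 Q2 a2 b2.
    apply: (rung_cross e_sym e_irr V R3 R2); rewrite (same_sym e_sym).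
    by apply: nunit_l na (u2 _ i2).
  have [d13 c13] := rung_cross e_sym e_irr V R1 R3 nza.
  have out w v r a' b' : w \in F -> rg r a' b' -> ~~ unit y a' -> v \in r -> e w v = (w == f1) && e f1 a' && (v == a').
    move=> wF R n vr; have [i _ _ _ _] := rung_in V R.
    have nv : ~~ unit y v by apply: (nunit_r e_sym) n (rung_unit e_sym e_irr R i vr).
    case: (eqVneq w f1) => [->|wf]; last first.
      by apply/negP => /(N2 _ _ wF wf (rungH R vr)); apply/negP.
    case: (eqVneq v a') => [->|va]; rewrite ?andbT //= andbF; apply/negP => ev.
    by have := N1 _ _ f1F k2 (rungH R vr) ev; rewrite (rungAE R vr) (negPf va).
  have mem w : w \in F ++ P -> w \in F \/ w \in P by rewrite mem_cat => /orP.
  have bF : b2 \notin F by apply: contraL (inBH V B2) => /FH.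
  have fP : f1 \notin P by apply/negP => /PH; apply/negP; apply: FH.
  have L1 : cross2 e (F ++ P) f1 b2 r1 z b1.
    split=> [w /mem [wF|wP]|w v /mem [wF|wP] vr].
    - by apply/negP => /(rungH R1); apply/negP; apply: FH.
    - by apply/negP => wr; case: c12 => k _; have := k _ wr; rewrite (sP _ wP).
    - rewrite (out _ _ _ _ _ wF R1 nz vr) fz andbT.
      by have -> : (w == b2) = false; [apply: contraNF bF => /eqP <-|rewrite orbF].
    case: c12 => _ k; rewrite e_sym k ?sP //.
    have -> : (w == a2) = false by apply: contraNF aP => /eqP <-.
    have -> : (w == f1) = false by apply: contraNF fP => /eqP <-.
    by rewrite andbF /= andbC.
  have zr3 : z \notin r3 by apply: d13.
  have pz : pth e (z :: r3) z b3.
    case: (R3) => p3 _ _ _ _; apply: (pth_cons e_sym e_irr p3 zr3) => v vr.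
    by rewrite c13 // eqxx (negPf d1) /= orbF.
  have L2 : cross2 e (F ++ P) f1 b2 (z :: r3) z b3.
    case: L1 => L1 L1'; split=> [w wq|w v wq].
      rewrite inE negb_or; apply/andP; split; first by apply: contraNneq (L1 _ wq) => ->.
      case/mem: wq => [wF|wP]; first by apply/negP => /(rungH R3); apply/negP; apply: FH.
      by apply/negP => wr; case: c32 => k _; have := k _ wr; rewrite (sP _ wP).
    rewrite inE => /orP [/eqP ->|vr].
      rewrite L1' // eqxx (negPf d1) andbF orbF andbT.
      have -> : (z == b3) = false by apply: contraNF zr3 => /eqP ->.
      by rewrite andbF orbF.
    have -> : (v == z) = false by apply: contraNF zr3 => /eqP <-.
    case/mem: wq => [wF|wP].
      rewrite (out _ _ _ _ _ wF R3 na vr) (negPf nfa) andbF /=.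
      by have -> : (w == b2) = false by apply: contraNF bF => /eqP <-.
    case: c32 => _ k; rewrite e_sym k ?sP //.
    have -> : (w == a2) = false by apply: contraNF aP => /eqP <-.
    by rewrite !andbF /= andbC.
  have [p1 _ _ _ _] := R1.
  have o1 := rung_odd e_sym e_irr noodd noprism V R1; have o3 := rung_odd e_sym e_irr noodd noprism V R3.
  have s1 := pth_size2 p1 d1; have s3 : 1 < size r3 by case: (R3) => p3 _ _ _ _; exact: pth_size2 p3 d3.
  have e1 := ladder_even e_sym e_irr noodd pq p1 L1; have e2 := ladder_even e_sym e_irr noodd pq pz L2.
  move: e1 e2; rewrite size_cat /=; move: sF s1 s3 o1 o3; clear; lia.
apply: (@extA y y) => //.
- move=> a aA na; have [r3 [a3 [b3 [R3 n1 n2]]]] := third_rung e_sym e_irr V y x.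
  have [_ _ A3 _ _] := rung_in V R3.
  case: (boolP (unit x a)) => xa; last exact: key xA _ _ _ _ fx.
  apply: (key a3) => //; first by rewrite (same_sym e_sym); apply: nunit_l xa.
  exact: (key x).
- move=> w h wF hH nu ewh; case: (eqVneq w f1) => [ew|wf]; last by rewrite (N2 _ _ wF wf hH ewh) in nu.
  by split=> //; apply: (N1 _ _ wF _ hH ewh); rewrite ew.
- by move=> w h wF wf hH _; exact: N1.
- exact: same_refl.
Qed.

Section AB.
Hypothesis hF : forall w h, w \in F -> h \in H -> e w h -> (w = f1 /\ h \in A) \/ (w = fk /\ h \in B).

Let inA w h : w \in F -> h \in A -> e w h = (w == f1) && e f1 h.
Proof.
move=> wF hA; case: (eqVneq w f1) => [->//|wf]; apply/negP => k.
case: (hF wF (inAH V hA) k) => -[ew]; first by rewrite ew eqxx in wf.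
by rewrite (negPf (notAB V hA)).
Qed.

Let inB w h : w \in F -> h \in B -> e w h = (w == fk) && e fk h.
Proof.
move=> wF hB; case: (eqVneq w fk) => [->//|wf]; apply/negP => k.
case: (hF wF (inBH V hB) k) => -[ew]; last by rewrite ew eqxx in wf.
by move/(notAB V); rewrite hB.
Qed.

Let inR w r a b v : w \in F -> rg r a b -> v \in r ->
  e w v = [&& w == f1, v == a & e f1 a] || [&& w == fk, v == b & e fk b].
Proof.
move=> wF R vr; case: (eqVneq v a) => [->|va] /=.
  have [ar _ aA bB dab] := rung_in V R; by rewrite inA // (negPf dab) andbF orbF.
rewrite andbF /=; case: (eqVneq v b) => [->|vb] /=.
  by have [_ br aA bB dab] := rung_in V R; rewrite inB.
rewrite andbF; apply/negP => k; case: (hF wF (rungH R vr) k) => -[_].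
  by rewrite (rungAE R vr) (negPf va).
by rewrite (rungBE R vr) (negPf vb).
Qed.

(** The cycle runs along the rung, through [z] and [a], and along [F]. It closes directly at [b']
    when [F] has even size and through a further seen vertex of [B] when it has odd size; it is odd
    either way. *)
Lemma AB_hole r a' b' a z : rg r a' b' -> a \in A -> unit a' a ->
  (forall v, v \in r -> (a != v) && ~~ e a v) -> z \in A -> ~~ unit a' z ->
  e f1 a -> ~~ e f1 z -> ~~ e f1 a' -> e fk b' = ~~ odd (size F) ->
  (odd (size F) -> exists2 b, b \in B & ~~ unit a' b && e fk b) -> False.
Proof.
move=> R aA ua ha zA nz fa fz fa' fb' hb.
have [ar br aA' bB' dab] := rung_in V R.
have ur v : v \in r -> unit a' v by exact: rung_unit R ar.
have zr : z \notin r by apply/negP => /ur k; rewrite k in nz.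
have [pr _ _ _ _] := R.
have diff u v : u \in H -> v \in H -> unit a' u -> ~~ unit a' v -> e u v = both A B u v.
  by move=> uH vH k1 k2'; apply: (@diffunit _ _ A B H) => //; apply: nunit_l k1.
have zH := inAH V zA; have aH := inAH V aA.
have eza : e z a by rewrite e_sym (diff _ _ aH zH ua nz) /both aA zA.
have nza : z != a by apply: contraTneq eza => ->; rewrite e_irr.
have pP : pth e (z :: r) z b'.
  apply: (pth_cons e_sym e_irr pr zr) => v vr.
  by rewrite e_sym (diff _ _ (rungH R vr) zH (ur _ vr) nz) /both zA (negPf (notAB V zA)) andbF orbF andbT (rungAE R vr).
have aF : a \notin F by apply/negP => /FH; rewrite aH.
have pR : pth e (a :: F) a fk.
  by apply: (pth_cons e_sym e_irr pF aF) => w wF; rewrite e_sym inA // fa andbT.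
have base v w : v \in z :: r -> w \in a :: F ->
    (v != w) && (e v w == (v == z) && (w == a) || [&& v == b', w == fk & ~~ odd (size F)]).
  rewrite !inE => /orP [/eqP ->|vr] /orP [/eqP ->|wF].
  - by rewrite nza eza !eqxx.
  - rewrite eq_sym Hne // e_sym inA // (negPf fz) andbF eqxx /=.
    have -> : (w == a) = false by apply: contraNF aF => /eqP <-.
    by have -> : (z == b') = false by apply: contraNF zr => /eqP ->.
  - have /andP [k1 k2'] := ha _ vr; rewrite eq_sym k1 e_sym (negPf k2').
    have -> : (v == z) = false by apply: contraNF zr => /eqP <-.
    by have -> : (a == fk) = false by [apply: contraNF aF => /eqP ->]; rewrite !andbF.
  have -> : (v == z) = false by apply: contraNF zr => /eqP <-.
  rewrite eq_sym (Hne wF (rungH R vr)) e_sym (inR wF R vr) (negPf fa') !andbF /= fb'.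
  by apply/eqP; case: (w == fk); case: (v == b').
have zb : (z == b') = false by apply: contraNF zr => /eqP ->.
have afk : (a == fk) = false by apply: contraNF aF => /eqP ->.
have o := rung_odd e_sym e_irr noodd noprism V R.
have s2 := pth_size2 pr dab.
case oF: (odd (size F)) hb base => hb base; last first.
  have C : cross2 e (z :: r) z b' (a :: F) a fk.
    split=> [v vP|v w vP wP]; last by have /andP [_ /eqP ->] := base _ _ vP wP; rewrite andbT.
    by apply/negP => vP'; have := base _ _ vP vP'; rewrite eqxx.
  have := ladder_even e_sym e_irr noodd pP pR C; rewrite /=; move: o oF s2; clear; lia.
have [b bB /andP [nb fb]] := hb isT; have bH := inBH V bB.
have bF : b \notin F by apply/negP => /FH; rewrite bH.
have ba : (b == a) = false by apply/negP => /eqP k; move: (notAB V aA); rewrite -k bB.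
have bR : b \notin a :: F by rewrite inE ba.
have pR2 : pth e (rcons (a :: F) b) a b.
  apply: (pth_rcons e_sym e_irr pR bR) => w; rewrite inE => /orP [/eqP ->|wF].
    by rewrite (negPf (nadjBA e_sym e_irr noodd noprism V aA bB)) afk.
  by rewrite e_sym inB // fb andbT.
have C : cross2 e (z :: r) z b' (rcons (a :: F) b) a b.
  split=> [v vP|v w vP].
    rewrite mem_rcons inE negb_or; apply/andP; split; last first.
      by apply/negP => vP'; have := base _ _ vP vP'; rewrite eqxx.
    move: vP; rewrite inE => /orP [/eqP ->|vr]; apply/negP => /eqP k.
      by move: (notAB V zA); rewrite k bB.
    by move: nb; rewrite -k ur.
  rewrite mem_rcons inE => /orP [/eqP ->|wP].
    rewrite ba andbF eqxx andbT /=; move: vP; rewrite inE => /orP [/eqP ->|vr].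
      by rewrite (negPf (nadjAB e_sym e_irr noodd noprism V zA bB)) zb.
    rewrite (diff _ _ (rungH R vr) bH (ur _ vr) nb) /both bB andbT (rungBE R vr).
    by have -> : (b \in A) = false; [apply/negP => /(notAB V); rewrite bB|rewrite andbF].
  have /andP [_ /eqP ->] := base _ _ vP wP; rewrite !andbF orbF.
  have -> : (w == b) = false by apply: contraNF bR => /eqP <-.
  by rewrite andbF orbF.
have := ladder_even e_sym e_irr noodd pP pR2 C; rewrite size_rcons /=; move: o oF s2; clear; lia.
Qed.

(** The flags say whether [f1] is joined to the [A] vertices, and [fk] to the [B] vertices, of two
    marked units. A false flag keeps that end of [F] off the side, and the new rung is prolonged by
    [x] or [y] instead. *)
Lemma extend_by_path (tA tB : bool) x y : x \in A -> e f1 x -> y \in B -> e fk y ->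
  (forall c h, c \in [:: c1; c2] -> unit c h -> (h \in A -> e f1 h = tA) /\ (h \in B -> e fk h = tB)) -> False.
Proof.
move=> xA fx yB fy hc.
have xH := inAH V xA; have yH := inBH V yB.
have xF : x \notin F by apply/negP => /FH; rewrite xH.
have yF : y \notin F by apply/negP => /FH; rewrite yH.
have yA : y \notin A by apply/negP => /(notAB V); rewrite yB.
have xB := notAB V xA.
pose hd := if tA then f1 else x; pose tl := if tB then fk else y.
pose s := if tA then F else x :: F; pose q := if tB then s else rcons s y.
have ps : pth e s hd fk.
  rewrite /s /hd; case: tA {hc hd q s} => //.
  by apply: (pth_cons e_sym e_irr pF xF) => w wF; rewrite e_sym inA // fx andbT.
have ms w : w \in s -> (w \in F) || (~~ tA && (w == x)).
  by rewrite /s; case: (tA) => [->//|]; rewrite inE => /orP [->|->]; rewrite ?orbT.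
have ys : y \notin s.
  apply/negP => /ms; rewrite (negPf yF) /= => /andP [_ /eqP k]; by rewrite k xA in yA.
have pq : pth e q hd tl.
  rewrite /q /tl; case: tB {hc tl q} => //.
  apply: (pth_rcons e_sym e_irr ps ys) => w /ms /orP [wF|/andP [_ /eqP ->]].
    by rewrite e_sym inB // fy andbT.
  rewrite (negPf (nadjBA e_sym e_irr noodd noprism V xA yB)); apply/esym/negbTE.
  by apply: contraNneq xF => ->.
have mq w : w \in q -> [|| w \in F, ~~ tA && (w == x) | ~~ tB && (w == y)].
  rewrite /q; case: (tB) => [/ms /orP [->//|->]|]; rewrite ?orbT //.
  by rewrite mem_rcons inE => /orP [->|/ms /orP [->//|->]]; rewrite ?orbT.
pose A' := if tA then f1 |: A else A; pose B' := if tB then fk |: B else B.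
have A'E w : (w \in A') = (w \in A) || tA && (w == f1).
  by rewrite /A'; case: (tA); rewrite ?inE /= ?orbF // orbC.
have B'E w : (w \in B') = (w \in B) || tB && (w == fk).
  by rewrite /B'; case: (tB); rewrite ?inE /= ?orbF // orbC.
apply: (extend2 (A':=A') (B':=B') (F:=[set w in F]) M) => //.
- by rewrite disjoint_subset; apply/subsetP => w; rewrite inE => /FH.
- by apply/set0Pn; exists f1; rewrite inE.
- by apply/subsetP => w wA; rewrite A'E wA.
- by apply/subsetP => w; rewrite A'E !inE => /orP [->//|/andP [_ /eqP ->]]; rewrite f1F orbT.
- by apply/subsetP => w wA; rewrite B'E wA.
- by apply/subsetP => w; rewrite B'E !inE => /orP [->//|/andP [_ /eqP ->]]; rewrite fkF orbT.
- rewrite disjoint_subset; apply/subsetP => w; rewrite A'E !inE B'E negb_or.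
  case/orP => [wA|/andP [_ /eqP ->]]; last by rewrite (negPf (nB f1F)) (negPf k2) andbF.
  rewrite (notAB V wA) /= negb_and; apply/orP; right; apply: contraTneq wA => ->; exact: nA.
- move=> f; rewrite inE => fF; exists q, hd, tl; split; last first.
    by rewrite /q /s; case: (tB); case: (tA); rewrite ?mem_rcons ?inE fF ?orbT.
  split=> //.
  + by rewrite A'E /hd; case: (tA); rewrite ?eqxx ?orbT // xA.
  + by rewrite B'E /tl; case: (tB); rewrite ?eqxx ?orbT // yB.
  + by move=> w /mq; rewrite !inE => /or3P [->|/andP [_ /eqP ->]|/andP [_ /eqP ->]]; rewrite ?xH ?yH ?orbT.
  move=> w /mq wq; rewrite A'E B'E /hd /tl; case/or3P: wq => [wF|/andP [/negPf -> /eqP ->]|/andP [/negPf -> /eqP ->]].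
  + rewrite (negPf (nA wF)) (negPf (nB wF)) /=.
    by split=> /andP [-> /eqP].
  + split=> //; rewrite (negPf xB) /= => /andP [_ /eqP k]; by rewrite k fkF in xF.
  split=> //; rewrite (negPf yA) /= => /andP [_ /eqP k]; by rewrite k f1F in yF.
move=> c h f cc hH ch; rewrite inE => fF; have [k1 k2'] := hc _ _ cc ch.
rewrite /both !A'E !B'E (negPf (nA fF)) (negPf (nB fF)) /=.
have -> : (h == f1) = false by rewrite eq_sym (negPf (Hne f1F hH)).
have -> : (h == fk) = false by rewrite eq_sym (negPf (Hne fkF hH)).
rewrite !andbF !orbF e_sym.
case: (boolP (h \in A)) => hA.
  by rewrite inA // k1 // (negPf (notAB V hA)) /= orbF andbC.
case: (boolP (h \in B)) => hB; first by rewrite inB // k2' //= andbC.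
by apply/negP => k; case: (hF fF hH k) => -[_ kk]; rewrite kk in hA hB.
Qed.

(** This and the next two lemmas read off the parity of [F] from a cycle along one rung; a missed
    end of the rung is reached by a detour over a seen vertex of another unit. *)
Lemma full_odd r a b : rg r a b -> e f1 a -> e fk b -> odd (size F).
Proof.
move=> R fa fb; have [pr _ _ _ _] := R; have o := rung_odd e_sym e_irr noodd noprism V R.
have [_ _ _ _ d] := rung_in V R; have s2 := pth_size2 pr d.
have C : cross2 e F f1 fk r a b.
  split=> [w wF|w v wF vr]; first by apply/negP => /(rungH R); apply/negP; apply: FH.
  by rewrite (inR wF R vr) fa fb !andbT.
have := ladder_even e_sym e_irr noodd pF pr C; move: o sF s2; clear; lia.
Qed.

Lemma enter_even r a' b a : rg r a' b -> a \in A -> ~~ unit a a' -> e f1 a -> ~~ e f1 a' -> e fk b -> ~~ odd (size F).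
Proof.
move=> R aA na fa fa' fb; have [pr _ _ _ _] := R; have o := rung_odd e_sym e_irr noodd noprism V R.
have [ir _ _ bB d] := rung_in V R; have s2 := pth_size2 pr d.
have na' v : v \in r -> ~~ unit a v.
  by move=> vr; apply: (nunit_r e_sym) na (rung_unit e_sym e_irr R ir vr).
have ar : a \notin r by apply/negP => /na'; rewrite same_refl.
have aH := inAH V aA; have aB := notAB V aA.
have aF : a \notin F by apply/negP => /FH; rewrite aH.
have p : pth e (a :: r) a b.
  apply: (pth_cons e_sym e_irr pr ar) => v vr.
  by rewrite (diffunit aH (rungH R vr) (na' _ vr)) /both aA (negPf aB) orbF (rungAE R vr).
have C : cross2 e F f1 fk (a :: r) a b.
  split=> [w wF|w v wF].
    rewrite inE negb_or; apply/andP; split; first by apply: contraNneq aF => <-.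
    by apply/negP => /(rungH R); apply/negP; apply: FH.
  rewrite inE => /orP [/eqP ->|vr].
    rewrite inA // fa eqxx; have -> : (a == b) = false by apply: contraNF aB => /eqP ->.
    by rewrite andbF orbF.
  have -> : (v == a) = false by apply: contraNF ar => /eqP <-.
  by rewrite (inR wF R vr) (negPf fa') fb !andbT !andbF.
have := ladder_even e_sym e_irr noodd pF p C; rewrite /=; move: o sF s2; clear; lia.
Qed.

Lemma missed_odd r a' b' a b : rg r a' b' -> a \in A -> b \in B -> ~~ unit a a' -> ~~ unit a b -> ~~ unit b a' ->
  e f1 a -> e fk b -> ~~ e f1 a' -> ~~ e fk b' -> odd (size F).
Proof.
move=> R aA bB na nab nb fa fb fa' fb'; have [pr _ _ _ _] := R; have o := rung_odd e_sym e_irr noodd noprism V R.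
have [ir _ _ bB' d] := rung_in V R; have s2 := pth_size2 pr d.
have na' v : v \in r -> ~~ unit a v.
  by move=> vr; apply: (nunit_r e_sym) na (rung_unit e_sym e_irr R ir vr).
have nb' v : v \in r -> ~~ unit b v.
  by move=> vr; apply: (nunit_r e_sym) nb (rung_unit e_sym e_irr R ir vr).
have ar : a \notin r by apply/negP => /na'; rewrite same_refl.
have br : b \notin r by apply/negP => /nb'; rewrite same_refl.
have aH := inAH V aA; have aB := notAB V aA; have bH := inBH V bB.
have bA : b \notin A by apply/negP => /(notAB V); rewrite bB.
have aF : a \notin F by apply/negP => /FH; rewrite aH.
have bF : b \notin F by apply/negP => /FH; rewrite bH.
have p : pth e (a :: r) a b'.
  apply: (pth_cons e_sym e_irr pr ar) => v vr.
  by rewrite (diffunit aH (rungH R vr) (na' _ vr)) /both aA (negPf aB) orbF (rungAE R vr).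
have ab : (a == b) = false by apply: contraNF aB => /eqP ->.
have bs : b \notin a :: r by rewrite inE negb_or br eq_sym ab.
have p2 : pth e (rcons (a :: r) b) a b.
  apply: (pth_rcons e_sym e_irr p bs) => v; rewrite inE => /orP [/eqP ->|vr].
    rewrite (negPf (nadjBA e_sym e_irr noodd noprism V aA bB)); apply/esym; by apply: contraNF aB => /eqP ->.
  by rewrite (diffunit bH (rungH R vr) (nb' _ vr)) /both bB (negPf bA) /= (rungBE R vr).
have C : cross2 e F f1 fk (rcons (a :: r) b) a b.
  split=> [w wF|w v wF].
    rewrite mem_rcons !inE !negb_or; apply/and3P; split.
    - by apply: contraNneq bF => <-.
    - by apply: contraNneq aF => <-.
    by apply/negP => /(rungH R); apply/negP; apply: FH.
  rewrite mem_rcons inE => /orP [/eqP ->|]; first by rewrite inB // fb eqxx (eq_sym b a) ab andbF.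
  rewrite inE => /orP [/eqP ->|vr]; first by rewrite inA // fa eqxx ab andbF orbF.
  have -> : (v == a) = false by apply: contraNF ar => /eqP <-.
  have -> : (v == b) = false by apply: contraNF br => /eqP <-.
  by rewrite (inR wF R vr) (negPf fa') (negPf fb') !andbF.
have := ladder_even e_sym e_irr noodd pF p2 C; rewrite size_rcons /=; move: o sF s2; clear; lia.
Qed.
End AB.
End Path.
End Max.
End Ext.

Section Ext2.
Variables (T : finType) (e : rel T).
Hypothesis e_sym : symmetric e.
Hypothesis e_irr : irreflexive e.
Hypothesis noodd : forall c, hole e c -> ~~ odd (size c).
Hypothesis noanti : forall c, ~~ hole (compl e) c.
Hypothesis noprism : forall a1 a2 a3 q1 q2 q3, ~~ odd_prism e a1 a2 a3 q1 q2 q3.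
Implicit Types (s t r q Q F P : seq T) (x y z a b c d u v w h f : T) (X Y S A B H : {set T}).

Local Notation rung := (rung e).
Local Notation valid := (valid e).
Local Notation maxv := (maxv e).
Local Notation same := (same e).
Local Notation major := (major e).

Lemma nsame_sym A B H u v : ~~ same A B H u v -> ~~ same A B H v u.
Proof. by rewrite same_sym. Qed.

Lemma pigeon3 (F1 F2 F3 M1 M2 M3 : Prop) : F1 \/ F2 -> F1 \/ F3 -> F2 \/ F3 ->
  M1 \/ M2 -> M1 \/ M3 -> M2 \/ M3 ->
  (F1 -> M1 -> F2 \/ F3 -> M2 \/ M3 -> False) -> (F2 -> M2 -> F1 \/ F3 -> M1 \/ M3 -> False) ->
  (F3 -> M3 -> F1 \/ F2 -> M1 \/ M2 -> False) -> False.
Proof. tauto. Qed.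

Section AB1.
Variables (A B H : {set T}) (c1 c2 c3 : T).
Hypothesis M : maxv A B H c1 c2 c3.
Local Notation unit := (same A B H).
Local Notation rg := (rung A B H).
Let V : valid A B H c1 c2 c3 := proj1 M.
Variables (F : seq T) (f1 fk : T).
Hypothesis pF : pth e F f1 fk.
Hypothesis FH : forall w, w \in F -> w \notin H.
Hypothesis k2 : f1 != fk.
Hypothesis hF : forall w h, w \in F -> h \in H -> e w h -> (w = f1 /\ h \in A) \/ (w = fk /\ h \in B).
Hypothesis hx : forall u, exists x, [/\ x \in A, e f1 x & ~~ unit u x].
Hypothesis hy : forall u, exists y, [/\ y \in B, e fk y & ~~ unit u y].

Let pF' := pth_rev e_sym e_irr pF.
Let FH' w : w \in rev F -> w \notin H. Proof. by rewrite mem_rev; exact: FH. Qed.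
Let k2' : fk != f1. Proof. by rewrite eq_sym. Qed.
Let hF' w h : w \in rev F -> h \in H -> e w h -> (w = fk /\ h \in B) \/ (w = f1 /\ h \in A).
Proof. by rewrite mem_rev => wF hH /(hF wF hH) [] ?; [right|left]. Qed.

(** The parity lemmas settle each pattern of seen and missed ends. When both are missed, the detours
    need seen vertices in suitably different units, whence the case analysis with [hx] and [hy]. *)
Lemma rung_types r a b : rg r a b -> e f1 a = (e fk b == odd (size F)).
Proof.
move=> R; have [ar br aA bB d] := rung_in V R.
have uab : unit a b by exact: (rung_unit e_sym e_irr R ar br).
have missed r' a' b' x y : rg r' a' b' -> ~~ e f1 a' -> ~~ e fk b' -> x \in A -> y \in B -> e f1 x -> e fk y ->
    ~~ unit a' x -> ~~ unit a' y -> ~~ unit x y -> ~~ odd (size F) -> False.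
  move=> R' n1 n2 xA yB fx fy nx ny nxy; apply/negP; rewrite negbK.
  apply: (missed_odd e_sym e_irr noodd noprism M pF FH k2 hF R' xA yB) => //; exact: nsame_sym.
case fa: (e f1 a); case fb: (e fk b); case o: (odd (size F)) => //=.
- by have := full_odd e_sym e_irr noodd noprism M pF FH k2 hF R fa fb; rewrite o.
- have [y [yB fy ny]] := hy a.
  have := enter_even e_sym e_irr noodd noprism (maxv_swap e_sym e_irr M) pF' FH' k2' hF' (rung_swap e_sym e_irr R) yB.
  rewrite size_rev o fb fa fy => h; apply/esym; apply: h => //.
  by rewrite same_swap (same_sym e_sym); apply: nunit_l uab.
- have [x [xA fx nx]] := hx a.
  by have := enter_even e_sym e_irr noodd noprism M pF FH k2 hF R xA (nsame_sym nx) fx (negbT fa) fb; rewrite o.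
exfalso; have no := negbT o; have na := negbT fa; have nb := negbT fb.
have [x [xA fx nx]] := hx a; have [y [yB fy ny]] := hy a.
case: (boolP (unit x y)) => xy; last exact: (missed _ _ _ x y R).
have yx : unit y x by rewrite (same_sym e_sym).
have [r4 [a4 [b4 [R4 n4 n4']]]] := third_rung e_sym e_irr V a x.
have [ar4 br4 aA4 bB4 _] := rung_in V R4.
have u4 := rung_unit e_sym e_irr R4 ar4 br4.
case: (boolP (e f1 a4)) => f4.
  apply: (missed _ _ _ a4 y R) => //; apply: nsame_sym; exact: nunit_l xy.
case: (boolP (e fk b4)) => g4.
  by apply: (missed _ _ _ x b4 R) => //; [exact: (nunit_r e_sym n4 u4)|exact: (nunit_r e_sym n4' u4)].
have [x2 [xA2 fx2 nx2]] := hx x.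
have nx2y : ~~ unit x2 y by apply: nsame_sym; exact: nunit_l xy.
case: (boolP (unit a x2)) => ax2; last exact: (missed _ _ _ x2 y R).
apply: (missed _ _ _ x2 y R4) => //; apply: nsame_sym; first exact: nunit_l ax2.
exact: nunit_l xy.
Qed.

(** [split_unit] finds a seen and a missed rung of the unit with nonadjacent ends on one side, and
    [AB_hole] on that side gives an odd hole. The rungs outside the unit provide its remaining
    vertices. *)
Lemma mixed_unit z r0 a0 b0 r1 a1 b1 r2 a2 b2 r3 a3 b3 :
  rg r0 a0 b0 -> unit z a0 -> e f1 a0 -> rg r1 a1 b1 -> unit z a1 -> ~~ e f1 a1 ->
  rg r2 a2 b2 -> ~~ unit z a2 -> e f1 a2 -> rg r3 a3 b3 -> ~~ unit z a3 -> ~~ e f1 a3 -> False.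
Proof.
move=> R0 z0 p0 R1 z1 p1 R2 z2 p2 R3 z3 p3.
have [r [a [b [r' [a' [b' [R R' [za za'] /andP [pa pa'] [cr nab]]]]]]]] :=
  split_unit (phi := e f1) (psi := fun b => e fk b == odd (size F)) e_sym e_irr V
   (fun r a b R _ => rung_types R) R0 z0 p0 R1 z1 p1.
have [ar br aA bB d] := rung_in V R; have [ar' br' aA' bB' d'] := rung_in V R'.
have [ar2 br2 aA2 bB2 _] := rung_in V R2; have [ar3 br3 aA3 bB3 _] := rung_in V R3.
have t := rung_types R; have t' := rung_types R'; have t2 := rung_types R2; have t3 := rung_types R3.
have u := rung_unit e_sym e_irr R ar br; have u' := rung_unit e_sym e_irr R' ar' br'.
have u2 := rung_unit e_sym e_irr R2 ar2 br2; have u3 := rung_unit e_sym e_irr R3 ar3 br3.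
have zb : unit z b := same_trans za u; have zb' : unit z b' := same_trans za' u'.
have zb2 := nunit_r e_sym z2 u2; have zb3 := nunit_r e_sym z3 u3.
have na' x : ~~ unit z x -> ~~ unit a' x by move=> n; exact: nunit_l za'.
have nb' x : ~~ unit z x -> ~~ unit b' x by move=> n; exact: nunit_l zb'.
have nb x : ~~ unit z x -> ~~ unit b x by move=> n; exact: nunit_l zb.
rewrite pa in t; rewrite (negPf pa') in t'; rewrite p2 in t2; rewrite (negPf p3) in t3.
case/orP: nab => nab.
  apply: (AB_hole e_sym e_irr noodd noprism M pF FH hF R' aA (z := a3)) => //; rewrite ?na' //.
  - by rewrite (same_sym e_sym); exact: (unit_tr e_sym za za').
  - move=> v vr; have /andP [-> /implyP h] := cr _ _ ar vr; apply/negP => k.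
    have := h k; rewrite /both aA (negPf (notAB V aA)) orbF /= (rungAE R' vr) => /eqP ev.
    by rewrite -ev k in nab.
  - by case: (e fk b') t'; case: (odd (size F)).
  by move=> o; exists b2; rewrite ?na' //=; move: t2; rewrite o; case: (e fk b2).
have MS := maxv_swap e_sym e_irr M.
have nba b'' : b'' \in B -> b'' \notin A by move=> k; apply/negP => /(notAB V); rewrite k.
case o: (odd (size F)).
  have e0 : ~~ odd (size (rev F)) = false by rewrite size_rev o.
  apply: (AB_hole e_sym e_irr noodd noprism MS pF' FH' hF' (rung_swap e_sym e_irr R') bB (z := b3)) => //;
    rewrite 1?same_swap ?nb' //.
  - exact: (unit_tr e_sym zb' zb).
  - move=> v; rewrite mem_rev => vr; have /andP [-> /implyP h] := cr _ _ br vr; apply/negP => k.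
    have := h k; rewrite /both bB (negPf (nba _ bB)) /= (rungBE R' vr) => /eqP ev.
    by rewrite -ev k in nab.
  - by move: t; rewrite o; case: (e fk b).
  - by move: t3; rewrite o; case: (e fk b3).
  - by move: t'; rewrite o; case: (e fk b').
  - by rewrite e0; apply/negbTE.
  by move=> _; exists a2; rewrite // same_swap nb'.
apply: (AB_hole e_sym e_irr noodd noprism MS pF' FH' hF' (rung_swap e_sym e_irr R) bB' (z := b2)) => //;
  rewrite 1?same_swap ?nb ?size_rev ?o //.
- exact: (unit_tr e_sym zb zb').
- move=> v; rewrite mem_rev => vr; have /andP [h1 /implyP h] := cr _ _ vr br'; rewrite eq_sym h1 /=.
  apply/negP; rewrite e_sym => k.
  have := h k; rewrite /both bB' (negPf (nba _ bB')) !andbF andbT /= (rungBE R vr) => /eqP ev.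
  by rewrite -ev k in nab.
- by move: t'; rewrite o; case: (e fk b').
- by move: t2; rewrite o; case: (e fk b2).
by move: t; rewrite o; case: (e fk b).
Qed.

(** A common type on two marked units prescribes how [F] must be attached, so [extend_by_path]
    applies; the second flag comes from [rung_types]. *)
Lemma two_pure (t : bool) : (forall r a b, rg r a b -> unit c1 a || unit c2 a -> e f1 a = t) -> False.
Proof.
move=> pure; have [x [xA fx _]] := hx c1; have [y [yB fy _]] := hy c1.
apply: (extend_by_path e_sym e_irr noodd noprism M pF FH k2 hF (tA := t) (tB := t == odd (size F)) xA fx yB fy).
move=> c h cc ch; have cu a : unit c a -> unit c1 a || unit c2 a.
  by move: cc; rewrite !inE => /orP [] /eqP ->  ->; rewrite ?orbT.
split=> [hA|hB].
  by have [r [b R]] := rungA V hA; apply: (pure _ _ _ R); exact: cu.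
have [r [a R]] := rungB V hB; have [ar br _ _ _] := rung_in V R.
have := pure _ _ _ R (cu _ (same_trans ch (rung_unit e_sym e_irr R br ar))).
by rewrite (rung_types R) => <-; case: (e fk h); case: (odd (size F)).
Qed.
End AB1.

(** By [two_pure] each of the two types occurs in at least two of the three marked units. Hence some
    unit contains both, and both occur outside it as well, against [mixed_unit]. *)
Lemma no_path_A_B A B H c1 c2 c3 F f1 fk : maxv A B H c1 c2 c3 -> pth e F f1 fk ->
  (forall w, w \in F -> w \notin H) -> f1 != fk ->
  (forall w h, w \in F -> h \in H -> e w h -> (w = f1 /\ h \in A) \/ (w = fk /\ h \in B)) ->
  (forall u, exists x, [/\ x \in A, e f1 x & ~~ same A B H u x]) ->
  (forall u, exists y, [/\ y \in B, e fk y & ~~ same A B H u y]) -> False.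
Proof.
move=> M pF FH k2 hF hx hy; have V := proj1 M.
pose tp c (t : bool) := exists r a b, [/\ rung A B H r a b, same A B H c a & e f1 a = t].
have two d1 d2 d3 (t : bool) : maxv A B H d1 d2 d3 -> tp d1 t \/ tp d2 t.
  move=> M'; apply: NNPP => n; apply: (two_pure (t := ~~ t) M' pF FH k2 hF hx hy) => r a b R /orP ua.
  case ft: (e f1 a); case: (t) n => // n; case: n; case: ua => ua; [left|right|left|right]; exists r, a, b; split=> //.
have mix d1 d2 d3 : maxv A B H d1 d2 d3 -> tp d1 true -> tp d1 false -> tp d2 true \/ tp d3 true -> tp d2 false \/ tp d3 false -> False.
  move=> M' [r0 [a0 [b0 [R0 z0 p0]]]] [r1 [a1 [b1 [R1 z1 p1]]]] h2 h3.
  have [_ _ _ [_ _ _ [n2 n3 _]] _] := proj1 M'.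
  have out (t : bool) : tp d2 t \/ tp d3 t -> exists r a b, [/\ rung A B H r a b, ~~ same A B H d1 a & e f1 a = t].
    case=> -[r [a [b [R z p]]]]; exists r, a, b; split=> //; [exact: (nunit_r e_sym n2 z)|exact: (nunit_r e_sym n3 z)].
  have [r2 [a2 [b2 [R2 z2 p2]]]] := out _ h2; have [r3 [a3 [b3 [R3 z3 p3]]]] := out _ h3.
  exact: (mixed_unit M pF FH k2 hF hx hy R0 z0 p0 R1 z1 (negbT p1) R2 z2 p2 R3 z3 (negbT p3)).
have M2 := maxv_rot e_sym M; have M3 := maxv_rot e_sym M2.
apply: (pigeon3 (two _ _ _ true M) _ (two _ _ _ true M2) (two _ _ _ false M) _ (two _ _ _ false M2) (mix _ _ _ M)).
- by case: (two _ _ _ true M3) => ?; [right|left].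
- by case: (two _ _ _ false M3) => ?; [right|left].
- by move=> k1 k3 k4 k5; apply: (mix _ _ _ M2) => //; [case: k4|case: k5] => ?; [right|left|right|left].
exact: (mix _ _ _ M3).
Qed.

(** Comparison with all other rungs through [vertex_types] shows that outside the unit of [a1] the
    vertex sees exactly the [A] ends; as a path with one vertex it is then added by [extA]. *)
Lemma special_ext A B H c1 c2 c3 f r1 a1 b1 r2 a2 b2 r3 a3 b3 : maxv A B H c1 c2 c3 ->
  f \notin H -> ~ major A B H f ->
  rung A B H r1 a1 b1 -> rung A B H r2 a2 b2 -> rung A B H r3 a3 b3 ->
  ~~ same A B H a1 a2 -> ~~ same A B H a1 a3 -> ~~ same A B H a2 a3 ->
  special e f r1 a1 r2 a2 r3 a3 -> False.
Proof.
move=> M fH nm R1 R2 R3 n12 n13 n23 [h2 h3 [y yr1 /andP [ya fy]]]; have V := proj1 M.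
have [i1 j1 A1 B1 d1] := rung_in V R1; have [i2 j2 A2 B2 d2] := rung_in V R2; have [i3 j3 A3 B3 d3] := rung_in V R3.
have nf r a b : rung A B H r a b -> f \notin r by move=> R; apply/negP => /(rungH R); apply/negP.
have main r a b r' a' b' : rung A B H r a b -> rung A B H r' a' b' -> ~~ same A B H a1 a -> ~~ same A B H a1 a' ->
    ~~ same A B H a' a -> (forall v, v \in r' -> e f v = (v == a')) -> forall v, v \in r -> e f v = (v == a).
  move=> R R' n n' n'' hr'.
  have [i j Aa Bb d] := rung_in V R; have [i' j' Aa' Bb' d'] := rung_in V R'.
  have K := rungs_prism e_sym e_irr V R1 R' R n' n n''.
  have fa' : e f a' by rewrite hr' ?eqxx.
  have fb' : ~~ e f b' by rewrite hr' // eq_sym.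
  have nmj : ~~ (two3 (e f a1) (e f a') (e f a) && two3 (e f b1) (e f b') (e f b)).
    by apply/negP => k; case: nm; exists r1, a1, b1, r', a', b', r, a, b.
  have := vertex_types e_sym e_irr noodd noprism K (nf _ _ _ R1) (nf _ _ _ R') (nf _ _ _ R) nmj yr1 i' fy fa'.
  rewrite (negPf ya) (negPf d') andbF => /(_ isT isT) [[[_ //]|[k _ _]]|[[k _ _]|[k _ _]]].
  - by move: fy; rewrite k // (negPf ya).
  - by move: fb'; rewrite k ?eqxx.
  exfalso; apply: (noskip (m := a') (z := f) e_sym e_irr noodd (let: And5 p _ _ _ _ := R1 in p)
     (rung_odd e_sym e_irr noodd noprism V R1) d1 _ (nf _ _ _ R1)) => //.
  - by apply/negP => k1; have := rung_unit e_sym e_irr R1 i1 k1; apply/negP.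
  - by rewrite e_sym.
  - have [_ cc] := rung_cross e_sym e_irr V R1 R' n'.
    by move=> v vr; rewrite e_sym cc // eqxx (negPf d') andbT andbF orbF.
have all3 r a b : rung A B H r a b -> ~~ same A B H a1 a -> forall v, v \in r -> e f v = (v == a).
  move=> R n; case: (boolP (same A B H a2 a)) => k.
    apply: (main _ _ _ _ _ _ R R3 n n13 _ h3); apply: nsame_sym; exact: nunit_l k.
  exact: (main _ _ _ _ _ _ R R2 n n12 k h2).
have p1 := pth1 e_sym e_irr f.
apply: (extA e_sym e_irr M p1 _ (u := a1) (y := y)) => //.
- by move=> w; rewrite inE => /eqP ->.
- move=> a aA n; have [r [b R]] := rungA V aA; have [i _ _ _ _] := rung_in V R.
  by rewrite (all3 _ _ _ R) ?eqxx.
- move=> w h; rewrite inE => /eqP -> hH n fh; split=> //.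
  have [r [a [b [R hr]]]] := on_rung V hH; have [i _ aA _ _] := rung_in V R.
  have na : ~~ same A B H a1 a by apply: (nunit_r e_sym n); exact: (rung_unit e_sym e_irr R hr i).
  by move: fh; rewrite (all3 _ _ _ R na) // => /eqP ->.
- by move=> w h; rewrite inE => ->.
- exact: rungH R1 yr1.
- by rewrite (rungAE R1).
- exact: (rung_unit e_sym e_irr R1 i1 yr1).
Qed.

Lemma bad_vertex A B H c1 c2 c3 f x y : maxv A B H c1 c2 c3 ->
  f \notin H -> ~ major A B H f -> x \in H -> y \in H -> ~~ same A B H x y -> ~~ both A B x y ->
  e f x -> e f y -> False.
Proof.
move=> M fH nm xH yH nxy nb fx fy; have V := proj1 M.
have [Q1 [a1 [b1 [R1 x1]]]] := on_rung V xH; have [Q2 [a2 [b2 [R2 y2]]]] := on_rung V yH.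
have [Q3 [a3 [b3 [R3 m1 m2]]]] := third_rung e_sym e_irr V x y.
have [i1 j1 A1 B1 _] := rung_in V R1; have [i2 j2 A2 B2 _] := rung_in V R2; have [i3 j3 _ _ _] := rung_in V R3.
have u1 := rung_unit e_sym e_irr R1 x1; have u2 := rung_unit e_sym e_irr R2 y2.
have n12 : ~~ same A B H a1 a2.
  by apply: nunit_l (u1 _ i1); apply: (nunit_r e_sym) (u2 _ i2).
have n13 : ~~ same A B H a1 a3 by apply: nunit_l (u1 _ i1).
have n23 : ~~ same A B H a2 a3 by apply: nunit_l (u2 _ i2).
have K := rungs_prism e_sym e_irr V R1 R2 R3 n12 n13 n23.
have nf r a b : rung A B H r a b -> f \notin r by move=> R; apply/negP => /(rungH R); apply/negP.
have nmj : ~~ (two3 (e f a1) (e f a2) (e f a3) && two3 (e f b1) (e f b2) (e f b3)).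
  by apply/negP => k; case: nm; exists Q1, a1, b1, Q2, a2, b2, Q3, a3, b3.
have g1 : ~~ ((x == a1) && (y == a2)).
  by apply: contra nb => /andP [/eqP -> /eqP ->]; rewrite /both A1 A2.
have g2 : ~~ ((x == b1) && (y == b2)).
  by apply: contra nb => /andP [/eqP -> /eqP ->]; rewrite /both B1 B2 orbT.
have MS := maxv_swap e_sym e_irr M.
have nmS : ~ major B A H f by move=> k; apply: nm; exact: (major_swap e_sym e_irr (proj1 MS) k).
have sb r a b : rung A B H r a b -> same A B H a b.
  by move=> R; have [? ? _ _ _] := rung_in V R; apply: (rung_unit e_sym e_irr R).
have nn r a b r' a' b' : rung A B H r a b -> rung A B H r' a' b' -> ~~ same A B H a a' -> ~~ same B A H b b'.
  move=> R R' n; rewrite same_swap; apply: nunit_l (sb _ _ _ R); exact: (nunit_r e_sym) (sb _ _ _ R').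
have revs r1 d1 r2 d2 r3 d3 : special e f r1 d1 r2 d2 r3 d3 -> special e f (rev r1) d1 (rev r2) d2 (rev r3) d3.
  case=> k1 k2 [v vr kv]; split=> [w|w|]; rewrite ?mem_rev; [exact: k1|exact: k2|].
  by exists v; rewrite ?mem_rev.
case: (vertex_types e_sym e_irr noodd noprism K (nf _ _ _ R1) (nf _ _ _ R2) (nf _ _ _ R3) nmj x1 y2 fx fy g1 g2).
  case=> sp; first exact: (special_ext M fH nm R1 R2 R3).
  exact: (special_ext M fH nm R2 R1 R3 (nsame_sym n12)).
case=> /revs sp.
  apply: (special_ext MS fH nmS (rung_swap e_sym e_irr R1) (rung_swap e_sym e_irr R2) (rung_swap e_sym e_irr R3)) sp.
  - exact: (nn _ _ _ _ _ _ R1 R2 n12).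
  - exact: (nn _ _ _ _ _ _ R1 R3 n13).
  - exact: (nn _ _ _ _ _ _ R2 R3 n23).
apply: (special_ext MS fH nmS (rung_swap e_sym e_irr R2) (rung_swap e_sym e_irr R1) (rung_swap e_sym e_irr R3)) sp.
- exact: (nn _ _ _ _ _ _ R2 R1 (nsame_sym n12)).
- exact: (nn _ _ _ _ _ _ R2 R3 n23).
- exact: (nn _ _ _ _ _ _ R1 R3 n13).
Qed.

Lemma local_type A B H c1 c2 c3 (N : T -> Prop) x : valid A B H c1 c2 c3 -> N x ->
  (forall u v, N u -> N v -> ~~ same A B H u v -> both A B u v) ->
  [\/ forall h, N h -> same A B H x h, (forall h, N h -> h \in A) /\ exists2 h, N h & ~~ same A B H x h |
   (forall h, N h -> h \in B) /\ exists2 h, N h & ~~ same A B H x h].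
Proof.
move=> V Nx hN; case: (classic (exists2 h, N h & ~~ same A B H x h)) => [[h Nh nh]|n]; last first.
  by constructor 1 => h Nh; apply: contraT => k; case: n; exists h.
have := hN _ _ Nx Nh nh; rewrite /both => /orP [] /andP [xA hA].
  constructor 2; split=> [w Nw|]; last by exists h.
  case: (boolP (same A B H x w)) => k; last first.
    by have := hN _ _ Nx Nw k; rewrite /both (negPf (notAB V xA)) orbF => /andP [].
  have k' : ~~ same A B H h w by apply: nsame_sym; apply: nunit_l k.
  by have := hN _ _ Nh Nw k'; rewrite /both (negPf (notAB V hA)) orbF => /andP [].
have nB z : z \in B -> (z \in A) = false by move=> zB; apply/negP => /(notAB V); rewrite zB.
constructor 3; split=> [w Nw|]; last by exists h.
case: (boolP (same A B H x w)) => k; last first.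
  by have := hN _ _ Nx Nw k; rewrite /both nB //= => /andP [].
have k' : ~~ same A B H h w by apply: nsame_sym; apply: nunit_l k.
by have := hN _ _ Nh Nw k'; rewrite /both nB //= => /andP [].
Qed.
End Ext2.

(** * Connected sets of nonmajor vertices; triples of rungs *)

Section BadPath.
Variables (T : finType) (e : rel T).
Hypothesis e_sym : symmetric e.
Hypothesis e_irr : irreflexive e.
Hypothesis noodd : forall c, hole e c -> ~~ odd (size c).
Hypothesis noanti : forall c, ~~ hole (compl e) c.
Hypothesis noprism : forall a1 a2 a3 q1 q2 q3, ~~ odd_prism e a1 a2 a3 q1 q2 q3.
Implicit Types (s t r q Q F P : seq T) (x y z a b c d u v w h f m : T) (X Y S A B H : {set T}).

Local Notation rung := (rung e).
Local Notation valid := (valid e).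
Local Notation maxv := (maxv e).
Local Notation same := (same e).
Local Notation major := (major e).

(** Induction on the size of [F]. Deleting either end leaves a path whose attachments are pairwise
    consistent, hence lie in one unit, in [A], or in [B]; each of the nine combinations is excluded
    by a path lemma or by the choice of [x] and [y]. *)
Lemma bad_path A B H c1 c2 c3 F f1 fk x y : maxv A B H c1 c2 c3 -> pth e F f1 fk ->
  (forall w, w \in F -> w \notin H /\ ~ major A B H w) -> x \in H -> y \in H ->
  ~~ same A B H x y -> ~~ both A B x y -> e f1 x -> e fk y -> False.
Proof.
move=> M; have V := proj1 M.
move: {2}(size F).+1 (ltnSn (size F)) => n; elim: n F f1 fk x y => // n IH F f1 fk x y.
rewrite ltnS => Fn pF FH xH yH nxy nb fx fy.
have f1F := pth_in1 pF; have fkF := pth_in2 pF.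
case: (eqVneq f1 fk) => [ef|nf].
  have [k1 k2] := FH _ f1F; rewrite -ef in fy.
  exact: (bad_vertex e_sym e_irr noodd noprism M k1 k2 xH yH nxy nb).
pose N (G : seq T) g h := h \in H /\ exists w, [/\ w \in G, w != g & e w h].
have half G g1 g2 : pth e G g1 g2 -> g1 != g2 -> G =i F -> forall u v, N G g2 u -> N G g2 v -> ~~ same A B H u v -> both A B u v.
  move=> pG ng eG u v [uH [w [wG wk wu]]] [vH [w' [w'G w'k w'v]]] nuv; apply: contraT => nbuv.
  have [G0 eG0] : exists G0, G = rcons G0 g2.
    case: pG => _ _; case/lastP: (G) => [//|G0 l]; rewrite ol_rcons => -[<-]; by exists G0.
  have G00 : G0 != [::].
    apply/eqP => k; move: pG; rewrite eG0 k /= => -[_ [k1] _]; by rewrite k1 eqxx in ng.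
  have [c pG0] : exists c, pth e G0 g1 c.
    by move: (pG) => pG'; rewrite eG0 -cats1 in pG'; exact: (pth_catl e_sym e_irr pG').
  have wG0 : w \in G0 by move: wG; rewrite eG0 mem_rcons inE (negPf wk).
  have w'G0 : w' \in G0 by move: w'G; rewrite eG0 mem_rcons inE (negPf w'k).
  have [q [pq hq]] : exists q, pth e q w w' /\ {subset q <= [set x in G0]}.
    by apply: (conn_pth e_sym e_irr (conn_pset e_sym e_irr pG0)); rewrite inE.
  have hq' : {subset q <= G0} by move=> z /hq; rewrite inE.
  have sz : size q < n.
    apply: leq_trans Fn; have : size q <= size G0 by apply: uniq_leq_size hq'; exact: pth_uniq pq.
    have <- : size G = size F.
      by apply: perm_size; apply: uniq_perm; [exact: pth_uniq pG|exact: pth_uniq pF|exact: eG].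
    by rewrite eG0 size_rcons ltnS.
  exfalso; apply: (IH q w w' u v) => // z zq; apply: FH; rewrite -eG eG0 mem_rcons inE hq' ?orbT //.
have pF' := pth_rev e_sym e_irr pF.
have nf' : fk != f1 by rewrite eq_sym.
have mr : rev F =i F by move=> w; rewrite mem_rev.
have p1 := half _ _ _ pF nf (fun _ => erefl); have p2 := half _ _ _ pF' nf' mr.
have N1x : N F fk x by split=> //; exists f1; split.
have N2y : N (rev F) f1 y by split=> //; exists fk; split=> //; rewrite mem_rev.
have k1 := local_type e_sym V N1x p1; have k2 := local_type e_sym V N2y p2.
have FH1 w : w \in F -> w \notin H by move=> /FH [].
have FH1' w : w \in rev F -> w \notin H by rewrite mem_rev; exact: FH1.
have N1I w h : w \in F -> w != fk -> h \in H -> e w h -> N F fk h by move=> *; split=> //; exists w; split.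
have N2I w h : w \in F -> w != f1 -> h \in H -> e w h -> N (rev F) f1 h.
  by move=> *; split=> //; exists w; split=> //; rewrite mem_rev.
have nyx := nsame_sym e_sym nxy.
have MS := maxv_swap e_sym e_irr M.
have disj z : z \in B -> z \in A = false by move=> zB; apply/negP => /(notAB V); rewrite zB.
have yx z : z \in A -> z \in B = false by move=> zA; apply/negP => zB; rewrite disj in zA.
have lab A' B' : maxv A' B' H c1 c2 c3 -> (forall h, h \in A' -> h \in B' -> False) ->
    (forall u v, same A' B' H u v = same A B H u v) ->
    (forall h, N F fk h -> h \in A') -> (exists2 h, N F fk h & ~~ same A B H x h) ->
    (forall h, N (rev F) f1 h -> h \in B') -> (exists2 h, N (rev F) f1 h & ~~ same A B H y h) -> False.
  move=> M' dd sm a1 [h1 Nh1 nh1] a2 [h2 Nh2 nh2].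
  apply: (no_path_A_B e_sym e_irr noodd noprism M' pF FH1 nf).
  - move=> w h wF hH ewh; case: (eqVneq w f1) => [ew|w1].
      by left; split=> //; apply: a1; apply: (N1I w) => //; rewrite ew.
    have hB := a2 _ (N2I _ _ wF w1 hH ewh); case: (eqVneq w fk) => [ew|wk]; first by right.
    by case: (dd h (a1 _ (N1I _ _ wF wk hH ewh)) hB).
  - have get h : N F fk h -> e f1 h.
      case=> hH [w [wF wk wh]]; case: (eqVneq w f1) => [<- //|w1].
      by case: (dd h (a1 _ (N1I _ _ wF wk hH wh)) (a2 _ (N2I _ _ wF w1 hH wh))).
    move=> u; case: (boolP (same A B H u x)) => ux; last first.
      by exists x; rewrite sm; split=> //; apply: a1.
    exists h1; rewrite sm; split; [exact: a1|exact: get|].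
    by apply: nunit_l nh1 _; rewrite same_sym.
  have get h : N (rev F) f1 h -> e fk h.
    case=> hH [w [wF w1 wh]]; rewrite mem_rev in wF; case: (eqVneq w fk) => [<- //|wk].
    by case: (dd h (a1 _ (N1I _ _ wF wk hH wh)) (a2 _ (N2I _ _ wF w1 hH wh))).
  move=> u; case: (boolP (same A B H u y)) => uy; last first.
    by exists y; rewrite sm; split=> //; apply: a2.
  exists h2; rewrite sm; split; [exact: a2|exact: get|].
  by apply: nunit_l nh2 _; rewrite same_sym.
case: k1 => [k1|[k1 k1']|[k1 k1']]; case: k2 => [k2|[k2 k2']|[k2 k2']].
- apply: (no_path_unit_unit e_sym e_irr noodd noprism M pF FH1 nf xH yH nxy nb) => // w h *; [apply: k1|apply: k2].
    exact: (N1I w).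
  exact: (N2I w).
- have yA := k2 _ N2y; have xA : x \notin A by apply: contra nb => xA; rewrite /both xA yA.
  apply: (no_path_A_unit e_sym e_irr noodd noprism M pF' FH1' nf' yA xH xA nxy) => // w h; rewrite mem_rev => *; [apply: k2|apply: k1].
    exact: (N2I w).
  exact: (N1I w).
- have yB := k2 _ N2y; have xB : x \notin B by apply: contra nb => xB; rewrite /both xB yB orbT.
  apply: (no_path_A_unit e_sym e_irr noodd noprism MS pF' FH1' nf' yB xH xB) => //; first by rewrite same_swap.
    by move=> w h; rewrite mem_rev => *; apply: k2; exact: (N2I w).
  by move=> w h; rewrite mem_rev same_swap => *; apply: k1; exact: (N1I w).
- have xA := k1 _ N1x; have yA : y \notin A by apply: contra nb => yA; rewrite /both xA yA.
  apply: (no_path_A_unit e_sym e_irr noodd noprism M pF FH1 nf xA yH yA nyx) => // w h *; [apply: k1|apply: k2].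
    exact: (N1I w).
  exact: (N2I w).
- by move: nb; rewrite /both (k1 _ N1x) (k2 _ N2y).
- apply: (lab A B M) => // h hA; by rewrite yx.
- have xB := k1 _ N1x; have yB : y \notin B by apply: contra nb => yB; rewrite /both xB yB orbT.
  apply: (no_path_A_unit e_sym e_irr noodd noprism MS pF FH1 nf xB yH yB) => //; first by rewrite same_swap.
    by move=> w h *; apply: k1; exact: (N1I w).
  by move=> w h; rewrite same_swap => *; apply: k2; exact: (N2I w).
- apply: (lab B A MS) => //; first by move=> h hB; rewrite disj.
  by move=> u v; rewrite same_swap.
by move: nb; rewrite /both (k1 _ N1x) (k2 _ N2y) orbT.
Qed.

Lemma bad_set A B H c1 c2 c3 S f g x y : maxv A B H c1 c2 c3 -> conn e S ->
  (forall w, w \in S -> w \notin H /\ ~ major A B H w) -> f \in S -> g \in S -> x \in H -> y \in H ->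
  e f x -> e g y -> ~~ same A B H x y -> both A B x y.
Proof.
move=> M cS SH fS gS xH yH fx gy nxy; apply: contraT => nb.
have [q [pq hq]] := conn_pth e_sym e_irr cS fS gS; exfalso.
by apply: (bad_path M pq _ xH yH nxy nb fx gy) => w /hq /SH.
Qed.

Definition rg3 A B H (g : seq T * T * T) := rung A B H g.1.1 g.1.2 g.2.
Definition tri A B H g1 g2 g3 := [/\ rg3 A B H g1, rg3 A B H g2, rg3 A B H g3 &
  [/\ ~~ same A B H g1.1.2 g2.1.2, ~~ same A B H g1.1.2 g3.1.2 & ~~ same A B H g2.1.2 g3.1.2]].
Definition mj m (g1 g2 g3 : seq T * T * T) := two3 (e m g1.1.2) (e m g2.1.2) (e m g3.1.2) &&
  two3 (e m g1.2) (e m g2.2) (e m g3.2).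
Definition full m (g : seq T * T * T) := e m g.1.2 && e m g.2.
Definition missed m (g : seq T * T * T) := ~~ has (e m) g.1.1.
Definition flip (g : seq T * T * T) := (rev g.1.1, g.2, g.1.2).

Lemma tri_rot A B H g1 g2 g3 : tri A B H g1 g2 g3 -> tri A B H g2 g3 g1.
Proof. by case=> h1 h2 h3 [n1 n2 n3]; split=> //; split; rewrite // same_sym. Qed.
Lemma tri_swap A B H g1 g2 g3 : tri A B H g1 g2 g3 -> tri A B H g2 g1 g3.
Proof. by case=> h1 h2 h3 [n1 n2 n3]; split=> //; split; rewrite // same_sym. Qed.
Lemma mj_rot m g1 g2 g3 : mj m g1 g2 g3 = mj m g2 g3 g1.
Proof. by rewrite /mj two3rot; congr (_ && _); rewrite two3rot. Qed.
Lemma mj_swap m g1 g2 g3 : mj m g1 g2 g3 = mj m g2 g1 g3.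
Proof. by rewrite /mj two3C12; congr (_ && _); rewrite two3C12. Qed.

Lemma majorP A B H m : major A B H m <-> exists g1 g2 g3, tri A B H g1 g2 g3 /\ mj m g1 g2 g3.
Proof.
split=> [[r1 [a1 [b1 [r2 [a2 [b2 [r3 [a3 [b3 [R1 R2 R3 n k]]]]]]]]]]|].
  by exists (r1, a1, b1), (r2, a2, b2), (r3, a3, b3).
case=> -[[r1 a1] b1] [[[r2 a2] b2] [[[r3 a3] b3] [[R1 R2 R3 n] k]]].
by exists r1, a1, b1, r2, a2, b2, r3, a3, b3.
Qed.

Section V.
Variables (A B H : {set T}) (c1 c2 c3 : T).
Hypothesis V : valid A B H c1 c2 c3.
Local Notation unit := (same A B H).

Lemma rg_AB g : rg3 A B H g -> unit g.1.2 g.2.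
Proof. by move=> R; have [? ? _ _ _] := rung_in V R; apply: (rung_unit e_sym e_irr R). Qed.

Lemma tri_prism g1 g2 g3 : tri A B H g1 g2 g3 ->
  prism3 e g1.1.1 g1.1.2 g1.2 g2.1.1 g2.1.2 g2.2 g3.1.1 g3.1.2 g3.2.
Proof. by case=> R1 R2 R3 [n1 n2 n3]; apply: (rungs_prism e_sym e_irr V R1 R2 R3). Qed.

Lemma tri_flip g1 g2 g3 : tri A B H g1 g2 g3 -> tri B A H (flip g1) (flip g2) (flip g3).
Proof.
case=> R1 R2 R3 [n1 n2 n3].
have nn g g' : rg3 A B H g -> rg3 A B H g' -> ~~ unit g.1.2 g'.1.2 -> ~~ same B A H g.2 g'.2.
  move=> R R' n; rewrite same_swap; apply: nunit_l (rg_AB R); exact: (nunit_r e_sym n (rg_AB R')).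
split; [exact: (rung_swap e_sym e_irr R1)|exact: (rung_swap e_sym e_irr R2)|exact: (rung_swap e_sym e_irr R3)|].
by split; apply: nn.
Qed.

(** A vertex of [H] sees other units only inside a common side; two corners seen on each side would
    place it in both [A] and [B]. *)
Lemma mj_out m g1 g2 g3 : tri A B H g1 g2 g3 -> mj m g1 g2 g3 -> m \notin H.
Proof.
case=> R1 R2 R3 [n1 n2 n3] /andP [h1 h2]; apply/negP => mH.
have D a : a \in A -> e m a -> ~~ unit m a -> m \in A.
  move=> aA ma n; have := diffunit mH (inAH V aA) n; rewrite ma /both aA (negPf (notAB V aA)).
  by rewrite andbT andbF orbF.
have D' b : b \in B -> e m b -> ~~ unit m b -> m \in B.
  move=> bB mb n; have := diffunit mH (inBH V bB) n; rewrite mb /both bB.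
  have -> : b \in A = false by apply/negP => /(notAB V); rewrite bB.
  by rewrite andbT andbF.
have [_ _ A1 B1 _] := rung_in V R1; have [_ _ A2 B2 _] := rung_in V R2; have [_ _ A3 B3 _] := rung_in V R3.
have nb g g' : rg3 A B H g -> rg3 A B H g' -> ~~ unit g.1.2 g'.1.2 -> ~~ unit g.2 g'.2.
  move=> R R' n; apply: nunit_l (rg_AB R); exact: (nunit_r e_sym n (rg_AB R')).
have two u v : ~~ unit u v -> ~~ unit m u || ~~ unit m v.
  by move=> n; rewrite -negb_and; apply: contra n => /andP [k1 k2]; exact: (unit_tr e_sym k1 k2).
have mA : m \in A.
  case/or3P: h1 => /andP [k1 k2].
  - by case/orP: (two _ _ n1) => k; [exact: (D _ A1)|exact: (D _ A2)].
  - by case/orP: (two _ _ n2) => k; [exact: (D _ A1)|exact: (D _ A3)].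
  - by case/orP: (two _ _ n3) => k; [exact: (D _ A2)|exact: (D _ A3)].
have mB : m \in B.
  case/or3P: h2 => /andP [k1 k2].
  - by case/orP: (two _ _ (nb _ _ R1 R2 n1)) => k; [exact: (D' _ B1)|exact: (D' _ B2)].
  - by case/orP: (two _ _ (nb _ _ R1 R3 n2)) => k; [exact: (D' _ B1)|exact: (D' _ B3)].
  - by case/orP: (two _ _ (nb _ _ R2 R3 n3)) => k; [exact: (D' _ B2)|exact: (D' _ B3)].
by move: (notAB V mA); rewrite mB.
Qed.

Lemma any_rep m g1 g1' g2 g3 : m \notin H -> tri A B H g1 g2 g3 -> tri A B H g1' g2 g3 -> mj m g1 g2 g3 ->
  [\/ mj m g1' g2 g3, [/\ full m g1, missed m g1', full m g2 & missed m g3] |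
   [/\ full m g1, missed m g1', full m g3 & missed m g2]].
Proof.
move=> mH t t' /andP [h1 h2]; have nm g : rg3 A B H g -> m \notin g.1.1.
  by move=> R; apply/negP => /(rungH R); apply/negP.
have [R1 R2 R3 _] := t; have [R1' _ _ _] := t'.
have [] := replace_rung e_sym e_irr noodd noprism (tri_prism t) (tri_prism t')
  (nm _ R1) (nm _ R1') (nm _ R2) (nm _ R3) h1 h2.
- by case=> k1 k2; constructor 1; rewrite /mj k1 k2.
- by constructor 2.
by constructor 3.
Qed.

(* If a rung replacement inside a unit failed, the unit would split into full and missed
   rungs, and m with a full and a missed rung would give an odd hole. *)
Lemma same_unit_hole m r a b r' a' b' g2 g3 : m \notin H -> rung A B H r a b -> rung A B H r' a' b' ->
  rg3 A B H g2 -> rg3 A B H g3 -> unit a a' -> ~~ unit a g2.1.2 -> ~~ unit a g3.1.2 ->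
  ~~ unit g2.1.2 g3.1.2 -> (forall v, v \in r' -> (a != v) && (e a v ==> both A B a v)) -> ~~ e a a' ->
  e m a -> ~~ has (e m) r' -> e m g2.2 -> ~~ e m g3.1.2 -> False.
Proof.
move: g2 g3 => [[r2 a2] b2] [[r3 a3] b3]; rewrite /rg3 /= => mH R R' R2 R3 ua n2 n3 n23 cr naa ma mr' mb2 ma3.
have [ar br aA bB d] := rung_in V R; have [ar' br' aA' bB' d'] := rung_in V R'.
have [ar2 br2 aA2 bB2 d2] := rung_in V R2; have [ar3 br3 aA3 bB3 d3] := rung_in V R3.
have mR x : x \in H -> (m == x) = false by move=> xH; apply: contraNF mH => /eqP ->.
have aH := inAH V aA; have bH2 := inBH V bB2; have aH3 := inAH V aA3.
have nA x : x \in B -> x \in A = false by move=> xB; apply/negP => /(notAB V); rewrite xB.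
have ur v : v \in r' -> unit a v by move=> vr; apply: same_trans ua (rung_unit e_sym e_irr R' ar' vr).
have n2b : ~~ unit a b2 by exact: (nunit_r e_sym n2 (rung_unit e_sym e_irr R2 ar2 br2)).
have pP : pth e [:: a; m; b2] a b2.
  apply: (pth_cons e_sym e_irr (pth_2 e_sym e_irr mb2)).
    by rewrite !inE negb_or eq_sym mR //= (AB_ne V).
  move=> y; rewrite !inE => /orP [] /eqP ->; first by rewrite e_sym ma eqxx.
  by rewrite (negPf (nadjAB e_sym e_irr noodd noprism V aA bB2)) eq_sym mR.
have a3r : a3 \notin r' by apply/negP => /ur; apply/negP.
have [pr' _ _ _ _] := R'.
have e3 v : v \in r' -> e a3 v = (v == a').
  move=> vr; have n : ~~ unit a3 v by apply: (nsame_sym e_sym); apply: nunit_l (ur _ vr).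
  by rewrite (diffunit aH3 (rungH R' vr) n) /both aA3 (negPf (notAB V aA3)) orbF (rungAE R' vr).
have pQ : pth e (a3 :: r') a3 b' by apply: (pth_cons e_sym e_irr pr' a3r).
have dA : a != a3 by apply: contraNneq n3 => <-; exact: same_refl.
have C : cross2 e [:: a; m; b2] a b2 (a3 :: r') a3 b'.
  split=> [w|w v].
    rewrite !inE negb_or => /or3P [] /eqP ->.
    - rewrite dA /=; apply/negP => k; by have := cr _ k; rewrite eqxx.
    - by rewrite mR //=; apply/negP => /(rungH R'); apply/negP.
    have -> : b2 != a3 by apply: contraTneq aA3 => <-; rewrite nA.
    by apply/negP => /ur; apply/negP.
  rewrite !inE => /or3P [] /eqP -> /orP [/eqP ->|vr].
  - rewrite (diffunit aH aH3 n3) /both aA aA3 !eqxx.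
    by have -> : (a == b2) = false by apply/negbTE; exact: (AB_ne V).
  - have -> : (a == b2) = false by apply/negbTE; exact: (AB_ne V).
    have -> : (v == a3) = false by apply: contraNF a3r => /eqP <-.
    rewrite andbF /=; apply/negP => k; have /andP [_ /implyP /(_ k)] := cr _ vr.
    rewrite /both aA (negPf (notAB V aA)) orbF /= (rungAE R' vr) => /eqP ev; by rewrite -ev k in naa.
  - by rewrite (negPf ma3) !mR.
  - rewrite !mR //=; apply/negP => k; by case/hasP: mr'; exists v.
  - rewrite (negPf (nadjBA e_sym e_irr noodd noprism V aA3 bB2)) !eqxx.
    have -> : (b2 == a) = false by apply: contraNF n2b => /eqP ->; exact: same_refl.
    by have -> : (a3 == b') = false by apply/negbTE; exact: (AB_ne V).
  have -> : (b2 == a) = false by apply: contraNF n2b => /eqP ->; exact: same_refl.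
  have n : ~~ unit b2 v by apply: (nsame_sym e_sym); apply: nunit_l (ur _ vr).
  by rewrite eqxx (diffunit bH2 (rungH R' vr) n) /both (nA _ bB2) bB2 (rungBE R' vr).
have := ladder_even e_sym e_irr noodd pP pQ C; rewrite /=.
have := rung_odd e_sym e_irr noodd noprism V R'; have := pth_size2 pr' d'; clear; lia.
Qed.
End V.

(** If the replacement failed, every rung of the unit would be full or missed for [m], and
    [split_unit] with [same_unit_hole] gives a contradiction. So majority may be tested on any rung
    of a unit. *)
Lemma same_unit_rep A B H c1 c2 c3 m g1 g1' g2 g3 : valid A B H c1 c2 c3 -> m \notin H ->
  tri A B H g1 g2 g3 -> rg3 A B H g1' -> same A B H g1.1.2 g1'.1.2 -> mj m g1 g2 g3 ->
  tri A B H g1' g2 g3 /\ mj m g1' g2 g3.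
Proof.
move=> V mH t R1' uu h.
have tri' g : rg3 A B H g -> same A B H g1.1.2 g.1.2 -> tri A B H g g2 g3.
  by move=> R u; case: t => _ R2 R3 [n1 n2 n3]; split=> //; split=> //; apply: nunit_l u.
split; first exact: tri'.
have core g2' g3' : tri A B H g1 g2' g3' -> (forall g, mj m g g2' g3' = mj m g g2 g3) ->
    full m g1 -> missed m g1' -> full m g2' -> missed m g3' -> False.
  move=> t2 mj2 f1 m1' f2 m3.
  have [R1 R2 R3 [n12 n13 n23]] := t2.
  have [_ _ A3 B3 _] := rung_in V R3; have [i3 j3 _ _ _] := rung_in V R3.
  have m3a : ~~ e m g3'.1.2 by apply: contra m3 => k; apply/hasP; exists g3'.1.2.
  have m3b : ~~ e m g3'.2 by apply: contra m3 => k; apply/hasP; exists g3'.2.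
  have /andP [f2a f2b] := f2.
  have dich r a b : rung A B H r a b -> same A B H g1.1.2 a -> full m (r, a, b) \/ missed m (r, a, b).
    move=> R u; have t3 : tri A B H (r, a, b) g2' g3' by split=> //; split=> //=; apply: nunit_l u.
    have hh : mj m g1 g2' g3' by rewrite mj2.
    case: (any_rep V mH t2 t3 hh) => [/andP []|[_ k _ _]|[_ k _ _]]; [|by right|by right].
    rewrite (negPf m3a) (negPf m3b) f2a f2b /two3 /= !andbF !andbT !orbF => k1 k2.
    by left; rewrite /full k1 k2.
  have pure r a b : rung A B H r a b -> same A B H g1.1.2 a -> e m a = e m b.
    move=> R u; have [ar br _ _ _] := rung_in V R.
    case: (dich _ _ _ R u) => [/andP [/= -> ->//]|k].
    have -> : e m a = false by apply: contraNF k => k; apply/hasP; exists a.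
    by apply/esym; apply: contraNF k => k; apply/hasP; exists b.
  have [i1 j1 _ _ _] := rung_in V R1; have [i1' j1' _ _ _] := rung_in V R1'.
  have m1a : ~~ e m g1'.1.2 by apply: contra m1' => k; apply/hasP; exists g1'.1.2.
  have /andP [f1a f1b] := f1.
  have [r [a [b [r' [a' [b' [R R' [za za'] /andP [pa pa'] [cr nab]]]]]]]] :=
    split_unit e_sym e_irr V pure R1 (same_refl _ _ _ _ _) f1a R1' uu m1a.
  have mr' : missed m (r', a', b') by case: (dich _ _ _ R' za') => // /andP [/= k _]; rewrite k in pa'.
  have pb : e m b by rewrite -(pure _ _ _ R).
  have [ar br aA bB d] := rung_in V R; have [ar' br' aA' bB' d'] := rung_in V R'.
  have uab := rung_unit e_sym e_irr R ar br; have uab' := rung_unit e_sym e_irr R' ar' br'.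
  case/orP: nab => nab.
    apply: (same_unit_hole V mH R R' R2 R3) => //; try exact: nunit_l za.
      exact: (unit_tr e_sym za za').
    by move=> v vr; apply: cr.
  have V' := valid_swap e_sym e_irr V.
  have [_ R2f R3f [_ _ n23f]] := tri_flip V t2.
  apply: (same_unit_hole V' mH (rung_swap e_sym e_irr R) (rung_swap e_sym e_irr R') R2f R3f) => //=.
  - rewrite same_swap; apply: (unit_tr e_sym (z := g1.1.2)); [exact: same_trans za uab|exact: same_trans za' uab'].
  - rewrite same_swap; apply: nunit_l (same_trans za uab); exact: (nunit_r e_sym n12 (rg_AB V R2)).
  - rewrite same_swap; apply: nunit_l (same_trans za uab); exact: (nunit_r e_sym n13 (rg_AB V R3)).
  - move=> v; rewrite mem_rev => vr; have /andP [-> /implyP k] := cr _ _ br vr.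
    by apply/implyP; rewrite both_swap.
  by rewrite has_rev.
case: (any_rep V mH t (tri' _ R1' uu) h) => // -[k1 k2 k3 k4]; exfalso.
  exact: (core g2 g3 t (fun g => erefl) k1 k2 k3 k4).
apply: (core g3 g2 _ _ k1 k2 k3 k4); first exact: (tri_rot (tri_swap t)).
by move=> g; rewrite mj_swap mj_rot.
Qed.
End BadPath.

(** * Major vertices *)

Section Majors.
Variables (T : finType) (e : rel T).
Hypothesis e_sym : symmetric e.
Hypothesis e_irr : irreflexive e.
Hypothesis noodd : forall c, hole e c -> ~~ odd (size c).
Hypothesis noanti : forall c, ~~ hole (compl e) c.
Hypothesis noprism : forall a1 a2 a3 q1 q2 q3, ~~ odd_prism e a1 a2 a3 q1 q2 q3.
Hypothesis NS : forall B, disconnected_on (compl e) B -> conn e (~: B).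
Implicit Types (s t r q Q F P : seq T) (x y z a b c d u v w h f m : T) (X Y S A B H : {set T}).

Local Notation rung := (rung e).
Local Notation valid := (valid e).
Local Notation maxv := (maxv e).
Local Notation same := (same e).
Local Notation major := (major e).
Local Notation tri := (tri e).
Local Notation rg3 := (rg3 e).
Local Notation mj := (mj e).

Lemma rung_inner A B H c1 c2 c3 r a b : valid A B H c1 c2 c3 -> rung A B H r a b ->
  exists c, [/\ c \in r, c \notin A & c \notin B].
Proof.
move=> V R; have [ar br aA bB d] := rung_in V R; have [pr _ _ _ _] := R.
have [t [x [z [er pt at_ bt _]]]] := pth_inner e_sym e_irr pr d (nadjAB e_sym e_irr noodd noprism V aA bB).
have xt := pth_in1 pt; have xr : x \in r by rewrite er inE mem_rcons inE xt !orbT.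
exists x; split=> //; first by rewrite (rungAE R xr); apply: contraNneq at_ => <-.
by rewrite (rungBE R xr); apply: contraNneq bt => <-.
Qed.

Lemma tri_rep A B H g1 g2 g3 g : tri A B H g1 g2 g3 -> rg3 A B H g -> same A B H g1.1.2 g.1.2 -> tri A B H g g2 g3.
Proof. by move=> [_ R2 R3 [n1 n2 n3]] R u; split=> //; split=> //; apply: nunit_l u. Qed.

(** The rungs at [a] and [a'] can replace those of the triple for every vertex of [Y] at once, and
    [complete2] makes one of the two ends complete to [Y]. *)
Lemma exc_pair A B H c1 c2 c3 Y g1 g2 g3 a a' : valid A B H c1 c2 c3 -> tri A B H g1 g2 g3 -> anticonn e Y ->
  (forall y, y \in Y -> y \notin H /\ mj y g1 g2 g3) ->
  a \in A -> same A B H g1.1.2 a -> ~~ cpl e Y a -> a' \in A -> same A B H g2.1.2 a' -> ~~ cpl e Y a' -> False.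
Proof.
move=> V t aY hY aA ua na aA' ua' na'.
have [r [b R]] := rungA V aA; have [r' [b' R']] := rungA V aA'.
have t2 := tri_rep t (g := (r, a, b)) R ua.
have t3 := tri_swap e_sym (tri_rep (tri_swap e_sym t2) (g := (r', a', b')) R' ua').
have hY3 y : y \in Y -> mj y (r, a, b) (r', a', b') g3.
  move=> /hY [yH k]; have [_ k1] := same_unit_rep e_sym e_irr noodd noprism V yH t (g1' := (r, a, b)) R ua k.
  rewrite mj_swap in k1.
  have [_ k2] := same_unit_rep e_sym e_irr noodd noprism V yH (tri_swap e_sym t2) (g1' := (r', a', b')) R' ua' k1.
  by rewrite mj_swap.
have [_ _ _ [_ _ _] [[_ c12] [_ c13] [_ c23]]] := tri_prism e_sym e_irr V t3.
have [_ _ R3 _] := t3.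
have [ar br _ bB d] := rung_in V R; have [ar' br' _ bB' d'] := rung_in V R'; have [i3 j3 _ B3 d3] := rung_in V R3.
have dis x : x \in H -> x \notin Y by move=> xH; apply: contraL xH => /hY [].
apply: (complete2 e_sym e_irr noanti (a1 := a) (a2 := a') (b1 := b) (b2 := b') (b3 := g3.2) aY) => //.
- by rewrite c12 ?eqxx.
- by rewrite c12 ?eqxx ?orbT.
- by rewrite c13 ?eqxx ?orbT.
- by rewrite c23 ?eqxx ?orbT.
- move=> x z xa zb.
  have xA : x \in A by move: xa; rewrite !inE => /orP [] /eqP ->.
  have zB : z \in B by move: zb; rewrite !inE => /or3P [] /eqP ->.
  by rewrite (AB_ne V) //= (nadjAB e_sym e_irr noodd noprism V).
- move=> w; rewrite !inE => /orP [/eqP ->|/or4P [] /eqP ->]; apply: dis;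
   by [exact: (inAH V)|exact: (inBH V)].
- by move=> w /hY3 /andP [/= + _]; rewrite /two3; case: (e w a); case: (e w a').
by move=> w /hY3 /andP [].
Qed.

Section Core.
Variables (A B H : {set T}) (c1 c2 c3 : T).
Hypothesis M : maxv A B H c1 c2 c3.
Local Notation unit := (same A B H).
Let V : valid A B H c1 c2 c3 := proj1 M.

(** [F] lengthened by [z] attaches only to the first two rungs, since nonmajor vertices stay within
    the unit of [c]. As [z] sees both ends of the second rung, [alpha] applies with either end. *)
Lemma reach g1 g2 g3 c F f1 fk z : tri A B H g1 g2 g3 -> c \in g1.1.1 -> c \notin A -> c \notin B ->
  pth e F f1 fk -> (forall w, w \in F -> w \notin H /\ ~ major A B H w) -> e f1 c -> e fk z ->
  z \notin H -> z \notin F -> missed e z g1 -> full e z g2 -> missed e z g3 -> False.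
Proof.
move=> t cg cA cB pF FH fc fz zH zF m1 /andP [f2a f2b] m3.
have [R1 R2 R3 [n12 n13 n23]] := t.
have [i1 j1 A1 B1 d1] := rung_in V R1; have [i2 j2 A2 B2 d2] := rung_in V R2; have [i3 j3 A3 B3 d3] := rung_in V R3.
have cH := rungH R1 cg; have u1 := rung_unit e_sym e_irr R1 cg i1.
have f1F := pth_in1 pF; have fkF := pth_in2 pF.
have outU w h : w \in F -> h \in H -> e w h -> unit c h.
  move=> wF hH wh; apply: contraT => n.
  have cS := conn_pset e_sym e_irr pF.
  have := bad_set e_sym e_irr noodd noprism M cS (f := f1) (g := w) (x := c) (y := h) _ _ _ cH hH fc wh n.
  rewrite !inE /both (negPf cA) (negPf cB) => k; apply: k => // x; rewrite inE; exact: FH.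
have f1S : f1 \in [set x in F] by rewrite inE.
have fkS : fk \in [set x in F] by rewrite inE.
have hs : has (e f1) g1.1.1 by apply/hasP; exists c.
have zfk : e z fk by rewrite e_sym.
have [r [c' [d' [pr sr N1 N2 [h1 h2]]]]] := conn_link e_sym e_irr (N1 := fun w => has (e w) g1.1.1) (N2 := e z)
  (conn_pset e_sym e_irr pF) f1S hs fkS zfk.
have rF w : w \in r -> w \in F by move=> /sr; rewrite inE.
have zr : z \notin r by apply: contra zF => /rF.
have pz := pth_rcons e_sym e_irr pr zr h2.
have [x xQ c'x] := hasP N1.
have c'r := pth_in1 pr.
have cz : c' != z by apply: contraNneq zr => <-.
have offH w : w \in rcons r z -> w \notin H.
  by rewrite mem_rcons inE => /orP [/eqP -> //|/rF /FH []].
have notU w v g : w \in rcons r z -> w != z -> rg3 A B H g -> ~~ unit g1.1.2 g.1.2 -> v \in g.1.1 -> ~~ e w v.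
  rewrite mem_rcons inE => /orP [/eqP -> /eqP //|/rF wF _ R n vg]; apply/negP => wv.
  have k := outU _ _ wF (rungH R vg) wv; case/negP: n.
  have [i _ _ _ _] := rung_in V R.
  by apply: (unit_tr e_sym u1); apply: same_trans k (rung_unit e_sym e_irr R vg i).
have zm g v : missed e z g -> v \in g.1.1 -> ~~ e z v by move=> k vg; apply: contra k => k; apply/hasP; exists v.
apply: (alpha e_sym e_irr noodd noprism (tri_prism e_sym e_irr V t) pz (x := x) (y := g2.2) (x' := x) (y' := g2.1.2)) => //.
- move=> w /offH wH; split; apply: contra wH; [exact: rungH R1|exact: rungH R2|exact: rungH R3].
- move=> w v; rewrite mem_rcons inE => /orP [/eqP -> _|wr wc]; first exact: zm.
  by move=> vQ; have := h1 _ wr; rewrite (negPf wc) => /negbT; apply: contra => k; apply/hasP; exists v.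
- by move=> w v wr wz; apply: (notU w v g2).
- move=> w v wr; case: (eqVneq w z) => [-> |wz]; [exact: zm|exact: (notU w v g3)].
- by rewrite (eq_sym g2.2) (negPf d2) andbF.
- by rewrite (negPf d2) andbF.
- by rewrite (negPf cz).
Qed.

(** [Y :|: D] does not cut the graph, so the inside of the first unit is connected to that of the
    second. Where the connection leaves what nonmajor vertices can reach, it meets a major vertex
    [v] not complete to [Y], which enlarges [Y]. It remains to find three rungs on which [v] and all
    of [Y] are major. *)
Lemma more_majors Y g1 g2 g3 : tri A B H g1 g2 g3 -> anticonn e Y -> Y != set0 ->
  (forall y, y \in Y -> y \notin H /\ mj y g1 g2 g3) ->
  (forall a, a \in A -> unit g1.1.2 a -> cpl e Y a) -> (forall b, b \in B -> unit g1.1.2 b -> cpl e Y b) ->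
  (forall a, a \in A -> unit g2.1.2 a -> cpl e Y a) ->
  exists z p1 p2 p3, [/\ z \notin Y, tri A B H p1 p2 p3, anticonn e (z |: Y) &
    forall y, y \in z |: Y -> y \notin H /\ mj y p1 p2 p3].
Proof.
move=> t aY Y0 hY fA fB fA2.
have [R1 R2 R3 [n12 n13 n23]] := t.
have [i1 j1 A1 B1 d1] := rung_in V R1; have [i2 j2 A2 B2 d2] := rung_in V R2.
pose D := [set w | cpl e Y w && [|| w \notin H, w \in A | w \in B]].
have D0 : D != set0.
  by apply/set0Pn; exists g1.1.2; rewrite inE (fA _ A1 (same_refl _ _ _ _ _)) A1 orbT.
have cS : conn e (~: (Y :|: D)).
  by apply: NS; apply: (anti_sep e_sym e_irr Y0) => // w; rewrite inE => /andP [].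
have [x1 [x1r x1A x1B]] := rung_inner V R1; have [x2 [x2r x2A x2B]] := rung_inner V R2.
have inS x : x \in H -> x \notin A -> x \notin B -> x \in ~: (Y :|: D).
  move=> xH xA xB; rewrite !inE xH (negPf xA) (negPf xB) andbF orbF.
  by apply: contraL xH => /hY [].
have u1 : unit g1.1.2 x1 by exact: (rung_unit e_sym e_irr R1 i1 x1r).
have u2 : ~~ unit g1.1.2 x2 by exact: (nunit_r e_sym n12 (rung_unit e_sym e_irr R2 i2 x2r)).
pose P w := (w \in H /\ unit g1.1.2 w) \/ (exists F f1 c, [/\ pth e F f1 w,
  forall x, x \in F -> x \notin H /\ ~ major A B H x, c \in H, (c \notin A) && (c \notin B) & unit g1.1.2 c && e f1 c]).
have P1 : P x1 by left; split=> //; exact: rungH R1 x1r.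
have nP2 : ~ P x2.
  case=> [[_ k]|[F [f1 [c [pF FH _ _ _]]]]]; first by rewrite k in u2.
  by have [] := FH _ (pth_in2 pF); rewrite (rungH R2 x2r).
have [u [v [_ /and3P [uS vS uv] Pu nPv]]] :=
  connect_exit (cS _ _ (inS _ (rungH R1 x1r) x1A x1B) (inS _ (rungH R2 x2r) x2A x2B)) P1 nP2.
have notAB1 w : w \in ~: (Y :|: D) -> w \in H -> unit g1.1.2 w -> (w \notin A) && (w \notin B).
  rewrite !inE negb_or => /andP [_ wD] wH uw; apply/andP; split.
    by apply: contra wD => wA; rewrite wA orbT fA.
  by apply: contra wD => wB; rewrite wB !orbT fB.
have vH : v \notin H.
  apply/negP => vH; have nv : ~~ unit g1.1.2 v by apply/negP => k; apply: nPv; left.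
  case: Pu => [[uH uu]|[F [f1 [c [pF FH cH /andP [cA cB] /andP [uc f1c]]]]]].
    have /andP [uA uB] := notAB1 _ uS uH uu.
    by have := diffunit uH vH (nunit_l nv uu); rewrite uv /both (negPf uA) (negPf uB).
  have := bad_set e_sym e_irr noodd noprism M (conn_pset e_sym e_irr pF) (f := f1) (g := u) (x := c) (y := v)
    _ _ _ cH vH f1c uv (nunit_l nv uc).
  rewrite !inE /both (negPf cA) (negPf cB) (pth_in1 pF) (pth_in2 pF) => k.
  by have /k/(_ isT isT) : forall w, w \in [set x in F] -> w \notin H /\ ~ major A B H w by move=> w; rewrite inE; exact: FH.
have mv : major A B H v.
  apply: NNPP => nm; apply: nPv; right.
  case: Pu => [[uH uu]|[F [f1 [c [pF FH cH cAB ucf]]]]].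
    exists [:: v], v, u; split=> //; [exact: pth1|by move=> w; rewrite inE => /eqP ->|exact: notAB1|by rewrite uu e_sym].
  have uF : u \in [set x in F] by rewrite inE (pth_in2 pF).
  have cF := connU1 e_sym (conn_pset e_sym e_irr pF) uF uv.
  have [q [pq hq]] : exists q, pth e q f1 v /\ {subset q <= v |: [set x in F]}.
    by apply: (conn_pth e_sym e_irr cF); rewrite !inE ?eqxx // (pth_in1 pF) orbT.
  by exists q, f1, c; split=> // w /hq; rewrite !inE => /orP [/eqP ->//|]; exact: FH.
have vY : v \notin Y by move: vS; rewrite !inE negb_or => /andP [].
have nvY : ~~ cpl e Y v by move: vS; rewrite !inE negb_or vH /= andbT => /andP [].
(* The vertex [c] is where [v] is reached from. For rungs through it, the outcome in which [v]
   misses that rung and treats the other two in opposite ways is impossible, so replacements there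
   succeed. *)
have [c [cH cA cB uc rch]] : exists c, [/\ c \in H, c \notin A, c \notin B, unit g1.1.2 c &
   forall (h h' h'' : seq T * T * T), tri A B H h h' h'' -> c \in h.1.1 -> missed e v h -> full e v h' -> missed e v h'' -> False].
  case: Pu => [[uH uu]|[F [f1 [c [pF FH cH /andP [cA cB] /andP [uc f1c]]]]]].
    have /andP [uA uB] := notAB1 _ uS uH uu.
    exists u; split=> // h h' h'' _ uh /negP k _ _; apply: k; apply/hasP; exists u => //; by rewrite e_sym.
  exists c; split=> // h h' h'' th ch k1 k2 k3; apply: (reach th ch cA cB pF FH f1c uv vH _ k1 k2 k3).
  by apply/negP => /FH [].
have [r [a [b [Rq cq]]]] := on_rung V cH; pose q1 := (r, a, b).
have Rq1 : rg3 A B H q1 by [].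
have [iq jq Aq Bq dq] := rung_in V Rq.
have uq : unit g1.1.2 q1.1.2 by exact: same_trans uc (rung_unit e_sym e_irr Rq cq iq).
have [p2 [p3 [tp mp]]] : exists p2 p3, tri A B H q1 p2 p3 /\ mj v q1 p2 p3.
  have st (h h' h'' : seq T * T * T) : tri A B H h h' h'' -> mj v h h' h'' -> unit g1.1.2 h.1.2 -> exists p2 p3, tri A B H q1 p2 p3 /\ mj v q1 p2 p3.
    move=> th mh uh; exists h', h''.
    exact: (same_unit_rep e_sym e_irr noodd noprism V vH th Rq1 (unit_tr e_sym uh uq) mh).
  have [h1 [h2 [h3 [th mh]]]] := (proj1 (majorP _ _ _ _ _)) mv.
  case: (boolP (unit g1.1.2 h1.1.2)) => k1; first exact: (st _ _ _ th mh k1).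
  case: (boolP (unit g1.1.2 h2.1.2)) => k2; first by apply: (st h2 h3 h1) => //; [exact: tri_rot|rewrite -mj_rot].
  case: (boolP (unit g1.1.2 h3.1.2)) => k3; first by apply: (st h3 h1 h2) => //; [do 2!apply: (tri_rot e_sym)|rewrite mj_rot].
  have tq : tri A B H q1 h2 h3.
    have [_ r2 r3 [_ _ k23]] := th; split=> //; split=> //; [exact: nunit_l k2 uq|exact: nunit_l k3 uq].
  exists h2, h3; split=> //.
  case: (any_rep e_sym e_irr noodd noprism V vH th tq mh) => // -[k4 k5 k6 k7]; exfalso.
    exact: (rch _ _ _ tq cq k5 k6 k7).
  exact: (rch _ _ _ (tri_swap e_sym (tri_rot e_sym (tri_rot e_sym tq))) cq k5 k6 k7).
(* The second rung is moved into the unit of [g2]: its [A] end is then complete to [Y], so no vertex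
   of [Y] misses it when the third rung is replaced. *)
have [q2 [p [tq mq uq2]]] : exists q2 p : seq T * T * T, [/\ tri A B H q1 q2 p, mj v q1 q2 p & unit g2.1.2 q2.1.2].
  have [_ r2 r3 [m12 m13 m23]] := tp.
  case: (boolP (unit g2.1.2 p2.1.2)) => k2; first by exists p2, p3.
  case: (boolP (unit g2.1.2 p3.1.2)) => k3.
    exists p3, p2; split=> //; first exact: (tri_swap e_sym (tri_rot e_sym (tri_rot e_sym tp))).
    by rewrite mj_swap mj_rot.
  have nq : ~~ unit g2.1.2 q1.1.2 by apply: (nsame_sym e_sym); apply: nunit_l uq.
  have tA : tri A B H g2 q1 p2 by split.
  have tB : tri A B H g2 q1 p3 by split.
  have tp3 : tri A B H p3 q1 p2 by do 2!apply: (tri_rot e_sym).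
  have mp3 : mj v p3 q1 p2 by rewrite mj_rot.
  case: (any_rep e_sym e_irr noodd noprism V vH tp3 tA mp3) => [k|[_ k4 k5 k6]|[_ k4 k5 k6]].
  - by exists g2, p2; split=> //; [exact: tri_swap|rewrite mj_swap|exact: same_refl].
  - have tp2 : tri A B H p2 q1 p3 by exact: tri_swap.
    have mp2 : mj v p2 q1 p3 by rewrite mj_swap.
    have np2 : ~~ full e v p2.
      apply/negP => /andP [k _]; case/negP: k6; apply/hasP; exists p2.1.2 => //.
      by have [? _ _ _ _] := rung_in V r2.
    case: (any_rep e_sym e_irr noodd noprism V vH tp2 tB mp2) => [k|[k _ _ _]|[k _ _ _]]; try by rewrite k in np2.
    by exists g2, p3; split=> //; [exact: tri_swap|rewrite mj_swap|exact: same_refl].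
  by exfalso; apply: (rch q1 p2 g2 (tri_rot e_sym tA) cq k6 k5 k4).
exists v, q1, q2, p; split=> //.
  have [w wY nvw] : exists2 w, w \in Y & ~~ e w v.
    by move: nvY; rewrite /cpl negb_forall => /existsP [w]; rewrite negb_imply => /andP [? ?]; exists w.
  have cs : symmetric (compl e) by exact: compl_sym.
  apply: (connU1 cs aY wY); rewrite /compl nvw andbT; by apply: contraNneq vY => <-.
move=> y; rewrite in_setU1 => /orP [/eqP ->//|yY]; have [yH my] := hY y yY; split=> //.
have [_ Rq2 Rp [nq12 nq1p nq2p]] := tq.
have [ta ma] := same_unit_rep e_sym e_irr noodd noprism V yH t Rq1 uq my.
rewrite mj_swap in ma.
have [tb mb] := same_unit_rep e_sym e_irr noodd noprism V yH (tri_swap e_sym ta) Rq2 uq2 ma.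
have tb' : tri A B H g3 q1 q2 by exact: (tri_rot e_sym (tri_rot e_sym (tri_swap e_sym tb))).
have tp' : tri A B H p q1 q2 by do 2!apply: (tri_rot e_sym).
have mb' : mj y g3 q1 q2 by rewrite mj_rot mj_swap.
have [iq2 _ Aq2 _ _] := rung_in V Rq2.
case: (any_rep e_sym e_irr noodd noprism V yH tb' tp' mb') => [|[_ _ _ k]|[_ _ _ k]]; first by rewrite mj_rot.
  case/negP: k; apply/hasP; exists q2.1.2 => //; exact: (cplP _ _ _ (fA2 _ Aq2 uq2)).
case/negP: k; apply/hasP; exists a => //; exact: (cplP _ _ _ (fA _ Aq uq)).
Qed.

(** Take a largest anticonnected [Y] that is major on one triple. By [exc_pair] at most one of the
    three units has an [A] vertex not complete to [Y], and at most one such a [B] vertex, so some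
    ordering of the triple satisfies [more_majors]. *)
Lemma no_major m : ~ major A B H m.
Proof.
move=> /majorP [g1 [g2 [g3 [t mm]]]].
pose I := ({set T} * ((seq T * T * T) * (seq T * T * T) * (seq T * T * T)))%type.
pose P (i : I) := [/\ tri A B H i.2.1.1 i.2.1.2 i.2.2, anticonn e i.1, i.1 != set0 &
  forall y, y \in i.1 -> y \notin H /\ mj y i.2.1.1 i.2.1.2 i.2.2].
have P0 : P ([set m], (g1, g2, g3)).
  split=> //=; first exact: conn1.
    by apply/set0Pn; exists m; rewrite inE.
  by move=> y; rewrite inE => /eqP ->; split=> //; exact: (mj_out e_sym e_irr V t mm).
have [[Y [[h1 h2] h3]] [/= th aY Y0 hY] mx] := min_ex (fun i : I => #|T| - #|i.1|) P0.
pose exA (g : seq T * T * T) := exists2 a, a \in A & same A B H g.1.2 a && ~~ cpl e Y a.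
pose exB (g : seq T * T * T) := exists2 b, b \in B & same A B H g.1.2 b && ~~ cpl e Y b.
pose tY g1 g2 g3 := tri A B H g1 g2 g3 /\ forall y, y \in Y -> y \notin H /\ mj y g1 g2 g3.
have tYr k1 k2 k3 : tY k1 k2 k3 -> tY k2 k3 k1.
  by case=> s1 s2; split=> [|y /s2 [s3 s4]]; [exact: tri_rot|split=> //; rewrite -mj_rot].
have tYs k1 k2 k3 : tY k1 k2 k3 -> tY k2 k1 k3.
  by case=> s1 s2; split=> [|y /s2 [s3 s4]]; [exact: tri_swap|split=> //; rewrite mj_swap].
have eA k1 k2 k3 : tY k1 k2 k3 -> exA k1 -> exA k2 -> False.
  move=> [s1 s2] [a aA /andP [ua na]] [a' aA' /andP [ua' na']].
  exact: (exc_pair V s1 aY s2 aA ua na aA' ua' na').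
have eB k1 k2 k3 : tY k1 k2 k3 -> exB k1 -> exB k2 -> False.
  move=> [s1 s2] [a aA /andP [ua na]] [a' aA' /andP [ua' na']].
  have V' := valid_swap e_sym e_irr V; have s1' := tri_flip e_sym e_irr V s1.
  have [r1 r2 _ _] := s1.
  apply: (exc_pair V' s1' aY _ aA _ na aA' _ na'); last 2 first.
  - by rewrite same_swap; exact: (unit_tr e_sym (rg_AB e_sym e_irr V r1) ua).
  - by rewrite same_swap; exact: (unit_tr e_sym (rg_AB e_sym e_irr V r2) ua').
  by move=> y /s2 [s3 /andP [s4 s5]]; split=> //; rewrite /mj /= s4 s5.
have fin k1 k2 k3 : tY k1 k2 k3 -> ~ exA k1 -> ~ exB k1 -> ~ exA k2 -> False.
  move=> [s1 s2] n1 n2 n3.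
  have full' (g : seq T * T * T) X : ~ (exists2 a, a \in X & same A B H g.1.2 a && ~~ cpl e Y a) ->
     forall a, a \in X -> same A B H g.1.2 a -> cpl e Y a.
    by move=> n a aX ua; apply: contraT => na; case: n; exists a; rewrite ?ua.
  have [z [p1 [p2 [p3 [zY tp aZ hZ]]]]] := more_majors s1 aY Y0 s2 (full' _ _ n1) (full' _ _ n2) (full' _ _ n3).
  have PZ : P (z |: Y, (p1, p2, p3)).
    by split=> //=; apply/set0Pn; exists z; rewrite in_setU1 eqxx.
  have := mx _ PZ; have := max_card (mem (z |: Y)); rewrite /= !cardsU1 zY add1n; move: #|T| #|Y| => p q; clear; lia.
have t0 : tY h1 h2 h3 by split.
have t1 := tYr _ _ _ t0; have t2 := tYr _ _ _ t1; have t3 := tYs _ _ _ t0; have t4 := tYr _ _ _ t3; have t5 := tYr _ _ _ t4.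
case: (classic (exA h1)) => a1.
  have a2 := eA _ _ _ t0 a1; have a3 : ~ exA h3 by move=> k; exact: (eA _ _ _ t2 k a1).
  case: (classic (exB h2)) => b2; last exact: (fin _ _ _ t1).
  by apply: (fin _ _ _ t5) => // k; exact: (eB _ _ _ t1 b2 k).
case: (classic (exA h2)) => a2.
  have a3 : ~ exA h3 by move=> k; exact: (eA _ _ _ t1 a2 k).
  case: (classic (exB h1)) => b1; last exact: (fin _ _ _ t4).
  by apply: (fin _ _ _ t2) => // k; exact: (eB _ _ _ t2 k b1).
case: (classic (exB h1)) => b1; last exact: (fin _ _ _ t0).
apply: (fin _ _ _ t3) => // k; exact: (eB _ _ _ t0 b1 k).
Qed.
End Core.
End Majors.

(** * Decompositions of the whole graph *)

Section Whole.
Variables (T : finType) (e : rel T).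
Hypothesis e_sym : symmetric e.
Hypothesis e_irr : irreflexive e.
Hypothesis noodd : forall c, hole e c -> ~~ odd (size c).
Hypothesis noanti : forall c, ~~ hole (compl e) c.
Hypothesis noprism : forall a1 a2 a3 q1 q2 q3, ~~ odd_prism e a1 a2 a3 q1 q2 q3.
Hypothesis NS : forall B, disconnected_on (compl e) B -> conn e (~: B).
Implicit Types (s t r q Q F P : seq T) (x y z a b c d u v w h f m : T) (X Y S A B H : {set T}).

Local Notation rung := (rung e).
Local Notation valid := (valid e).
Local Notation maxv := (maxv e).
Local Notation same := (same e).

Lemma valid_init Q1 a1 b1 Q2 a2 b2 Q3 a3 b3 : prism3 e Q1 a1 b1 Q2 a2 b2 Q3 a3 b3 ->
  exists H, valid [set a1; a2; a3] [set b1; b2; b3] H a1 a2 a3 /\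
   forall w, (w \in H) = [|| w \in Q1, w \in Q2 | w \in Q3].
Proof.
case=> p1 p2 p3 [d1 d2 d3 [[n12 c12] [n13 c13] [n23 c23]]].
pose A := [set a1; a2; a3]; pose B := [set b1; b2; b3].
pose H := [set w | [|| w \in Q1, w \in Q2 | w \in Q3]].
have i1 := pth_in1 p1; have i2 := pth_in1 p2; have i3 := pth_in1 p3.
have j1 := pth_in2 p1; have j2 := pth_in2 p2; have j3 := pth_in2 p3.
have n21 x : x \in Q2 -> x \notin Q1 by apply: contraL => /n12.
have n31 x : x \in Q3 -> x \notin Q1 by apply: contraL => /n13.
have n32 x : x \in Q3 -> x \notin Q2 by apply: contraL => /n23.
have ne Q x z : x \in Q -> z \notin Q -> (x == z) = false.
  by move=> xQ; apply: contraNF => /eqP <-.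
have sA1 u : u \in Q1 -> (u \in A) = (u == a1).
  by move=> k; rewrite !inE (ne _ _ _ k (n21 _ i2)) (ne _ _ _ k (n31 _ i3)) !orbF.
have sB1 u : u \in Q1 -> (u \in B) = (u == b1).
  by move=> k; rewrite !inE (ne _ _ _ k (n21 _ j2)) (ne _ _ _ k (n31 _ j3)) !orbF.
have sA2 u : u \in Q2 -> (u \in A) = (u == a2).
  by move=> k; rewrite !inE (ne _ _ _ k (n12 _ i1)) (ne _ _ _ k (n32 _ i3)) orbF.
have sB2 u : u \in Q2 -> (u \in B) = (u == b2).
  by move=> k; rewrite !inE (ne _ _ _ k (n12 _ j1)) (ne _ _ _ k (n32 _ j3)) orbF.
have sA3 u : u \in Q3 -> (u \in A) = (u == a3).
  by move=> k; rewrite !inE (ne _ _ _ k (n13 _ i1)) (ne _ _ _ k (n23 _ i2)).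
have sB3 u : u \in Q3 -> (u \in B) = (u == b3).
  by move=> k; rewrite !inE (ne _ _ _ k (n13 _ j1)) (ne _ _ _ k (n23 _ j2)).
have inH w : (w \in H) = [|| w \in Q1, w \in Q2 | w \in Q3] by rewrite inE.
exists H; split=> //.
have lk Q Q' a b a' b' u v : (forall u, u \in Q -> (u \in A) = (u == a)) -> (forall u, u \in Q -> (u \in B) = (u == b)) ->
   (forall u, u \in Q' -> (u \in A) = (u == a')) -> (forall u, u \in Q' -> (u \in B) = (u == b')) ->
   (forall x y, x \in Q -> y \in Q' -> e x y = ((x == a) && (y == a')) || ((x == b) && (y == b'))) ->
   u \in Q -> v \in Q' -> link e A B u v = false.
  by move=> h1 h2 h3 h4 h5 uQ vQ; rewrite /link /both h5 // h1 // h2 // h3 // h4 // eqxx andbF.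
have sym Q a b Q' a' b' : (forall x y, x \in Q -> y \in Q' -> e x y = ((x == a) && (y == a')) || ((x == b) && (y == b'))) ->
   forall x y, x \in Q' -> y \in Q -> e x y = ((x == a') && (y == a)) || ((x == b') && (y == b)).
  by move=> h x y xq yq; rewrite e_sym h //; congr (_ || _); rewrite andbC.
have sep x y Q : x \in Q -> y \notin Q -> (forall u v, u \in Q -> v \in H -> v \notin Q -> link e A B u v = false) ->
    ~~ same A B H x y.
  move=> xQ yQ hQ; apply/negP => k.
  have nP : ~ y \in Q by apply/negP.
  have [u [v [_ /and3P [uH vH uv] uQ vQ]]] := connect_exit (P := fun w => w \in Q) k xQ nP.
  by move: uv; rewrite hQ //; apply/negP.
have s1 := sep _ _ Q1 i1.
have c1 u v : u \in Q1 -> v \in H -> v \notin Q1 -> link e A B u v = false.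
  rewrite inH => uQ /or3P [->//|vQ|vQ] _.
    exact: (lk _ _ _ _ _ _ _ _ sA1 sB1 sA2 sB2 c12 uQ vQ).
  exact: (lk _ _ _ _ _ _ _ _ sA1 sB1 sA3 sB3 c13 uQ vQ).
have c2 u v : u \in Q2 -> v \in H -> v \notin Q2 -> link e A B u v = false.
  rewrite inH => uQ /or3P [vQ|->//|vQ] _.
    exact: (lk _ _ _ _ _ _ _ _ sA2 sB2 sA1 sB1 (sym _ _ _ _ _ _ c12) uQ vQ).
  exact: (lk _ _ _ _ _ _ _ _ sA2 sB2 sA3 sB3 c23 uQ vQ).
have rg Q a b : pth e Q a b -> (forall u, u \in Q -> (u \in A) = (u == a)) -> (forall u, u \in Q -> (u \in B) = (u == b)) ->
    {subset Q <= H} -> rung A B H Q a b.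
  move=> p h1 h2 sQ; split=> //; first by rewrite h1 ?(pth_in1 p).
    by rewrite h2 ?(pth_in2 p).
  by move=> w wQ; rewrite h1 // h2 //; split=> /eqP.
have q1 : {subset Q1 <= H} by move=> w wQ; rewrite inH wQ.
have q2 : {subset Q2 <= H} by move=> w wQ; rewrite inH wQ orbT.
have q3 : {subset Q3 <= H} by move=> w wQ; rewrite inH wQ !orbT.
split.
- by apply/subsetP => w; rewrite !inE => /orP [/orP []|] /eqP ->; rewrite ?i1 ?i2 ?i3 ?orbT.
- by apply/subsetP => w; rewrite !inE => /orP [/orP []|] /eqP ->; rewrite ?j1 ?j2 ?j3 ?orbT.
- rewrite disjoint_subset; apply/subsetP => w wA; rewrite -topredE /=.
  move: wA; rewrite !inE => /orP [/orP []|] /eqP ->.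
  + by have := sB1 _ i1; rewrite !inE (negPf d1) => ->.
  + by have := sB2 _ i2; rewrite !inE (negPf d2) => ->.
  + by have := sB3 _ i3; rewrite !inE (negPf d3) => ->.
- split; [exact: q1|exact: q2|exact: q3|split].
  + by apply: sep i1 (n21 _ i2) c1.
  + by apply: sep i1 (n31 _ i3) c1.
  + by apply: sep i2 (n32 _ i3) c2.
move=> h; rewrite inH => /or3P [] hQ.
- by exists Q1, a1, b1; split=> //; apply: rg.
- by exists Q2, a2, b2; split=> //; apply: rg.
by exists Q3, a3, b3; split=> //; apply: rg.
Qed.

Lemma maxv_ex A0 B0 H0 c1 c2 c3 : valid A0 B0 H0 c1 c2 c3 ->
  exists A B H, [/\ maxv A B H c1 c2 c3, A0 \subset A, B0 \subset B & H0 \subset H].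
Proof.
move=> V0; pose P (i : {set T} * {set T} * {set T}) :=
  [/\ valid i.1.1 i.1.2 i.2 c1 c2 c3, A0 \subset i.1.1, B0 \subset i.1.2 & H0 \subset i.2].
have P0 : P (A0, B0, H0) by split.
have [[[A B] H] [/= V sA sB sH] mx] := min_ex (fun i : {set T} * {set T} * {set T} => #|T| - #|i.2|) P0.
exists A, B, H; split=> //; split=> // A' B' H' V' sA' sB' sH'.
have P' : P (A', B', H') by split; rewrite //=; [exact: subset_trans sA'|exact: subset_trans sB'|exact: subset_trans sH'].
have le := mx _ P'; rewrite /= in le.
have : #|H'| <= #|H|.
  by move: le (max_card (mem H)) (max_card (mem H')) (subset_leq_card sH'); move: #|T| #|H| #|H'| => p q r; clear; lia.
move=> k; have /eqP <- // : H == H'.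
by rewrite eqEcard sH' k.
Qed.

(** Vertices of [A] in different units are adjacent, so [A] is antidisconnected and cannot separate
    an outside component from [B]. *)
Lemma no_A_component A B H c1 c2 c3 v : valid A B H c1 c2 c3 -> v \notin H ->
  (forall w h, w \in ccomp e (~: H) v -> h \in H -> e w h -> h \in A) -> False.
Proof.
move=> V vH hA.
have [_ _ _ [h1 h2 _ [n12 _ _]] _] := V.
have [r1 [a1 [b1 [R1 i1]]]] := on_rung V h1; have [r2 [a2 [b2 [R2 i2]]]] := on_rung V h2.
have [j1 _ A1 B1 _] := rung_in V R1; have [j2 _ A2 _ _] := rung_in V R2.
pose X := [set a in A | same A B H a1 a]; pose N := A :\: X.
have n : ~~ same A B H a1 a2.
  apply: nunit_l (rung_unit e_sym e_irr R1 i1 j1); exact: (nunit_r e_sym n12 (rung_unit e_sym e_irr R2 i2 j2)).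
have X0 : X != set0 by apply/set0Pn; exists a1; rewrite inE A1 same_refl.
have N0 : N != set0 by apply/set0Pn; exists a2; rewrite !inE A2 (negPf n).
have XN : X :|: N = A.
  by apply/setP => w; rewrite !inE; case: (w \in A); case: (same A B H a1 w).
have cX : {in N, forall w, cpl e X w}.
  move=> w; rewrite !inE => /andP [nw wA]; apply/cplP => a; rewrite inE => /andP [aA ua].
  have na : ~~ same A B H a w by rewrite wA /= in nw; exact: nunit_l nw ua.
  by rewrite (diffunit (inAH V aA) (inAH V wA) na) /both aA wA.
have cS := NS (anti_sep e_sym e_irr X0 cX N0); rewrite XN in cS.
have vS : v \in ~: A by rewrite inE; apply: contra vH; exact: (inAH V).
have bS : b1 \in ~: A by rewrite inE; apply/negP => /(notAB V); rewrite B1.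
have vC : v \in ~: H by rewrite inE.
have nb : ~ b1 \in ccomp e (~: H) v.
  by move=> k; have := subsetP (comp_sub e_sym e_irr vC) _ k; rewrite inE (inBH V B1).
have [u [w [_ /and3P [_ wA uw] uc wc]]] := connect_exit (P := fun w => w \in ccomp e (~: H) v) (cS _ _ vS bS) (comp_self _ _ _) nb.
case: (boolP (w \in H)) => wH.
  by move: wA; rewrite inE (hA _ _ uc wH uw).
by apply: wc; apply: (comp_out e_sym e_irr vC uc _ uw); rewrite inE.
Qed.

(** Each component outside [H] attaches within a single unit: attachments confined to one side but
    spread over several units are excluded by [no_A_component]. Outside vertices therefore merge no
    units. *)
Lemma whole_units A B H c1 c2 c3 u v : maxv A B H c1 c2 c3 -> u \in H -> v \in H ->
  same A B [set: T] u v -> same A B H u v.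
Proof.
move=> M uH vH; have V := proj1 M.
have loc (s0 s s' : T) h h' : s0 \notin H -> s \in ccomp e (~: H) s0 -> s' \in ccomp e (~: H) s0 -> h \in H -> h' \in H ->
    e s h -> e s' h' -> same A B H h h'.
  move=> s0H sc sc' hH hH' sh sh'; have s0C : s0 \in ~: H by rewrite inE.
  have cC := comp_conn e_sym e_irr s0C.
  have oH w : w \in ccomp e (~: H) s0 -> w \notin H /\ ~ major e A B H w.
    move=> k; have := subsetP (comp_sub e_sym e_irr s0C) _ k; rewrite inE => wH; split=> //.
    exact: (no_major e_sym e_irr noodd noanti noprism NS M).
  pose N h := h \in H /\ exists2 s : T, s \in ccomp e (~: H) s0 & e s h.
  have Nh : N h by split=> //; exists s.
  have Nh' : N h' by split=> //; exists s'.
  have hN x y : N x -> N y -> ~~ same A B H x y -> both A B x y.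
    move=> [xH [f fc fx]] [yH [g gc gy]] n.
    exact: (bad_set e_sym e_irr noodd noprism M cC oH fc gc xH yH fx gy n).
  case: (local_type e_sym V Nh hN) => [k|[k _]|[k _]]; first exact: k.
    exfalso; apply: (no_A_component V s0H) => w x wc xH wx; apply: k; split=> //; by exists w.
  exfalso; apply: (no_A_component (valid_swap e_sym e_irr V) s0H) => w x wc xH wx; apply: k; split=> //; by exists w.
move=> uv; apply: contraT => nuv.
pose P w := (w \in H /\ same A B H u w) \/ (w \notin H /\ exists (s : T) h, [/\ s \in ccomp e (~: H) w, h \in H, e s h & same A B H u h]).
have Pu : P u by left; split=> //; exact: same_refl.
have nPv : ~ P v by case=> [[_ k]|[k _]]; [rewrite k in nuv|rewrite vH in k].
have [x [y [_ /and3P [_ _ xy] Px nPy]]] := connect_exit uv Pu nPv.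
have nl w z : w \notin H -> link e A B w z -> e w z.
  move=> wH /andP [_]; have -> : both A B w z = false.
    rewrite /both; have -> : w \in A = false by apply: contraNF wH; exact: (inAH V).
    by have -> : w \in B = false by apply: contraNF wH; exact: (inBH V).
  by case: (e w z).
case: nPy; case: (boolP (y \in H)) => yH; case: Px => [[xH ux]|[xH [s [h [sc hH sh uh]]]]].
- by left; split=> //; apply: same_trans ux _; apply: same1.
- left; split=> //; apply: same_trans uh _.
  exact: (loc x s x h y xH sc (comp_self _ _ _) hH yH sh (nl _ _ xH xy)).
- right; split=> //; exists y, x; split=> //; first exact: comp_self.
  by apply: nl => //; rewrite link_sym.
right; split=> //; exists s, h; split=> //.
have xC : x \in ~: H by rewrite inE.
have yC : y \in ~: H by rewrite inE.
have k : connect (restr e (~: H)) y x.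
  by apply: connect1; rewrite /restr xC yC e_sym nl.
by move: sc; rewrite !inE; exact: connect_trans k.
Qed.

Definition split3 A B a1 a2 a3 := [/\ ~~ same A B [set: T] a1 a2, ~~ same A B [set: T] a1 a3 & ~~ same A B [set: T] a2 a3].

(* The final decomposition: A and B are anticomplete, and distinct link-classes of the whole
   vertex set are joined exactly inside A and inside B. *)
Definition decomposition A B := [/\ [disjoint A & B], forall a b, a \in A -> b \in B -> ~~ e a b,
  exists a1 a2 a3, [/\ a1 \in A, a2 \in A, a3 \in A & split3 A B a1 a2 a3] &
  exists b1 b2 b3, [/\ b1 \in B, b2 \in B, b3 \in B & split3 A B b1 b2 b3]].

Theorem prism_decomposition Q1 a1 b1 Q2 a2 b2 Q3 a3 b3 : prism3 e Q1 a1 b1 Q2 a2 b2 Q3 a3 b3 ->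
  exists A B, [/\ decomposition A B, [/\ a1 \in A, a2 \in A & a3 \in A] & split3 A B a1 a2 a3].
Proof.
move=> K; have [H0 [V0 H0E]] := valid_init K.
have [A [B [H [M sA sB sH]]]] := maxv_ex V0; have V := proj1 M.
have A1 : a1 \in A by apply: (subsetP sA); rewrite !inE eqxx.
have A2 : a2 \in A by apply: (subsetP sA); rewrite !inE eqxx orbT.
have A3 : a3 \in A by apply: (subsetP sA); rewrite !inE eqxx orbT.
have [_ _ dAB [_ _ _ [n12 n13 n23]] _] := V.
have w2 x y : x \in H -> y \in H -> ~~ same A B H x y -> ~~ same A B [set: T] x y.
  by move=> xH yH; apply: contra; exact: whole_units M xH yH.
have sAs : split3 A B a1 a2 a3 by split; apply: w2; rewrite ?(inAH V).
exists A, B; split=> //; split=> //.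
- by move=> a b; exact: (nadjAB e_sym e_irr noodd noprism V).
- by exists a1, a2, a3.
have [r1 [x1 R1]] := rungA V A1; have [r2 [x2 R2]] := rungA V A2; have [r3 [x3 R3]] := rungA V A3.
have [i1 j1 _ B1 _] := rung_in V R1; have [i2 j2 _ B2 _] := rung_in V R2; have [i3 j3 _ B3 _] := rung_in V R3.
have u1 := rung_unit e_sym e_irr R1 i1 j1; have u2 := rung_unit e_sym e_irr R2 i2 j2; have u3 := rung_unit e_sym e_irr R3 i3 j3.
exists x1, x2, x3; split=> //; split; (apply: w2; [exact: (inBH V)|exact: (inBH V)|]).
- by apply: nunit_l u1; exact: (nunit_r e_sym n12 u2).
- by apply: nunit_l u1; exact: (nunit_r e_sym n13 u3).
- by apply: nunit_l u2; exact: (nunit_r e_sym n23 u3).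
Qed.
End Whole.

(** * A vertex seeing no triangle edge of a prism *)

Section Laminar.
Variables (T : finType) (e : rel T).
Hypothesis e_sym : symmetric e.
Hypothesis e_irr : irreflexive e.
Hypothesis noodd : forall c, hole e c -> ~~ odd (size c).
Hypothesis noanti : forall c, ~~ hole (compl e) c.
Hypothesis noprism : forall a1 a2 a3 q1 q2 q3, ~~ odd_prism e a1 a2 a3 q1 q2 q3.
Hypothesis NS : forall B, disconnected_on (compl e) B -> conn e (~: B).
Implicit Types (x y z a b c d u v w h f m : T) (X Y S A B H D : {set T}).

Local Notation cls A B := (same e A B [set: T]).
Local Notation decomposition := (decomposition e).

Lemma decomposition_swap A B : decomposition A B -> decomposition B A.
Proof.
case=> d ac [a1 [a2 [a3 [A1 A2 A3 [n1 n2 n3]]]]] [b1 [b2 [b3 [B1 B2 B3 [m1 m2 m3]]]]].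
split; first by rewrite disjoint_sym.
- by move=> a b aB bA; rewrite e_sym ac.
- by exists b1, b2, b3; split=> //; split; rewrite same_swap.
by exists a1, a2, a3; split=> //; split; rewrite same_swap.
Qed.

Lemma decomposition_out A B x : decomposition A B -> exists a a', [/\ a \in A, a' \in A, ~~ cls A B x a, ~~ cls A B x a' & ~~ cls A B a a'].
Proof.
case=> _ _ [a1 [a2 [a3 [A1 A2 A3 [n1 n2 n3]]]]] _.
case: (boolP (cls A B x a1)) => k1.
  by exists a2, a3; split=> //; apply: (nsame_sym e_sym); apply: (nunit_r e_sym _ (_ : cls A B a1 x)); rewrite ?(same_sym e_sym _ _ _ a1 x) // (same_sym e_sym).
case: (boolP (cls A B x a2)) => k2; last by exists a1, a2.
exists a1, a3; split=> //; apply/negP => k3; case/negP: n3; exact: (unit_tr e_sym k2 k3).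
Qed.

Lemma cls_adj A B u v : ~~ cls A B u v -> e u v = both A B u v.
Proof. exact: diffunit (in_setT u) (in_setT v). Qed.

Lemma class_conn A B D a a' : D \subset A -> a \in D -> a' \in D -> ~~ cls A B a a' -> conn e (~: D).
Proof.
move=> sD aD aD' n; pose X := [set w in D | cls A B a w]; pose N := D :\: X.
have X0 : X != set0 by apply/set0Pn; exists a; rewrite inE aD same_refl.
have N0 : N != set0 by apply/set0Pn; exists a'; rewrite !inE aD' (negPf n).
have XN : X :|: N = D by apply/setP => w; rewrite !inE; case: (w \in D); case: (cls A B a w).
have cX : {in N, forall w, cpl e X w}.
  move=> w; rewrite !inE => /andP [nw wD]; apply/cplP => x; rewrite inE => /andP [xD ux].
  have na : ~~ cls A B x w by rewrite wD /= in nw; exact: nunit_l nw ux.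
  by rewrite (cls_adj na) /both (subsetP sD _ xD) (subsetP sD _ wD).
by have := NS (anti_sep e_sym e_irr X0 cX N0); rewrite XN.
Qed.

(** Delete [B] except possibly [t0]; a vertex of [A] is still reachable from [t0]. Outside [A],
    other classes are seen only from [B], so the connection stays in the class until it enters [S],
    and the entering edge is the one wanted. *)
Lemma port A B x t0 S : decomposition A B -> cls A B x t0 -> t0 \notin S -> (forall a, a \in A -> cls A B x a -> a \in S) ->
  exists s t, [/\ cls A B x s, s \in S & s \notin B] /\ [/\ cls A B x t, t \notin S, t \notin A & e s t].
Proof.
move=> G xt t0S hS.
have [b [b' [bB bB' n1 n2 n3]]] := decomposition_out t0 (decomposition_swap G).
have ne b0 : ~~ cls B A t0 b0 -> b0 != t0 by apply: contraNneq => ->; exact: same_refl.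
have cD : conn e (~: (B :\ t0)).
  apply: (@class_conn B A _ b b'); rewrite ?subD1set // !inE ?bB ?bB' andbT; exact: ne.
have [_ _ [a1 [_ [_ [A1 _ _ _]]]] _] := G; have [dAB _ _ _] := G.
have t0D : t0 \in ~: (B :\ t0) by rewrite !inE eqxx.
have a1D : a1 \in ~: (B :\ t0) by rewrite !inE (disjointFr dAB A1) andbF.
have nP : ~ (cls A B x a1 /\ a1 \notin S) by case=> k; rewrite (hS _ A1 k).
have [u [v [_ /and3P [_ vD uv] [xu uS] nPv]]] :=
  connect_exit (P := fun w => cls A B x w /\ w \notin S) (cD _ _ t0D a1D) (conj xt t0S) nP.
have uA : u \notin A by apply: contra uS => uA; exact: hS.
have xv : cls A B x v.
  apply: contraT => nxv; have nuv := nunit_l nxv xu.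
  move: uv; rewrite (cls_adj nuv) /both (negPf uA) /= => /andP [_ vB].
  move: vD; rewrite !inE vB andbT negbK => /eqP ev; by rewrite ev xt in nxv.
have vS : v \in S by apply: contraT => vS; case: nPv.
exists v, u; split; split=> //; last by rewrite e_sym.
by apply: contraTN vS => vB; move: vD; rewrite !inE vB andbT negbK => /eqP ->.
Qed.

Lemma both_type A B u v : both A B u v -> exists X, (X = A \/ X = B) /\ u \in X /\ v \in X.
Proof. by case/orP => /andP [? ?]; [exists A|exists B]; split; auto. Qed.

(* A class of minimal size among all classes meeting the A-side of some decomposition cannot be
   refined: the decomposition of a prism with two corners next to y would have a smaller one. *)
Lemma laminar A B s0 y : decomposition A B -> s0 \in A ->
  (forall A' B' s, decomposition A' B' -> s \in A' -> #|[set w | cls A B s0 w]| <= #|[set w | cls A' B' s w]|) ->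
  cls A B s0 y -> y \notin A -> y \notin B ->
  forall p1 a1 b1 p2 a2 b2 p3 a3 b3, prism3 e p1 a1 b1 p2 a2 b2 p3 a3 b3 -> e y a1 -> e y a2 -> False.
Proof.
move=> G s0A mx sy yA yB p1 a1 b1 p2 a2 b2 p3 a3 b3 K ya1 ya2.
have [A' [B' [G' [A1 A2 _] [n12 _ _]]]] := prism_decomposition e_sym e_irr noodd noanti noprism NS K.
have [dAB _ _ _] := G; have [dAB' _ _ _] := G'.
pose S := [set w | cls A B s0 w].
have inS w : (w \in S) = cls A B s0 w by rewrite inE.
have nAB' w : w \in A' -> w \notin B' by move=> k; rewrite (disjointFr dAB' k).
have yA' : y \in A'.
  have get a : a \in A' -> e y a -> ~~ cls A' B' y a -> y \in A'.
    by move=> aA ya n; move: ya; rewrite (cls_adj n) /both aA (negPf (nAB' _ aA)) andbT andbF orbF.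
  case: (boolP (cls A' B' y a1)) => k; last exact: (get a1).
  by apply: (get a2) => //; apply: contra n12 => k2; exact: (unit_tr e_sym k k2).
have adj u v : u \in S -> v \notin S -> e u v = both A B u v.
  by rewrite !inS => k1 k2; apply: cls_adj; exact: nunit_l k2 k1.
have yS : y \in S by rewrite inS.
have NyS w : e y w -> w \in S.
  by move=> yw; apply: contraT => wS; move: yw; rewrite (adj _ _ yS wS) /both (negPf yA) (negPf yB).
have A'S a : a \in A' -> ~~ cls A' B' y a -> a \in S.
  by move=> aA n; apply: NyS; rewrite (cls_adj n) /both yA' aA.
have [p [q [pA qA np nq npq]]] := decomposition_out y G'.
have pS := A'S _ pA np; have qS := A'S _ qA nq.
(* By minimality a new class that avoids a vertex of [S] is not contained in [S]; [port] then
   provides an edge of this class leaving [S]. *)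
have getp x z : x \in A' -> z \in S -> ~~ cls A' B' x z -> (forall a, a \in A' -> cls A' B' x a -> a \in S) ->
   exists s t, [/\ cls A' B' x s, s \in S & s \notin B'] /\ [/\ cls A' B' x t, t \notin S, t \notin A' & e s t].
  move=> xA zS nz hS; apply: NNPP => no.
  have := mx _ _ _ G' xA; rewrite leqNgt => /negP; apply; apply: proper_card.
  apply/properP; split; last by exists z; rewrite -?inS // inE.
  apply/subsetP => w; rewrite inE => xw; apply: contraT => wS; case: no; exact: port xw wS hS.
have clS x : ~~ cls A' B' y x -> forall a, a \in A' -> cls A' B' x a -> a \in S.
  by move=> nx a aA xa; apply: A'S => //; exact: (nunit_r e_sym nx xa).
have [s1 [t1 [[ps1 s1S s1B] [pt1 t1S t1A st1]]]] := getp p y pA yS (nsame_sym e_sym np) (clS _ np).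
have [s2 [t2 [[qs2 s2S s2B] [qt2 t2S t2A st2]]]] := getp q y qA yS (nsame_sym e_sym nq) (clS _ nq).
have nadj x x' u v : ~~ cls A' B' x x' -> cls A' B' x u -> cls A' B' x' v -> u \notin B' -> v \notin A' ->
    u \in S -> v \notin S -> both A B u v = false.
  move=> nx xu xv uB vA uS vS; have n : ~~ cls A' B' u v by apply: nunit_l xu; exact: (nunit_r e_sym nx xv).
  by rewrite -adj // (cls_adj n) /both (negPf uB) (negPf vA) !andbF.
have nqp := nsame_sym e_sym npq; have npy := nsame_sym e_sym np; have nqy := nsame_sym e_sym nq.
rewrite adj // in st1; rewrite adj // in st2.
have f12 := nadj _ _ _ _ npq ps1 qt2 s1B t2A s1S t2S.
have f21 := nadj _ _ _ _ nqp qs2 pt1 s2B t1A s2S t1S.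
have g21 := nadj _ _ _ _ nqp (same_refl _ _ _ _ _) pt1 (nAB' _ qA) t1A qS t1S.
have g12 := nadj _ _ _ _ npq (same_refl _ _ _ _ _) qt2 (nAB' _ pA) t2A pS t2S.
have ft u v X : both A B u v = false -> X = A \/ X = B -> u \in X -> v \in X -> False.
  by move=> h [->|->] k1 k2; move: h; rewrite /both k1 k2 ?orbT.
have [X1 [hX1 [s1X t1X]]] := both_type st1; have [X2 [hX2 [s2X t2X]]] := both_type st2.
(* Edges leaving [S] lie inside [A] or inside [B]. If both used the same side, [s1 t2] would be an
   edge between different new classes inside neither [A'] nor [B']. *)
have X12 : X1 <> X2 by move=> k; rewrite -k in t2X; exact: ft f12 hX1 s1X t2X.
have ally a : a \in A' -> cls A' B' y a -> a \in S.
  move=> aA ya; apply: contraT => aS; exfalso.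
  have nap : ~~ cls A' B' p a by apply: (nsame_sym e_sym); exact: nunit_l np ya.
  have naq : ~~ cls A' B' q a by apply: (nsame_sym e_sym); exact: nunit_l nq ya.
  have ep : both A B p a by rewrite -adj // (cls_adj nap) /both pA aA.
  have eq : both A B q a by rewrite -adj // (cls_adj naq) /both qA aA.
  have [X3 [hX3 [pX aX]]] := both_type ep; have [X4 [hX4 [qX aX']]] := both_type eq.
  have X34 : X3 = X4.
    have dd : ~ ((a \in A) && (a \in B)) by move=> /andP [kA]; rewrite (disjointFr dAB kA).
    by case: hX3 aX => ->; case: hX4 aX' => -> // k1 k2; case: dd; rewrite k1 k2.
  rewrite -X34 in qX.
  case: (classic (X3 = X1)) => k; first by rewrite k in qX; exact: ft g21 hX1 qX t1X.
  have k2 : X3 = X2 by case: hX3 hX1 hX2 k X12 => -> [] -> [] ->; tauto.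
  by rewrite k2 in pX; exact: ft g12 hX2 pX t2X.
(* The class of [y] is a third one leaving [S], but only two sides are available. *)
have [s3 [t3 [[ys3 s3S s3B] [yt3 t3S t3A st3]]]] := getp y p yA' pS np ally.
rewrite adj // in st3.
have [X3 [hX3 [s3X t3X]]] := both_type st3.
case: (classic (X3 = X1)) => k.
  by rewrite k in s3X; exact: ft (nadj _ _ _ _ np ys3 pt1 s3B t1A s3S t1S) hX1 s3X t1X.
have k2 : X3 = X2 by case: hX3 hX1 hX2 k X12 => -> [] -> [] ->; tauto.
by rewrite k2 in s3X; exact: ft (nadj _ _ _ _ nq ys3 qt2 s3B t2A s3S t2S) hX2 s3X t2X.
Qed.

(** As [A] and [B] are anticomplete, a class without inner vertices would lie in [A]. Deleting the
    rest of [A], which is antidisconnected, would then isolate [s0]. *)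
Lemma inner_vertex A B s0 : decomposition A B -> s0 \in A -> exists y, [/\ cls A B s0 y, y \notin A & y \notin B].
Proof.
move=> G s0A; have [dAB ac _ [b [_ [_ [bB _ _ _]]]]] := G; apply: NNPP => no.
have s0B : s0 \in B = false by rewrite (disjointFr dAB s0A).
have bA : b \in A = false by rewrite (disjointFl dAB bB).
have inA w : cls A B s0 w -> w \in A.
  move=> sw; apply: contraT => wA.
  have nP : ~ w \in A by apply/negP.
  have [u [v [su uv uA vA]]] := connect_exit (P := fun w => w \in A) sw s0A nP.
  have sv : cls A B s0 v by exact: connect_trans su (connect1 uv).
  have vB : v \in B by apply: contraT => vB; case: no; exists v; split=> //; apply/negP.
  move: uv => /and3P [_ _ /andP [_]]; rewrite (negPf (ac _ _ uA vB)) /both (disjointFr dAB uA) /=.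
  by rewrite (disjointFl dAB vB) andbF.
have [a [a' [aA aA' n1 n2 n3]]] := decomposition_out s0 G.
have ne x : ~~ cls A B s0 x -> x != s0 by apply: contraNneq => ->; exact: same_refl.
have cD : conn e (~: (A :\ s0)).
  apply: (@class_conn A B _ a a'); rewrite ?subD1set // !inE ?aA ?aA' andbT; exact: ne.
have h1 : s0 \in ~: (A :\ s0) by rewrite !inE eqxx.
have h2 : b \in ~: (A :\ s0) by rewrite !inE bA andbF.
have nP : b <> s0 by move=> k; rewrite k s0A in bA.
have [u [v [_ /and3P [_ vD uv] eu vs]]] := connect_exit (P := fun w => w = s0) (cD _ _ h1 h2) erefl nP.
rewrite eu in uv; have vA : v \notin A.
  by apply/negP => vA; move: vD; rewrite !inE vA andbT negbK => /eqP.
have nv : ~~ cls A B s0 v by apply: contra vA; exact: inA.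
by move: uv; rewrite (cls_adj nv) /both (negPf vA) s0B andbF.
Qed.

Lemma isolated D y v : conn e (~: D) -> y \notin D -> v \notin D -> v != y -> exists2 w, e y w & w \notin D.
Proof.
move=> cD yD vD vy.
have h1 : y \in ~: D by rewrite inE.
have h2 : v \in ~: D by rewrite inE.
have nP : v <> y by apply/eqP.
have [u [w [_ /and3P [_ wD uw] eu _]]] := connect_exit (P := fun w => w = y) (cD _ _ h1 h2) erefl nP.
by exists w; [rewrite -eu|move: wD; rewrite inE].
Qed.

Lemma edge_conn u v : e u v -> conn e (~: [set u; v]).
Proof.
move=> uv; have X0 : [set u] != set0 by apply/set0Pn; exists u; rewrite inE.
have N0 : [set v] != set0 by apply/set0Pn; exists v; rewrite inE.
apply: NS; apply: (anti_sep e_sym e_irr X0) N0 => w; rewrite inE => /eqP ->.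
by apply/cplP => x; rewrite inE => /eqP ->.
Qed.

(** The vertex sees only its own class. A clique neighbourhood with at least two vertices is
    antidisconnected and would cut the vertex off; with fewer neighbours, the two ends of a suitable
    edge are such a cutset. *)
Lemma nonsimplicial A B y : decomposition A B -> y \notin A -> y \notin B ->
  exists c c', [/\ e y c, e y c', c != c' & ~~ e c c'].
Proof.
move=> G yA yB; apply: NNPP => no.
have cl c c' : e y c -> e y c' -> c != c' -> e c c'.
  by move=> k1 k2 k3; apply: contraT => k4; case: no; exists c, c'.
have [a [a' [aA aA' n1 n2 n3]]] := decomposition_out y G.
have [b [_ [bB _ n4 _ _]]] := decomposition_out y (decomposition_swap G); rewrite same_swap in n4.
have [dAB _ _ _] := G.
have Ny w : ~~ cls A B y w -> ~~ e y w.
  by move=> n; rewrite (cls_adj n) /both (negPf yA) (negPf yB).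
have eaa : e a a' by rewrite (cls_adj n3) /both aA aA'.
have ny w : ~~ cls A B y w -> w != y by apply: contraNneq => ->; exact: same_refl.
have ab : b \notin [set a; a'].
  by rewrite !inE; apply/norP; split; apply: contraTneq bB => ->; rewrite (disjointFr dAB).
have yaa : y \notin [set a; a'] by rewrite !inE; apply/norP; split; rewrite eq_sym ny.
have [z yz _] := isolated (edge_conn eaa) yaa ab (ny _ n4).
have zy : z != y by apply: contraTneq yz => ->; rewrite e_irr.
case: (classic (exists2 w, e y w & w != z)) => [[w yw wz]|n].
  pose X := [set z]; pose N := [set x | e y x] :\ z.
  have X0 : X != set0 by apply/set0Pn; exists z; rewrite inE.
  have N0 : N != set0 by apply/set0Pn; exists w; rewrite !inE wz yw.
  have cX : {in N, forall x, cpl e X x}.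
    move=> x; rewrite !inE => /andP [xz yx]; apply/cplP => x'; rewrite inE => /eqP ->.
    by apply: cl => //; rewrite eq_sym.
  have cS := NS (anti_sep e_sym e_irr X0 cX N0).
  have inXN x : x \in X :|: N = e y x.
    by rewrite !inE; case: (eqVneq x z) => [->|]; rewrite ?yz.
  have yXN : y \notin X :|: N by rewrite inXN e_irr.
  have aXN : a \notin X :|: N by rewrite inXN Ny.
  by have [x yx nx] := isolated cS yXN aXN (ny _ n1); rewrite inXN yx in nx.
have only x : e y x -> x = z by move=> yx; apply/eqP; apply: contraT => xz; case: n; exists x.
have nz x : ~~ cls A B y x -> x != z by move=> k; apply: contraNneq (Ny _ k) => ->.
case: (classic (exists2 w, e z w & w != y)) => [[w zw wy]|n'].
  have wz : w != z by apply: contraTneq zw => ->; rewrite e_irr.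
  have yD : y \notin [set z; w] by rewrite !inE; apply/norP; split; rewrite eq_sym.
  have naa : a != a' by apply: contraNneq n3 => ->; exact: same_refl.
  have [v [vD vy]] : exists v, v \notin [set z; w] /\ v != y.
    case: (eqVneq a w) => [ew|aw]; [exists a'|exists a]; rewrite ny // !inE negb_or nz //=; split=> //.
    by rewrite -ew eq_sym.
  have [x /only -> ] := isolated (edge_conn zw) yD vD vy.
  by rewrite !inE eqxx.
have cD := edge_conn eaa.
have h1 : y \in ~: [set a; a'] by rewrite inE.
have h2 : b \in ~: [set a; a'] by rewrite inE.
have nP : ~ (b = y \/ b = z) by case; apply/eqP; [exact: ny|exact: nz].
have [u [v [_ /and3P [_ _ uv] eu nv]]] := connect_exit (P := fun w => w = y \/ w = z) (cD _ _ h1 h2) (or_introl erefl) nP.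
apply: nv; case: eu => eu; rewrite eu in uv; first by right; apply: only.
by left; apply/eqP; apply: contraT => vy; case: n'; exists v.
Qed.

Lemma good_vertex : (exists y c c', [/\ e y c, e y c', c != c' & ~~ e c c']) ->
  exists y, (exists c c', [/\ e y c, e y c', c != c' & ~~ e c c']) /\
  forall p1 a1 b1 p2 a2 b2 p3 a3 b3, prism3 e p1 a1 b1 p2 a2 b2 p3 a3 b3 -> e y a1 -> e y a2 -> False.
Proof.
move=> [y hy]; case: (classic (exists p1 a1 b1 p2 a2 b2 p3 a3 b3, prism3 e p1 a1 b1 p2 a2 b2 p3 a3 b3)); last first.
  move=> n; exists y; split=> // p1 a1 b1 p2 a2 b2 p3 a3 b3 K; case: n.
  by exists p1, a1, b1, p2, a2, b2, p3, a3, b3.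
move=> [p1 [a1 [b1 [p2 [a2 [b2 [p3 [a3 [b3 K]]]]]]]]].
have [A0 [B0 [G0 [A1 _ _] _]]] := prism_decomposition e_sym e_irr noodd noanti noprism NS K.
pose P (i : {set T} * {set T} * T) := decomposition i.1.1 i.1.2 /\ i.2 \in i.1.1.
have P0 : P (A0, B0, a1) by split.
have [[[A B] s0] [/= G s0A] mx] := min_ex (fun i : {set T} * {set T} * T => #|[set w | cls i.1.1 i.1.2 i.2 w]|) P0.
have [z [sz zA zB]] := inner_vertex G s0A.
exists z; split; first exact: (nonsimplicial G).
apply: (laminar G s0A _ sz zA zB) => A' B' s G' sA'.
by apply: (mx (A', B', s)).
Qed.

(** [X] is taken largest, starting from [y] alone. Maximality gives the clique condition [hR], and
    [y \in X] makes common neighbours of [X] neighbours of [y], which gives [star]. *)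
Lemma even_pair_ex y c c' : e y c -> e y c' -> c != c' -> ~~ e c c' ->
  (forall p1 a1 b1 p2 a2 b2 p3 a3 b3, prism3 e p1 a1 b1 p2 a2 b2 p3 a3 b3 -> e y a1 -> e y a2 -> False) ->
  exists u v, even_pair e u v.
Proof.
move=> yc yc' ncc nec np.
pose P X := [/\ anticonn e X, y \in X & exists c c', [/\ cpl e X c, cpl e X c', c != c' & ~~ e c c']].
have P0 : P [set y].
  split; [exact: conn1|by rewrite inE|exists c, c'; split=> //].
    by apply/cplP => h; rewrite inE => /eqP ->.
  by apply/cplP => h; rewrite inE => /eqP ->.
have [X [aX yX [d [d' [Cd Cd' ndd ned]]]] mx] := min_ex (fun X : {set T} => #|T| - #|X|) P0.
have X0 : X != set0 by apply/set0Pn; exists y.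
apply: (mt_even_pair e_sym e_irr noodd noanti noprism NS aX X0 _ _ Cd Cd' ndd ned).
  move=> r f f' rX nr Cf Cf' rf rf' nff; apply: contraT => nef.
  have [h hX nhr] : exists2 h, h \in X & ~~ e h r.
    by move: nr; rewrite /cpl negb_forall => /existsP [h]; rewrite negb_imply => /andP [? ?]; exists h.
  have hr : h != r by apply: contraNneq rX => <-.
  have Cr g : cpl e X g -> e r g -> cpl e (r |: X) g.
    by move=> /cplP k rg; apply/cplP => x; rewrite in_setU1 => /orP [/eqP ->|/k].
  have PX : P (r |: X).
    split; last by exists f, f'; split=> //; exact: Cr.
      by apply: (connU1 (compl_sym e_sym) aX hX); rewrite /compl hr.
    by rewrite in_setU1 yX orbT.
  have := mx _ PX; have := max_card (mem (r |: X)); rewrite /= !cardsU1 rX add1n; move: #|T| #|X| => k1 k2; clear; lia.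
move=> p1 a1 b1 p2 a2 b2 p3 a3 b3 K /cplP C1 /cplP C2; apply: (np _ _ _ _ _ _ _ _ _ K); [exact: C1|exact: C2].
Qed.
End Laminar.

Theorem theorem1p2 (T : finType) (e : rel T)
  (e_sym : symmetric e) (e_irr : irreflexive e)
  (hBerge : berge e)
  (hNoAntihole : forall c : seq T, antihole e c -> size c < 6)
  (hNoOddPrism : forall (a1 a2 a3 : T) (q1 q2 q3 : seq T),
      ~~ odd_prism e a1 a2 a3 q1 q2 q3)
  (hNoBSP : ~ exists A : {set T}, skew_partition e A /\ balanced e A) :
  complete e \/ exists u v : T, even_pair e u v.
Proof.
have noodd c : hole e c -> ~~ odd (size c) by case: (hBerge c).
have noanti c : ~~ hole (compl e) c.
  apply/negP => hc; have c6 := hNoAntihole c hc; have := (hBerge c).2 hc.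
  have : 5 <= size c by case/and3P: hc.
  by case: (size c) c6 => [|[|[|[|[|[|?]]]]]].
have NS := antidisconnected_no_cut e_sym e_irr noodd noanti hNoOddPrism hNoBSP.
case: (classic (exists y c c', [/\ e y c, e y c', c != c' & ~~ e c c'])) => [hy|hn].
  right; have [y [[c [c' [k1 k2 k3 k4]]] np]] := good_vertex e_sym e_irr noodd noanti hNoOddPrism NS hy.
  exact: (even_pair_ex e_sym e_irr noodd noanti hNoOddPrism NS k1 k2 k3 k4 np).
(* Now every neighbourhood is a clique, so induced paths have at most one edge and any nonadjacent
   pair is vacuously an even pair. *)
case: (classic (complete e)) => [|nc]; [by left|right].
have [u [v [nuv euv]]] : exists u v, u != v /\ ~~ e u v.
  apply: NNPP => no; apply: nc => x y nxy; apply: contraT => nxy'; case: no; by exists x, y.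
exists u, v; split=> // q; case: q => [|w [|x q]] //.
  rewrite (ipath_cons e_sym e_irr) => /and3P [_ /allP hu _] /= ew; rewrite -ew in euv.
  by move: euv; rewrite (eqP (hu w (mem_head _ _))) eqxx.
rewrite (ipath_cons e_sym e_irr) => /and3P [uq /allP hu]; rewrite (ipath_cons e_sym e_irr) => /and3P [_ /allP hw _] _.
have uw : e u w by rewrite (eqP (hu w (mem_head _ _))).
have wx : e w x by rewrite (eqP (hw x (mem_head _ _))).
have xs : x \in [:: w, x & q] by rewrite !inE eqxx orbT.
exfalso; apply: hn; exists w, u, x; split=> //; first by rewrite e_sym.
  by apply: contraNneq uq => ->.
by rewrite (eqP (hu x xs)) /=; apply: contraTneq wx => -[->]; rewrite e_irr.
Qed.
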